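(* Let $a,b,c>0$ be algebraic numbers not in rational ratio, with $a<c\le b$, and suppose that there are $l_1,l_2,l_3\in\mathbb{Z}$ with $(l_1,l_2,l_3)\ne(0,0,0)$ and $\gcd(l_1,l_2,l_3)=1$ such that $$al_1=bl_2+cl_3,$$ where the sign of the triple is chosen so that, if all the nonzero entries among $l_1,l_2,l_3$ have the same sign, then they are positive. Then there is an effective constant $K_{a,b,c}>0$ such that, as $T\to\infty$, the following hold. (i) If $l_i<0$ for some $1\le i\le3$, then $$I_{a,b,c}(T)=T+O\Big(T\exp\Big(-K_{a,b,c}\frac{(\log T)^{1/3}}{(\log\log T)^{1/3}}\Big)\Big).$$ (ii) If $l_i\ge0$ for every $1\le i\le3$, then $$I_{a,b,c}(T)=\zeta\Big(\frac{l_1+l_2+l_3}{2}\Big)T+O\Big(T\exp\Big(-K_{a,b,c}\frac{(\log T)^{1/3}}{(\log\log T)^{1/3}}\Big)\Big).$$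
   Context: $\zeta$ is the Riemann zeta function and, for $a,b,c\in\mathbb{R}^+$ and $T>1$, $$I_{a,b,c}(T)=\int_0^T\zeta(1/2+ait)\,\zeta(1/2-bit)\,\zeta(1/2-cit)\,dt.$$ ''$a,b,c$ are not in rational ratio'' means that the ratios $b/a$ and $c/a$ are not both rational. Implicit constants may depend on $a,b,c$. *)

(* Defs.v *)
From mathcomp Require Import all_boot all_order all_algebra complex.
From mathcomp Require Import all_classical all_reals all_analysis.

Set Implicit Arguments.
Unset Strict Implicit.
Unset Printing Implicit Defensive.

Import Order.TTheory GRing.Theory Num.Theory.
Import numFieldNormedType.Exports.

Local Open Scope classical_set_scope.
Local Open Scope ring_scope.
Local Open Scope complex_scope.

Section Zeta.
Context {R : realType}.

Definition cexp (z : R[i]) : R[i] :=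
  (expR (complex.Re z))%:C * (cos (complex.Im z) +i* sin (complex.Im z)).

(* n ^ (- s), for n > 0 *)
Definition dirichlet_term (s : R[i]) (n : nat) : R[i] :=
  cexp (- s * (ln n%:R)%:C).

(* [derivable] over the scalar field R[i] is complex differentiability, so the
   first clause says that Z is holomorphic away from 1. *)
Definition is_zeta (Z : R[i] -> R[i]) : Prop :=
  (forall s, s != 1 -> derivable (Z : R[i]^o -> R[i]^o) s 1) /\
  (forall s, 1 < complex.Re s ->
     series (fun n => dirichlet_term s n.+1 : R[i]^o) @ \oo --> (Z s : R[i]^o)).

(* By uniqueness of analytic continuation, [is_zeta] determines the function
   away from its pole s = 1; the value at s = 1 is unspecified. *)
Definition zeta : R[i] -> R[i] := xget (fun=> 0) [set Z | is_zeta Z].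

Definition zeta_prod (a b c t : R) : R[i] :=
  zeta (2^-1 +i* (a * t)) * zeta (2^-1 +i* (- (b * t))) *
  zeta (2^-1 +i* (- (c * t))).

Definition zeta_moment (a b c T : R) : R[i] :=
  (\int[lebesgue_measure]_(t in `[0, T]) complex.Re (zeta_prod a b c t)) +i*
  (\int[lebesgue_measure]_(t in `[0, T]) complex.Im (zeta_prod a b c t)).

Definition rational_real (x : R) : Prop := exists q : rat, x = ratr q.

Definition rational_ratio (a b c : R) : Prop :=
  rational_real (b / a) /\ rational_real (c / a).

Definition error_term (K T : R) : R :=
  T * expR (- (K * (ln T `^ (1 / 3) / ln (ln T) `^ (1 / 3)))).

(* f(T) = M T + O(error_term K T) as T -> +oo *)
Definition asymp_with_error (f : R -> R[i]) (M : R[i]) (K : R) : Prop :=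
  exists C : R, \forall T \near +oo,
    Normc.normc (f T - M * T%:C) <= C * error_term K T.

End Zeta.

Definition sign_normalized (l1 l2 l3 : int) : Prop :=
  let l := [:: l1; l2; l3] in
  {in l &, forall x y, x != 0 -> y != 0 -> sgz x = sgz y} ->
  {in l, forall x, x != 0 -> 0 < x}.

(* Partial recursive functions on tuples of natural numbers. *)
Inductive recfun : Type :=
| RZero
| RSucc
| RProj of nat
| RComp of recfun & seq recfun
| RPrec of recfun & recfun
| RMin of recfun.

(* [rec_eval f s y]: f is defined at the arguments s, with value y. *)
Inductive rec_eval : recfun -> seq nat -> nat -> Prop :=
| EZero s : rec_eval RZero s 0%N
| ESucc n s : rec_eval RSucc (n :: s) n.+1
| EProj i s : (i < size s)%N -> rec_eval (RProj i) s (nth 0%N s i)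
| EComp f gs s ys z :
    rec_eval_all gs s ys -> rec_eval f ys z -> rec_eval (RComp f gs) s z
| EPrec0 f g s y : rec_eval f s y -> rec_eval (RPrec f g) (0%N :: s) y
| EPrecS f g n s y z :
    rec_eval (RPrec f g) (n :: s) y -> rec_eval g [:: n, y & s] z ->
    rec_eval (RPrec f g) (n.+1 :: s) z
| EMin f s n (w : nat -> nat) :
    (forall m, (m < n)%N -> rec_eval f (m :: s) (w m).+1) ->
    rec_eval f (n :: s) 0%N -> rec_eval (RMin f) s n
with rec_eval_all : seq recfun -> seq nat -> seq nat -> Prop :=
| ENil s : rec_eval_all [::] s [::]
| ECons g gs s y ys :
    rec_eval g s y -> rec_eval_all gs s ys ->
    rec_eval_all (g :: gs) s (y :: ys).

(* An integer polynomial with the endpoints of an isolating interval. *)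
Definition alg_code : Type := ({poly int} * (rat * rat))%type.

Definition encodes (R : realType) (k : alg_code) (x : R) : Prop :=
  let: (p, (lo, hi)) := k in
  let isolated y := root (map_poly intr p) y /\ ratr lo <= y <= ratr hi in
  [/\ p != 0, isolated x & forall y : R, isolated y -> y = x].

(* The rational K is the output of the program F on any presentation of
   a, b, c by isolating polynomials. The mathcomp [pickle]s used here are
   computable codings of finite data by natural numbers. *)
Definition computed_by (R : realType) (F : recfun) (a b c : R) (K : rat) : Prop :=
  forall ka kb kc : alg_code,
    encodes ka a -> encodes kb b -> encodes kc c ->
    rec_eval F [:: pickle ka; pickle kb; pickle kc] (pickle K).

(* Main.v *)
(* For [w = i t] the integrand is [zeta(1/2 + a w) zeta(1/2 - b w) zeta(1/2 - c w)].
   Since [a < c <= b], the line of integration can be moved to [Re w = - s1] with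
   [a s1 < 1/2 < c s1], where the last two factors are absolutely convergent
   Dirichlet series and the first one is close to a Dirichlet polynomial of length
   [T ^ (1 + e)]; the horizontal segments are negligible by a convexity bound for
   zeta, here obtained from Weyl differencing and the Kusmin-Landau inequality.

   After multiplying out, a triple [(n, m, k)] contributes [T] times its weight if
   the form [a ln n - b ln m - c ln k] vanishes. By the Gelfond-Schneider theorem and
   the linear relation between [a, b, c] this happens for [(r ^ l1, r ^ l2, r ^ l3)]
   only, hence for [(1, 1, 1)] only if some [l_i] is negative. The other triples are
   harmless, unless [n] is the integer nearest to [m ^ (b / a) k ^ (c / a)]. For those,
   if [m, k <= exp((ln T) ^ (1/3))], a quantitative form of the Gelfond-Schneider
   theorem shows that the linear form exceeds [T ^ (-1/2)]; larger [m, k] are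
   disposed of by absolute convergence, which yields the saving
   [exp(- eta (ln T) ^ (1/3))]. It beats the error term of the theorem for every
   constant, so that [K = 1] is admissible for all [a, b, c].

   The lower bound for linear forms is Laurent's: the determinant of the monomials
   [x ^ p Y ^ q] at the points [(r + s beta, a1 ^ r a2 ^ s)] is small analytically,
   nonzero for a suitable choice of points, and therefore not too small arithmetically. *)
Require Import Defs.
From mathcomp Require Import all_boot all_order all_algebra perm complex.
From mathcomp Require Import all_classical all_reals all_analysis.
From mathcomp Require Import zify ring lra.

Import Order.TTheory GRing.Theory Num.Theory.
Import numFieldNormedType.Exports.

Local Open Scope ring_scope.
Local Open Scope complex_scope.

Set Implicit Arguments.
Unset Strict Implicit.
Unset Printing Implicit Defensive.

(** * A lower bound for linear forms in two logarithms *)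

(** A general form in three logarithms would call for Baker's theorem. The relation eliminates one
    coefficient: [l1] times the form ([l2] times it if [l1 = 0]) equals [c * (beta * P - Q)] with
    [beta] an irrational algebraic ratio and [P], [Q] logarithms of rational numbers, which is
    within reach of the method of Gelfond and Schneider. All exponents come from one budget. For
    logarithms up to [p ^ 3] the determinant uses [D] powers of the exponential coordinate and
    [D * p ^ 8] powers of the other, so its size is [L = D ^ 2 * p ^ 8]. The analytic estimate saves
    [p] to the power about [L ^ 2 / 2]; all losses together cost [p] to a power at most
    [(10 + 9 d) * D * p ^ 8 * L], where [d] is the degree of [beta], so a large fixed [D] decides.
    The resulting bound loses about [p ^ 8 * ln p] in the exponent. With [p] of order [x] this is
    less than [x ^ 9 / 2], whence the scale [T = exp (x ^ 9)] and the range [m, k <= exp (x ^ 3)].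
    On the analytic side [zeta] is known only through [is_zeta]: a continuation is constructed
    first, and an identity to the left of [Re s = 1] has to be transported from the half plane of
    convergence. *)

Lemma det_row_sum (A : comNzRingType) n m (v : 'I_n -> 'I_m -> 'I_n -> A) :
  \det (\matrix_(i, j) \sum_k v i k j) =
  \sum_(f : {ffun 'I_n -> 'I_m}) \det (\matrix_(i, j) v i (f i) j).
Proof.
rewrite /determinant exchange_big /=; apply: eq_bigr => s _.
rewrite -mulr_sumr; congr (_ * _).
under eq_bigr do rewrite mxE.
rewrite bigA_distr_bigA /=; apply: eq_bigr => f _.
by apply: eq_bigr => i _; rewrite mxE.
Qed.

Lemma normr_det_le (F : numDomainType) n (M : 'M[F]_n) (c : 'I_n -> F) :
  (forall i j, `|M i j| <= c i) -> `|\det M| <= n`!%:R * \prod_i c i.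
Proof.
move=> Mc; rewrite /determinant.
apply: le_trans (ler_norm_sum _ _ _) _.
have -> : n`!%:R * \prod_i c i = \sum_(s : 'S_n) \prod_i c i.
  by rewrite mulr_natl sumr_const card_Sn.
apply: ler_sum => s _.
rewrite normrM normrX normrN1 expr1n mul1r normr_prod.
by apply: ler_prod => i _; rewrite normr_ge0 Mc.
Qed.

Lemma sum_ltn_minn n k : (\sum_(t < n) (t < k))%N = minn n k.
Proof.
elim: n => [|n IH]; first by rewrite big_ord0 min0n.
rewrite big_ord_recr /= IH; case: (ltnP n k) => /=; lia.
Qed.

(** Count by levels: for each [t < n] at most [t + 1] indices have [f i <= t], so at least
    [n - 1 - t] have [f i > t]. Values from [n] on may repeat because, in [det_power_rows_le], the
    pieces numbered [n] are remainders and need not be proportional. *)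
Lemma sum_injective_ge n (f : 'I_n -> nat) :
  (forall i j, (f i < n)%N -> f i = f j -> i = j) ->
  ('C(n, 2) <= \sum_i f i)%N.
Proof.
move=> fI.
apply: (@leq_trans (\sum_(i < n) \sum_(t < n) (t < f i))%N); last first.
  by apply: leq_sum => i _; rewrite sum_ltn_minn geq_minr.
rewrite exchange_big /= -bin2_sum.
rewrite big_mkord.
rewrite (reindex_inj rev_ord_inj) /=; apply: leq_sum => t _.
rewrite leq_subLR addnC.
have tn := ltn_ord t.
have le : (#|[set i | (f i <= t)%N]| <= t.+1)%N.
  pose g (i : 'I_n) : 'I_t.+1 := inord (f i).
  rewrite -[X in (_ <= X)%N](card_ord t.+1).
  rewrite -(@card_in_imset _ _ g); first exact: max_card.
  move=> i j; rewrite !inE /g => hi hj /(congr1 val) /=; rewrite !inordK // => e.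
  by apply: fI => //; apply: leq_ltn_trans hi tn.
have -> : (\sum_(i < n) (t < f i) = #|~: [set i | (f i <= t)%N]|)%N.
  rewrite -sum1_card [RHS]big_mkcond /=; apply: eq_bigr => i _.
  by rewrite !inE -ltnNge; case: ltnP.
rewrite -[X in (X <= _)%N](card_ord n) -(cardsC [set i | (f i <= t)%N]).
by rewrite addnC leq_add2l.
Qed.

(* Expanding the rows of the determinant over the pieces [k], a term vanishes
   as soon as two rows use the same piece [k < n], because these pieces are all
   proportional to the row [x j ^+ k]: the surviving choices have total weight
   at least [0 + 1 + ... + (n - 1)]. *)
Lemma det_power_rows_le (F : realFieldType) n (a : 'I_n -> nat -> F)
    (x : 'I_n -> F) (rem : 'I_n -> 'I_n -> F) (w : 'I_n -> 'I_n.+1 -> F) (q : F) :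
  0 <= q <= 1 -> (forall i k, 0 <= w i k) ->
  (forall i j (k : 'I_n.+1), (k < n)%N -> `|a i k * x j ^+ k| <= w i k * q ^+ k) ->
  (forall i j, `|rem i j| <= w i ord_max * q ^+ n) ->
  `|\det (\matrix_(i, j) (\sum_(k < n) a i k * x j ^+ k + rem i j))| <=
  n`!%:R * q ^+ 'C(n, 2) * \prod_i \sum_k w i k.
Proof.
move=> /andP[q0 q1] w_ge0 ha hr.
pose v i (k : 'I_n.+1) j := if (k < n)%N then a i k * x j ^+ k else rem i j.
have vle i k j : `|v i k j| <= w i k * q ^+ k.
  rewrite /v; case: ifPn => [kn|]; first exact: ha.
  rewrite -leqNgt => nk; have -> : k = ord_max.
    by apply: val_inj => /=; apply/eqP; rewrite eqn_leq nk -ltnS ltn_ord.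
  exact: hr.
have -> : \matrix_(i, j) (\sum_(k < n) a i k * x j ^+ k + rem i j) =
          \matrix_(i, j) \sum_k v i k j.
  apply/matrixP => i j; rewrite !mxE big_ord_recr /= /v /= ltnn; congr (_ + _).
  by apply: eq_bigr => k _; rewrite ltn_ord.
rewrite det_row_sum bigA_distr_bigA /= mulr_sumr.
apply: le_trans (ler_norm_sum _ _ _) _; apply: ler_sum => f _.
have pw_ge0 : 0 <= \prod_(i < n) w i (f i) by apply: prodr_ge0.
have [fI|] := pselect (forall i j, (f i < n)%N -> f i = f j :> nat -> i = j); last first.
  move=> /existsNP[i /existsNP[j /not_implyP[fin /not_implyP[fij ij]]]].
  have -> : \det (\matrix_(i, j) v i (f i) j) = 0.
    pose d := \row_i (if (f i < n)%N then a i (f i) else 1).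
    pose Y := \matrix_(i, j) (if (f i < n)%N then x j ^+ f i else rem i j).
    have -> : \matrix_(i, j) v i (f i) j = diag_mx d *m Y.
      apply/matrixP => k l; rewrite mul_diag_mx !mxE /v.
      by case: ifP => //; rewrite mul1r.
    rewrite det_mulmx (@determinant_alternate _ _ Y i j) ?mulr0 //.
      by apply/eqP.
    by move=> l; rewrite !mxE -fij fin.
  by rewrite normr0 mulr_ge0 // mulr_ge0 ?ler0n ?exprn_ge0.
apply: le_trans (@normr_det_le _ _ _ (fun i => w i (f i) * q ^+ f i) _) _.
  by move=> i j; rewrite mxE.
rewrite big_split /= -mulrA ler_wpM2l ?ler0n // mulrC ler_wpM2r //.
rewrite prodrXr ler_wiXn2l //.
exact: sum_injective_ge.
Qed.

(** This plays the part of the Schwarz lemma on a disc enlarged by the factor [E]: for [k >= m] one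
    has [|z| ^ k <= E ^- m * (E * |z|) ^ k], and the enlarged series is again an exponential
    series. *)
Lemma expR_taylor_le {R : realType} (z E : R) m : 1 <= E ->
  `|expR z - \sum_(k < m) z ^+ k / k`!%:R| <= E ^- m * expR (E * `|z|).
Proof.
move=> E1.
have E0 : 0 < E by apply: lt_le_trans E1.
pose S n := \sum_(k < n) z ^+ k / k`!%:R.
have cv : (S n @[n --> \oo] --> expR z)%classic.
  have := is_cvg_series_exp_coeff z.
  rewrite /expR => h; apply: cvg_trans h; apply: near_eq_cvg.
  by near=> n; rewrite /series /= big_mkord.
have bd n : `|S (m + n)%N - S m| <= E ^- m * expR (E * `|z|).
  have -> : S (m + n)%N - S m = \sum_(k < n) z ^+ (m + k) / (m + k)`!%:R.
    by rewrite /S big_split_ord /= [X in X - _]addrC addrK.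
  apply: le_trans (ler_norm_sum _ _ _) _.
  apply: (@le_trans _ _ (E ^- m * \sum_(k < m + n) (E * `|z|) ^+ k / k`!%:R)).
    rewrite big_split_ord /= mulrDr ler_wpDl //.
      rewrite mulr_ge0 ?invr_ge0 ?exprn_ge0 ?(ltW E0) //.
      by apply: sumr_ge0 => k _; rewrite divr_ge0 ?exprn_ge0 ?mulr_ge0 ?(ltW E0).
    rewrite mulr_sumr; apply: ler_sum => k _.
    rewrite normrM normfV normrX (ger0_norm (ler0n _ _)) mulrA.
    rewrite ler_wpM2r ?invr_ge0 ?ler0n // exprMn mulrA.
    rewrite (exprD E) mulKf ?expf_neq0 ?gt_eqF // ler_peMl ?exprn_ge0 //.
    exact: exprn_ege1.
  rewrite ler_wpM2l ?invr_ge0 ?exprn_ge0 ?(ltW E0) //.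
  have Ez : 0 <= E * `|z| by rewrite mulr_ge0 ?(ltW E0).
  have := nondecreasing_cvgn_le (_ : nondecreasing_seq (series (exp_coeff (E * `|z|)))) (is_cvg_series_exp_coeff _) (m + n)%N.
  rewrite /expR; move=> h; apply: le_trans (h _).
    by rewrite /series /= big_mkord.
  move=> p q pq; rewrite /series /= -subr_ge0 sub_series_geq //.
  by apply: sumr_ge0 => k _; rewrite exp_coeff_ge0.
have cv2 : (`|S (m + n)%N - S m| @[n --> \oo] --> `|expR z - S m|)%classic.
  apply: cvg_norm; apply: cvgB; last exact: cvg_cst.
  have := cv; rewrite -(cvg_shiftn m); apply: cvg_trans.
  by apply: near_eq_cvg; near=> n; rewrite addnC.
rewrite -/(S m) -(cvg_lim _ cv2) //; apply: limr_le; first by apply/cvg_ex; exists `|expR z - S m|.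
by apply: nearW.
Unshelve. all: by end_near. Qed.

Section ExpMonomial.
Context {R : realType}.
Implicit Types (mu x X E : R) (p n k : nat).

(** The Taylor coefficients at 0 of [x ^+ p * expR (mu * x)]. *)
Definition exp_monomial_coef mu p k : R :=
  if (p <= k)%N then mu ^+ (k - p) / (k - p)`!%:R else 0.

Lemma sum_exp_monomial_coef mu p n x : (p <= n)%N ->
  \sum_(k < n) exp_monomial_coef mu p k * x ^+ k =
  x ^+ p * \sum_(k < n - p) (mu * x) ^+ k / k`!%:R.
Proof.
move=> pn; have [m ->] : exists m, n = (p + m)%N by exists (n - p)%N; rewrite subnKC.
rewrite addKn big_split_ord /= big1 ?add0r; last first.
  by move=> k _; rewrite /exp_monomial_coef leqNgt ltn_ord mul0r.
rewrite mulr_sumr; apply: eq_bigr => k _.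
rewrite /exp_monomial_coef leq_addr addKn exprD exprMn.
by ring.
Qed.

Lemma expR_partial_le (z : R) n : 0 <= z ->
  \sum_(k < n) z ^+ k / k`!%:R <= expR z.
Proof.
move=> z0.
have := nondecreasing_cvgn_le (_ : nondecreasing_seq (series (exp_coeff z))) (is_cvg_series_exp_coeff _) n.
rewrite /expR; move=> h; apply: le_trans (h _).
  by rewrite /series /= big_mkord.
move=> p q pq; rewrite /series /= -subr_ge0 sub_series_geq //.
by apply: sumr_ge0 => k _; rewrite exp_coeff_ge0.
Qed.

Lemma sum_norm_exp_monomial_coef mu p n x : (p <= n)%N -> 0 <= x ->
  \sum_(k < n) `|exp_monomial_coef mu p k| * x ^+ k <= x ^+ p * expR (`|mu| * x).
Proof.
move=> pn x0.
have -> : \sum_(k < n) `|exp_monomial_coef mu p k| * x ^+ k =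
          \sum_(k < n) exp_monomial_coef `|mu| p k * x ^+ k.
  apply: eq_bigr => k _; congr (_ * _); rewrite /exp_monomial_coef.
  case: ifP => // _; last by rewrite normr0.
  by rewrite normrM normrX normfV (ger0_norm (ler0n _ _)).
rewrite sum_exp_monomial_coef // ler_wpM2l ?exprn_ge0 //.
by rewrite expR_partial_le // mulr_ge0.
Qed.

Lemma exp_monomial_rem mu p n x X E : (p <= n)%N -> 1 <= E -> `|x| <= X ->
  `|x ^+ p * expR (mu * x) - \sum_(k < n) exp_monomial_coef mu p k * x ^+ k| <=
  E ^- n * ((E * X) ^+ p * expR (`|mu| * (E * X))).
Proof.
move=> pn E1 xX; have E0 : 0 < E by apply: lt_le_trans E1.
have X0 : 0 <= X by apply: le_trans xX.
rewrite sum_exp_monomial_coef // -mulrBr normrM normrX.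
apply: (@le_trans _ _ (X ^+ p * (E ^- (n - p) * expR (E * `|mu * x|)))).
  apply: ler_pM; rewrite ?exprn_ge0 //; first by rewrite lerXn2r ?nnegrE.
  exact: expR_taylor_le.
rewrite exprMn.
have -> : E ^- n * (E ^+ p * X ^+ p * expR (`|mu| * (E * X))) =
  X ^+ p * (E ^- (n - p) * expR (`|mu| * (E * X))).
  have -> : E ^- n = E ^- (n - p) * E ^- p.
    by rewrite -invfM -exprD subnK.
  by field; rewrite ?expf_neq0 ?gt_eqF.
rewrite ler_wpM2l ?exprn_ge0 // ler_wpM2l ?invr_ge0 ?exprn_ge0 ?(ltW E0) //.
rewrite ler_expR normrM [leRHS]mulrCA ler_wpM2l ?(ltW E0) //.
by rewrite ler_wpM2l.
Qed.

(** Each row is a Taylor polynomial of degree below [L] plus a remainder, so [det_power_rows_le]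
    applies with [q = E^-1]. The entries need only be within a Taylor remainder of the exponential
    monomials; later this leaves room for a small nonzero linear form. The factor 3 is one for the
    polynomial part and two for the remainder, where perturbation and Taylor tail add up. *)
Lemma interpolation_det_le L (M : 'M[R]_L) (p : 'I_L -> nat) (mu x : 'I_L -> R) X E :
  1 <= E -> 0 <= X -> (forall i, p i <= L)%N -> (forall j, `|x j| <= X) ->
  (forall i j, `|M i j - x j ^+ p i * expR (mu i * x j)| <=
     E ^- L * ((E * X) ^+ p i * expR (`|mu i| * (E * X)))) ->
  `|\det M| <=
  L`!%:R * E ^- 'C(L, 2) * \prod_i (3 * ((E * X) ^+ p i * expR (`|mu i| * (E * X)))).
Proof.
move=> E1 X0 pL xX hM; have E0 : 0 < E by apply: lt_le_trans E1.
pose B i := (E * X) ^+ p i * expR (`|mu i| * (E * X)).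
have EX0 : 0 <= E * X by rewrite mulr_ge0 // ltW.
have B0 i : 0 <= B i by rewrite mulr_ge0 ?exprn_ge0 // ltW ?expR_gt0.
pose a i k := exp_monomial_coef (mu i) (p i) k.
pose w i (k : 'I_L.+1) := if (k < L)%N then `|a i k| * (E * X) ^+ k else 2 * B i.
pose rem i j := M i j - \sum_(k < L) a i k * x j ^+ k.
have -> : M = \matrix_(i, j) (\sum_(k < L) a i k * x j ^+ k + rem i j).
  by apply/matrixP => i j; rewrite !mxE /rem addrC subrK.
apply: le_trans (@det_power_rows_le _ L a x rem w E^-1 _ _ _ _) _.
- by rewrite invr_ge0 (ltW E0) invf_le1.
- move=> i k; rewrite /w; case: ifP => _; first by rewrite mulr_ge0 ?exprn_ge0.
  by rewrite mulr_ge0.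
- move=> i j k kL; rewrite /w kL normrM -mulrA ler_wpM2l // normrX.
  rewrite -exprMn mulrC mulrA mulVf ?gt_eqF // mul1r.
  by rewrite lerXn2r ?nnegrE.
- move=> i j; rewrite /w ltnn /rem.
  have -> : M i j - \sum_(k < L) a i k * x j ^+ k =
    (M i j - x j ^+ p i * expR (mu i * x j)) +
    (x j ^+ p i * expR (mu i * x j) - \sum_(k < L) a i k * x j ^+ k) by ring.
  apply: le_trans (ler_normD _ _) _.
  have -> : 2 * B i * E^-1 ^+ L = E ^- L * B i + E ^- L * B i by rewrite exprVn; ring.
  by apply: lerD; [exact: hM|exact: exp_monomial_rem].
rewrite exprVn ler_wpM2l ?mulr_ge0 ?invr_ge0 ?exprn_ge0 ?(ltW E0) //.
apply: ler_prod => i _; apply/andP; split.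
  apply: sumr_ge0 => k _; rewrite /w; case: ifP => _; first by rewrite mulr_ge0 ?exprn_ge0.
  by rewrite mulr_ge0.
rewrite big_ord_recr /= /w /= ltnn -/(B i).
have -> : 3 * B i = B i + 2 * B i by ring.
rewrite lerD2r; under eq_bigr do rewrite ltn_ord.
exact: sum_norm_exp_monomial_coef.
Qed.

End ExpMonomial.

(** * Zero estimate for polynomials in a point and its exponential coordinate *)

Section ZeroEstimate.
Variable F : idomainType.
Implicit Types (p q : {poly F}).

Lemma coef_prod_top n (f : 'I_n -> {poly F}) (d : 'I_n -> nat) :
  (forall i, size (f i) <= (d i).+1)%N ->
  (\prod_i f i)`_(\sum_i d i)%N = \prod_i (f i)`_(d i) /\
  (size (\prod_i f i)%R <= (\sum_i d i).+1)%N.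
Proof.
elim: n f d => [|n IH] f d fd.
  by rewrite !big_ord0 coef1 /= size_poly1.
have [h1 h2] := IH (fun i => f (lift ord0 i)) (fun i => d (lift ord0 i)) (fun i => fd _).
rewrite !big_ord_recl; set g := \prod_(i < n) _ in h1 h2 *; set e := (\sum_(i < n) _)%N in h1 h2 *.
split; last first.
  apply: leq_trans (size_polyMleq _ _) _; have := fd ord0; lia.
rewrite coefM (bigD1 (inord (d ord0))) //= inordK ?ltnS ?leq_addr // addKn h1.
rewrite [X in _ + X]big1 ?addr0 // => i ine.
have [lt|ge] := ltnP (d ord0) i.
  by rewrite nth_default ?mul0r //; apply: leq_trans (fd ord0) _.
rewrite [X in _ * X]nth_default ?mulr0 //; apply: leq_trans h2 _.
have : i != d ord0 :> nat.
  by apply: contra ine => /eqP ie; apply/eqP/val_inj; rewrite /= inordK ?ltnS ?leq_addr.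
lia.
Qed.

Lemma lead_coef_shift p c : lead_coef (p \Po ('X + c%:P)) = lead_coef p.
Proof.
by rewrite lead_coef_comp ?size_XaddC // lead_coefXaddC expr1n mulr1.
Qed.

Lemma size_shift p c : size (p \Po ('X + c%:P)) = size p.
Proof. by rewrite size_comp_poly2 // size_XaddC. Qed.

(* Translating by [(r, 0)], [r < l], the [l] nonzero coefficients give a square
   linear system whose determinant is a polynomial in [X]; its leading coefficient
   is a Vandermonde determinant, and it vanishes at every [x] of [s]. *)
Lemma zero_estimate (l D1 : nat) (P : 'I_l -> {poly F}) (k : 'I_l -> nat) (alpha : F)
    (s : seq (F * F)) :
  (0 < l)%N -> (forall i, P i != 0) -> (forall i, size (P i) <= D1)%N ->
  alpha != 0 -> (forall i j, alpha ^+ k i = alpha ^+ k j -> i = j) ->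
  uniq (map fst s) -> (l * D1 <= size s)%N -> (forall z, z \in s -> z.2 != 0) ->
  exists2 z, z \in s &
  exists2 r, (r < l)%N &
    \sum_i (P i).[z.1 + r%:R] * (alpha ^+ r * z.2) ^+ k i != 0.
Proof.
move=> l0 Pn0 PD a0 kI us ss s0; apply: contrapT => H.
have {}H z r : z \in s -> (r < l)%N ->
    \sum_i (P i).[z.1 + r%:R] * (alpha ^+ r * z.2) ^+ k i = 0.
  move=> zs rl; apply/eqP/negP => /negP h; apply: H; exists z => //; by exists r.
pose M := \matrix_(g < l, i < l) ((P i \Po ('X + (g%:R : F)%:P)) * (alpha ^+ (g * k i))%:P).
pose Delta := \det M.
pose d i := (size (P i)).-1.
have szP i : size (P i) = (d i).+1 by rewrite prednK // size_poly_gt0.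
have szM (t : 'S_l) i : (size (M i (t i)) <= (d (t i)).+1)%N.
  rewrite mxE; apply: leq_trans (size_polyMleq _ _) _.
  by rewrite size_shift szP; have := size_polyC_leq1 (alpha ^+ (i * k (t i))); lia.
have sumd (t : 'S_l) : (\sum_i d (t i) = \sum_i d i)%N.
  by rewrite [RHS](reindex_inj (@perm_inj _ t)).
have prodM (t : 'S_l) := @coef_prod_top _ (fun i => M i (t i)) (fun i => d (t i)) (szM t).
have szD : (size Delta <= (\sum_i d i).+1)%N.
  rewrite /Delta /determinant; apply: (leq_trans (size_sum _ _ _)).
  apply/bigmax_leqP => t _; rewrite size_Msign -(sumd t).
  exact: (prodM t).2.
have Dn0 : Delta != 0.
  have : Delta`_(\sum_i d i)%N != 0; last by apply: contraNneq => ->; rewrite coef0.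
  have -> : Delta`_(\sum_i d i)%N = (\prod_i lead_coef (P i)) *
      \det (Vandermonde l (\row_i (alpha ^+ k i))).
    rewrite /Delta /determinant coef_sum mulr_sumr; apply: eq_bigr => t _.
    have -> : ((-1) ^+ t * \prod_i M i (t i))`_(\sum_i d i)%N =
        (-1) ^+ t * (\prod_i M i (t i))`_(\sum_i d i)%N.
      by rewrite !mulr_sign; case: ifP => // _; rewrite coefN.
    rewrite mulrCA; congr (_ * _); rewrite -{1}(sumd t) (prodM t).1.
    rewrite [X in X * _](reindex_inj (@perm_inj _ t)) -big_split /=.
    apply: eq_bigr => i _; rewrite !mxE coefMC; congr (_ * _); last first.
      by rewrite mulnC exprM.
    by rewrite -(lead_coef_shift _ (i%:R)) lead_coefE size_shift.
  rewrite mulf_neq0 //; first by apply/prodf_neq0 => i _; rewrite lead_coef_eq0.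
  rewrite det_Vandermonde; apply/prodf_neq0 => i _; apply/prodf_neq0 => j ij.
  rewrite !mxE subr_eq0; apply/eqP => /kI ji; by rewrite ji ltnn in ij.
(* At each abscissa [z.1] the system has the nonzero kernel vector [z.2 ^+ k i], so [Delta] has
   [size s] distinct roots, more than its degree allows. *)
have szs : (size s < size Delta)%N.
  rewrite -(size_map fst); apply: max_poly_roots => //.
  apply/allP => x /mapP[z zs ->]; rewrite /root.
  have -> : Delta.[z.1] = \det (map_mx (horner_eval z.1) M).
    by rewrite det_map_mx.
  rewrite -det_tr; apply/det0P; exists (\row_i z.2 ^+ k i).
    apply/eqP => /rowP /(_ (Ordinal l0)); rewrite !mxE => /eqP.
    by rewrite expf_eq0 (negbTE (s0 _ zs)) andbF.
  apply/rowP => g; rewrite !mxE -[RHS](H z g zs (ltn_ord g)).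
  apply: eq_bigr => i _; rewrite !mxE /horner_eval hornerM hornerC horner_comp.
  rewrite hornerD hornerX hornerC exprMn exprM; ring.
have : (\sum_i d i < \sum_(i < l) D1)%N.
    apply: (@leq_trans (\sum_i (d i).+1)%N).
    rewrite [X in (_ <= X)%N](eq_bigr (fun i => (d i + 1)%N)); last by move=> i _; rewrite addn1.
    by rewrite big_split /= sum1_card card_ord -addn1 leq_add2l.
  by apply: leq_sum => i _; rewrite -szP.
rewrite sum_nat_const card_ord; lia.
Qed.
End ZeroEstimate.

Lemma leqX2n m n e : (m <= n)%N -> (m ^ e <= n ^ e)%N.
Proof. by case: e => // e mn; rewrite leq_exp2r. Qed.

Lemma normr_intr (F : numDomainType) (z : int) : `|z%:~R : F| = (absz z)%:R.
Proof. by rewrite natr_absz intr_norm. Qed.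

(** * Liouville's inequality for integer polynomials at an algebraic number *)

Section Liouville.
Context {R : realType}.

Definition polyl1 (p : {poly int}) : nat := (\sum_(i < size p) `|(p`_i)%R|%N)%N.

Lemma polyl1E (p : {poly int}) n : (size p <= n)%N ->
  polyl1 p = (\sum_(i < n) `|(p`_i)%R|%N)%N.
Proof.
move=> pn; rewrite /polyl1 (big_ord_widen _ (fun i => `|(p`_i)%R|%N) pn) big_mkcond /=.
by apply: eq_bigr => i _; case: ltnP => // h; rewrite nth_default.
Qed.

Lemma polyl1D p q : (polyl1 (p + q)%R <= polyl1 p + polyl1 q)%N.
Proof.
pose n := maxn (size p) (size q).
rewrite (@polyl1E p n) ?leq_maxl // (@polyl1E q n) ?leq_maxr //.
rewrite (@polyl1E (p + q)%R n) ?size_polyD // -big_split /=; apply: leq_sum => i _.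
rewrite coefD; move: (p`_i) (q`_i) => x y; lia.
Qed.

Lemma polyl1_sum (I : Type) (r : seq I) (f : I -> {poly int}) :
  (polyl1 (\sum_(i <- r) f i)%R <= \sum_(i <- r) polyl1 (f i))%N.
Proof.
elim: r => [|i r IH]; first by rewrite !big_nil /polyl1 size_poly0 big_ord0.
by rewrite !big_cons; apply: leq_trans (polyl1D _ _) _; rewrite leq_add2l.
Qed.

Lemma polyl1Cm c p : polyl1 (c%:P * p)%R = (`|c| * polyl1 p)%N.
Proof.
have h : (size (c%:P * p)%R <= size p)%N by rewrite mul_polyC size_scale_leq.
rewrite (polyl1E h) (polyl1E (leqnn _)) big_distrr /=; apply: eq_bigr => i _.
by rewrite coefCM abszM.
Qed.

Lemma polyl1Xm p : polyl1 ('X * p)%R = polyl1 p.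
Proof.
have h : (size ('X * p)%R <= (size p).+1)%N.
  by apply: leq_trans (size_polyMleq _ _) _; rewrite size_polyX.
rewrite (polyl1E h) big_ord_recl /= coefXM /= add0n; apply: eq_bigr => i _.
by rewrite coefXM.
Qed.

Lemma polyl1M p q : (polyl1 (p * q)%R <= polyl1 p * polyl1 q)%N.
Proof.
elim/poly_ind: p => [|p c IH].
  by rewrite mul0r /polyl1 size_poly0 !big_ord0.
have [->|p0] := eqVneq p 0.
  rewrite mul0r add0r polyl1Cm -[c%:P]mulr1 polyl1Cm.
  by rewrite [polyl1 1](@polyl1E 1 1) ?size_poly1 // big_ord1 coef1 /= muln1.
have -> : polyl1 (p * 'X + c%:P)%R = (polyl1 p + `|c|)%N.
  rewrite /polyl1 -cons_poly_def polyseq_cons nil_poly (negbTE p0) /=.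
  by rewrite big_ord_recl /= addnC.
rewrite mulrDl mulnDl; apply: leq_trans (polyl1D _ _) _.
by rewrite polyl1Cm leq_add2r [p * 'X]mulrC -mulrA polyl1Xm.
Qed.

Lemma polyl1_prod n (f : 'I_n -> {poly int}) :
  (polyl1 (\prod_i f i)%R <= \prod_i polyl1 (f i))%N.
Proof.
elim: n f => [|n IH] f.
  by rewrite !big_ord0 /polyl1 size_poly1 big_ord1 coef1.
rewrite !big_ord_recl; apply: leq_trans (polyl1M _ _) _.
by rewrite leq_mul2l IH orbT.
Qed.

Lemma polyl1X p n : (polyl1 (p ^+ n)%R <= polyl1 p ^ n)%N.
Proof.
elim: n => [|n IH]; first by rewrite expr0 expn0 /polyl1 size_poly1 big_ord1 coef1.
by rewrite exprS expnS; apply: leq_trans (polyl1M _ _) _; rewrite leq_mul2l IH orbT.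
Qed.

Lemma polyl1_det n (M : 'M[{poly int}]_n) (c : 'I_n -> nat) :
  (forall i j, polyl1 (M i j) <= c i)%N -> (polyl1 (\det M) <= n`! * \prod_i c i)%N.
Proof.
move=> Mc; rewrite /determinant; apply: leq_trans (polyl1_sum _ _) _.
rewrite -card_Sn -sum_nat_const /=.
apply: leq_sum => t _.
have -> : polyl1 ((-1) ^+ t * \prod_i M i (t i))%R = polyl1 (\prod_i M i (t i))%R.
  rewrite mulr_sign; case: ifP => // _.
  by rewrite -mulN1r -polyCN polyl1Cm mul1n.
by apply: leq_trans (polyl1_prod _) _; apply: leq_prod => i _.
Qed.

(* Multiplication by [b * beta] on the basis [1, beta, ..., beta ^ (d-1)] of
   [Q(beta)] is an integer matrix; so is multiplication by [b ^ m * G(beta)], and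
   its determinant is a nonzero integer. *)
Lemma liouville_poly (beta : R) : algebraicOver ratr beta ->
  exists d C : nat, (0 < C)%N /\ forall (m A : nat) (G : {poly int}),
    (size G <= m.+1)%N -> (polyl1 G <= A)%N -> (map_poly intr G).[beta] != 0 ->
    1 <= `|(map_poly intr G).[beta]| * (C ^ m.+1 * A)%:R ^+ d.
Proof.
move=> [p0 p0n0 p0r].
(* Minimising the size gives a minimal polynomial of [beta]; the minimality is what makes [detM]
   work. *)
pose deg_ok n := `[<exists p : {poly rat}, [/\ p != 0, root (map_poly ratr p) beta & size p = n]>].
have exn : exists n, deg_ok n by exists (size p0); apply/asboolP; exists p0.
have [n /asboolP[p [pn0 pr szp]] nmin] := ex_minnP exn.
have {}nmin (r : {poly rat}) : root (map_poly ratr r) beta -> (size r < n)%N -> r = 0.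
  move=> rr; apply: contraTeq => rn0; rewrite -leqNgt; apply: nmin.
  by apply/asboolP; exists r.
have [q [c cn0 pq]] := rat_poly_scale p.
have qr : \sum_(j < n) (q`_j)%:~R * beta ^+ j = 0.
  have : (map_poly (ratr : rat -> R) p).[beta] = 0 by apply/eqP.
  have -> : map_poly (ratr : rat -> R) p = (c%:~R^-1 : R) *: map_poly intr q.
    rewrite pq; apply/polyP => i; rewrite coefZ !coef_map coefZ coef_map /=.
    by rewrite rmorphM /= fmorphV /= !ratr_int.
  rewrite hornerZ => /eqP; rewrite mulf_eq0 invr_eq0 intr_eq0 (negbTE cn0) /= => /eqP.
  have szq : (size (map_poly (intr : int -> R) q) <= n)%N.
    rewrite -szp pq size_scale ?invr_eq0 ?intr_eq0 // size_map_poly_id0 ?size_map_inj_poly //=.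
    - exact: intr_inj.
    - by rewrite intr_eq0 lead_coef_eq0; apply: contraNneq pn0; rewrite pq => ->; rewrite raddf0 scaler0.
  by rewrite (horner_coef_wide _ szq) => E; rewrite -[RHS]E; apply: eq_bigr => i _; rewrite coef_map.
have szq : size q = n.
  by rewrite -szp pq size_scale ?invr_eq0 ?intr_eq0 // size_map_inj_poly //=; exact: intr_inj.
case: n => [|[|d]] in szp nmin qr szq *.
- by move/eqP: szp; rewrite size_poly_eq0 (negbTE pn0).
- move: qr; rewrite big_ord1 expr0 mulr1 => /eqP; rewrite intr_eq0 => /eqP q0.
  have : lead_coef q = 0 by rewrite lead_coefE szq.
  by move/eqP; rewrite lead_coef_eq0 -size_poly_eq0 szq.
pose b := q`_d.+1.
(* [b] times the companion matrix. It is integral because the last row rewrites [b * beta ^+ d.+1]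
   by the equation of [beta] instead of dividing by [b]. *)
pose T : 'M[int]_d.+1 := \matrix_(i, j) (if (i < d)%N then b *+ (j == i.+1 :> nat) else - q`_j).
pose v : 'cV[R]_d.+1 := \col_j beta ^+ j.
have Tv : map_mx intr T *m v = (b%:~R * beta) *: v.
  apply/colP => i; rewrite !mxE.
  under eq_bigr do rewrite !mxE.
  have [id|di] := ltnP i d.
    rewrite (bigD1 (inord i.+1)) //= inordK ?eqxx ?mulr1n; last by rewrite ltnS.
    rewrite big1 ?addr0 ?exprS ?mulrA // => j jn.
    have -> : (j == i.+1 :> nat) = false; last by rewrite mulr0n mul0r.
    apply: contraNF jn => /eqP ji; apply/eqP/val_inj.
    by rewrite /= inordK ?ltnS.
  have id : i = d :> nat by apply/eqP; rewrite eqn_leq di -ltnS ltn_ord.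
  move: qr; rewrite big_ord_recr /= => /eqP; rewrite addrC addr_eq0 => /eqP qr.
  rewrite id -mulrA -exprS qr -sumrN; apply: eq_bigr => j _.
  by rewrite rmorphN mulNr.
have Tiv i : map_mx intr (T ^+ i) *m v = ((b%:~R * beta) ^+ i) *: v.
  elim: i => [|i IH]; first by rewrite !expr0 map_mx1 mul1mx scale1r.
  by rewrite exprSr map_mxM -mulmxA Tv -scalemxAr IH scalerA -exprS.
pose tau := (\sum_i \sum_j `|T i j|)%N.
have taule i j : (`|T i j| <= tau)%N.
  rewrite /tau (bigD1 i) //= (bigD1 j) //=; lia.
have Tile i j k : (`|(T ^+ i) j k| <= (d.+1 * tau) ^ i)%N.
  elim: i j k => [|i IH] j k.
    by rewrite expr0 expn0 mxE; case: (j == k).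
  rewrite exprS mxE expnS -mulnA.
  have le_sum (I : finType) (f : I -> int) : (`|(\sum_i f i)%R| <= \sum_i `|f i|)%N.
    by elim/big_ind2: _ => // x1 x2 y1 y2; lia.
  apply: leq_trans (le_sum _ _) _.
  rewrite -[X in (_ <= X * _)%N](card_ord d.+1) -sum_nat_const.
  by apply: leq_sum => l _; rewrite abszM leq_mul.
pose B := (`|b| + d.+1 * tau + 1)%N.
pose Vn := (Num.truncn ((1 + `|beta|) ^+ d.+1)).+1.
have Vle (j : 'I_d.+1) : `|beta| ^+ j <= Vn%:R.
  apply: (@le_trans _ _ ((1 + `|beta|) ^+ d.+1)); last first.
    by apply: ltW; apply: truncnS_gt.
  apply: (@le_trans _ _ ((1 + `|beta|) ^+ j)).
    by rewrite lerXn2r ?nnegrE ?addr_ge0 // lerDr.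
  by rewrite ler_weXn2l ?lerDl // ltnW.
pose K := (d.+1`! * Vn)%N.
have K0 : (0 < K)%N by rewrite muln_gt0 fact_gt0.
exists d.+1, (B * K)%N; split; first by rewrite muln_gt0 K0 /B addn1.
move=> m A G szG GA Gn0.
have A0 : (0 < A)%N.
  apply: leq_trans GA; rewrite lt0n; apply: contraNneq Gn0 => /eqP.
  rewrite /polyl1 sum_nat_eq0 => /forallP G0.
  have -> : G = 0; last by rewrite raddf0 horner0.
  apply/polyP => i; rewrite coef0; have [iG|] := ltnP i (size G); last exact: nth_default.
  by have := G0 (Ordinal iG); rewrite /= absz_eq0 => /eqP.
pose M := \sum_(i < m.+1) (G`_i * b ^+ (m - i)) *: T ^+ i.
have Mle j k : (`|M j k| <= A * B ^ m)%N.
  rewrite /M summxE.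
  have le_sum (I : finType) (f : I -> int) : (`|(\sum_i f i)%R| <= \sum_i `|f i|)%N.
    by elim/big_ind2: _ => // x1 x2 y1 y2; lia.
  apply: leq_trans (le_sum _ _) _.
  apply: (@leq_trans (\sum_(i < m.+1) `|(G`_i)%R| * B ^ m)%N); last first.
    by rewrite -big_distrl /= -(polyl1E szG) leq_mul2r GA orbT.
  apply: leq_sum => i _; rewrite mxE !abszM -mulnA leq_mul2l; apply/orP; right.
  rewrite abszX -[X in (_ <= _ ^ X)%N](@subnK i m); last by rewrite -ltnS.
  rewrite expnD leq_mul //; first by rewrite leqX2n // /B; lia.
  by apply: leq_trans (Tile _ _ _) _; rewrite leqX2n // /B; lia.
pose g := (map_poly (intr : int -> R) G).[beta].
have Mv : map_mx intr M *m v = (b%:~R ^+ m * g) *: v.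
  rewrite /M (big_morph (map_mx intr) (id1 := 0) (op1 := +%R)); last 2 first.
  - by move=> x y; rewrite map_mxD.
  - by rewrite map_mx0.
  rewrite mulmx_suml.
  under eq_bigr do rewrite map_mxZ -scalemxAl Tiv scalerA.
  rewrite -scaler_suml; congr (_ *: _).
  have szG' : (size (map_poly (intr : int -> R) G) <= m.+1)%N.
    by apply: leq_trans szG; exact: size_poly.
  rewrite /g (horner_coef_wide _ szG') mulr_sumr; apply: eq_bigr => i _.
  rewrite coef_map /= rmorphM /= rmorphXn /= exprMn.
  have -> : b%:~R ^+ m = b%:~R ^+ (m - i) * b%:~R ^+ i :> R.
    by rewrite -exprD subnK // -ltnS.
  ring.
have b0 : b != 0.
  have -> : b = lead_coef q by rewrite lead_coefE szq.
  by rewrite lead_coef_eq0 -size_poly_eq0 szq.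
(* A rational vector killed by [M] is orthogonal to [v], since [b ^+ m * g] is nonzero; its entries
   are then the coefficients of a polynomial vanishing at [beta] and shorter than the minimal
   one. *)
have detM : \det M != 0.
  apply/eqP => M0.
  have /eqP/det0P[w wn0 wM] : \det (map_mx (intr : int -> rat) M) = 0.
    by rewrite det_map_mx M0 rmorph0.
  have wMR : map_mx (ratr : rat -> R) w *m map_mx intr M = 0.
    have := congr1 (map_mx (ratr : rat -> R)) wM; rewrite map_mx0 map_mxM => <-.
    congr (_ *m _); apply/matrixP => i j; rewrite !mxE.
    by rewrite [RHS]ratr_int.
  have : (map_mx (ratr : rat -> R) w *m v) = 0.
    have : map_mx (ratr : rat -> R) w *m map_mx intr M *m v = 0 by rewrite wMR mul0mx.
    rewrite -mulmxA Mv -scalemxAr => /eqP; rewrite scaler_eq0 mulf_eq0 => /orP[|/eqP//].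
    by rewrite expf_eq0 intr_eq0 (negbTE b0) andbF (negbTE Gn0).
  move=> /matrixP /(_ ord0 ord0); rewrite !mxE => wv.
  pose r : {poly rat} := \poly_(i < d.+1) w ord0 (inord i).
  have r0 : r = 0.
    apply: nmin; last by rewrite ltnS; exact: size_poly.
    have szr : (size (map_poly (ratr : rat -> R) r) <= d.+1)%N.
      by apply: leq_trans (size_poly _ _) _; exact: size_poly.
    rewrite /root (horner_coef_wide _ szr) -[X in _ == X]wv; apply/eqP.
    apply: eq_bigr => i _; rewrite coef_map coef_poly ltn_ord !mxE /=.
    by rewrite inord_val.
  move/eqP: wn0; apply; apply/rowP => i; rewrite mxE.
  by have := congr1 (fun r : {poly rat} => r`_i) r0; rewrite coef_poly ltn_ord coef0 inord_val.
have adjle j k : `|(\adj (map_mx intr M)) j k : R| <= (d`! * (A * B ^ m) ^ d)%:R.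
  rewrite mxE /cofactor normrM normrX normrN1 expr1n mul1r.
  apply: le_trans (@normr_det_le _ _ _ (fun=> (A * B ^ m)%:R) _) _.
    by move=> x y; rewrite !mxE normr_intr ler_nat; exact: Mle.
  by rewrite prodr_const card_ord -natrX -natrM.
(* Cramer's rule on the coordinate 0 of [v], which equals 1: [\det M] is [b ^+ m * g] times an entry
   of [\adj M *m v]. *)
have : `|(\det M)%:~R : R| <= (`|b| ^ m)%:R * `|g| * (K * (A * B ^ m) ^ d)%:R.
  have : ((\det M)%:~R : R) *: v = (b%:~R ^+ m * g) *: (\adj (map_mx intr M) *m v).
    rewrite scalemxAr -Mv mulmxA mul_adj_mx det_map_mx mul_scalar_mx.
    by [].
  move=> /colP /(_ ord0); rewrite !mxE /= expr0 mulr1 => ->.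
  rewrite !normrM normrX.
  rewrite normr_intr -natrX.
  rewrite ler_wpM2l ?mulr_ge0 //.
  apply: le_trans (ler_norm_sum _ _ _) _.
  apply: (@le_trans _ _ (\sum_(j < d.+1) (d`! * (A * B ^ m) ^ d)%:R * Vn%:R)).
    apply: ler_sum => j _; rewrite normrM ler_pM //.
    by rewrite mxE normrX.
  rewrite sumr_const card_ord -natrM -[X in X <= _]mulr_natl -natrM ler_nat /K factS.
  by apply: eq_leq; ring.
move=> h.
have : 1 <= (`|b| ^ m)%:R * `|g| * (K * (A * B ^ m) ^ d)%:R.
  apply: le_trans h; rewrite normr_intr -[X in X <= _]/(1%:R) ler_nat.
  by rewrite absz_gt0.
move=> {}h; apply: le_trans h _.
rewrite mulrAC mulrC ler_wpM2l // -natrM -natrX ler_nat.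
have B0 : (0 < B)%N by rewrite /B addn1.
have AB : (A * B ^ m <= (B * K) ^ m.+1 * A)%N.
  rewrite mulnC leq_mul2r; apply/orP; right.
  have BK : (0 < B * K)%N by rewrite muln_gt0 B0.
  apply: (@leq_trans ((B * K) ^ m)%N); last exact: (leq_pexp2l BK (leqnSn m)).
  by rewrite leqX2n // leq_pmulr.
rewrite expnS mulnA leq_mul // ?leqX2n //.
rewrite expnMn [in X in (_ <= X)%N]expnS -[X in (X <= _)%N]muln1 leq_mul //.
apply: leq_mul.
  rewrite -[X in (X <= _)%N]mul1n leq_mul // leqX2n //; rewrite /B; lia.
by rewrite -{1}[K]expn1; apply: leq_pexp2l.
Qed.

End Liouville.

Lemma le_of_eq (d : Order.disp_t) (T : porderType d) (x y : T) : x = y -> (x <= y)%O.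
Proof. by move=> ->. Qed.

(** * The interpolation determinant: analytic upper bound against arithmetic lower bound *)

Section Gelfond.
Context {R : realType}.

Lemma expR_le_exprn (t c : R) n : expR c <= t -> expR (c * n%:R) <= t ^+ n.
Proof. by move=> h; rewrite expRM_natr lerXn2r ?nnegrE ?expR_ge0 // (le_trans _ h) ?expR_ge0. Qed.

Lemma sum_divmod (V : nmodType) m n (F : nat -> nat -> V) : (0 < n)%N ->
  \sum_(i < m * n) F (i %/ n)%N (i %% n)%N = \sum_(p < m) \sum_(q < n) F p q.
Proof.
move=> n0; rewrite -(big_mkord xpredT (fun i => F (i %/ n)%N (i %% n)%N)).
elim: m => [|m IH]; first by rewrite big_geq // big_ord0.
rewrite big_ord_recr /= -IH mulSnr (@big_cat_nat _ _ _ (m * n)%N) ?leq_addr //=.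
congr (_ + _); rewrite -{1}[(m * n)%N]add0n big_addn addKn big_mkord.
by apply: eq_bigr => j _; rewrite addnC divnMDl // modnMDl divn_small // modn_small // addn0.
Qed.

(* The grid of points (r + s beta, a1 ^ r a2 ^ s), numbered by [j = r * S + s]. *)
Lemma interpolation_row_free (beta a1 a2 : R) (D D1 S : nat) :
  ~ rational_real beta -> 0 < a1 -> a1 != 1 -> 0 < a2 -> (D * D1 <= S * S)%N ->
  row_free (\matrix_(i < D1 * D, j < (S + D) * S)
    (((j %/ S)%:R + (j %% S)%:R * beta) ^+ (i %/ D) *
     (a1 ^+ (j %/ S) * a2 ^+ (j %% S)) ^+ (i %% D))).
Proof.
move=> irr a10 a1n1 a20 DS; set A := (\matrix_(i, j) _).
have Dlt (i : 'I_(D1 * D)) : (0 < D)%N.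
  by rewrite lt0n; apply/eqP => D0; have := ltn_ord i; rewrite {2}D0 muln0.
apply/row_freeP; apply: contrapT => nfree.
have : exists2 w : 'rV_(D1 * D), w != 0 & w *m A = 0.
  apply: contrapT => H; apply: nfree; apply/row_freeP.
  rewrite -kermx_eq0; apply/eqP/row_matrixP => i; rewrite row0.
  apply: contrapT => /eqP h; apply: H; exists (row i (kermx A)) => //.
  by apply/sub_kermxP; rewrite row_sub.
move=> [w wn0 wA].
have /existsP[i0 wi0] : [exists i, w ord0 i != 0].
  apply: contraNT wn0; rewrite negb_exists => /forallP h.
  by apply/eqP/rowP => i; rewrite mxE; apply/eqP; have := h i; rewrite negbK.
have D0 := Dlt i0.
pose wn n := if insub n is Some i then w ord0 i else 0.
(* A relation [w] between the rows is a polynomial [\sum_q P q * Y ^ q] that vanishes at every point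
   of the grid. *)
pose P (q : nat) : {poly R} := \poly_(p < D1) wn (p * D + q)%N.
have wAj (j : 'I_((S + D) * S)) x y : x = (j %/ S)%:R + (j %% S)%:R * beta ->
    y = a1 ^+ (j %/ S) * a2 ^+ (j %% S) -> \sum_(q < D) (P q).[x] * y ^+ q = 0.
  move=> xE yE.
  have := congr1 (fun M : 'rV_ _ => M ord0 j) wA; rewrite !mxE => E; rewrite -[RHS]E {E}.
  under eq_bigr do rewrite horner_poly mulr_suml.
  rewrite exchange_big /= -(@sum_divmod _ _ _ (fun p q => wn (p * D + q)%N * x ^+ p * y ^+ q)) //.
  apply: eq_bigr => i _; rewrite -divn_eq /wn valK !mxE -xE -yE mulrA.
  by [].
pose K := [set q : 'I_D | P q != 0].
have lD : (#|K| <= D)%N by rewrite -[X in (_ <= X)%N](card_ord D) max_card.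
have l0 : (0 < #|K|)%N.
  have hq : (i0 %% D < D)%N by rewrite ltn_mod.
  apply/card_gt0P; exists (Ordinal hq); rewrite inE /=.
  apply: contraNneq wi0 => /polyP /(_ (i0 %/ D)%N).
  rewrite coef0 coef_poly ltn_divLR // ltn_ord -divn_eq /wn valK => ->.
  by [].
have [S0|S0] := posnP S.
  move: DS; rewrite S0 muln0 leqn0 muln_eq0 => /orP[|] /eqP e.
    by rewrite e in D0.
  by have := ltn_ord i0; rewrite {2}e.
have key (xx yy : R) : \sum_(i < #|K|) (P (enum_val i)).[xx] * yy ^+ enum_val i =
    \sum_(q < D) (P q).[xx] * yy ^+ q.
  rewrite [RHS](bigID (mem K)) /= [X in _ = _ + X]big1 ?addr0; last first.
    by move=> i; rewrite inE negbK => /eqP ->; rewrite horner0 mul0r.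
  by rewrite [RHS]big_enum_val.
pose s := [seq ((r%:R + s%:R * beta), a1 ^+ r * a2 ^+ s) | r <- iota 0 S, s <- iota 0 S].
have ss : size s = (S * S)%N by rewrite size_allpairs !size_iota.
have a10' : a1 != 0 by rewrite gt_eqF.
have a20' : a2 != 0 by rewrite gt_eqF.
have [||||||||z zs [r rl nz]] := @zero_estimate R #|K| D1 (fun i => P (enum_val i)) (fun i => enum_val i) a1 s.
- exact: l0.
- by move=> i; have := enum_valP i; rewrite inE.
- by move=> i; exact: size_poly.
- exact: a10'.
- move=> i j e; apply/enum_val_inj/val_inj => /=.
  by apply: (ieexprIn a10 a1n1 e).
- rewrite map_allpairs /=.
  apply: allpairs_uniq; rewrite ?iota_uniq //.
  move=> [r1 s1] [r2 s2] /= _ _.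
  have [->|sn] := eqVneq s1 s2.
    by move=> /addIr /eqP; rewrite eqr_nat => /eqP ->.
  move=> e; exfalso; apply: irr; exists ((r2%:R - r1%:R) / (s1%:R - s2%:R)).
  rewrite fmorph_div !rmorphB /= !ratr_nat.
  have d0 : (s1%:R - s2%:R : R) != 0 by rewrite subr_eq0 eqr_nat.
  apply: (mulIf d0); rewrite divfK //.
  by apply/eqP; rewrite -subr_eq0 -(subrr (r2%:R + s2%:R * beta)) -{1}e; apply/eqP; ring.
- by rewrite ss; apply: leq_trans DS; rewrite leq_mul2r lD orbT.
- move=> z /allpairsP[[r1 s1] [_ _ ->]] /=.
  by rewrite mulf_neq0 // expf_neq0.
move: zs => /allpairsP[[r1 s1] [/= r1S s1S zE]].
move: r1S s1S; rewrite !mem_iota !add0n /= => r1S s1S.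
(* The grid has [S + D] values of the first index in order to contain the translates by
   [r < #|K| <= D] that the zero estimate uses. *)
have hj : ((r1 + r) * S + s1 < (S + D) * S)%N.
  apply: (@leq_trans ((r1 + r).+1 * S)); first by rewrite mulSn addnC ltn_add2r.
  by rewrite leq_mul2r -addSn leq_add ?orbT // ltnW // (leq_trans rl).
move/eqP: nz; apply.
have := @wAj (Ordinal hj) (z.1 + r%:R) (a1 ^+ r * z.2).
rewrite /= divnMDl // modnMDl divn_small // modn_small // addn0 zE /=.
have -> : r1%:R + s1%:R * beta + r%:R = (r1 + r)%:R + s1%:R * beta by rewrite natrD; ring.
have -> : a1 ^+ r * (a1 ^+ r1 * a2 ^+ s1) = a1 ^+ (r1 + r) * a2 ^+ s1 by rewrite exprD; ring.
move=> E0; have {E0}E := E0 erefl erefl; rewrite -[RHS]E.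
exact: key.
Qed.


Lemma expR_sub1_le (x : R) : `|x| <= 2^-1 -> `|expR x - 1| <= 2 * `|x|.
Proof.
move=> x1.
have e2 : expR x * expR (- x) = 1 by rewrite -expRD subrr expR0.
have e1 := expR_ge1Dx x.
have e3 := expR_ge1Dx (- x).
have e0 := expR_gt0 x.
move: x1; have [x_ge0|x_lt0] := lerP 0 x => x1.
  rewrite ger0_norm; last lra.
  have : expR x * (1 - x) <= 1 by rewrite -{2}e2 ler_wpM2l ?expR_ge0.
  by move: x1; rewrite ger0_norm // => x1 ?; nra.
have e4 : expR x <= 1 by rewrite -expR0 ler_expR ltW.
by move: x1; rewrite (ltr0_norm x_lt0) ler0_norm; lra.
Qed.

Lemma fact_le_expn n : (n`! <= n ^ n)%N.
Proof.
elim: n => // n IH; rewrite factS expnS leq_mul2l /=; apply: leq_trans IH _.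
by apply: leqX2n.
Qed.

Lemma size_det_le (F : idomainType) n k (M : 'M[{poly F}]_n) :
  (forall i j, size (M i j) <= k.+1)%N -> (size (\det M) <= (n * k).+1)%N.
Proof.
move=> h; rewrite /determinant; apply: (leq_trans (size_sum _ _ _)).
apply/bigmax_leqP => t _; rewrite size_Msign.
have := (@coef_prod_top F n (fun i => M i (t i)) (fun=> k) (fun i => h _ _)).2.
by rewrite sum_nat_const card_ord.
Qed.

Lemma polyl1_linear_exp (r s p : nat) (c : nat) :
  (polyl1 ((r%:Z%:P + s%:Z%:P * 'X) ^+ p * c%:Z%:P)%R <= (r + s) ^ p * c)%N.
Proof.
have p1 : polyl1 1 = 1%N by rewrite (@polyl1E 1 1) ?size_poly1 // big_ord1 coef1.
apply: leq_trans (polyl1M _ _) _.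
have -> : polyl1 (c%:Z%:P) = c by rewrite -[_%:P]mulr1 polyl1Cm p1 muln1.
rewrite leq_mul2r; apply/orP; right.
apply: leq_trans (polyl1X _ _) _; apply: leqX2n.
apply: leq_trans (polyl1D _ _) _; rewrite polyl1Cm -['X]mulr1 polyl1Xm p1 muln1.
by rewrite -[r%:Z%:P]mulr1 polyl1Cm p1 muln1.
Qed.

Lemma size_linear_exp (r s p : nat) (c : int) k : (p <= k)%N ->
  (size ((r%:Z%:P + s%:Z%:P * 'X) ^+ p * c%:P)%R <= k.+1)%N.
Proof.
move=> pk; apply: leq_trans (size_polyMleq _ _) _.
have h1 : (size (r%:Z%:P + s%:Z%:P * 'X : {poly int})%R <= 2)%N.
  apply: leq_trans (size_polyD _ _) _; rewrite geq_max.
  rewrite (leq_trans (size_polyC_leq1 _)) //=.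
  apply: leq_trans (size_polyMleq _ _) _; rewrite size_polyX.
  by have := size_polyC_leq1 (s%:Z); case: size => [|[]].
have h2 := size_poly_exp_leq (r%:Z%:P + s%:Z%:P * 'X : {poly int}) p.
have h3 := size_polyC_leq1 c.
have h4 : ((size (r%:Z%:P + s%:Z%:P * 'X : {poly int})%R).-1 * p <= p)%N.
  by move: h1; case: size => [|[|[|]]] //= _; rewrite ?mul0n ?mul1n.
set P := (_ + _ * _) in h1 h2 h4 *; move: h2 h3 h4.
move: (size (P ^+ p)) (size c%:P) ((size P).-1 * p)%N => x y z h2 h3 h4; lia.
Qed.

Lemma expn_form_le (u v r S q D : nat) : (0 < u)%N -> (0 < v)%N -> (r <= S)%N -> (q <= D)%N ->
  (u ^ (q * r) * v ^ (q * (S - r)) <= (u ^ S * v ^ S) ^ D)%N.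
Proof.
move=> u0 v0 rS qD; rewrite expnMn -!expnM leq_mul //; apply: leq_pexp2l => //.
  by rewrite mulnC leq_mul.
by rewrite mulnC leq_mul // leq_subr.
Qed.

Lemma expn_form_eq (u v r S q : nat) : (0 < v)%N -> (r <= S)%N ->
  (u ^ (q * r) * v ^ (q * (S - r)))%:R = (v ^ S)%:R ^+ q * ((u%:R / v%:R) ^+ r) ^+ q :> R.
Proof.
move=> v0 rS; rewrite natrM !natrX -!exprM expr_div_n.
have -> : (S * q)%N = (q * (S - r) + r * q)%N.
  by rewrite [(r * q)%N]mulnC -mulnDr subnK // mulnC.
rewrite exprD [(r * q)%N]mulnC; field.
by rewrite expf_neq0 // pnatr_eq0 -lt0n.
Qed.

(** If the form were smaller than [T ^- (2 * L)], the points [(x, a1 ^ r a2 ^ s)] would lie so close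
    to the curve [(x, exp (la1 * x))] that the determinant is at most
    [t ^+ (9 * D1 * L) * t ^- 'C(L, 2)]. Clearing denominators costs [t ^+ (D1 * L)], and
    Liouville's inequality, whose exponent is the degree [d] of [beta], costs
    [t ^+ (9 * D1 * L * d)]. As [L = D1 * D], the choice [D = 21 * d.+1] exceeds [2 * (10 + 9 * d)]
    and gives a contradiction. The hypothesis [u1 <> v1] makes the powers of [a1] distinct. *)
Lemma log_form_bound_prelim (beta : R) : algebraicOver ratr beta -> ~ rational_real beta ->
  exists D T0 : nat, forall (T u1 v1 u2 v2 : nat),
    (T0 <= T)%N -> (0 < u1)%N -> (0 < v1)%N -> (0 < u2)%N -> (0 < v2)%N ->
    ln (u1%:R : R) <= T%:R ^+ 3 -> ln (v1%:R : R) <= T%:R ^+ 3 ->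
    ln (u2%:R : R) <= T%:R ^+ 3 -> ln (v2%:R : R) <= T%:R ^+ 3 ->
    u1 <> v1 ->
    (T%:R ^- (2 * (D * T ^ 8 * D)) : R) <=
    `|beta * (ln u1%:R - ln v1%:R) - (ln u2%:R - ln v2%:R)|.
Proof.
move=> alg irr; have [d [C [C0 liou]]] := liouville_poly alg.
pose D := (21 * d.+1)%N.
pose c : R := 2 * D%:R * (1 + `|beta|).
(* Every constant of the proof is dominated by [T]: [expR c], the Liouville constant [C] and
   [6 * D * D]. *)
pose T0 := ((Num.truncn (expR c)).+1 + C + 6 * D * D + 9)%N.
exists D, T0 => T u1 v1 u2 v2 TT0 u10 v10 u20 v20 lu1 lv1 lu2 lv2 u1v1.
rewrite leNgt; apply/negP => small.
pose t : R := T%:R.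
have D0 : (0 < D)%N by [].
have T9 : (9 <= T)%N by apply: leq_trans TT0; rewrite /T0; lia.
have t9 : 9 <= t by rewrite /t ler_nat.
have t1 : 1 <= t by lra.
have t0 : 0 < t by lra.
have TC : (C <= T)%N by apply: leq_trans TT0; rewrite /T0; lia.
have TD : (6 * D * D <= T)%N by apply: leq_trans TT0; rewrite /T0; lia.
have Tc : expR c <= t.
  apply: ltW; apply: (@lt_le_trans _ _ (Num.truncn (expR c)).+1%:R).
    exact: truncnS_gt.
  by rewrite ler_nat; apply: leq_trans TT0; rewrite /T0; lia.
have c0 : 0 <= c by rewrite /c !mulr_ge0 ?addr_ge0.
have ct : c <= t by apply: le_trans Tc; apply: le_trans (expR_ge1Dx c); rewrite lerDr.
have D1R : 1 <= (D%:R : R) by rewrite -[1]/(1%:R) ler_nat.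
have e1t : expR 1 <= t.
  apply: le_trans Tc; rewrite ler_expR /c.
  have : 0 <= D%:R * `|beta| by rewrite mulr_ge0.
  lra.
(* [S * S = D * D1] is exactly what the zero estimate requires, while [D * T ^ 3 * (t * X)], the
   largest exponent that occurs, is still a constant times [D1] since [X] has order [T ^ 4]. *)
pose S := (D * T ^ 4)%N; pose D1 := (D * T ^ 8)%N; pose L := (D1 * D)%N.
pose a1 : R := u1%:R / v1%:R; pose a2 : R := u2%:R / v2%:R.
have u1p : 0 < (u1%:R : R) by rewrite ltr0n.
have v1p : 0 < (v1%:R : R) by rewrite ltr0n.
have u2p : 0 < (u2%:R : R) by rewrite ltr0n.
have v2p : 0 < (v2%:R : R) by rewrite ltr0n.
have a1p : 0 < a1 by rewrite divr_gt0.
have a2p : 0 < a2 by rewrite divr_gt0.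
pose la1 := ln a1; pose la2 := ln a2.
have la1E : la1 = ln u1%:R - ln v1%:R by rewrite /la1 ln_div.
have la2E : la2 = ln u2%:R - ln v2%:R by rewrite /la2 ln_div.
pose Lam := beta * la1 - la2.
have {}small : `|Lam| < t ^- (2 * L) by rewrite /Lam la1E la2E.
have a1n1 : a1 != 1.
  apply/eqP => a11; apply: u1v1; apply/eqP; rewrite -(eqr_nat R); apply/eqP.
  by move/(congr1 ( *%R^~ v1%:R)): a11; rewrite /a1 divfK ?gt_eqF // mul1r.
have rf := @interpolation_row_free beta a1 a2 D D1 S irr a1p a1n1 a2p.
have {}rf := rf ltac:(rewrite /D1 /S; apply: eq_leq; ring).
set A := (\matrix_(i, j) _) in rf.
have fT : row_full A^T by rewrite /row_full mxrank_tr; exact: rf.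
(* [fullrankfun] selects [L] points of the grid at which the square determinant is nonzero. *)
pose f := fullrankfun fT.
pose rr (j : 'I_L) := (f j %/ S)%N; pose ss (j : 'I_L) := (f j %% S)%N.
pose p (i : 'I_L) := (i %/ D)%N; pose q (i : 'I_L) := (i %% D)%N.
have Tp : (0 < T)%N by apply: leq_trans T9.
have T4 n : (0 < T ^ n)%N by rewrite expn_gt0 Tp.
have S0 : (0 < S)%N by rewrite muln_gt0 D0 T4.
have pD1 i : (p i < D1)%N by rewrite /p ltn_divLR // ltn_ord.
have qD i : (q i < D)%N by rewrite /q ltn_mod.
have rrS j : (rr j < S + D)%N by rewrite /rr ltn_divLR // ltn_ord.
have ssS j : (ss j < S)%N by rewrite /ss ltn_mod.
pose x j : R := (rr j)%:R + (ss j)%:R * beta.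
pose M : 'M[R]_L := \matrix_(i, j) (x j ^+ p i * (a1 ^+ rr j * a2 ^+ ss j) ^+ q i).
have detM : \det M != 0.
  have : rowsub f A^T \in unitmx by exact: fullrowsub_unit.
  rewrite unitmxE -det_tr unitfE.
  by have -> : (rowsub f A^T)^T = M by apply/matrixP => i j; rewrite !mxE.
pose X : R := (1 + `|beta|) * (S + D)%:R.
have X0 : 0 <= X by rewrite mulr_ge0 ?addr_ge0.
have DS : (D <= S)%N by rewrite /S leq_pmulr // T4.
have xX j : `|x j| <= X.
  apply: le_trans (ler_normD _ _) _; rewrite normrM !normr_nat /X mulrDl mul1r lerD //.
    by rewrite ler_nat ltnW.
  by rewrite mulrC ler_wpM2l // ler_nat ltnW // (leq_trans (ssS j)) ?leq_addr.
have Xct : X <= c * t ^+ 4.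
  apply: (@le_trans _ _ ((1 + `|beta|) * (2 * S)%:R)).
    by rewrite ler_wpM2l ?addr_ge0 // ler_nat mul2n -addnn leq_add2l.
  by rewrite /S /c 2!natrM natrX -/t; apply: le_of_eq; ring.
have tX : t * X <= t ^+ 6.
  rewrite exprS ler_wpM2l ?(ltW t0) //; apply: le_trans Xct _.
  by rewrite [in X in _ <= X]exprS ler_wpM2r ?exprn_ge0 ?(ltW t0).
have la1t : `|la1| <= t ^+ 3.
  have h1 : 0 <= ln (u1%:R : R) by rewrite ln_ge0 // -[1]/(1%:R) ler_nat.
  have h2 : 0 <= ln (v1%:R : R) by rewrite ln_ge0 // -[1]/(1%:R) ler_nat.
  by rewrite la1E ler_norml; apply/andP; split; lra.
have DSt : (6 * D * S)%:R <= t ^+ 5.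
  rewrite -natrX ler_nat /S; apply: (@leq_trans (6 * D * D * T ^ 4)).
    by apply: eq_leq; ring.
  by rewrite [in X in (_ <= X)%N]expnS leq_mul2r TD orbT.
have L5 : (5 <= L)%N.
  rewrite /L /D1; apply: (@leq_trans (1 * T ^ 8 * 1)); last by rewrite !leq_mul.
  rewrite mul1n muln1; apply: leq_trans (_ : 9 <= _)%N => //.
  by apply: (leq_trans T9); rewrite -{1}[T]expn1; apply: leq_pexp2l.
have DSL : 2 * (D%:R * S%:R) <= t ^+ L :> R.
  apply: (@le_trans _ _ (t ^+ 5)); last by rewrite ler_weXn2l.
  apply: le_trans DSt; rewrite -!natrM ler_nat mulnA.
  by rewrite leq_mul2r leq_mul2r orbT.
have qlat i : `|(q i)%:R * la1| * (t * X) <= c * D1%:R.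
  rewrite normrM normr_nat.
  apply: (@le_trans _ _ (D%:R * t ^+ 3 * (t * (c * t ^+ 4)))).
    apply: ler_pM; rewrite ?mulr_ge0 ?(ltW t0) //.
      by rewrite ler_pM // ler_nat ltnW.
    by rewrite ler_wpM2l // (ltW t0).
  by rewrite /D1 natrM natrX -/t; apply: le_of_eq; ring.
have expqt i : expR (`|(q i)%:R * la1| * (t * X)) <= t ^+ D1.
  by apply: le_trans (@expR_le_exprn t c D1 Tc); rewrite ler_expR.
have ub : `|\det M| <= L`!%:R * t ^- 'C(L, 2) *
    \prod_i (3 * ((t * X) ^+ p i * expR (`|(q i)%:R * la1| * (t * X)))).
  apply: (@interpolation_det_le R L M p (fun i => (q i)%:R * la1) x X t) => //.
    by move=> i; apply: ltnW; apply: leq_trans (pD1 i) _; rewrite /L leq_pmulr.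
  move=> i j.
  (* Substituting [la2 = beta * la1 - Lam] separates the exponential of [la1 * x j] from a factor
     within [t ^- L] of 1. *)
  have yE : (a1 ^+ rr j * a2 ^+ ss j) ^+ q i =
      expR ((q i)%:R * la1 * x j) * expR (- ((q i)%:R * (ss j)%:R * Lam)).
    rewrite -expRD -[a1]lnK ?posrE // -[a2]lnK ?posrE // -/la1 -/la2.
    rewrite -!expRM_natr -expRD -expRM_natr; congr expR.
    by rewrite /Lam /x; ring.
  rewrite mxE yE.
  have -> : forall a e1 e2 : R, a * (e1 * e2) - a * e1 = a * e1 * (e2 - 1) by move=> *; ring.
  have w2 : 2 * `|(q i)%:R * (ss j)%:R * Lam| <= t ^- L.
    rewrite !normrM !normr_nat mulrA.
    apply: (@le_trans _ _ (2 * (D%:R * S%:R) * t ^- (2 * L))).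
      apply: ler_pM => //; last exact: ltW.
      by rewrite ler_wpM2l // ler_pM // ler_nat ltnW.
    have -> : t ^- (2 * L) = t ^- L * t ^- L by rewrite mul2n -addnn exprD invfM.
    rewrite [leLHS]mulrA ler_piMl ?invr_ge0 ?exprn_ge0 ?(ltW t0) //.
    by rewrite ler_pdivrMr ?exprn_gt0 // mul1r.
  have tL1 : t ^- L <= 1 by rewrite invf_le1 ?exprn_gt0 // exprn_ege1.
  rewrite normrM mulrC normrM.
  apply: ler_pM; rewrite ?mulr_ge0 //.
    apply: le_trans (expR_sub1_le _) _; rewrite normrN //.
    by have := le_trans w2 tL1; lra.
  have XtX : X <= t * X by rewrite ler_peMl.
  apply: ler_pM => //.
    by rewrite normrX lerXn2r ?nnegrE // ?(le_trans X0 XtX) // (le_trans (xX j) XtX).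
  rewrite ger0_norm ?expR_ge0 // ler_expR; apply: le_trans (ler_norm _) _.
  rewrite [leLHS]normrM ler_wpM2l //.
  exact: le_trans (xX j) XtX.
have factor_le i : 3 * ((t * X) ^+ p i * expR (`|(q i)%:R * la1| * (t * X))) <= t ^+ (8 * D1).
  have -> : (8 * D1 = D1 + (6 * D1 + D1))%N by ring.
  rewrite exprD [t ^+ (6 * D1 + D1)]exprD.
  have tX0 : 0 <= t * X by rewrite mulr_ge0 // ltW.
  have D1p : (0 < D1)%N by apply: leq_ltn_trans (pD1 i).
  apply: ler_pM; rewrite ?mulr_ge0 ?exprn_ge0 ?expR_ge0 //.
    by apply: le_trans (ler_eXnr _ _) => //; lra.
  apply: ler_pM; rewrite ?exprn_ge0 ?expR_ge0 //.
  apply: le_trans (_ : (t ^+ 6) ^+ p i <= _).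
    by rewrite lerXn2r ?nnegrE ?exprn_ge0 ?(ltW t0).
  rewrite -exprM ler_weXn2l // leq_mul2l /=; exact: ltnW.
have L9 : (L <= T ^ 9)%N.
  rewrite /L /D1 [in X in (_ <= X)%N]expnS mulnAC leq_mul2r; apply/orP; right.
  apply: leq_trans TD; rewrite -mulnA leq_pmull //.
have D19 : (9 <= D1)%N.
  apply: leq_trans T9 _; apply: leq_trans (leq_pmull (T ^ 8) D0).
  by rewrite -{1}[T]expn1; apply: leq_pexp2l.
have factL : L`!%:R <= t ^+ (D1 * L) :> R.
  rewrite -natrX ler_nat; apply: leq_trans (fact_le_expn L) _.
  apply: (@leq_trans ((T ^ 9) ^ L)); first exact: leqX2n.
  by rewrite -expnM; apply: leq_pexp2l => //; rewrite leq_mul2r D19 orbT.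
have {}ub : `|\det M| <= t ^+ (9 * D1 * L) * t ^- 'C(L, 2).
  apply: le_trans ub _; rewrite mulrAC ler_wpM2r ?invr_ge0 ?exprn_ge0 ?(ltW t0) //.
  have -> : (9 * D1 * L = D1 * L + 8 * D1 * L)%N by ring.
  rewrite exprD ler_pM //; first by rewrite prodr_ge0 // => i _; rewrite !mulr_ge0 ?exprn_ge0 ?expR_ge0 ?mulr_ge0 ?(ltW t0).
  have -> : t ^+ (8 * D1 * L) = \prod_(i < L) t ^+ (8 * D1).
    by rewrite prodr_const card_ord exprM.
  apply: ler_prod => i _; rewrite factor_le !mulr_ge0 ?exprn_ge0 ?expR_ge0 ?mulr_ge0 ?(ltW t0) //.
(* Multiplying row [i] by [rho ^ q i] clears the denominators of the powers of [a1] and [a2]; the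
   determinant then becomes the value at [beta] of the integer polynomial [G]. [W] bounds the
   integer coefficients [cc i j]. *)
pose W := ((u1 ^ (S + D) * v1 ^ (S + D)) ^ D * (u2 ^ S * v2 ^ S) ^ D)%N.
pose rho := (v1 ^ (S + D) * v2 ^ S)%N.
pose cc i j := (u1 ^ (q i * rr j) * v1 ^ (q i * (S + D - rr j)) *
               (u2 ^ (q i * ss j) * v2 ^ (q i * (S - ss j))))%N.
pose N : 'M[{poly int}]_L :=
  \matrix_(i, j) (((rr j)%:Z%:P + (ss j)%:Z%:P * 'X) ^+ p i * (cc i j)%:Z%:P).
pose G := \det N.
have ccW i j : (cc i j <= W)%N.
  by rewrite /cc /W leq_mul // expn_form_le // ltnW // ?qD ?rrS.
have ccE i j : (cc i j)%:R = rho%:R ^+ q i * (a1 ^+ rr j * a2 ^+ ss j) ^+ q i :> R.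
  rewrite /cc natrM !expn_form_eq //; [|exact: ltnW|exact: ltnW].
  by rewrite mulrACA -!exprMn -natrM.
have GE : (map_poly intr G).[beta] = (\prod_i rho%:R ^+ q i) * \det M.
  have -> : (map_poly intr G).[beta] = \det (map_mx (horner_eval beta) (map_mx (map_poly (intr : int -> R)) N)).
    by rewrite !det_map_mx.
  have -> : map_mx (horner_eval beta) (map_mx (map_poly (intr : int -> R)) N) =
      diag_mx (\row_i rho%:R ^+ q i) *m M.
    apply/matrixP => i j; rewrite mul_diag_mx !mxE /horner_eval.
    rewrite rmorphM rmorphXn rmorphD rmorphM /= !map_polyC map_polyX /=.
    rewrite hornerM horner_exp hornerD hornerM !hornerC hornerX /=.
    have -> : (cc i j)%:~R = (cc i j)%:R :> R by [].
    by rewrite ccE mulrCA.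
  by rewrite det_mulmx det_diag; congr (_ * _); apply: eq_bigr => i _; rewrite mxE.
have rho0 : (0 < rho)%N by rewrite muln_gt0 !expn_gt0 v10 v20.
have Gn0 : (map_poly intr G).[beta] != 0 :> R.
  rewrite GE mulf_neq0 //; apply/prodf_neq0 => i _.
  by rewrite expf_neq0 // pnatr_eq0 -lt0n.
have natbd u n : (0 < u)%N -> ln (u%:R : R) <= t ^+ 3 -> u%:R ^+ n <= expR (t ^+ 3 * n%:R) :> R.
  move=> u0 lu; rewrite expRM_natr lerXn2r ?nnegrE ?expR_ge0 //.
  by rewrite -[leLHS]lnK ?posrE ?ltr0n // ler_expR.
have expT8 (n : nat) : (n <= 6 * D * S)%N -> expR (t ^+ 3 * n%:R) <= t ^+ D1.
  move=> n6; apply: le_trans (@expR_le_exprn t 1 D1 e1t); rewrite ler_expR mul1r.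
  apply: (@le_trans _ _ (t ^+ 8)).
    have -> : (8 = 3 + 5)%N by []. 
    rewrite exprD ler_wpM2l ?exprn_ge0 ?(ltW t0) //.
    by apply: le_trans DSt; rewrite ler_nat.
  by rewrite -natrX ler_nat leq_pmull.
have Wt : W%:R <= t ^+ D1.
  have -> : W%:R = (u1%:R ^+ (S + D) * v1%:R ^+ (S + D) * u2%:R ^+ S * v2%:R ^+ S) ^+ D :> R.
    by rewrite /W natrM !natrX !natrM !natrX -exprMn; congr (_ ^+ _); ring.
  apply: (@le_trans _ _ (expR (t ^+ 3 * ((S + D) + (S + D) + S + S)%N%:R) ^+ D)).
    rewrite lerXn2r ?nnegrE ?mulr_ge0 ?exprn_ge0 ?expR_ge0 //.
    have -> : expR (t ^+ 3 * ((S + D) + (S + D) + S + S)%N%:R) =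
       expR (t ^+ 3 * (S + D)%:R) * expR (t ^+ 3 * (S + D)%:R) *
       expR (t ^+ 3 * S%:R) * expR (t ^+ 3 * S%:R).
      by rewrite -!expRD; congr expR; rewrite !natrD; ring.
    apply: ler_pM; rewrite ?mulr_ge0 ?exprn_ge0 //; last exact: natbd.
    apply: ler_pM; rewrite ?mulr_ge0 ?exprn_ge0 //; last exact: natbd.
    by apply: ler_pM; rewrite ?exprn_ge0 //; exact: natbd.
  rewrite -expRM_natr -mulrA -natrM; apply: expT8.
  apply: (@leq_trans (6 * S * D)); last by apply: eq_leq; ring.
  by rewrite leq_mul2r; apply/orP; right; clear -DS; lia.
have rhot : rho%:R ^+ D <= t ^+ D1 :> R.
  rewrite /rho natrM !natrX.
  apply: (@le_trans _ _ (expR (t ^+ 3 * ((S + D) + S)%N%:R) ^+ D)).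
    rewrite lerXn2r ?nnegrE ?mulr_ge0 ?exprn_ge0 ?expR_ge0 // natrD mulrDr expRD.
    by rewrite ler_pM ?exprn_ge0 // natbd.
  rewrite -expRM_natr -mulrA -natrM; apply: expT8.
  apply: (@leq_trans (6 * S * D)); last by apply: eq_leq; ring.
  by rewrite leq_mul2r; apply/orP; right; clear -DS; lia.
have prodrho : `|\prod_(i < L) rho%:R ^+ q i| <= t ^+ (D1 * L) :> R.
  rewrite normr_prod exprM -[in leRHS](card_ord L) -prodr_const; apply: ler_prod => i _.
  rewrite normr_ge0 ger0_norm ?exprn_ge0 //; apply: le_trans rhot.
  by rewrite ler_weXn2l ?ler1n // ltnW.
pose A0 := (L`! * \prod_(i < L) ((6 * D * S) ^ D1 * W))%N.
have GA : (polyl1 G <= A0)%N.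
  apply: polyl1_det => i j; rewrite mxE; apply: leq_trans (polyl1_linear_exp _ _ _ _) _.
  apply: leq_mul => //.
  have h : (rr j + ss j <= 6 * D * S)%N.
    apply: (@leq_trans ((S + D) + S)); first by apply: leq_add; apply: ltnW.
    apply: (@leq_trans (6 * 1 * S)); first by clear -DS; lia.
    by rewrite leq_mul2r leq_mul2l D0 !orbT.
  apply: leq_trans (leqX2n _ h) _; apply: leq_pexp2l; last exact: ltnW.
  by apply: (leq_trans S0); apply: leq_pmull; rewrite muln_gt0 /= D0.
have szG : (size G <= (L * D1).+1)%N.
  by apply: size_det_le => i j; rewrite mxE; apply: size_linear_exp; apply: ltnW.
have A0t : A0%:R <= t ^+ (7 * D1 * L) :> R.
  rewrite /A0 natrM prod_nat_const card_ord natrX natrM natrX.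
  have -> : (7 * D1 * L = D1 * L + (5 * D1 + D1) * L)%N by ring.
  rewrite exprD; apply: ler_pM => //.
  rewrite [leRHS]exprM lerXn2r ?nnegrE ?mulr_ge0 ?exprn_ge0 ?(ltW t0) // exprD.
  by rewrite ler_pM ?exprn_ge0 // exprM lerXn2r ?nnegrE ?exprn_ge0 ?(ltW t0).
have D1L1 : (1 <= L * D1)%N.
  by rewrite muln_gt0 (leq_trans _ L5) //= (leq_trans _ D19).
have := liou _ _ _ szG GA Gn0; rewrite GE normrM.
have CA : (C ^ (L * D1).+1 * A0)%:R ^+ d <= t ^+ (9 * D1 * L * d).
  rewrite exprM lerXn2r ?nnegrE ?exprn_ge0 ?(ltW t0) // natrM natrX.
  have -> : (9 * D1 * L = (2 * (L * D1)) + 7 * D1 * L)%N by ring.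
  rewrite exprD ler_pM ?exprn_ge0 //.
  apply: (@le_trans _ _ (t ^+ (L * D1).+1)); first by rewrite lerXn2r ?nnegrE ?(ltW t0) // ler_nat.
  by rewrite ler_weXn2l // mul2n -addnn -addn1 leq_add2l.
move=> lio.
have : 1 <= t ^+ (D1 * L) * (t ^+ (9 * D1 * L) * t ^- 'C(L, 2)) * t ^+ (9 * D1 * L * d).
  by apply: le_trans lio _; rewrite !ler_pM ?mulr_ge0 ?exprn_ge0.
rewrite mulrA -mulrA [_^-1 * _]mulrC !mulrA ler_pdivlMr ?exprn_gt0 // mul1r -!exprD.
rewrite ler_eXn2l //; last by lra.
rewrite leqNgt => /negP; apply.
have e : (2 * 'C(L, 2) = L * L.-1)%N by rewrite -mul_bin_diag bin1.
have L0 : (0 < L)%N by apply: leq_trans L5.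
rewrite -(@ltn_pmul2l 2) // e.
have -> : (2 * (D1 * L + 9 * D1 * L + 9 * D1 * L * d) = L * (20 * D1 + 18 * (D1 * d)))%N by ring.
rewrite ltn_pmul2l // -ltnS (ltn_predK L0) /L /D.
have -> : (D1 * (21 * d.+1) = 21 * D1 + 21 * (D1 * d))%N by ring.
by clear -D19; move: (D1 * d)%N => y; lia.
Qed.

(** For [u1 = v1] the first logarithm disappears and only [ln u2 - ln v2] remains, which is at least
    the inverse of the larger of [u2], [v2] in absolute value; this is far above the bound
    claimed. *)
Lemma log_form_bound (beta : R) : algebraicOver ratr beta -> ~ rational_real beta ->
  exists D T0 : nat, forall (T u1 v1 u2 v2 : nat),
    (T0 <= T)%N -> (0 < u1)%N -> (0 < v1)%N -> (0 < u2)%N -> (0 < v2)%N ->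
    ln (u1%:R : R) <= T%:R ^+ 3 -> ln (v1%:R : R) <= T%:R ^+ 3 ->
    ln (u2%:R : R) <= T%:R ^+ 3 -> ln (v2%:R : R) <= T%:R ^+ 3 ->
    u1 <> v1 \/ u2 <> v2 ->
    (T%:R ^- (D * T ^ 8) : R) <=
    `|beta * (ln u1%:R - ln v1%:R) - (ln u2%:R - ln v2%:R)|.
Proof.
move=> alg irr; have [D [T0 H]] := log_form_bound_prelim alg irr.
exists (2 * D * D + 2)%N, (T0 + 3 + (Num.truncn (expR 1 : R)).+1)%N => T u1 v1 u2 v2 TT u10 v10 u20 v20 lu1 lv1 lu2 lv2 ne.
have T3 : (3 <= T)%N by apply: leq_trans TT; rewrite addnAC leq_addl.
have t3 : 3 <= (T%:R : R) by rewrite ler_nat.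
have t1 : 1 <= (T%:R : R) by lra.
have t0 : 0 < (T%:R : R) by lra.
have [uv|uv] := eqVneq u1 v1; last first.
  apply: le_trans (H T u1 v1 u2 v2 _ _ _ _ _ _ _ _ _ _) => //.
  - rewrite lef_pV2 ?posrE ?exprn_gt0 // ler_weXn2l //.
    apply: (@leq_trans ((2 * D * D) * T ^ 8)); first by apply: eq_leq; ring.
    by rewrite leq_mul2r leq_addr orbT.
  - by apply: leq_trans TT; rewrite -addnA leq_addr.
  - exact/eqP.
have {}ne : u2 <> v2 by case: ne => // /eqP; rewrite uv eqxx.
rewrite uv subrr mulr0 sub0r normrN.
have e3 : expR 1 <= (T%:R : R).
  apply: ltW; apply: lt_le_trans (truncnS_gt (expR 1)) _.
  by rewrite ler_nat; apply: leq_trans TT; rewrite leq_addl.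
have main u v : (0 < u)%N -> (u < v)%N -> ln (v%:R : R) <= T%:R ^+ 3 ->
    T%:R ^- ((2 * D * D + 2) * T ^ 8) <= ln (v%:R : R) - ln u%:R.
  move=> u0 uv' lv.
  have v0 : (0 < v)%N by apply: leq_trans uv'.
  have up : 0 < (u%:R : R) by rewrite ltr0n.
  have vp : 0 < (v%:R : R) by rewrite ltr0n.
  have h1 : (v%:R : R) <= T%:R ^+ (T ^ 3).
    rewrite -[leLHS]lnK ?posrE //; apply: le_trans (_ : expR (1 * (T ^ 3)%N%:R) <= _).
      by rewrite ler_expR mul1r natrX.
    exact: expR_le_exprn.
  apply: (@le_trans _ _ (v%:R^-1)).
    rewrite lef_pV2 ?posrE ?exprn_gt0 //; apply: le_trans h1 _.
    rewrite ler_weXn2l //; apply: (@leq_trans (1 * T ^ 8)).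
      by rewrite mul1n; apply: leq_pexp2l => //; apply: leq_trans T3.
    by rewrite leq_mul2r addn2 orbT.
  have := @le_ln1Dx R (u%:R / v%:R - 1).
  rewrite addrCA subrr addr0 ln_div ?posrE // => h.
  have h2 : -1 < (u%:R / v%:R - 1 : R) by rewrite ltrBDr addrC subrr divr_gt0.
  have h3 : (u%:R / v%:R : R) <= 1 - v%:R^-1.
    rewrite ler_pdivrMr // mulrBl mul1r mulVf ?gt_eqF // lerBrDr natr1 ler_nat.
    by [].
  have := h h2; lra.
have [lt|gt|e] := ltngtP u2 v2; last by [].
- by rewrite distrC; apply: le_trans (main _ _ u20 lt lv2) (ler_norm _).
- by apply: le_trans (main _ _ v20 gt lu2) (ler_norm _).
Qed.

End Gelfond.

(** * Complex integration and Cauchy's formula *)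

Local Open Scope classical_set_scope.

Section Cdiff.
Context {R : realType}.
Local Notation C := R[i].
Implicit Types (f g : C -> C) (z w : C).

Definition cdiff f z := derivable (f : C^o -> C^o) z 1.

Lemma cdiff_cst c z : cdiff (fun=> c) z.
Proof. exact: derivable_cst. Qed.

Lemma cdiff_id z : cdiff id z.
Proof. exact: derivable_id. Qed.

Lemma cdiffD f g z : cdiff f z -> cdiff g z -> cdiff (fun w => f w + g w) z.
Proof. move=> df dg; exact: (@derivableD C C^o C^o (f : C^o -> C^o) (g : C^o -> C^o) z 1 df dg). Qed.

Lemma cdiffB f g z : cdiff f z -> cdiff g z -> cdiff (fun w => f w - g w) z.
Proof. move=> df dg; exact: (@derivableB C C^o C^o (f : C^o -> C^o) (g : C^o -> C^o) z 1 df dg). Qed.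

Lemma cdiffM f g z : cdiff f z -> cdiff g z -> cdiff (fun w => f w * g w) z.
Proof. move=> df dg; exact: (@derivableM C C^o (f : C^o -> C^o) (g : C^o -> C^o) z 1 df dg). Qed.

Lemma cdiffV f z : f z != 0 -> cdiff f z -> cdiff (fun w => (f w)^-1) z.
Proof. move=> fz df; exact: (@derivableV C C^o (f : C^o -> C^o) z 1 fz df). Qed.

Lemma cdiff_comp f g z : cdiff g z -> cdiff f (g z) -> cdiff (fun w => f (g w)) z.
Proof.
rewrite /cdiff !derivable1_diffP => dg df.
exact: (differentiable_comp dg df).
Qed.

Lemma cdiff_continuous f z : cdiff f z -> {for z, continuous (f : C^o -> C^o)}.
Proof.
by rewrite /cdiff derivable1_diffP; apply: differentiable_continuous.
Qed.


Local Notation nc := (@Normc.normc R).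

Lemma ncN z : nc (- z) = nc z.
Proof. exact: normcN. Qed.

Lemma ncD z w : nc (z + w) <= nc z + nc w.
Proof. exact: le_normcD. Qed.

Lemma ncB z w : nc (z - w) <= nc z + nc w.
Proof. by rewrite -(ncN w); exact: ncD. Qed.

Lemma ncC z w : nc (z - w) = nc (w - z).
Proof. by rewrite -ncN opprB. Qed.

Lemma nc_ge0 z : 0 <= nc z.
Proof. by case: z => a b; rewrite sqrtr_ge0. Qed.

Lemma nc0 : nc 0 = 0.
Proof. exact: Normc.normc0. Qed.

Lemma nc1 : nc 1 = 1.
Proof. exact: Normc.normc1. Qed.

Lemma ncM z w : nc (z * w) = nc z * nc w.
Proof. exact: Normc.normcM. Qed.

Lemma ncV z : nc z^-1 = (nc z)^-1.
Proof. exact: Normc.normcV. Qed.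

Lemma ncX z n : nc (z ^+ n) = nc z ^+ n.
Proof. by elim: n => [|n IH]; rewrite ?expr0 ?nc1 // !exprS ncM IH. Qed.

Lemma nc_eq0 z : (nc z == 0) = (z == 0).
Proof.
by apply/eqP/eqP => [/Normc.eq0_normc //|->]; rewrite nc0.
Qed.

Lemma nc_gt0 z : (0 < nc z) = (z != 0).
Proof. by rewrite lt_def nc_eq0 nc_ge0 andbT. Qed.

Lemma nc_real (x : R) : nc x%:C = `|x|.
Proof. by rewrite /= expr0n /= addr0 sqrtr_sqr. Qed.

Lemma nc_Re z : `|complex.Re z| <= nc z.
Proof.
by case: z => a b /=; rewrite -sqrtr_sqr ler_wsqrtr // lerDl sqr_ge0.
Qed.

Lemma nc_Im z : `|complex.Im z| <= nc z.
Proof.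
by case: z => a b /=; rewrite -sqrtr_sqr ler_wsqrtr // lerDr sqr_ge0.
Qed.

Lemma nc_leD z : nc z <= `|complex.Re z| + `|complex.Im z|.
Proof.
case: z => a b /=; rewrite -[leRHS]ger0_norm ?addr_ge0 // -sqrtr_sqr ler_wsqrtr //.
rewrite sqrrD !real_normK ?num_real // addrAC lerDl mulrn_wge0 // mulr_ge0 //.
Qed.

Lemma nc_sum (I : Type) (r : seq I) (P : pred I) (F : I -> C) :
  nc (\sum_(i <- r | P i) F i) <= \sum_(i <- r | P i) nc (F i).
Proof.
elim/big_ind2: _ => [|a b c d h1 h2|//]; first by rewrite nc0.
by apply: le_trans (ncD _ _) _; rewrite lerD.
Qed.

Lemma nc_triangle z w : nc z - nc w <= nc (z - w).
Proof. by rewrite lerBlDr; apply: le_trans (ncD _ _); rewrite subrK. Qed.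

Lemma normcE (z : C) : `|z| = (nc z)%:C.
Proof. by []. Qed.

Lemma posC (d : C) : 0 < d -> d = (complex.Re d)%:C /\ 0 < complex.Re d.
Proof. by rewrite ltcE; case: d => x y /= /andP[/eqP -> ->]. Qed.

Lemma ccontP f z : {for z, continuous (f : C^o -> C^o)} <->
  (forall e : R, 0 < e -> exists2 d : R, 0 < d &
     forall w, nc (w - z) < d -> nc (f w - f z) < e).
Proof.
split.
  move=> /cvgrPdist_lt fz e e0.
  have /fz /nbhs_ballP [d /= d0 H] : (0 : C) < e%:C by rewrite ltcR.
  have [d00 d0'] := posC d0.
  exists (complex.Re d) => // w wz.
  have := H w; rewrite /ball /= d00 normcE ltcR -ncN opprB => /(_ wz).
  by rewrite normcE ltcR -ncN opprB.
move=> H; apply/(@cvgrPdist_lt C C^o C^o (nbhs (z : C^o)) _ f (f z)) => e e0.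
have [e00 e0'] := posC e0.
have [d d0 Hd] := H _ e0'.
apply/nbhs_ballP; exists d%:C => /=; first by rewrite ltcR.
move=> w; rewrite /ball /= normcE ltcR -ncN opprB => /Hd.
by rewrite e00 normcE ltcR -[X in _ -> X < _]ncN opprB.
Qed.

Lemma cdiffP f z : cdiff f z <-> exists d, forall e : R, 0 < e -> exists2 dl : R, 0 < dl &
     forall w, nc (w - z) < dl -> nc (f w - f z - d * (w - z)) <= e * nc (w - z).
Proof.
split.
  move=> /cvg_ex[/= d /cvgrPdist_le H]; exists d => e e0.
  have /H : (0 : C) < e%:C by rewrite ltcR.
  rewrite near_withinE => /nbhs_ballP [dl /= dl0 {}H].
  have [dl00 dl0'] := posC dl0.
  exists (complex.Re dl) => // w wz.
  have [->|wnz] := eqVneq w z; first by rewrite !subrr mulr0 subr0 nc0 mulr0.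
  have wz0 : w - z != 0 by rewrite subr_eq0.
  have := H (w - z); rewrite /ball /= sub0r dl00 normcE ltcR ncN => /(_ wz wz0).
  rewrite /shift /= normcE lecR.
  have -> : d - (w - z)^-1 *: (f ((w - z) *: (1 : C^o) + z) - f z) =
            - ((f w - f z - d * (w - z)) * (w - z)^-1).
    have -> : (w - z) *: (1 : C^o) + z = w by rewrite -[_ *: _]/(_ * _) mulr1 subrK.
    by rewrite -[_ *: _]/(_ * _) mulrBl mulfK // opprB mulrC.
  by rewrite ncN ncM ncV ler_pdivrMr // nc_gt0.
move=> [d H]; apply/cvg_ex; exists d; apply/cvgrPdist_le => e e0.
have [e00 e0'] := posC e0.
have [dl dl0 {}H] := H _ e0'.
rewrite near_withinE; apply/nbhs_ballP; exists dl%:C => /=; first by rewrite ltcR.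
move=> h; rewrite /ball /= sub0r normcE ltcR ncN => hd h0.
rewrite e00 normcE lecR /shift /=.
have -> : d - h^-1 *: (f (h *: (1 : C^o) + z) - f z) =
            - ((f (h + z) - f z - d * h) * h^-1).
  have -> : h *: (1 : C^o) + z = h + z by rewrite -[_ *: _]/(_ * _) mulr1.
  by rewrite -[_ *: _]/(_ * _) mulrBl mulfK // opprB mulrC.
rewrite ncN ncM ncV ler_pdivrMr ?nc_gt0 //.
by have := H (h + z); rewrite addrK => /(_ hd).
Qed.

Lemma sin_le_norm (y : R) : `|sin y| <= `|y|.
Proof.
wlog y0 : y / 0 <= y.
  move=> H; have [/H //|yn] := leP 0 y.
  by have := H (- y); rewrite sinN !normrN oppr_ge0; apply; exact: ltW.
move: y0; rewrite le_eqVlt => /predU1P[<-|y0]; first by rewrite sin0 normr0.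
have [x _] := @MVT R sin cos 0 y y0 (fun x _ => is_derive_sin x) (continuous_subspaceT (@continuous_sin R)).
rewrite sin0 !subr0 => ->; rewrite normrM ler_piMl //.
by rewrite ler_norml cos_geN1 cos_le1.
Qed.

Lemma one_sub_cos_le (y : R) : 0 <= 1 - cos y <= y ^+ 2 / 2.
Proof.
rewrite subr_ge0 cos_le1 /=.
have e : y = (y / 2) *+ 2 by rewrite -mulr_natr divfK.
have h := sin_le_norm (y / 2).
have : sin (y / 2) ^+ 2 <= (y / 2) ^+ 2.
  by rewrite -[leLHS]real_normK ?num_real // -[leRHS]real_normK ?num_real // lerXn2r ?nnegrE.
have -> : cos y = 2 * cos (y / 2) ^+ 2 - 1 by rewrite {1}e cos_mulr2n mulr_natl.
by rewrite cos2sin2 => h2; lra.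
Qed.

Lemma sin_sub_le (y : R) : `|sin y - y| <= `|y| * (y ^+ 2 / 2).
Proof.
wlog y0 : y / 0 <= y.
  move=> H; have [/H //|yn] := leP 0 y.
  have := H (- y); rewrite sinN -opprD !normrN sqrrN oppr_ge0; apply; exact: ltW.
move: y0; rewrite le_eqVlt => /predU1P[<-|y0]; first by rewrite sin0 subr0 normr0 mul0r.
have dd (x : R) : x \in `]0%R, y[%R -> is_derive x 1 (fun x => sin x - x) (cos x - 1).
  by move=> _; apply: is_deriveB.
have cc : {within `[0, y], continuous (fun x : R => sin x - x)}.
  by apply: continuous_subspaceT => x; apply: cvgB; [exact: continuous_sin|exact: cvg_id].
have [x /[!in_itv]/= /andP[x0 xy]] := @MVT R (fun x => sin x - x) (fun x => cos x - 1) 0 y y0 dd cc.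
rewrite sin0 !subr0 => ->; rewrite normrM mulrC ler_wpM2l // distrC.
have /andP[h1 h2] := one_sub_cos_le x.
rewrite ger0_norm //; apply: le_trans h2 _.
by rewrite ler_wpM2r ?invr_ge0 // lerXn2r ?nnegrE ?ltW.
Qed.

Lemma cexp0 : cexp 0 = 1 :> C.
Proof. by rewrite /cexp /= expR0 cos0 sin0 mul1r. Qed.

Lemma cexpD z w : cexp (z + w) = cexp z * cexp w.
Proof.
case: z w => [a b] [c d]; rewrite /cexp /= expRD cosD sinD.
apply/eqP; rewrite eq_complex /=; apply/andP; split; apply/eqP; ring.
Qed.

Lemma nc_cexp z : nc (cexp z) = expR (complex.Re z).
Proof.
by case: z => a b; rewrite /cexp ncM nc_real /= cos2Dsin2 sqrtr1 mulr1 gtr0_norm ?expR_gt0.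
Qed.

Lemma cexp_neq0 z : cexp z != 0.
Proof. by rewrite -nc_gt0 nc_cexp expR_gt0. Qed.

Lemma cexpN z : cexp (- z) = (cexp z)^-1.
Proof.
by apply: (mulfI (cexp_neq0 z)); rewrite -cexpD subrr cexp0 mulfV ?cexp_neq0.
Qed.

Lemma expR_sub1x_le (x : R) : `|x| <= 2^-1 -> `|expR x - 1 - x| <= 2 * x ^+ 2.
Proof.
move=> x1; have h1 := expR_ge1Dx x; have h0 := expR_sub1_le x1.
have e2 : expR x * expR (- x) = 1 by rewrite -expRD subrr expR0.
have e3 := expR_ge1Dx (- x).
have h3 : expR x * (1 - x) <= 1 by rewrite -[leRHS]e2 ler_wpM2l ?expR_ge0.
rewrite ger0_norm; last by rewrite subr_ge0; lra.
have h4 : x * (expR x - 1) <= `|x| * (2 * `|x|).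
  by apply: le_trans (ler_norm _) _; rewrite normrM ler_wpM2l.
have h5 : `|x| * (2 * `|x|) = 2 * x ^+ 2 by rewrite mulrCA -expr2 real_normK ?num_real.
nra.
Qed.

Lemma cexp_sub1x_le z : nc z <= 2^-1 -> nc (cexp z - 1 - z) <= 6 * nc z ^+ 2.
Proof.
move=> z1; have r1 := nc_Re z; have i1 := nc_Im z.
apply: le_trans (nc_leD _) _; case: z z1 r1 i1 => x y; rewrite /cexp /= => z1 r1 i1.
set n := Num.sqrt _ in z1 r1 i1 *.
have n0 : 0 <= n by exact: sqrtr_ge0.
have x1 : `|x| <= 2^-1 by exact: le_trans z1.
have h1 := expR_sub1x_le x1; have h2 := expR_sub1_le x1.
have /andP[c0 c1] := one_sub_cos_le y.
have s0 := sin_le_norm y; have s1 := sin_sub_le y.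
have xn : x ^+ 2 <= n ^+ 2 by rewrite -[leLHS]real_normK ?num_real // lerXn2r ?nnegrE.
have yn : y ^+ 2 <= n ^+ 2 by rewrite -[leLHS]real_normK ?num_real // lerXn2r ?nnegrE.
have e2 : expR x <= 2 by have := ler_norm (expR x - 1); lra.
have -> : expR x * cos y - 0 * sin y - 1 - x = (expR x - 1 - x) - expR x * (1 - cos y) by ring.
have -> : expR x * sin y + 0 * cos y - 0 - y = (expR x - 1) * sin y + (sin y - y) by ring.
have g1 : `|(expR x - 1 - x) - expR x * (1 - cos y)| <= 3 * n ^+ 2.
  apply: le_trans (ler_normB _ _) _; rewrite [`|expR x * _|]ger0_norm ?mulr_ge0 ?expR_ge0 //.
  have : expR x * (1 - cos y) <= 2 * (y ^+ 2 / 2) by rewrite ler_pM ?expR_ge0.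
  lra.
have g2 : `|(expR x - 1) * sin y + (sin y - y)| <= 3 * n ^+ 2.
  apply: le_trans (ler_normD _ _) _; rewrite normrM.
  have : `|expR x - 1| * `|sin y| <= (2 * n) * n.
    by rewrite ler_pM //; [apply: le_trans h2 _; rewrite ler_wpM2l|apply: le_trans s0 _].
  have : `|y| * (y ^+ 2 / 2) <= 1 * (n ^+ 2 / 2).
    apply: ler_pM => //; [by rewrite divr_ge0 ?sqr_ge0|by lra|by lra].
  rewrite -mulrA -expr2; have := sqr_ge0 n; lra.
lra.
Qed.

Lemma cdiff_cexp z : cdiff cexp z.
Proof.
apply/cdiffP; exists (cexp z) => e e0.
have E0 : 0 < nc (cexp z) by rewrite nc_gt0 cexp_neq0.
exists (Num.min 2^-1 (e / (6 * nc (cexp z)))).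
  by rewrite lt_min invr_gt0 ltr0n /= divr_gt0 // mulr_gt0.
move=> w; rewrite lt_min => /andP[w1 w2].
have -> : cexp w - cexp z - cexp z * (w - z) = cexp z * (cexp (w - z) - 1 - (w - z)).
  have -> : cexp w = cexp z * cexp (w - z) by rewrite -cexpD addrC subrK.
  by ring.
rewrite ncM; apply: le_trans (ler_wpM2l (ltW E0) (cexp_sub1x_le (ltW w1))) _.
move: w2; rewrite ltr_pdivlMr ?mulr_gt0 // => w2.
have := nc_ge0 (w - z); nra.
Qed.

End Cdiff.

(** * Integrals of complex functions of a real variable *)

Section Cint.
Context {R : realType}.
Local Notation C := R[i].
Local Notation nc := (@Normc.normc R).
Local Notation mu := (@lebesgue_measure R).
Implicit Types (f g : R -> C) (a b : R).

(** Continuity relative to the segment. It is spelled out with the real-valued [nc] because the norm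
    of [R[i]] takes its values in [R[i]]. *)
Definition ccont f a b := forall t, a <= t <= b -> forall e, 0 < e -> exists2 d, 0 < d &
  forall t', a <= t' <= b -> `|t' - t| < d -> nc (f t' - f t) < e.

Definition rcont (f : R -> R) a b := forall t, a <= t <= b -> forall e, 0 < e -> exists2 d, 0 < d &
  forall t', a <= t' <= b -> `|t' - t| < d -> `|f t' - f t| < e.

Lemma rcont_within (f : R -> R) a b : rcont f a b -> {within `[a, b], continuous f}.
Proof.
move=> H; apply/subspace_continuousP => x /=; rewrite in_itv /= => xab.
apply/cvgrPdist_lt => e e0; have [d d0 Hd] := H x xab e e0.
rewrite near_withinE; apply/nbhs_ballP; exists d => //= t.
rewrite /ball /= distrC => td; rewrite in_itv /= => tab.
by rewrite distrC; apply: Hd.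
Qed.

Lemma rcont_integrable (f : R -> R) a b : rcont f a b -> mu.-integrable `[a, b] (EFin \o f).
Proof.
move=> H; apply: continuous_compact_integrable; first exact: segment_compact.
exact: rcont_within.
Qed.

Lemma ccont_Re f a b : ccont f a b -> rcont (fun t => complex.Re (f t)) a b.
Proof.
move=> H t tab e e0; have [d d0 Hd] := H t tab e e0; exists d => // t' t'ab td.
apply: le_lt_trans (Hd t' t'ab td); rewrite -raddfB.
exact: nc_Re.
Qed.

Lemma ccont_Im f a b : ccont f a b -> rcont (fun t => complex.Im (f t)) a b.
Proof.
move=> H t tab e e0; have [d d0 Hd] := H t tab e e0; exists d => // t' t'ab td.
apply: le_lt_trans (Hd t' t'ab td); rewrite -raddfB.
exact: nc_Im.
Qed.

Lemma rcontZ (h : R -> R) r a b : rcont h a b -> rcont (fun t => r * h t) a b.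
Proof.
move=> ch t tab e e0; have r0 : 0 < `|r| + 1 by rewrite ltr_wpDl.
have [d d0 Hd] := ch t tab _ (divr_gt0 e0 r0); exists d => // t' h1 h2.
have := Hd t' h1 h2; rewrite ltr_pdivlMr // -mulrBr normrM.
by have := normr_ge0 (h t' - h t); nra.
Qed.

Definition cint a b f : C :=
  (\int[mu]_(t in `[a, b]) complex.Re (f t)) +i* (\int[mu]_(t in `[a, b]) complex.Im (f t)).

Lemma eq_cint a b f g : (forall t, a <= t <= b -> f t = g t) -> cint a b f = cint a b g.
Proof.
move=> fg; congr (_ +i* _); apply: eq_Rintegral => x; rewrite inE /= in_itv /= => xab.
  by rewrite fg.
by rewrite fg.
Qed.

Lemma ccont_cst c a b : ccont (fun=> c) a b.
Proof. by move=> t _ e e0; exists 1 => // t' _ _; rewrite subrr nc0. Qed.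

Lemma ccontD f g a b : ccont f a b -> ccont g a b -> ccont (fun t => f t + g t) a b.
Proof.
move=> cf cg t tab e e0.
have e20 : 0 < e / 2 by rewrite divr_gt0.
have [d d0 Hd] := cf t tab _ e20; have [d' d0' Hd'] := cg t tab _ e20.
exists (Num.min d d'); first by rewrite lt_min d0.
move=> t' t'ab; rewrite lt_min => /andP[h1 h2].
rewrite opprD addrACA; apply: le_lt_trans (ncD _ _) _.
have := Hd t' t'ab h1; have := Hd' t' t'ab h2; lra.
Qed.

Lemma ccontM f g a b : ccont f a b -> ccont g a b -> ccont (fun t => f t * g t) a b.
Proof.
move=> cf cg t tab e e0.
have F0 : 0 < nc (f t) + 1 by rewrite ltr_wpDl ?nc_ge0.
have G0 : 0 < nc (g t) + 1 by rewrite ltr_wpDl ?nc_ge0.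
have e1 : 0 < Num.min 1 (e / (2 * (nc (g t) + 1))) by rewrite lt_min ltr01 divr_gt0 ?mulr_gt0.
have e2 : 0 < e / (2 * (nc (f t) + 1)) by rewrite divr_gt0 ?mulr_gt0.
have e2' : 0 < Num.min 1 (e / (4 * (nc (f t) + 1))) by rewrite lt_min ltr01 divr_gt0 ?mulr_gt0.
have e1' : 0 < Num.min 1 (e / (4 * (nc (g t) + 1))) by rewrite lt_min ltr01 divr_gt0 ?mulr_gt0.
have [d d0 Hd] := cf t tab _ e1'; have [d' d0' Hd'] := cg t tab _ e2'.
exists (Num.min d d'); first by rewrite lt_min d0.
move=> t' t'ab; rewrite lt_min => /andP[h1 h2].
have := Hd t' t'ab h1; rewrite lt_min => /andP[x1].
rewrite ltr_pdivlMr ?mulr_gt0 // => x2.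
have := Hd' t' t'ab h2; rewrite lt_min => /andP[y1].
rewrite ltr_pdivlMr ?mulr_gt0 // => y2.
have -> : f t' * g t' - f t * g t =
  (f t' - f t) * (g t' - g t) + (f t' - f t) * g t + f t * (g t' - g t) by ring.
apply: le_lt_trans (ncD _ _) _; apply: le_lt_trans (lerD (ncD _ _) (lexx _)) _.
rewrite !ncM.
have p1 := nc_ge0 (f t' - f t); have p2 := nc_ge0 (g t' - g t).
have p3 := nc_ge0 (f t); have p4 := nc_ge0 (g t).
nra.
Qed.

Lemma ccontZ c f a b : ccont f a b -> ccont (fun t => c * f t) a b.
Proof. by move=> cf; apply: ccontM => //; exact: ccont_cst. Qed.

Lemma ccontN f a b : ccont f a b -> ccont (fun t => - f t) a b.
Proof.
move=> cf t tab e e0; have [d d0 Hd] := cf t tab e e0; exists d => // t' h1 h2.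
by rewrite -opprD ncN; exact: Hd.
Qed.

Lemma ccontB f g a b : ccont f a b -> ccont g a b -> ccont (fun t => f t - g t) a b.
Proof. by move=> cf cg; apply: ccontD => //; exact: ccontN. Qed.

Lemma cintD a b f g : ccont f a b -> ccont g a b ->
  cint a b (fun t => f t + g t) = cint a b f + cint a b g.
Proof.
move=> cf cg; apply/eqP; rewrite eq_complex /=; apply/andP; split; apply/eqP.
  rewrite -RintegralD //; first by apply: eq_Rintegral => x _; rewrite raddfD.
  - exact: rcont_integrable (ccont_Re cf).
  - exact: rcont_integrable (ccont_Re cg).
rewrite -RintegralD //; first by apply: eq_Rintegral => x _; rewrite raddfD.
- exact: rcont_integrable (ccont_Im cf).
- exact: rcont_integrable (ccont_Im cg).
Qed.

Lemma cintZ a b c f : ccont f a b -> cint a b (fun t => c * f t) = c * cint a b f.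
Proof.
move=> cf; case: c => x y.
have ir := rcont_integrable (ccont_Re cf).
have ii := rcont_integrable (ccont_Im cf).
have mi : measurable (`[a, b] : set R) by [].
have iRe r := rcont_integrable (rcontZ r (ccont_Re cf)).
have iIm r := rcont_integrable (rcontZ r (ccont_Im cf)).
apply/eqP; rewrite eq_complex /=; apply/andP; split; apply/eqP.
  rewrite -!RintegralZl // -RintegralB //.
  by apply: eq_Rintegral => t _; case: (f t).
rewrite -!RintegralZl // -RintegralD //.
by apply: eq_Rintegral => t _; case: (f t).
Qed.

Lemma cintN a b f : ccont f a b -> cint a b (fun t => - f t) = - cint a b f.
Proof.
move=> cf; rewrite -mulN1r -cintZ //; apply: eq_cint => t _.
by rewrite mulN1r.
Qed.

Lemma cintB a b f g : ccont f a b -> ccont g a b ->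
  cint a b (fun t => f t - g t) = cint a b f - cint a b g.
Proof. by move=> cf cg; rewrite cintD ?cintN //; exact: ccontN. Qed.

Lemma cint_sum (I : Type) (r : seq I) (P : pred I) (F : I -> R -> C) a b :
  (forall i, ccont (F i) a b) ->
  cint a b (fun t => \sum_(i <- r | P i) F i t) = \sum_(i <- r | P i) cint a b (F i).
Proof.
move=> cF; have cS (s : seq I) : ccont (fun t => \sum_(i <- s | P i) F i t) a b.
  elim: s => [|i s IH].
    by move=> t tab e e0; exists 1 => // t' _ _; rewrite !big_nil subrr nc0.
  have [Pi|nPi] := boolP (P i).
    have := ccontD (cF i) IH; congr ccont; apply/funext => t; by rewrite big_cons Pi.
  by move: IH; congr ccont; apply/funext => t; rewrite big_cons (negbTE nPi).
elim: r => [|i r IH].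
  rewrite big_nil.
  have -> : cint a b (fun t => \sum_(i <- [::] | P i) F i t) = cint a b (fun t => 0 * 0).
    by apply: eq_cint => t _; rewrite big_nil mul0r.
  by rewrite cintZ ?mul0r //; exact: ccont_cst.
rewrite big_cons; case: ifP => Pi.
  rewrite -IH -cintD //; apply: eq_cint => t _; by rewrite big_cons Pi.
by rewrite -IH; apply: eq_cint => t _; rewrite big_cons Pi.
Qed.

Lemma cint_itv a b c : a <= b -> cint a b (fun=> c) = c * (b - a)%:C.
Proof.
move=> ab; have mi : measurable (`[a, b] : set R) by [].
have mab : fine (mu `[a, b]) = b - a.
  rewrite lebesgue_measure_itv /= lte_fin; case: ltP => // ba.
  by apply/eqP; rewrite eq_sym subr_eq0 eq_le ab ba.
rewrite /cint !Rintegral_cst // mab; case: c => x y /=.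
by apply/eqP; rewrite eq_complex /=; apply/andP; split; apply/eqP; ring.
Qed.

(** Multiplication by a unimodular [u] turns the integral into its modulus, so that only the real
    part of [u * f] has to be bounded, without integrating [nc (f t)]. *)
Lemma cint_le a b f M : a <= b -> ccont f a b -> (forall t, a <= t <= b -> nc (f t) <= M) ->
  nc (cint a b f) <= M * (b - a).
Proof.
move=> ab cf fM.
have M0 : 0 <= M by apply: le_trans (nc_ge0 (f a)) (fM a _); rewrite lexx ab.
have ba0 : 0 <= b - a by rewrite subr_ge0.
have [->|I0] := eqVneq (cint a b f) 0; first by rewrite nc0 mulr_ge0.
set I := cint a b f in I0 *.
pose u := (nc I)%:C / I.
have uI : u * I = (nc I)%:C by rewrite /u divfK.
have nu : nc u = 1.
  by rewrite /u ncM nc_real ncV ger0_norm ?nc_ge0 // mulfV // nc_eq0.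
have : u * I = cint a b (fun t => u * f t) by rewrite cintZ.
rewrite uI => /(congr1 (@complex.Re R)) /= ->.
have mi : measurable (`[a, b] : set R) by [].
have mab : fine (mu `[a, b]) = b - a.
  rewrite lebesgue_measure_itv /= lte_fin; case: ltP => // ba.
  by apply/eqP; rewrite eq_sym subr_eq0 eq_le ab ba.
rewrite -mab -Rintegral_cst //; apply: le_Rintegral => //.
- exact: rcont_integrable (ccont_Re (ccontZ u cf)).
- by apply: rcont_integrable => t _ e e0; exists 1 => // t' _ _; rewrite subrr normr0.
- move=> t /=; rewrite in_itv /= => tab.
  apply: le_trans (ler_norm _) _; apply: le_trans (nc_Re _) _.
  by rewrite ncM nu mul1r fM.
Qed.

Lemma cint_split a b c f : a <= c -> c <= b -> ccont f a b ->
  cint a b f = cint a c f + cint c b f.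
Proof.
move=> ac cb cf.
have key (h : R -> R) : rcont h a b ->
    \int[mu]_(t in `[a, b]) h t = \int[mu]_(t in `[a, c]) h t + \int[mu]_(t in `[c, b]) h t.
  move=> ch; have ih := rcont_integrable ch.
  have := @Rintegral_itvB R h (BLeft a) (BRight b) c ih; rewrite !bnd_simp => /(_ ac cb).
  rewrite Rintegral_itv_obnd_cbnd => [<-|]; first by rewrite addrC subrK.
  apply: integrableS ih => //; apply: subset_itvr; rewrite bnd_simp //.
rewrite /cint (key _ (ccont_Re cf)) (key _ (ccont_Im cf)).
by apply/eqP; rewrite eq_complex /= !eqxx.
Qed.


Lemma is_derive_eps (F : R -> R) t l :
  (forall e, 0 < e -> exists2 d, 0 < d & forall t', `|t' - t| < d ->
     `|F t' - F t - l * (t' - t)| <= e * `|t' - t|) -> is_derive t 1 F l.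
Proof.
move=> H; have cv : (fun h => h^-1 *: ((F \o shift t) (h *: 1) - F t)) @ 0^' --> l.
  apply/cvgrPdist_le => e e0; have [d d0 Hd] := H e e0.
  rewrite near_withinE; apply/nbhs_ballP; exists d => //= h.
  rewrite /ball /= sub0r normrN => hd h0; rewrite /shift /=.
  have -> : l - h^-1 *: (F (h *: 1 + t) - F t) = - ((F (h + t) - F t - l * h) / h).
    have -> : h *: (1 : R) + t = h + t by rewrite -[_ *: _]/(_ * _) mulr1.
    by rewrite -[_ *: _]/(_ * _) mulrBl mulfK // opprB mulrC.
  rewrite normrN normrM normfV ler_pdivrMr ?normr_gt0 //.
  by have := Hd (h + t); rewrite addrK => /(_ hd).
split; first by apply/cvg_ex; exists l.
exact: cvg_lim.
Qed.

(* [f] is the derivative of [F] at [t], for a complex function of a real variable. *)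
Definition crder F f (t : R) := forall e, 0 < e -> exists2 d, 0 < d & forall t', `|t' - t| < d ->
     nc (F t' - F t - f t * (t' - t)%:C) <= e * `|t' - t|.

Lemma cint_FTC (F f : R -> C) a b : a <= b -> ccont f a b ->
  (forall t, a <= t <= b -> crder F f t) -> cint a b f = F b - F a.
Proof.
rewrite le_eqVlt => /predU1P[<-|ab] cf dF.
  rewrite subrr -(mulr0 (f a)) -[RHS]/(f a * (0%:C)) -(subrr a).
  rewrite -cint_itv //; apply: eq_cint => t /andP[h1 h2].
  by congr f; apply/eqP; rewrite eq_le h1 h2.
have key (p : C -> R) (pB : forall z w, p (z - w) = p z - p w)
   (pr : forall z (x : R), p (z * x%:C) = p z * x) (ple : forall z, `|p z| <= nc z) :
   rcont (fun t => p (f t)) a b ->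
   \int[mu]_(t in `[a, b]) p (f t) = p (F b) - p (F a).
  move=> cpf.
  have dpF t : a <= t <= b -> is_derive t 1 (fun t => p (F t)) (p (f t)).
    move=> tab; apply: is_derive_eps => e e0; have [d d0 Hd] := dF t tab e e0.
    exists d => // t' td; rewrite -pr -!pB; exact: le_trans (ple _) (Hd t' td).
  have cpF t : a <= t <= b -> {for t, continuous (fun t => p (F t))}.
    move=> tab; apply: differentiable_continuous; apply/derivable1_diffP.
    by have [] := dpF t tab.
  rewrite /Rintegral (@continuous_FTC2 R (fun t => p (f t)) (fun t => p (F t)) a b) //=.
  - exact: rcont_within.
  - split.
    + by move=> t; rewrite in_itv /= => /andP[h1 h2]; have [] := dpF t ltac:(rewrite !ltW).
    + apply: cvg_at_right_filter; apply: cpF; by rewrite lexx ltW.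
    + apply: cvg_at_left_filter; apply: cpF; by rewrite lexx ltW.
  - move=> t; rewrite in_itv /= => /andP[h1 h2]; rewrite derive1E.
    by have dt := dpF t ltac:(rewrite !ltW //); rewrite derive_val.
rewrite /cint (key (@complex.Re R)) //; last 4 first.
- by move=> z w; rewrite raddfB.
- by case=> x y r /=; ring.
- exact: nc_Re.
- exact: ccont_Re.
rewrite (key (@complex.Im R)) //; last 4 first.
- by move=> z w; rewrite raddfB.
- by case=> x y r /=; ring.
- exact: nc_Im.
- exact: ccont_Im.
by apply/eqP; rewrite eq_complex !raddfB /= !eqxx.
Qed.

Lemma cint_shift f a b h : a <= b -> ccont f (a + h) (b + h) ->
  cint a b (fun t => f (t + h)) = cint (a + h) (b + h) f.
Proof.
move=> ab cf.
have key (g : R -> R) : rcont g (a + h) (b + h) ->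
    \int[mu]_(t in `[a, b]) g (t + h) = \int[mu]_(t in `[a + h, b + h]) g t.
  move=> cg; rewrite /Rintegral.
  have d1 : (fun x : R => x + h)^`() = cst 1.
    by apply/funext => x; have dx := is_derive_shift x 1 h; rewrite derive1E; exact: (@derive_val _ _ _ _ _ _ _ dx).
  rewrite (@integration_by_substitution_increasing R (fun x => x + h) g a b) //.
  - by congr fine; apply: eq_integral => t _; rewrite d1 /= mulr1.
  - by move=> x y _ _; rewrite ltrD2r.
  - by move=> x _; rewrite d1; exact: cst_continuous.
  - by rewrite d1; exact: is_cvg_cst.
  - by rewrite d1; exact: is_cvg_cst.
  - split.
    + by move=> x _; apply: ex_derive; exact: (is_derive_shift x 1 h).
    + by apply: cvg_at_right_filter; apply: cvgD; [exact: cvg_id|exact: cvg_cst].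
    + by apply: cvg_at_left_filter; apply: cvgD; [exact: cvg_id|exact: cvg_cst].
  - exact: rcont_within.
by rewrite /cint (key _ (ccont_Re cf)) (key _ (ccont_Im cf)).
Qed.

End Cint.

(** * Contour integrals around rectangles and Goursat's theorem *)

Section Rectangles.
Context {R : realType}.
Local Notation C := R[i].
Local Notation nc := (@Normc.normc R).
Local Notation I := (0 +i* 1 : C).
Implicit Types (f g : C -> C) (x y : R) (z w : C).

Definition pcont f z := forall e : R, 0 < e -> exists2 d : R, 0 < d &
  forall w, nc (w - z) < d -> nc (f w - f z) < e.

Definition cder f z d := forall e : R, 0 < e -> exists2 dl : R, 0 < dl &
  forall w, nc (w - z) < dl -> nc (f w - f z - d * (w - z)) <= e * nc (w - z).

Definition in_rect x0 x1 y0 y1 z :=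
  (x0 <= complex.Re z <= x1) && (y0 <= complex.Im z <= y1).

Lemma cdiff_pcont f z : cdiff f z -> pcont f z.
Proof. by move=> /cdiff_continuous /ccontP. Qed.

Lemma nc_hdist x x' y : nc ((x' +i* y) - (x +i* y)) = `|x' - x|.
Proof. by rewrite /= subrr expr0n addr0 sqrtr_sqr. Qed.

Lemma nc_vdist x y y' : nc ((x +i* y') - (x +i* y)) = `|y' - y|.
Proof. by rewrite /= subrr expr0n add0r sqrtr_sqr. Qed.

Lemma ccont_hline f y x0 x1 : (forall x, x0 <= x <= x1 -> pcont f (x +i* y)) ->
  ccont (fun x => f (x +i* y)) x0 x1.
Proof.
move=> H t tab e e0; have [d d0 Hd] := H t tab e e0; exists d => // t' _ td.
by apply: Hd; rewrite nc_hdist.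
Qed.

Lemma ccont_vline f x y0 y1 : (forall y, y0 <= y <= y1 -> pcont f (x +i* y)) ->
  ccont (fun y => f (x +i* y)) y0 y1.
Proof.
move=> H t tab e e0; have [d d0 Hd] := H t tab e e0; exists d => // t' _ td.
by apply: Hd; rewrite nc_vdist.
Qed.

Definition hint f y x0 x1 := cint x0 x1 (fun x => f (x +i* y)).
Definition vint f x y0 y1 := cint y0 y1 (fun y => f (x +i* y)).

(* The contour integral of [f] around the rectangle [x0, x1] x [y0, y1]. *)
Definition rint f x0 x1 y0 y1 : C :=
  hint f y0 x0 x1 - hint f y1 x0 x1 + I * (vint f x1 y0 y1 - vint f x0 y0 y1).

Section Rect.
Variables (x0 x1 y0 y1 : R).
Hypotheses (x01 : x0 <= x1) (y01 : y0 <= y1).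

Definition on_boundary z := in_rect x0 x1 y0 y1 z &&
  [|| complex.Re z == x0, complex.Re z == x1, complex.Im z == y0 | complex.Im z == y1].

Lemma rect_hline f y : (y == y0) || (y == y1) ->
  (forall z, on_boundary z -> pcont f z) -> ccont (fun x => f (x +i* y)) x0 x1.
Proof.
move=> yy H; apply: ccont_hline => x xx; apply: H; rewrite /on_boundary /in_rect /= xx yy !orbT andbT.
by case/orP: yy => /eqP ->; rewrite lexx ?y01.
Qed.

Lemma rect_vline f x : (x == x0) || (x == x1) ->
  (forall z, on_boundary z -> pcont f z) -> ccont (fun y => f (x +i* y)) y0 y1.
Proof.
move=> xx H; apply: ccont_vline => y yy; apply: H; rewrite /on_boundary /in_rect /= yy andbT orbA xx andbT.
by case/orP: xx => /eqP ->; rewrite lexx ?x01.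
Qed.

Lemma rint_vsplit f p : x0 <= p -> p <= x1 ->
  (forall z, on_boundary z -> pcont f z) ->
  rint f x0 x1 y0 y1 = rint f x0 p y0 y1 + rint f p x1 y0 y1.
Proof.
move=> h1 h2 H; rewrite /rint /hint (cint_split h1 h2 (rect_hline _ H)) ?eqxx ?orbT //.
rewrite (cint_split h1 h2 (rect_hline _ H)) ?eqxx ?orbT //; ring.
Qed.

Lemma rint_hsplit f p : y0 <= p -> p <= y1 ->
  (forall z, on_boundary z -> pcont f z) ->
  rint f x0 x1 y0 y1 = rint f x0 x1 y0 p + rint f x0 x1 p y1.
Proof.
move=> h1 h2 H; rewrite /rint /vint (cint_split h1 h2 (rect_vline _ H)) ?eqxx ?orbT //.
rewrite (cint_split h1 h2 (rect_vline _ H)) ?eqxx ?orbT //; ring.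
Qed.

Lemma rint_le f M : (forall z, on_boundary z -> pcont f z) ->
  (forall z, on_boundary z -> nc (f z) <= M) ->
  nc (rint f x0 x1 y0 y1) <= M * (2 * ((x1 - x0) + (y1 - y0))).
Proof.
move=> H HM; rewrite /rint.
have h y : (y == y0) || (y == y1) -> nc (hint f y x0 x1) <= M * (x1 - x0).
  move=> yy; have yin : y0 <= y <= y1 by case/orP: yy => /eqP ->; rewrite lexx ?y01.
  apply: cint_le => //; first exact: rect_hline.
  by move=> t tt; apply: HM; rewrite /on_boundary /in_rect /= tt yin yy !orbT.
have v x : (x == x0) || (x == x1) -> nc (vint f x y0 y1) <= M * (y1 - y0).
  move=> xx; have xin : x0 <= x <= x1 by case/orP: xx => /eqP ->; rewrite lexx ?x01.
  apply: cint_le => //; first exact: rect_vline.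
  by move=> t tt; apply: HM; rewrite /on_boundary /in_rect /= tt xin orbA xx.
have nI : nc I = 1 by rewrite nc_vdist subr0 normr1 || rewrite /= expr0n expr1n add0r sqrtr1.
apply: le_trans (ncD _ _) _; rewrite ncM nI mul1r.
apply: le_trans (lerD (ncB _ _) (ncB _ _)) _.
have := h y0 ltac:(by rewrite eqxx); have := h y1 ltac:(by rewrite eqxx orbT).
have := v x0 ltac:(by rewrite eqxx); have := v x1 ltac:(by rewrite eqxx orbT).
lra.
Qed.

Lemma rintD f g : (forall z, on_boundary z -> pcont f z) ->
  (forall z, on_boundary z -> pcont g z) ->
  rint (fun z => f z + g z) x0 x1 y0 y1 = rint f x0 x1 y0 y1 + rint g x0 x1 y0 y1.
Proof.
move=> Hf Hg; rewrite /rint /hint /vint !cintD; first ring.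
all: by [exact: rect_hline; rewrite ?eqxx ?orbT|exact: rect_vline; rewrite ?eqxx ?orbT|
         apply: rect_hline; rewrite ?eqxx ?orbT|apply: rect_vline; rewrite ?eqxx ?orbT].
Qed.

Lemma rintZ c f : (forall z, on_boundary z -> pcont f z) ->
  rint (fun z => c * f z) x0 x1 y0 y1 = c * rint f x0 x1 y0 y1.
Proof.
move=> Hf; rewrite /rint /hint /vint !cintZ; first ring.
all: by [apply: rect_hline; rewrite ?eqxx ?orbT|apply: rect_vline; rewrite ?eqxx ?orbT].
Qed.

Lemma eq_rint f g : (forall z, on_boundary z -> f z = g z) ->
  rint f x0 x1 y0 y1 = rint g x0 x1 y0 y1.
Proof.
move=> fg; rewrite /rint /hint /vint; congr (_ - _ + _ * (_ - _)); apply: eq_cint => t tt;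
  apply: fg; by rewrite /on_boundary /in_rect /= tt ?lexx ?x01 ?y01 ?eqxx ?orbT.
Qed.

Lemma rint_prim f G : (forall z, on_boundary z -> pcont f z) ->
  (forall z, in_rect x0 x1 y0 y1 z -> cder G z (f z)) -> rint f x0 x1 y0 y1 = 0.
Proof.
move=> Hf HG.
have h y : (y == y0) || (y == y1) -> hint f y x0 x1 = G (x1 +i* y) - G (x0 +i* y).
  move=> yy; have yin : y0 <= y <= y1 by case/orP: yy => /eqP ->; rewrite lexx ?y01.
  apply: (@cint_FTC R (fun x => G (x +i* y))) => //; first exact: rect_hline.
  move=> t tt e e0; have [|d d0 Hd] := HG (t +i* y) _ e e0; first by rewrite /in_rect /= tt yin.
  exists d => // t' td; have := Hd (t' +i* y); rewrite nc_hdist => /(_ td).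
  by congr (nc (_ - _ * _) <= _); apply/eqP; rewrite eq_complex /= subrr !eqxx.
have v x : (x == x0) || (x == x1) -> I * vint f x y0 y1 = G (x +i* y1) - G (x +i* y0).
  move=> xx; have xin : x0 <= x <= x1 by case/orP: xx => /eqP ->; rewrite lexx ?x01.
  rewrite -cintZ; last exact: rect_vline.
  apply: (@cint_FTC R (fun y => G (x +i* y))) => //; first by apply: ccontZ; exact: rect_vline.
  move=> t tt e e0; have [|d d0 Hd] := HG (x +i* t) _ e e0; first by rewrite /in_rect /= tt xin.
  exists d => // t' td; have := Hd (x +i* t'); rewrite nc_vdist => /(_ td).
  congr (nc (_ - _) <= _); rewrite [I * _]mulrC -mulrA; congr (_ * _).
  by apply/eqP; rewrite eq_complex /=; apply/andP; split; apply/eqP; ring.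
by rewrite /rint mulrBr !h ?v ?eqxx ?orbT //; ring.
Qed.

End Rect.

Lemma cder_quadratic A d z : cder (fun w => A * w + d / 2 * w ^+ 2) z (A + d * z).
Proof.
move=> e e0; have D0 : 0 < nc (d / 2) + 1 by rewrite ltr_wpDl ?nc_ge0.
exists (e / (nc (d / 2) + 1)); first by rewrite divr_gt0.
move=> w; rewrite ltr_pdivlMr // => we.
have -> : A * w + d / 2 * w ^+ 2 - (A * z + d / 2 * z ^+ 2) - (A + d * z) * (w - z) =
  d / 2 * (w - z) ^+ 2 by field.
by rewrite ncM ncX; have := nc_ge0 (w - z); have := nc_ge0 (d / 2); nra.
Qed.


Lemma itv_dist_le (a w s t : R) : a <= s <= a + w -> a <= t <= a + w -> `|s - t| <= w.
Proof. by move=> /andP[h1 h2] /andP[h3 h4]; rewrite ler_norml; apply/andP; split; lra. Qed.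

Lemma le_eps_sqr_absurd (d S : R) : 0 < d -> d <= 2 * (d / (4 * (S ^+ 2 + 1))) * S ^+ 2 -> False.
Proof.
move=> d0 h; have S0 := sqr_ge0 S; have K0 : 0 < S ^+ 2 + 1 by lra.
move: h; rewrite mulrAC mulrA ler_pdivlMr ?mulr_gt0 //; nra.
Qed.

(** Quadrisection: one of the four quarters carries at least a quarter of the modulus of the
    integral. Around the limit point [f] is affine up to [e] times the distance; the affine part has
    a primitive, and the rest contributes [e] times the square of the size, which shrinks at the
    rate [4 ^- n] of the lower bound. *)
Lemma goursat f x0 x1 y0 y1 : x0 <= x1 -> y0 <= y1 ->
  (forall z, in_rect x0 x1 y0 y1 z -> cdiff f z) -> rint f x0 x1 y0 y1 = 0.
Proof.
move=> x01 y01 df.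
have cf z : in_rect x0 x1 y0 y1 z -> pcont f z by move=> /df /cdiff_pcont.
apply/eqP; apply: contrapT => /negP; rewrite -nc_gt0 => d00.
set d0 := nc _ in d00.
pose W := x1 - x0; pose H := y1 - y0.
have W0 : 0 <= W by rewrite subr_ge0.
have H0 : 0 <= H by rewrite subr_ge0.
pose wn n := W / 2 ^+ n; pose hn n := H / 2 ^+ n.
have wn0 n : 0 <= wn n by rewrite divr_ge0 ?exprn_ge0.
have hn0 n : 0 <= hn n by rewrite divr_ge0 ?exprn_ge0.
have wn0E : x0 + wn 0%N = x1 by rewrite /wn expr0 divr1 /W addrC subrK.
have hn0E : y0 + hn 0%N = y1 by rewrite /hn expr0 divr1 /H addrC subrK.
have wnS n : wn n = wn n.+1 + wn n.+1.
  by rewrite /wn exprS invfM; field; rewrite expf_neq0.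
have hnS n : hn n = hn n.+1 + hn n.+1.
  by rewrite /hn exprS invfM; field; rewrite expf_neq0.
pose Q n (p : R * R) := rint f p.1 (p.1 + wn n) p.2 (p.2 + hn n).
pose inQ n (p : R * R) := [/\ x0 <= p.1, p.1 + wn n <= x1, y0 <= p.2 & p.2 + hn n <= y1].
pose good n (p p' : R * R) := [/\ inQ n.+1 p', p.1 <= p'.1 /\ p'.1 + wn n.+1 <= p.1 + wn n,
  p.2 <= p'.2 /\ p'.2 + hn n.+1 <= p.2 + hn n & nc (Q n p) <= 4 * nc (Q n.+1 p')].
have step n p : inQ n p -> exists p', good n p p'.
  case: p => a b [/= h1 h2 h3 h4].
  have w0 := wn0 n.+1; have w1 := wnS n; have k0 := hn0 n.+1; have k1 := hnS n.
  pose a' := a + wn n.+1; pose b' := b + hn n.+1.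
  have E : Q n (a, b) = Q n.+1 (a, b) + Q n.+1 (a, b') + (Q n.+1 (a', b) + Q n.+1 (a', b')).
    have sub x y z : x0 <= x <= x1 -> y0 <= y <= y1 -> True by [].
    have cf' u0 u1 v0 v1 : x0 <= u0 -> u1 <= x1 -> y0 <= v0 -> v1 <= y1 ->
        forall z, on_boundary u0 u1 v0 v1 z -> pcont f z.
      move=> q1 q2 q3 q4 z /andP[/andP[/andP[r1 r2] /andP[r3 r4]] _]; apply: cf; rewrite /in_rect.
      by rewrite (le_trans q1 r1) (le_trans r2 q2) (le_trans q3 r3) (le_trans r4 q4).
    rewrite /Q /= (@rint_vsplit a (a + wn n) b (b + hn n) _ f a'); last first.
    - by apply: cf'; rewrite /a' /b'; lra.
    - rewrite /a'; lra.
    - rewrite /a'; lra.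
    - lra.
    rewrite (@rint_hsplit a a' b (b + hn n) _ f b'); last first.
    - by apply: cf'; rewrite /a' /b'; lra.
    - rewrite /b'; lra.
    - rewrite /b'; lra.
    - rewrite /a'; lra.
    rewrite (@rint_hsplit a' (a + wn n) b (b + hn n) _ f b'); last first.
    - by apply: cf'; rewrite /a' /b'; lra.
    - rewrite /b'; lra.
    - rewrite /b'; lra.
    - rewrite /a'; lra.
    by rewrite /a' /b' w1 k1 !addrA.
  apply: contrapT => nex.
  have lt p' : [/\ inQ n.+1 p', a <= p'.1 /\ p'.1 + wn n.+1 <= a + wn n &
      b <= p'.2 /\ p'.2 + hn n.+1 <= b + hn n] -> 4 * nc (Q n.+1 p') < nc (Q n (a, b)).
    move=> [g1 g2 g3]; rewrite ltNge; apply/negP => g4; apply: nex; exists p'.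
    by split.
  have mk a2 b2 : a <= a2 -> a2 + wn n.+1 <= a + wn n -> b <= b2 -> b2 + hn n.+1 <= b + hn n ->
      4 * nc (Q n.+1 (a2, b2)) < nc (Q n (a, b)).
    move=> i1 i2 i3 i4; apply: lt; split => //; split => /=.
    - exact: le_trans h1 i1.
    - exact: le_trans i2 h2.
    - exact: le_trans h3 i3.
    - exact: le_trans i4 h4.
  have aa : a <= a' by rewrite lerDl.
  have bb : b <= b' by rewrite lerDl.
  have aw : a + wn n.+1 <= a + wn n by rewrite w1 lerD2l lerDl.
  have bw : b + hn n.+1 <= b + hn n by rewrite k1 lerD2l lerDl.
  have aw' : a' + wn n.+1 <= a + wn n by rewrite w1 addrA.
  have bw' : b' + hn n.+1 <= b + hn n by rewrite k1 addrA.
  have l1 := mk a b (lexx _) aw (lexx _) bw.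
  have l2 := mk a b' (lexx _) aw bb bw'.
  have l3 := mk a' b aa aw' (lexx _) bw.
  have l4 := mk a' b' aa aw' bb bw'.
  move: l1 l2 l3 l4; clear -E.
  move: (Q n (a, b)) (Q n.+1 (a, b)) (Q n.+1 (a, b')) (Q n.+1 (a', b)) (Q n.+1 (a', b')) E.
  move=> q q1 q2 q3 q4 -> l1 l2 l3 l4.
  have := ncD (q1 + q2) (q3 + q4); have := ncD q1 q2; have := ncD q3 q4; lra.
have /boolp.choice[nx nxP] : forall np : nat * (R * R), exists p', inQ np.1 np.2 -> good np.1 np.2 p'.
  move=> [n p]; have [h|h] := pselect (inQ n p); last by exists p.
  by have [p' hp'] := step n p h; exists p'.
pose s := fix s n := if n is m.+1 then nx (m, s m) else (x0, y0).
have inS n : inQ n (s n).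
  elim: n => [|n IH]; last by have [] := nxP (n, s n) IH.
  by rewrite /inQ [s 0%N]/= wn0E hn0E; split.
have gS n : good n (s n) (s n.+1) := nxP (n, s n) (inS n).
have mono m k : [/\ (s m).1 <= (s (m + k)%N).1, (s (m + k)%N).1 <= (s m).1 + wn m,
   (s m).2 <= (s (m + k)%N).2 & (s (m + k)%N).2 <= (s m).2 + hn m].
  suff : [/\ (s m).1 <= (s (m + k)%N).1, (s (m + k)%N).1 + wn (m + k)%N <= (s m).1 + wn m,
   (s m).2 <= (s (m + k)%N).2 & (s (m + k)%N).2 + hn (m + k)%N <= (s m).2 + hn m].
    by move=> [q1 q2 q3 q4]; have := wn0 (m + k)%N; have := hn0 (m + k)%N; split; lra.
  elim: k => [|k [q1 q2 q3 q4]]; first by rewrite addn0.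
  by rewrite addnS; have [_ [q5 q6] [q7 q8] _] := gS (m + k)%N; split; lra.
pose A := [set (s n).1 | n in [set: nat]]; pose B := [set (s n).2 | n in [set: nat]].
have lim (p : R * R -> R) (u : nat -> R) (E := [set p (s n) | n in [set: nat]]) :
   (forall m k, p (s m) <= p (s (m + k)%N) <= p (s m) + u m) -> (forall n, 0 <= u n) ->
   exists l, forall n, p (s n) <= l <= p (s n) + u n.
  move=> Hu u0; exists (sup E) => n.
  have ub : ubound E (p (s n) + u n).
    move=> _ [m _ <-]; have [nm|/ltnW mn] := leqP n m.
      by have /andP[_] := Hu n (m - n)%N; rewrite subnKC.
    have /andP[h _] := Hu m (n - m)%N; rewrite subnKC // in h.
    by apply: le_trans h _; rewrite lerDl.
  apply/andP; split.
    by apply: ub_le_sup; [exists (p (s n) + u n)|exists n].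
  by apply: ge_sup => //; exists (p (s 0%N)); exists 0%N.
have [al alP] := lim fst wn (fun m k => let: And4 q1 q2 _ _ := mono m k in
   introT andP (conj q1 q2)) wn0.
have [be beP] := lim snd hn (fun m k => let: And4 _ _ q1 q2 := mono m k in
   introT andP (conj q1 q2)) hn0.
pose zs := al +i* be.
have zsQ n : in_rect (s n).1 ((s n).1 + wn n) (s n).2 ((s n).2 + hn n) zs.
  by rewrite /in_rect /= alP beP.
have : in_rect x0 x1 y0 y1 zs.
  by have := zsQ 0%N; rewrite [s 0%N]/= wn0E hn0E.
move=> /df /cdiffP[d Hd].
have J n : d0 <= 4 ^+ n * nc (Q n (s n)).
  elim: n => [|n IH]; first by rewrite expr0 mul1r /Q [s 0%N]/= wn0E hn0E lexx.
  have [_ _ _ g] := gS n; apply: le_trans IH _.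
  by rewrite exprSr -mulrA ler_wpM2l ?exprn_ge0.
(* The final comparison reads [d0 <= 2 * e * (W + H) ^+ 2]; the 1 added in [K] keeps the denominator
   of [e] positive and makes this absurd. *)
pose K := (W + H) ^+ 2 + 1.
have K0 : 0 < K by rewrite ltr_wpDl ?sqr_ge0.
pose e := d0 / (4 * K).
have e0 : 0 < e by rewrite divr_gt0 // mulr_gt0.
have [dl dl0 {}Hd] := Hd e e0.
have [n hn1] : exists n, (W + H) / 2 ^+ n < dl.
  pose n := (Num.truncn ((W + H) / dl)).+1; exists n.
  rewrite ltr_pdivrMr ?exprn_gt0 // mulrC -ltr_pdivrMr //.
  apply: lt_le_trans (truncnS_gt _) _; rewrite -natrX ler_nat.
  exact: ltnW (ltn_expl _ _).
pose a := (s n).1; pose b := (s n).2.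
pose r z := f z - (f zs - d * zs + d * z).
have [/= q1 q2 q3 q4] := inS n.
have inR z : in_rect a (a + wn n) b (b + hn n) z -> in_rect x0 x1 y0 y1 z.
  move=> /andP[/andP[r1 r2] /andP[r3 r4]]; rewrite /in_rect.
  by rewrite (le_trans q1 r1) (le_trans r2 q2) (le_trans q3 r3) (le_trans r4 q4).
have caff z : pcont (fun z => f zs - d * zs + d * z) z.
  apply: cdiff_pcont; apply: cdiffD; first exact: cdiff_cst.
  by apply: cdiffM; [exact: cdiff_cst|exact: cdiff_id].
have cr z : in_rect x0 x1 y0 y1 z -> pcont r z.
  move=> zi; apply: cdiff_pcont; apply: cdiffB; first exact: df.
  apply: cdiffD; first exact: cdiff_cst.
  by apply: cdiffM; [exact: cdiff_cst|exact: cdiff_id].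
have aw : a <= a + wn n by rewrite lerDl.
have bh : b <= b + hn n by rewrite lerDl.
have QE : Q n (s n) = rint r a (a + wn n) b (b + hn n).
  rewrite /Q -/a -/b.
  have -> : rint f a (a + wn n) b (b + hn n) =
     rint (fun z => r z + (f zs - d * zs + d * z)) a (a + wn n) b (b + hn n).
    by apply: eq_rint => // z _; rewrite /r subrK.
  rewrite rintD //; last by move=> z /andP[/inR /cr].
  rewrite [X in _ + X](@rint_prim _ _ _ _ _ _ _ (fun w => (f zs - d * zs) * w + d / 2 * w ^+ 2)) ?addr0 //.
  by move=> z _; exact: cder_quadratic.
have dist z : in_rect a (a + wn n) b (b + hn n) z -> nc (z - zs) <= wn n + hn n.
  move=> zin; apply: le_trans (nc_leD _) _.
  have := zsQ n; move: zin; case: z => zx zy; rewrite /in_rect /= -/a -/b.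
  move=> /andP[r1 r2] /andP[r3 r4].
  exact: lerD (itv_dist_le r1 r3) (itv_dist_le r2 r4).
have whn : wn n + hn n = (W + H) / 2 ^+ n by rewrite /wn /hn -mulrDl.
have rle : nc (Q n (s n)) <= e * ((W + H) / 2 ^+ n) * (2 * ((W + H) / 2 ^+ n)).
  rewrite QE; apply: le_trans (@rint_le a (a + wn n) b (b + hn n) aw bh r (e * ((W + H) / 2 ^+ n)) _ _) _.
  - by move=> z /andP[/inR /cr].
  - move=> z /andP[zin _]; have dz := dist z zin.
    have := Hd z; rewrite whn in dz; move=> /(_ (le_lt_trans dz hn1)).
    rewrite /r; have -> : f z - (f zs - d * zs + d * z) = f z - f zs - d * (z - zs) by ring.
    by move=> h; apply: le_trans h _; rewrite ler_wpM2l // ltW.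
  - by rewrite -whn ![_ + _ - _]addrAC !subrr !add0r.
have Jn := J n; have e4 : (4 ^+ n : R) = 2 ^+ n * 2 ^+ n by rewrite -exprMn -natrM.
apply: (@le_eps_sqr_absurd d0 (W + H) d00); rewrite -/K -/e.
apply: le_trans Jn _; apply: le_trans (ler_wpM2l _ rle) _; first by rewrite exprn_ge0.
rewrite e4; apply: le_of_eq; clear; field.
by rewrite expf_neq0.
Qed.

End Rectangles.

(** * Cauchy's formula, an identity theorem and a uniform Taylor estimate *)

Section Cauchy.
Context {R : realType}.
Local Notation C := R[i].
Local Notation nc := (@Normc.normc R).
Local Notation I := (0 +i* 1 : C).
Implicit Types (f g : C -> C) (x y : R) (z w : C).

Definition sint f z r :=
  rint f (complex.Re z - r) (complex.Re z + r) (complex.Im z - r) (complex.Im z + r).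

(** The lines through the sides of the small square cut off four strips that avoid [z], and
    Goursat's theorem applies to each of them. *)
Lemma rint_shrink g x0 x1 y0 y1 z r : 0 < r ->
  x0 <= complex.Re z - r -> complex.Re z + r <= x1 ->
  y0 <= complex.Im z - r -> complex.Im z + r <= y1 ->
  (forall w, in_rect x0 x1 y0 y1 w -> w != z -> cdiff g w) ->
  rint g x0 x1 y0 y1 = sint g z r.
Proof.
case: z => a b /= r0 h1 h2 h3 h4 dg; rewrite /sint /=.
have ar : a - r < a + r by rewrite ltrD2l gtrN.
have br : b - r < b + r by rewrite ltrD2l gtrN.
have a1 : a - r < a by rewrite gtrBl.
have a2 : a < a + r by rewrite ltrDl.
have b1 : b - r < b by rewrite gtrBl.
have b2 : b < b + r by rewrite ltrDl.
have x01 : x0 <= x1 by rewrite (le_trans h1) // (le_trans _ h2) // ltW.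
have y01 : y0 <= y1 by rewrite (le_trans h3) // (le_trans _ h4) // ltW.
have sub u0 u1 v0 v1 w : x0 <= u0 -> u1 <= x1 -> y0 <= v0 -> v1 <= y1 ->
   in_rect u0 u1 v0 v1 w -> in_rect x0 x1 y0 y1 w.
  move=> q1 q2 q3 q4 /andP[/andP[r1 r2] /andP[r3 r4]]; rewrite /in_rect.
  by rewrite (le_trans q1 r1) (le_trans r2 q2) (le_trans q3 r3) (le_trans r4 q4).
have off w : (complex.Re w != a) || (complex.Im w != b) -> w != a +i* b.
  by case: w => c d /=; rewrite eq_complex /= negb_and.
have zero u0 u1 v0 v1 : u0 <= u1 -> v0 <= v1 -> x0 <= u0 -> u1 <= x1 -> y0 <= v0 -> v1 <= y1 ->
   (u1 < a) || (a < u0) || (v1 < b) || (b < v0) -> rint g u0 u1 v0 v1 = 0.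
  move=> u01 v01 q1 q2 q3 q4 away; apply: goursat => // w win; apply: dg.
    exact: sub win.
  apply: off; move: win => /andP[/andP[r1 r2] /andP[r3 r4]].
  move: away; rewrite -!orbA => /or4P[] h.
  - by rewrite lt_eqF // (le_lt_trans r2).
  - by rewrite gt_eqF // (lt_le_trans h).
  - by rewrite orbC lt_eqF // (le_lt_trans r4).
  - by rewrite orbC gt_eqF // (lt_le_trans h).
have bd u0 u1 v0 v1 : u0 <= u1 -> v0 <= v1 -> x0 <= u0 -> u1 <= x1 -> y0 <= v0 -> v1 <= y1 ->
   u0 < a -> a < u1 -> v0 < b -> b < v1 ->
   forall w, on_boundary u0 u1 v0 v1 w -> pcont g w.
  move=> u01 v01 q1 q2 q3 q4 k1 k2 k3 k4 w /andP[win ob]; apply: cdiff_pcont.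
  apply: dg; first exact: sub win.
  apply: off; move: ob => /or4P[] /eqP ->.
  - by rewrite lt_eqF.
  - by rewrite gt_eqF.
  - by rewrite orbC lt_eqF.
  - by rewrite orbC gt_eqF.
have xa : x0 < a by exact: le_lt_trans a1.
have ax : a < x1 by exact: lt_le_trans h2.
have yb : y0 < b by exact: le_lt_trans b1.
have by1 : b < y1 by exact: lt_le_trans h4.
have s1 : rint g x0 x1 y0 y1 = rint g (a - r) x1 y0 y1.
  rewrite (@rint_vsplit R x0 x1 y0 y1 y01 g (a - r)) //.
  - by rewrite zero ?add0r ?a1 // (le_trans (ltW ar)).
  - by rewrite (le_trans (ltW ar)).
  - exact: bd.
have s2 : rint g (a - r) x1 y0 y1 = rint g (a - r) (a + r) y0 y1.
  rewrite (@rint_vsplit R (a - r) x1 y0 y1 y01 g (a + r)) ?(ltW ar) //.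
  - by rewrite [X in _ + X]zero ?addr0 ?a2 ?orbT // (le_trans h1) // ltW.
  - by apply: bd => //; rewrite (le_trans (ltW ar)).
have s3 : rint g (a - r) (a + r) y0 y1 = rint g (a - r) (a + r) (b - r) y1.
  rewrite (@rint_hsplit R (a - r) (a + r) y0 y1 (ltW ar) g (b - r)) //.
  - by rewrite zero ?add0r ?b1 ?orbT // ?(ltW ar) // (le_trans (ltW br)).
  - by rewrite (le_trans (ltW br)).
  - by apply: bd => //; exact: ltW.
have s4 : rint g (a - r) (a + r) (b - r) y1 = rint g (a - r) (a + r) (b - r) (b + r).
  rewrite (@rint_hsplit R (a - r) (a + r) (b - r) y1 (ltW ar) g (b + r)) ?(ltW br) //.
  - by rewrite [X in _ + X]zero ?addr0 ?b2 ?orbT // ?(ltW ar) // (le_trans h3) // ltW.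
  - by apply: bd => //; rewrite ?(ltW ar) // (le_trans (ltW br)).
by rewrite s1 s2 s3 s4.
Qed.

(** This is [2 pi i]. Its value is never computed: independence of [r] and nonvanishing suffice for
    Cauchy's formula. *)
Definition winding r : C := sint (fun w => w^-1) 0 r.

Lemma cdiff_inv z : z != 0 -> cdiff (fun w => w^-1) z.
Proof. by move=> z0; apply: (@cdiffV R id) => //; exact: cdiff_id. Qed.

Lemma cdiff_inv_sub z w : w != z -> cdiff (fun w => (w - z)^-1) w.
Proof.
move=> wz; apply: (@cdiffV R (fun w => w - z)); first by rewrite subr_eq0.
by apply: cdiffB; [exact: cdiff_id|exact: cdiff_cst].
Qed.

Lemma square_boundary_neq z r w : 0 < r ->
  on_boundary (complex.Re z - r) (complex.Re z + r) (complex.Im z - r) (complex.Im z + r) w ->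
  r <= nc (w - z).
Proof.
case: z w => a b [c d] r0 /andP[_] /=.
have rr := nc_Re ((c +i* d) - (a +i* b)); have ri := nc_Im ((c +i* d) - (a +i* b)).
have r1 := ler_norm (c - a); have r2 := ler_norm (a - c).
have r3 := ler_norm (d - b); have r4 := ler_norm (b - d).
move: rr ri; rewrite /=; set n := Num.sqrt _ => rr ri.
rewrite distrC in r2; rewrite distrC in r4.
by case/or4P => /eqP e; rewrite e in r1 r2 r3 r4 rr ri *; lra.
Qed.

Lemma sint_winding z r : 0 < r -> sint (fun w => (w - z)^-1) z r = winding r.
Proof.
case: z => a b r0; rewrite /winding /sint /rint /hint /vint /=.
have nr : - r <= r by clear -r0; lra.
have pc x y : (x != 0) || (y != 0) -> pcont (fun w : C => w^-1) (x +i* y).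
  by move=> h; apply/cdiff_pcont/cdiff_inv; rewrite eq_complex /= negb_and.
have r0' : r != 0 by rewrite gt_eqF.
have hh y : y != 0 -> cint (a - r) (a + r) (fun x => (x +i* (b + y) - a +i* b)^-1) =
   cint (0 - r) (0 + r) (fun x => (x +i* (0 + y))^-1).
  rewrite [0 + y]add0r => y0; have := @cint_shift R (fun x => (x +i* y)^-1) (a - r) (a + r) (- a).
  have -> : a - r - a = 0 - r by ring.
  have -> : a + r - a = 0 + r by ring.
  rewrite lerD2l => /(_ nr) <-; last first.
    apply: (@ccont_hline R (fun w => w^-1)) => x _; apply: pc; by rewrite y0 orbT.
  apply: eq_cint => t _; congr (_^-1).
  by apply/eqP; rewrite eq_complex /= eqxx /=; apply/eqP; ring.
have vv x : x != 0 -> cint (b - r) (b + r) (fun y => ((a + x) +i* y - a +i* b)^-1) =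
   cint (0 - r) (0 + r) (fun y => ((0 + x) +i* y)^-1).
  rewrite [0 + x]add0r => x0; have := @cint_shift R (fun y => (x +i* y)^-1) (b - r) (b + r) (- b).
  have -> : b - r - b = 0 - r by ring.
  have -> : b + r - b = 0 + r by ring.
  rewrite lerD2l => /(_ nr) <-; last first.
    apply: (@ccont_vline R (fun w => w^-1)) => y _; apply: pc; by rewrite x0.
  apply: eq_cint => t _; congr (_^-1).
  by apply/eqP; rewrite eq_complex /= eqxx andbT; apply/eqP; ring.
by rewrite !hh ?vv ?oppr_eq0.
Qed.

Lemma cint_Re_ge (a b m : R) (h : R -> C) : a <= b -> ccont h a b ->
  (forall t, a <= t <= b -> m <= complex.Re (h t)) -> m * (b - a) <= complex.Re (cint a b h).
Proof.
move=> ab ch hm.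
have : complex.Re (cint a b (fun=> m%:C)) <= complex.Re (cint a b h).
  apply: le_Rintegral => //.
  - by apply: rcont_integrable => t _ e e0; exists 1 => // t' _ _; rewrite subrr normr0.
  - exact: rcont_integrable (ccont_Re ch).
by rewrite cint_itv //= mul0r subr0.
Qed.

Lemma inv_ReIm (x y : R) : (x +i* y)^-1 = (x / (x ^+ 2 + y ^+ 2)) +i* (- (y / (x ^+ 2 + y ^+ 2))).
Proof. by rewrite /GRing.inv /= -mulNr. Qed.

(** After multiplication by [- I] each side contributes the integral of [r / (t ^+ 2 + r ^+ 2)] over
    a segment of length [2 * r]; the integrand is at least [(2 * r)^-1], so each side counts for at
    least 1. *)
Lemma winding_neq0 r : 0 < r -> winding r != 0.
Proof.
move=> r0; suff : 4 <= complex.Re (- (I * winding r)).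
  by apply: contraTneq => ->; rewrite mulr0 oppr0 /= -ltNge.
have nr : - r <= r by clear -r0; lra.
have pc x y : (x != 0) || (y != 0) -> pcont (fun w : C => w^-1) (x +i* y).
  by move=> h; apply/cdiff_pcont/cdiff_inv; rewrite eq_complex /= negb_and.
have r0' : r != 0 by rewrite gt_eqF.
have -> : winding r = rint (fun w => w^-1) (- r) r (- r) r.
  by rewrite /winding /sint -[complex.Re (0 : C)]/(0 : R) -[complex.Im (0 : C)]/(0 : R) sub0r add0r.
rewrite /rint /hint /vint.
set h0 := cint _ _ _; set h1 := cint _ _ _; set v1 := cint _ _ _; set v0 := cint _ _ _.
have -> : - (I * (h0 - h1 + I * (v1 - v0))) = (- I) * h0 + I * h1 + v1 + (- 1) * v0.
  have I2 : I * I = -1 by apply/eqP; rewrite eq_complex /=; apply/andP; split; apply/eqP; ring.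
  rewrite mulrDr mulrA I2; ring.
have ch y : y != 0 -> ccont (fun x => (x +i* y)^-1) (- r) r.
  by move=> y0; apply: (@ccont_hline R (fun w => w^-1)) => x _; apply: pc; rewrite y0 orbT.
have cv x : x != 0 -> ccont (fun y => (x +i* y)^-1) (- r) r.
  by move=> x0; apply: (@ccont_vline R (fun w => w^-1)) => y _; apply: pc; rewrite x0.
have bd t : - r <= t <= r -> (2 * r)^-1 <= r / (t ^+ 2 + r ^+ 2).
  move=> /andP[t1 t2]; have tr : t ^+ 2 <= r ^+ 2 by clear -t1 t2; nra.
  have r2 : 0 < r ^+ 2 by rewrite exprn_gt0.
  have tt := sqr_ge0 t.
  rewrite ler_pdivlMr; last by clear -r2 tt; lra.
  rewrite mulrC ler_pdivrMr ?mulr_gt0 //.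
  by clear -tr; lra.
have e1 : (2 * r)^-1 * (r - - r) = 1 by clear -r0'; field.
have side (c : C) (h : R -> C) : ccont h (- r) r ->
    (forall t, complex.Re (c * h t) = r / (t ^+ 2 + r ^+ 2)) ->
    1 <= complex.Re (c * cint (- r) r h).
  move=> hc he; rewrite -cintZ // -e1; apply: cint_Re_ge => //; first exact: ccontZ.
  by move=> t tt; rewrite he bd.
have s1 : 1 <= complex.Re (- I * h0).
  apply: side; first by apply: ch; rewrite oppr_eq0.
  by move=> t; rewrite inv_ReIm /= sqrrN; ring.
have s2 : 1 <= complex.Re (I * h1).
  apply: side; first exact: ch.
  by move=> t; rewrite inv_ReIm /=; ring.
have s3 : 1 <= complex.Re v1.
  rewrite -[v1]mul1r; apply: side; first exact: cv.
  by move=> t; rewrite inv_ReIm /= [_ + r ^+ 2]addrC; ring.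
have s4 : 1 <= complex.Re (-1 * v0).
  apply: side; first by apply: cv; rewrite oppr_eq0.
  by move=> t; rewrite inv_ReIm /= sqrrN [_ + r ^+ 2]addrC; ring.
rewrite !raddfD; clear -s1 s2 s3 s4; lra.
Qed.


Lemma winding_indep r r' : 0 < r -> r <= r' -> winding r' = winding r.
Proof.
move=> r0 rr; rewrite /winding [LHS]/sint (@rint_shrink _ _ _ _ _ 0 r) //=.
1,3: by rewrite lerD2l lerN2.
1,2: by rewrite lerD2l.
by move=> w _; exact: cdiff_inv.
Qed.

Lemma le_small_mul (a b : R) (r : R) : 0 < r -> 0 <= b ->
  (forall e, 0 < e -> e <= r -> a <= b * e) -> a <= 0.
Proof.
move=> r0 b0 H; rewrite leNgt; apply/negP => a0.
have b1 : 0 < b + 1 by lra.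
have e0 : 0 < Num.min r (a / (b + 1) / 2) by rewrite lt_min r0 !divr_gt0.
have := H _ e0; rewrite ge_min lexx /= => /(_ isT).
have : Num.min r (a / (b + 1) / 2) <= a / (b + 1) / 2 by rewrite ge_min lexx orbT.
set e := Num.min _ _ => h1 h2.
have : b * e <= b * (a / (b + 1) / 2) by rewrite ler_wpM2l.
have -> : b * (a / (b + 1) / 2) = a / 2 * (b / (b + 1)) by ring.
have : b / (b + 1) <= 1 by rewrite ler_pdivrMr // mul1r; lra.
move=> h3 h4; have : a / 2 * (b / (b + 1)) <= a / 2 * 1 by rewrite ler_wpM2l // ltW // divr_gt0.
lra.
Qed.

(** The difference quotient [g] is bounded near [z], so its integral over a square of half side [e]
    is [O(e)]; the contour can be shrunk to such a square, and what remains of the integrand is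
    [f z / (w - z)]. *)
Lemma cauchy_formula f x0 x1 y0 y1 z r : 0 < r ->
  x0 <= complex.Re z - r -> complex.Re z + r <= x1 ->
  y0 <= complex.Im z - r -> complex.Im z + r <= y1 ->
  (forall w, in_rect x0 x1 y0 y1 w -> cdiff f w) ->
  rint (fun w => f w / (w - z)) x0 x1 y0 y1 = winding r * f z.
Proof.
move=> r0 h1 h2 h3 h4 df.
have zin : in_rect x0 x1 y0 y1 z.
  by clear -r0 h1 h2 h3 h4; rewrite /in_rect; lra.
have [d Hd] := (cdiffP f z).1 (df z zin).
have [dl dl0 {}Hd] := Hd 1 ltr01.
pose g w := (f w - f z) / (w - z).
have gb w : w != z -> nc (w - z) < dl -> nc (g w) <= nc d + 1.
  move=> wz /Hd h; rewrite /g ncM ncV ler_pdivrMr ?nc_gt0 ?subr_eq0 //.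
  have -> : f w - f z = (f w - f z - d * (w - z)) + d * (w - z) by rewrite subrK.
  by apply: le_trans (ncD _ _) _; rewrite ncM mulrDl addrC lerD2l.
have dq w : in_rect x0 x1 y0 y1 w -> w != z -> cdiff (fun w => f w / (w - z)) w.
  by move=> win wz; apply: cdiffM; [exact: df|exact: cdiff_inv_sub].
apply/eqP; rewrite -subr_eq0 -nc_eq0 eq_le nc_ge0 andbT.
set L := nc _; have dr : 0 < Num.min r (dl / 4) by rewrite lt_min r0 divr_gt0.
apply: (@le_small_mul _ ((nc d + 1) * 8) (Num.min r (dl / 4))) => //.
  by rewrite mulr_ge0 // addr_ge0 // nc_ge0.
move=> e e0; rewrite le_min => /andP[er ed]; rewrite {}/L.
rewrite (winding_indep e0 er) (@rint_shrink _ _ _ _ _ z e) //.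
all: try by clear -r0 e0 er h1 h2 h3 h4; lra.
rewrite -(sint_winding z e0) mulrC.
have lx : complex.Re z - e <= complex.Re z + e by clear -e0; lra.
have ly : complex.Im z - e <= complex.Im z + e by clear -e0; lra.
have bn w : on_boundary (complex.Re z - e) (complex.Re z + e) (complex.Im z - e) (complex.Im z + e) w -> w != z.
  by move=> /(square_boundary_neq e0) h; rewrite -subr_eq0 -nc_gt0 (lt_le_trans e0).
have bi w : on_boundary (complex.Re z - e) (complex.Re z + e) (complex.Im z - e) (complex.Im z + e) w -> in_rect x0 x1 y0 y1 w.
  move=> /andP[]; rewrite /in_rect => + _; clear -r0 e0 er h1 h2 h3 h4; lra.
have pinv w : on_boundary (complex.Re z - e) (complex.Re z + e) (complex.Im z - e) (complex.Im z + e) w ->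
   pcont (fun w => (w - z)^-1) w.
  by move=> /bn wz; apply/cdiff_pcont/cdiff_inv_sub.
have pg w : on_boundary (complex.Re z - e) (complex.Re z + e) (complex.Im z - e) (complex.Im z + e) w -> pcont g w.
  move=> wb; apply/cdiff_pcont; apply: cdiffM; last exact/cdiff_inv_sub/bn.
  by apply: cdiffB; [exact/df/bi|exact: cdiff_cst].
have -> : sint (fun w => f w / (w - z)) z e =
    sint g z e + f z * sint (fun w => (w - z)^-1) z e.
  rewrite /sint -rintZ // -rintD //.
    by apply: eq_rint => // w wb; rewrite /g mulrBl subrK.
  by move=> w wb; apply/cdiff_pcont; apply: cdiffM; [exact: cdiff_cst|exact/cdiff_inv_sub/bn].
rewrite addrK -mulrA.
have -> : 8 * e = 2 * ((complex.Re z + e - (complex.Re z - e)) + (complex.Im z + e - (complex.Im z - e))) by ring.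
apply: rint_le => // w wb; apply: gb; first exact: bn.
move: wb => /andP[]; rewrite /in_rect => wr _.
apply: le_lt_trans (nc_leD _) _; clear -wr ed dl0.
have [a1 a2] : `|complex.Re (w - z)| <= e /\ `|complex.Im (w - z)| <= e.
  case: w z wr => a b [c d'] /=; rewrite !ler_norml; lra.
lra.
Qed.

Lemma ccont_bounded (f : R -> C) a b : a <= b -> ccont f a b ->
  exists M, forall t, a <= t <= b -> nc (f t) <= M.
Proof.
move=> ab cf; have rc : rcont (fun t => nc (f t)) a b.
  move=> t tt e e0; have [d d0 H] := cf t tt e e0; exists d => // t' t't td.
  apply: le_lt_trans (H t' t't td); rewrite ler_norml nc_triangle andbT lerNl opprB.
  by rewrite ncC nc_triangle.
have [c cc Hc] := EVT_max ab (rcont_within rc).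
by exists (nc (f c)) => t tt; apply: Hc; rewrite in_itv.
Qed.

Lemma boundary_bounded f x0 x1 y0 y1 : x0 <= x1 -> y0 <= y1 ->
  (forall w, on_boundary x0 x1 y0 y1 w -> pcont f w) ->
  exists2 M, 0 <= M & forall w, on_boundary x0 x1 y0 y1 w -> nc (f w) <= M.
Proof.
move=> x01 y01 H.
have [M1 H1] := ccont_bounded x01 (rect_hline y01 (y := y0) ltac:(by rewrite eqxx) H).
have [M2 H2] := ccont_bounded x01 (rect_hline y01 (y := y1) ltac:(by rewrite eqxx orbT) H).
have [M3 H3] := ccont_bounded y01 (rect_vline x01 (x := x0) ltac:(by rewrite eqxx) H).
have [M4 H4] := ccont_bounded y01 (rect_vline x01 (x := x1) ltac:(by rewrite eqxx orbT) H).
exists (`|M1| + `|M2| + `|M3| + `|M4|) => [|[x y] /andP[/andP[/= xx yy] hb]]; first by rewrite !addr_ge0.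
have a1 := ler_norm M1; have a2 := ler_norm M2; have a3 := ler_norm M3; have a4 := ler_norm M4.
have b1 := normr_ge0 M1; have b2 := normr_ge0 M2; have b3 := normr_ge0 M3; have b4 := normr_ge0 M4.
case/or4P: hb => /eqP e; rewrite e.
- by have := H3 y yy; clear -a1 a2 a3 a4 b1 b2 b3 b4; lra.
- by have := H4 y yy; clear -a1 a2 a3 a4 b1 b2 b3 b4; lra.
- by have := H1 x xx; clear -a1 a2 a3 a4 b1 b2 b3 b4; lra.
- by have := H2 x xx; clear -a1 a2 a3 a4 b1 b2 b3 b4; lra.
Qed.

Lemma le_expR_vanish (a b d : R) : 0 < d -> (forall l, 0 <= l -> a <= b * expR (- (l * d))) -> a <= 0.
Proof.
move=> d0 H; rewrite leNgt; apply/negP => a0.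
have b0 : 0 < b by have := H 0 (lexx _); rewrite mul0r oppr0 expR0 mulr1; exact: lt_le_trans.
have l0 : 0 <= b / a / d by rewrite !divr_ge0 // ltW.
have := H _ l0.
rewrite divfK ?gt_eqF // expRN ler_pdivlMr ?expR_gt0 //.
have := expR_ge1Dx (b / a) => h1 h2.
have : a * (1 + b / a) <= b by apply: le_trans h2; rewrite ler_wpM2l // ltW.
by rewrite mulrDr mulr1 mulrC divfK ?gt_eqF //; clear -a0; lra.
Qed.

Lemma cdiff_quad c w : cdiff (fun w => (w - c) + (w - c) * (w - c)) w.
Proof.
have d : cdiff (fun w => w - c) w by apply: cdiffB; [exact: cdiff_id|exact: cdiff_cst].
by apply: (cdiffD d); exact: (cdiffM d d).
Qed.

(* Cauchy's formula for [f * exp (l * (u + u ^ 2))], [u] centered on the left side of the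
   rectangle: on that side and on the horizontal ones [Re (u + u ^ 2) <= 0], whereas it is
   positive at the given point, so that [l -> +oo] forces [f = 0] there. *)
Lemma identity_right f x0 x1 p xi t Y : x0 < xi -> xi < p -> p < x1 -> 0 < Y ->
  (p - x0) + (p - x0) ^+ 2 <= Y ^+ 2 ->
  (forall w, in_rect x0 x1 (t - Y) (t + Y) w -> cdiff f w) ->
  (forall w, in_rect x0 x1 (t - Y) (t + Y) w -> p <= complex.Re w -> f w = 0) ->
  f (xi +i* t) = 0.
Proof.
move=> h1 h2 h3 Y0 hY df f0.
pose z := xi +i* t; pose u0 := xi - x0.
pose r := Num.min Y (Num.min (xi - x0) (x1 - xi)).
have r0 : 0 < r by rewrite !lt_min Y0 !subr_gt0 h1 (lt_trans h2 h3).
have rY : r <= Y by rewrite ge_min lexx.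
have rx : r <= xi - x0 by rewrite !ge_min lexx !orbT.
have rx1 : r <= x1 - xi by rewrite !ge_min lexx !orbT.
clearbody r.
pose phi (w : C) : C := (w - (x0 +i* t)) + (w - (x0 +i* t)) * (w - (x0 +i* t)).
have x01 : x0 <= x1 by clear -h1 h2 h3; lra.
have y01 : t - Y <= t + Y by clear -Y0; lra.
have [M M0 HM] : exists2 M, 0 <= M & forall w, on_boundary x0 x1 (t - Y) (t + Y) w -> nc (f w) <= M.
  by apply: boundary_bounded => // w /andP[win _]; exact/cdiff_pcont/df.
pose g (l : R) w := f w * cexp (l%:C * (phi w - phi z)).
have dg l w : in_rect x0 x1 (t - Y) (t + Y) w -> cdiff (g l) w.
  move=> win; apply: cdiffM; first exact: df.
  apply: (@cdiff_comp R cexp (fun w => l%:C * (phi w - phi z))); last exact: cdiff_cexp.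
  apply: cdiffM; first exact: cdiff_cst.
  apply: cdiffB; last exact: cdiff_cst.
  exact: cdiff_quad.
have phz : complex.Re (phi z) = u0 + u0 ^+ 2.
  by rewrite /phi /z /u0 /=; ring.
have u00 : 0 < u0 + u0 ^+ 2 by rewrite addr_gt0 ?exprn_gt0 // subr_gt0.
have gM l w : 0 <= l -> on_boundary x0 x1 (t - Y) (t + Y) w ->
   nc (g l w / (w - z)) <= M * expR (- (l * (u0 + u0 ^+ 2))) / r.
  move=> l0 wb; have [win hb] := andP wb.
  have wz : r <= nc (w - z).
    have ra := nc_Re (w - z); have ia := nc_Im (w - z).
    have r1 := ler_norm (complex.Re (w - z)); have r2 := ler_norm (- complex.Re (w - z)).
    have r3 := ler_norm (complex.Im (w - z)); have r4 := ler_norm (- complex.Im (w - z)).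
    rewrite !normrN in r2 r4.
    move: r1 r2 r3 r4 hb ra ia; case: (w) => a b /=; set n := Num.sqrt _.
    move=> r1 r2 r3 r4 hb ra ia.
    by case/or4P: hb => /eqP e; rewrite e in r1 r2 r3 r4 ra ia *;
       clear -r1 r2 r3 r4 ra ia rY rx rx1; lra.
  rewrite ncM ncV; apply: (@le_trans _ _ (nc (g l w) / r)).
    by rewrite ler_wpM2l ?nc_ge0 // lef_pV2 ?posrE // (lt_le_trans r0).
  rewrite ler_pM2r ?invr_gt0 // /g ncM nc_cexp.
  have [pw|wp] := leP p (complex.Re w).
    by rewrite f0 // nc0 mul0r mulr_ge0 ?expR_ge0.
  rewrite ler_pM ?nc_ge0 ?expR_ge0 ?HM // ler_expR.
  have -> : complex.Re (l%:C * (phi w - phi z)) = l * (complex.Re (phi w) - complex.Re (phi z)).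
    by case: (phi w - phi z) (raddfB (@complex.Re R) (phi w) (phi z)) => u v /= <-; rewrite mul0r subr0.
  rewrite phz -mulrN; apply: ler_wpM2l => //.
  suff : complex.Re (phi w) <= 0 by clear; lra.
  move: win hb wp; case: (w) => a b; rewrite /in_rect /phi /= => win hb ap.
  have aq : (a - x0) ^+ 2 <= (p - x0) ^+ 2.
    by have := ltW ap; move: win => /andP[/andP[+ _] _]; clear; nra.
  have bq := sqr_ge0 (b - t); rewrite !expr2 in aq bq hY.
  (* On the left side the real part is [- (b - t) ^+ 2], the right side contradicts [ap], and on the
     horizontal sides [hY] lets the term [- Y ^+ 2] win. *)
  case/or4P: hb => /eqP e; rewrite e in aq bq ap *.
  - by clear -bq; rewrite !subrr mul0r add0r sub0r oppr_le0.
  - by clear -ap h3; lra.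
  - by have -> : t - Y - t = - Y by [ring]; rewrite mulrNN; clear -ap aq hY; lra.
  - by have -> : t + Y - t = Y by [ring]; clear -ap aq hY; lra.
have key l : 0 <= l -> nc (winding r * f z) <= M / r * (2 * ((x1 - x0) + (t + Y - (t - Y)))) * expR (- (l * (u0 + u0 ^+ 2))).
  move=> l0; have <- : g l z = f z by rewrite /g subrr mulr0 cexp0 mulr1.
  have k1 : x0 <= complex.Re z - r by rewrite /z /=; clear -rx; lra.
  have k2 : complex.Re z + r <= x1 by rewrite /z /=; clear -rx1; lra.
  have k3 : t - Y <= complex.Im z - r by rewrite /z /=; clear -rY; lra.
  have k4 : complex.Im z + r <= t + Y by rewrite /z /=; clear -rY; lra.
  rewrite -(cauchy_formula r0 k1 k2 k3 k4 (dg l)).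
  apply: le_trans (rint_le x01 y01 _ (fun w => gM l w l0)) _.
    move=> w wb; have [win _] := andP wb; apply/cdiff_pcont; apply: cdiffM; first exact: dg.
    apply: cdiff_inv_sub; apply/negP => /eqP wz; have := gM l w l0 wb.
    move: wb; rewrite wz => /andP[_] /=.
    by rewrite /z /=; case/or4P => /eqP; clear -h1 h2 h3 Y0; lra.
  by apply: le_of_eq; ring.
have := le_expR_vanish u00 key; rewrite ncM => h.
have : nc (winding r) * nc (f z) == 0 by rewrite eq_le h mulr_ge0 ?nc_ge0.
by rewrite mulf_eq0 !nc_eq0 (negbTE (winding_neq0 r0)) /= => /eqP.
Qed.

(** The point is that [K] depends on [r] alone, so that the estimate can be summed over the terms of
    a series. The derivative is given by Cauchy's integral with [(w - z) ^+ 2], and the error is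
    [h ^+ 2] times a third such integral. *)
Lemma cauchy_taylor r : 0 < r -> exists2 K, 0 <= K & forall f z M, 0 <= M ->
  (forall w, in_rect (complex.Re z - 2 * r) (complex.Re z + 2 * r)
                     (complex.Im z - 2 * r) (complex.Im z + 2 * r) w -> cdiff f w /\ nc (f w) <= M) ->
  exists2 d, nc d <= K * M & forall h, nc h <= r -> nc (f (z + h) - f z - d * h) <= K * M * nc h ^+ 2.
Proof.
move=> r0; have w0 := winding_neq0 r0; have nw0 : 0 < nc (winding r) by rewrite nc_gt0.
pose K := (nc (winding r))^-1 * (16 * r) * (r^-1 ^+ 2 + r^-1 ^+ 3).
have K0 : 0 <= K.
  by rewrite !mulr_ge0 ?addr_ge0 ?exprn_ge0 ?invr_ge0 ?nc_ge0 // ltW.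
exists K => // f z M M0 Hf.
have r2 : 0 < 2 * r by rewrite mulr_gt0.
set x0 := complex.Re z - 2 * r; set x1 := complex.Re z + 2 * r.
set y0 := complex.Im z - 2 * r; set y1 := complex.Im z + 2 * r.
rewrite -/x0 -/x1 -/y0 -/y1 in Hf.
have x01 : x0 <= x1 by rewrite /x0 /x1; clear -r0; lra.
have y01 : y0 <= y1 by rewrite /y0 /y1; clear -r0; lra.
have wb w : on_boundary x0 x1 y0 y1 w -> 2 * r <= nc (w - z) by exact: square_boundary_neq.
have df w : in_rect x0 x1 y0 y1 w -> cdiff f w by move=> /Hf[].
have bdf w : on_boundary x0 x1 y0 y1 w -> cdiff f w by move=> /andP[/df].
have fM w : on_boundary x0 x1 y0 y1 w -> nc (f w) <= M by move=> /andP[/Hf[]].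
have hh (h : C) w : nc h <= r -> on_boundary x0 x1 y0 y1 w -> r <= nc (w - (z + h)).
  move=> hr /wb h1; rewrite opprD addrA; apply: le_trans (nc_triangle _ _).
  by clear -hr h1; lra.
have neq (h : C) w : nc h <= r -> on_boundary x0 x1 y0 y1 w -> w != z + h.
  by move=> hr /(hh _ _ hr) h1; rewrite -subr_eq0 -nc_gt0 (lt_le_trans r0).
have cf h : nc h <= r -> f (z + h) = (winding r)^-1 * rint (fun w => f w / (w - (z + h))) x0 x1 y0 y1.
  move=> hr; have a1 := le_trans (nc_Re h) hr; have a2 := le_trans (nc_Im h) hr.
  rewrite (@cauchy_formula f _ _ _ _ _ r) //; [by rewrite mulKf| | | |];
    rewrite /x0 /x1 /y0 /y1; move: a1 a2; rewrite !ler_norml; case: (h) => u v; case: (z) => u' v' /=; clear; lra.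
pose d := (winding r)^-1 * rint (fun w => f w / (w - z) ^+ 2) x0 x1 y0 y1.
have nc0r : nc (0 : C) <= r by rewrite nc0 ltW.
have perim : x1 - x0 + (y1 - y0) = 8 * r by rewrite /x0 /x1 /y0 /y1; ring.
have dpow w : on_boundary x0 x1 y0 y1 w -> cdiff (fun w => f w / (w - z) ^+ 2) w.
  move=> b; apply: cdiffM; first exact: bdf.
  have -> : (fun w => ((w - z) ^+ 2)^-1) = (fun w => (w - z)^-1 * (w - z)^-1).
    by apply/funext => v; rewrite expr2 invfM.
  have := neq 0 w nc0r b; rewrite addr0 => wz.
  by apply: cdiffM; apply: cdiff_inv_sub.
have dq h w : nc h <= r -> on_boundary x0 x1 y0 y1 w -> cdiff (fun w => f w / (w - (z + h))) w.
  by move=> hr b; apply: cdiffM; [exact: bdf|exact/cdiff_inv_sub/neq].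
exists d.
  rewrite /d ncM ncV /K -!mulrA ler_wpM2l ?invr_ge0 ?nc_ge0 //.
  have := @rint_le R x0 x1 y0 y1 x01 y01 (fun w => f w / (w - z) ^+ 2) (M * r^-1 ^+ 2).
  rewrite perim => /(_ (fun w b => cdiff_pcont (dpow w b))) h.
  apply: le_trans (h _) _ => [w b|].
    rewrite ncM ncV ncX ler_pM ?nc_ge0 ?invr_ge0 ?exprn_ge0 ?nc_ge0 ?fM //.
    rewrite exprVn lef_pV2 ?posrE ?exprn_gt0 //; last by rewrite (lt_le_trans r2) // wb.
    by rewrite lerXn2r ?nnegrE ?nc_ge0 ?(ltW r0) // (le_trans _ (wb _ b)) // ler_peMl ?(ltW r0) // ler1n.
  have -> : M * r^-1 ^+ 2 * (2 * (8 * r)) = 16 * (r * (r^-1 ^+ 2 * M)) by ring.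
  rewrite ler_pM2l // ler_pM2l // ler_wpM2r // lerDl exprn_ge0 // invr_ge0 ltW //.
move=> h hr.
have -> : f (z + h) - f z - d * h = (winding r)^-1 *
    rint (fun w => h ^+ 2 * (f w / ((w - (z + h)) * (w - z) ^+ 2))) x0 x1 y0 y1.
  have := cf 0 nc0r; rewrite addr0 => ->; rewrite cf // /d -mulrA -!mulrBr; congr (_ * _).
  have pd w (b : on_boundary x0 x1 y0 y1 w) := cdiff_pcont (dpow w b).
  have pq h' w (hr' : nc h' <= r) (b : on_boundary x0 x1 y0 y1 w) := cdiff_pcont (dq h' w hr' b).
  (* Integrated form of [1/(v - h) = 1/v + h/v^2 + h^2/((v - h) v^2)] with [v = w - z]. *)
  have e1 : rint (fun w => f w / (w - (z + h))) x0 x1 y0 y1 =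
     rint (fun w => f w / (w - z)) x0 x1 y0 y1 + h * rint (fun w => f w / (w - z) ^+ 2) x0 x1 y0 y1 +
     rint (fun w => h ^+ 2 * (f w / ((w - (z + h)) * (w - z) ^+ 2))) x0 x1 y0 y1.
    rewrite -rintZ // -rintD //; last first.
    - by move=> w b; apply/cdiff_pcont; apply: cdiffM; [exact: cdiff_cst|exact: dpow].
    - by move=> w b; have := pq 0 w nc0r b; rewrite addr0.
    rewrite -rintD //; last first.
    - move=> w b; apply/cdiff_pcont; apply: cdiffM; first exact: cdiff_cst.
      have -> : (fun w => f w / ((w - (z + h)) * (w - z) ^+ 2)) = (fun w => f w / (w - z) ^+ 2 * (w - (z + h))^-1).
        by apply/funext => v; rewrite invfM; ring.
      by apply: cdiffM; [exact: dpow|exact/cdiff_inv_sub/neq].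
    - move=> w b; apply/cdiff_pcont; apply: cdiffD.
        by have := dq 0 w nc0r b; rewrite addr0.
      by apply: cdiffM; [exact: cdiff_cst|exact: dpow].
    apply: eq_rint => // w b.
    have n1 := neq h w hr b; have := neq 0 w nc0r b; rewrite addr0 => n2.
    rewrite -subr_eq0 in n1; rewrite -subr_eq0 in n2.
    have : w - (z + h) = (w - z) - h by ring.
    move=> e; rewrite e in n1 *; move: (w - z) n1 n2 => v n1 n2; clear -n1 n2.
    by field; rewrite n1 n2.
  rewrite e1; ring.
rewrite ncM ncV /K -!mulrA ler_wpM2l ?invr_ge0 ?nc_ge0 //.
have := @rint_le R x0 x1 y0 y1 x01 y01 (fun w => h ^+ 2 * (f w / ((w - (z + h)) * (w - z) ^+ 2))) (nc h ^+ 2 * (M * r^-1 ^+ 3)).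
rewrite perim => H; apply: le_trans (H _ _) _ => [w b|w b|].
- apply/cdiff_pcont; apply: cdiffM; first exact: cdiff_cst.
  have -> : (fun w => f w / ((w - (z + h)) * (w - z) ^+ 2)) = (fun w => f w / (w - z) ^+ 2 * (w - (z + h))^-1).
    by apply/funext => v; rewrite invfM; ring.
  by apply: cdiffM; [exact: dpow|exact/cdiff_inv_sub/neq].
- rewrite ncM ncX ler_wpM2l ?exprn_ge0 ?nc_ge0 //.
  rewrite ncM ncV ler_pM ?nc_ge0 ?invr_ge0 ?nc_ge0 ?fM //.
  rewrite ncM ncX invfM [r^-1 ^+ 3]exprS ler_pM ?invr_ge0 ?exprn_ge0 ?nc_ge0 //.
    by rewrite lef_pV2 ?posrE // ?hh // (lt_le_trans r0) // hh.
  rewrite exprVn lef_pV2 ?posrE ?exprn_gt0 //; last by rewrite (lt_le_trans r2) // wb.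
  by rewrite lerXn2r ?nnegrE ?nc_ge0 ?(ltW r0) // (le_trans _ (wb _ b)) // ler_peMl ?(ltW r0) // ler1n.
have -> : nc h ^+ 2 * (M * r^-1 ^+ 3) * (2 * (8 * r)) = 16 * (r * (r^-1 ^+ 3 * (M * nc h ^+ 2))) by ring.
rewrite ler_pM2l // ler_pM2l // ler_wpM2r ?mulr_ge0 ?exprn_ge0 ?nc_ge0 // lerDr exprn_ge0 // invr_ge0 ltW //.
Qed.

End Cauchy.

(** * Series of holomorphic functions *)

Section Series.
Context {R : realType}.
Local Notation C := R[i].
Local Notation nc := (@Normc.normc R).
Implicit Types (u v : nat -> C) (S : C).

Definition csums u S := forall e : R, 0 < e -> exists N, forall n, (N <= n)%N ->
  nc (\sum_(0 <= i < n) u i - S) <= e.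

Lemma real_abs_sums (u : nat -> R) M : (forall n, \sum_(0 <= i < n) `|u i| <= M) ->
  exists S : R, forall e : R, 0 < e -> exists N, forall n, (N <= n)%N ->
    `|\sum_(0 <= i < n) u i - S| <= e.
Proof.
move=> H; have cn : cvgn [normed series u].
  apply: nondecreasing_is_cvgn.
    apply/nondecreasing_seqP => n.
    change (\sum_(0 <= i < n) `|u i| <= \sum_(0 <= i < n.+1) `|u i|).
    by rewrite [leRHS]big_nat_recr //= lerDl.
  by exists M => _ [n _ <-]; exact: H.
have /cvg_ex[/= S /cvgrPdist_le cS] := normed_cvg cn.
exists S => e e0; have [N _ HN] := cS e e0; exists N => n Nn.
by rewrite distrC; exact: HN.
Qed.

Lemma csums_abs u M : (forall n, \sum_(0 <= i < n) nc (u i) <= M) -> exists S, csums u S.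
Proof.
move=> H.
have [|a Ha] := @real_abs_sums (fun i => complex.Re (u i)) M.
  by move=> n; apply: le_trans (H n); apply: ler_sum => i _; exact: nc_Re.
have [|b Hb] := @real_abs_sums (fun i => complex.Im (u i)) M.
  by move=> n; apply: le_trans (H n); apply: ler_sum => i _; exact: nc_Im.
exists (a +i* b) => e e0; have e2 : 0 < e / 2 by rewrite divr_gt0.
have [N1 H1] := Ha _ e2; have [N2 H2] := Hb _ e2.
exists (maxn N1 N2) => n; rewrite geq_max => /andP[n1 n2].
apply: le_trans (nc_leD _) _; rewrite [leRHS](splitr e).
have -> : \sum_(0 <= i < n) u i = (\sum_(0 <= i < n) complex.Re (u i)) +i* (\sum_(0 <= i < n) complex.Im (u i)).
  elim: (n) => [|k IH]; first by rewrite !big_geq.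
  by rewrite !big_nat_recr //= IH; case: (u k).
by apply: lerD; [exact: H1|exact: H2].
Qed.

Lemma csums_le u S M : csums u S -> (forall n, nc (\sum_(0 <= i < n) u i) <= M) -> nc S <= M.
Proof.
move=> uS H; apply/ler_addgt0Pr => e e0; have [N HN] := uS e e0.
have := HN N (leqnn N); have := H N; have := nc_triangle S (\sum_(0 <= i < N) u i).
rewrite ncC; lra.
Qed.

Lemma csums_le_abs u S M : csums u S -> (forall n, \sum_(0 <= i < n) nc (u i) <= M) -> nc S <= M.
Proof.
by move=> uS H; apply: csums_le uS _ => n; exact: le_trans (nc_sum _ _ _) (H n).
Qed.

Lemma csums_unique u S S' : csums u S -> csums u S' -> S = S'.
Proof.
move=> h h'; apply/eqP; rewrite -subr_eq0 -nc_eq0 eq_le nc_ge0 andbT.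
apply/ler_addgt0Pr => e e0; rewrite add0r; have e2 : 0 < e / 2 by rewrite divr_gt0.
have [N HN] := h _ e2; have [N' HN'] := h' _ e2.
have := HN _ (leq_maxl N N'); have := HN' _ (leq_maxr N N').
set s := \sum_(_ <= _ < _) _ => h1 h2; have -> : S - S' = (s - S') - (s - S) by ring.
by apply: le_trans (ncB _ _) _; rewrite [leRHS]splitr lerD.
Qed.

Lemma csumsD u v S S' : csums u S -> csums v S' -> csums (fun n => u n + v n) (S + S').
Proof.
move=> h h' e e0; have e2 : 0 < e / 2 by rewrite divr_gt0.
have [N HN] := h _ e2; have [N' HN'] := h' _ e2.
exists (maxn N N') => n; rewrite geq_max => /andP[n1 n2].
rewrite big_split /= opprD addrACA; apply: le_trans (ncD _ _) _.
by rewrite [leRHS]splitr lerD ?HN ?HN'.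
Qed.

Lemma csumsZ c u S : csums u S -> csums (fun n => c * u n) (c * S).
Proof.
move=> h e e0; have c0 : 0 < nc c + 1 by rewrite ltr_wpDl ?nc_ge0.
have ec : 0 < e / (nc c + 1) by rewrite divr_gt0.
have [N HN] := h _ ec; exists N => n /HN H.
rewrite -mulr_sumr -mulrBr ncM.
apply: (@le_trans _ _ ((nc c + 1) * (e / (nc c + 1)))); last by rewrite mulrC divfK // gt_eqF.
by rewrite ler_pM ?nc_ge0 // lerDl.
Qed.

Lemma csumsB u v S S' : csums u S -> csums v S' -> csums (fun n => u n - v n) (S - S').
Proof.
move=> h h'; have := csumsD h (csumsZ (-1) h').
by rewrite mulN1r; congr csums; apply/funext => n; rewrite mulN1r.
Qed.

Lemma eq_csums u v S : (forall n, u n = v n) -> csums u S -> csums v S.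
Proof. by move=> h; have -> : u = v by apply/funext. Qed.

Lemma sumr_shift (V : zmodType) (w : nat -> V) N n :
  \sum_(0 <= i < N + n) w i = \sum_(0 <= i < N) w i + \sum_(0 <= i < n) w (N + i)%N.
Proof.
elim: n => [|n IH]; first by rewrite addn0 [X in _ + X]big_geq // addr0.
by rewrite addnS !big_nat_recr //= IH addrA.
Qed.

Lemma csums_shift u S N : csums u S -> csums (fun n => u (N + n)%N) (S - \sum_(0 <= i < N) u i).
Proof.
move=> h e e0; have [M HM] := h e e0; exists M => n Mn.
have := HM (N + n)%N; rewrite (leq_trans Mn (leq_addl _ _)) => /(_ isT).
rewrite sumr_shift; congr (nc _ <= _); ring.
Qed.

Lemma csums_telescope (v : nat -> C) :
  (forall e : R, 0 < e -> exists N, forall n, (N <= n)%N -> nc (v n) <= e) ->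
  csums (fun n => v n.+1 - v n) (- v 0%N).
Proof.
move=> h e e0; have [N HN] := h e e0; exists N => n /HN.
by rewrite telescope_sumr // opprK subrK.
Qed.

(* Cauchy's inequality makes the second order remainders of the terms summable. *)
Lemma cdiff_csums (f : nat -> C -> C) (F : C -> C) (m : nat -> R) B z r : 0 < r ->
  (forall n, 0 <= m n) -> (forall n, \sum_(0 <= i < n) m i <= B) ->
  (forall w, in_rect (complex.Re z - 2 * r) (complex.Re z + 2 * r)
                     (complex.Im z - 2 * r) (complex.Im z + 2 * r) w ->
     csums (f^~ w) (F w) /\ forall n, cdiff (f n) w /\ nc (f n w) <= m n) ->
  cdiff F z.
Proof.
move=> r0 m0 mB H; have [K K0 HK] := cauchy_taylor r0.
have hin h : nc h <= r -> in_rect (complex.Re z - 2 * r) (complex.Re z + 2 * r)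
                     (complex.Im z - 2 * r) (complex.Im z + 2 * r) (z + h).
  move=> hr; have := le_trans (nc_Re h) hr; have := le_trans (nc_Im h) hr.
  by rewrite !ler_norml /in_rect; case: (z) (h) => a b [a' b'] /=; clear -r0; lra.
have /choice[d Hd] n : exists d, nc d <= K * m n /\
    forall h, nc h <= r -> nc (f n (z + h) - f n z - d * h) <= K * m n * nc h ^+ 2.
  by have [|d d1 d2] := HK (f n) z (m n) (m0 n); [move=> w /H[_ /(_ n)]|exists d].
have [D HD] : exists D, csums d D.
  apply: (@csums_abs _ (K * B)) => n.
  apply: (@le_trans _ _ (\sum_(0 <= i < n) K * m i)); first by apply: ler_sum => i _; exact: (Hd i).1.
  by rewrite -mulr_sumr ler_wpM2l.
have B0 : 0 <= B by have := mB 0%N; rewrite big_geq.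
have key h : nc h <= r -> nc (F (z + h) - F z - D * h) <= K * B * nc h ^+ 2.
  move=> hr; have [s1 _] := H _ (hin h hr); have [s0 _] := H _ (hin 0 ltac:(by rewrite nc0 ltW)).
  rewrite addr0 in s0; have := csumsB (csumsB s1 s0) (csumsZ h HD); rewrite [h * D]mulrC => S.
  apply: csums_le_abs S _ => n.
  apply: (@le_trans _ _ (\sum_(0 <= i < n) (K * nc h ^+ 2) * m i)).
    by apply: ler_sum => i _; rewrite [h * _]mulrC; apply: le_trans ((Hd i).2 h hr) _; rewrite mulrAC.
  rewrite -mulr_sumr; have -> : K * B * nc h ^+ 2 = K * nc h ^+ 2 * B by ring.
  by rewrite ler_wpM2l // mulr_ge0 // exprn_ge0 // nc_ge0.
apply/cdiffP; exists D => e e0.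
have KB : 0 < K * B + 1 by rewrite ltr_wpDl // mulr_ge0.
exists (Num.min r (e / (K * B + 1))); first by rewrite lt_min r0 divr_gt0.
move=> w; rewrite lt_min => /andP[wr we].
have := key _ (ltW wr); rewrite [z + _]addrC subrK => h; apply: le_trans h _.
rewrite expr2 mulrA ler_wpM2r ?nc_ge0 //.
apply: (@le_trans _ _ ((K * B + 1) * (e / (K * B + 1)))); last by rewrite mulrC divfK // gt_eqF.
by rewrite ler_pM ?nc_ge0 ?mulr_ge0 // ?lerDl // ltW.
Qed.

Lemma csums_cvg u S : csums u S -> series (u : nat -> C^o) @ \oo --> (S : C^o).
Proof.
move=> h; apply/cvgrPdist_le => e e0; have [-> e0'] := posC e0.
have [N HN] := h _ e0'; exists N => // n /= Nn.
by rewrite normcE lecR ncC; exact: HN.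
Qed.

Lemma cvg_csums u S : series (u : nat -> C^o) @ \oo --> (S : C^o) -> csums u S.
Proof.
move=> /cvgrPdist_le h e e0; have [N _ HN] := h e%:C ltac:(by rewrite ltcR).
exists N => n Nn; have := HN n Nn; rewrite normcE lecR ncC; exact: id.
Qed.

End Series.

(** * Powers of positive reals with complex exponent, and sums of powers of integers *)

Section Powers.
Context {R : realType}.
Local Notation C := R[i].
Local Notation nc := (@Normc.normc R).
Implicit Types (x y : R) (s w z : C).

Definition pwr x s : C := cexp (s * (ln x)%:C).
Definition rpw (n : nat) x : R := expR (x * ln n%:R).

Lemma Re_mul_real z x : complex.Re (z * x%:C) = complex.Re z * x.
Proof. by case: z => a b /=; rewrite mulr0 subr0. Qed.

Lemma nc_pwr x s : nc (pwr x s) = expR (complex.Re s * ln x).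
Proof. by rewrite nc_cexp Re_mul_real. Qed.

Lemma nc_pwr_nat n s : nc (pwr n%:R s) = rpw n (complex.Re s).
Proof. exact: nc_pwr. Qed.

Lemma pwrD x s z : pwr x (s + z) = pwr x s * pwr x z.
Proof. by rewrite /pwr mulrDl cexpD. Qed.

Lemma pwrN x s : pwr x (- s) = (pwr x s)^-1.
Proof. by rewrite /pwr mulNr cexpN. Qed.

Lemma pwr0 x : pwr x 0 = 1.
Proof. by rewrite /pwr mul0r cexp0. Qed.

Lemma pwr1s s : pwr 1 s = 1.
Proof. by rewrite /pwr ln1 mulr0 cexp0. Qed.

Lemma pwrM x y s : 0 < x -> 0 < y -> pwr (x * y) s = pwr x s * pwr y s.
Proof. by move=> x0 y0; rewrite /pwr lnM // raddfD mulrDr cexpD. Qed.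

Lemma pwr_one x : 0 < x -> pwr x 1 = x%:C.
Proof.
move=> x0; rewrite /pwr mul1r /cexp /= cos0 sin0 lnK ?posrE //.
by apply/eqP; rewrite eq_complex /= !mulr0 mul0r mulr1 subr0 addr0 !eqxx.
Qed.

Lemma pwr_natexp x k : 0 < x -> pwr x k%:R = x%:C ^+ k.
Proof.
move=> x0; elim: k => [|k IH]; first by rewrite pwr0 expr0.
by rewrite -natr1 pwrD IH pwr_one // exprSr.
Qed.

Lemma cdiff_pwr x (f : C -> C) s : cdiff f s -> cdiff (fun s => pwr x (f s)) s.
Proof.
move=> df; apply: (@cdiff_comp R cexp (fun s => f s * (ln x)%:C)); last exact: cdiff_cexp.
by apply: (cdiffM df); exact: cdiff_cst.
Qed.

Lemma rpw_gt0 n x : 0 < rpw n x. Proof. exact: expR_gt0. Qed.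
Lemma rpw_ge0 n x : 0 <= rpw n x. Proof. exact: expR_ge0. Qed.
Lemma rpw0 n : rpw n 0 = 1. Proof. by rewrite /rpw mul0r expR0. Qed.
Lemma rpw1n x : rpw 1 x = 1. Proof. by rewrite /rpw ln1 mulr0 expR0. Qed.
Lemma rpwD n x y : rpw n (x + y) = rpw n x * rpw n y.
Proof. by rewrite /rpw mulrDl expRD. Qed.
Lemma rpwN n x : rpw n (- x) = (rpw n x)^-1.
Proof. by rewrite /rpw mulNr expRN. Qed.
Lemma rpw_one n : (0 < n)%N -> rpw n 1 = n%:R.
Proof. by move=> n0; rewrite /rpw mul1r lnK // posrE ltr0n. Qed.

Lemma rpw_nat n k : (0 < n)%N -> rpw n k%:R = n%:R ^+ k.
Proof.
move=> n0; elim: k => [|k IH]; first by rewrite rpw0 expr0.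
by rewrite -natr1 rpwD IH rpw_one // exprSr.
Qed.

Lemma ln_nat_ge0 n : 0 <= ln (n%:R : R).
Proof.
case: n => [|n]; first by rewrite ln0.
by rewrite ln_ge0 // ler1n.
Qed.

Lemma rpw_le n x y : x <= y -> rpw n x <= rpw n y.
Proof. by move=> xy; rewrite ler_expR ler_wpM2r // ln_nat_ge0. Qed.

Lemma rpw_homo m n x : (0 < m)%N -> (m <= n)%N -> 0 <= x -> rpw m x <= rpw n x.
Proof.
move=> m0 mn x0; rewrite ler_expR ler_wpM2l // ler_ln ?posrE ?ltr0n ?ler_nat //.
exact: leq_trans mn.
Qed.

Lemma rpw_anti m n x : (0 < m)%N -> (m <= n)%N -> x <= 0 -> rpw n x <= rpw m x.
Proof.
move=> m0 mn x0; rewrite -[x]opprK !(rpwN _ (- x)) lef_pV2 ?posrE ?rpw_gt0 //.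
by rewrite rpw_homo // oppr_ge0.
Qed.

Lemma rpw_le1 n x : (0 < n)%N -> x <= 0 -> rpw n x <= 1.
Proof. by move=> n0 x0; rewrite -(rpw1n x) rpw_anti. Qed.

Lemma ln_succ_ge n : (0 < n)%N -> n.+1%:R^-1 <= ln (n.+1%:R : R) - ln n%:R.
Proof.
move=> n0; have n0' : 0 < n%:R :> R by rewrite ltr0n.
have n1 : 0 < n.+1%:R :> R by [].
have := @le_ln1Dx R (- n.+1%:R^-1) ltac:(by rewrite ltrN2 invf_lt1 // ltr1n).
have -> : 1 + - n.+1%:R^-1 = n%:R / n.+1%:R :> R.
  by rewrite -{1}(@divff _ (n.+1%:R : R)) // -[X in _ - X]mul1r -mulrBl -natr1 addrK.
by rewrite lnM ?posrE ?invr_gt0 // lnV ?posrE // => h; rewrite -[leRHS]opprB lerNr.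
Qed.

Lemma rpw_step p n : 0 < p -> (0 < n)%N -> p * rpw n.+1 (- 1 - p) <= rpw n (- p) - rpw n.+1 (- p).
Proof.
move=> p0 n0; rewrite [- 1 - p]addrC rpwD.
have := expR_ge1Dx (p * (ln n.+1%:R - ln (n%:R : R))).
have -> : expR (p * (ln n.+1%:R - ln (n%:R : R))) = rpw n (- p) / rpw n.+1 (- p).
  by rewrite -rpwN opprK -expRD; congr expR; ring.
rewrite ler_pdivlMr ?rpw_gt0 // => h; have := ln_succ_ge n0.
rewrite [rpw _ (- 1)]rpwN rpw_one // => /(ler_wpM2l (ltW p0)) h2.
have := ler_wpM2r (rpw_ge0 n.+1 (- p)) h2; move: h; clear.
set a := rpw _ _; set b := rpw _ _; set c := ln _ - _; set q := _^-1; nra.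
Qed.

Lemma rpw_tail_sum p N M : 0 < p -> (0 < N)%N ->
  \sum_(0 <= i < M) rpw (N + i) (- 1 - p) <= rpw N (- p) * (1 + p^-1).
Proof.
move=> p0 N0; case: M => [|M].
  by rewrite big_geq // mulr_ge0 ?rpw_ge0 // addr_ge0 // invr_ge0 ltW.
(* The induction carries the term [p^-1 * rpw (N + M) (- p)], from which [rpw_step] pays for each
   new summand. *)
suff : \sum_(0 <= i < M.+1) rpw (N + i) (- 1 - p) + p^-1 * rpw (N + M) (- p) <=
       rpw N (- 1 - p) + p^-1 * rpw N (- p).
  have h1 : 0 <= p^-1 * rpw (N + M) (- p) by rewrite mulr_ge0 ?rpw_ge0 // invr_ge0 ltW.
  have h2 : rpw N (- 1 - p) <= rpw N (- p) by rewrite rpw_le // gerDr oppr_le0.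
  by rewrite mulrDr mulr1 [_ * p^-1]mulrC; move: h1 h2; clear; lra.
elim: M => [|M IH]; first by rewrite big_nat1 addn0.
rewrite big_nat_recr //= addnS; apply: le_trans IH.
have := @rpw_step p (N + M) p0 ltac:(by rewrite addn_gt0 N0).
rewrite -(ler_pM2l (x := p^-1)) ?invr_gt0 // mulrA mulVf ?gt_eqF // mul1r mulrBr.
clear; set S := \sum_(_ <= _ < _) _; lra.
Qed.

Lemma rpw_sum p N : 0 < p -> \sum_(0 <= i < N) rpw i.+1 (- 1 - p) <= 1 + p^-1.
Proof.
by move=> p0; have := @rpw_tail_sum p 1 N p0 isT; rewrite rpw1n mul1r.
Qed.

Lemma rpw_vanish p : 0 < p -> forall e, 0 < e -> exists N, forall n, (N <= n)%N -> rpw n (- p) <= e.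
Proof.
move=> p0 e e0.
pose x := expR (e^-1 / p).
exists (Num.bound x).+1 => n Nn.
have x0 : 0 < x by exact: expR_gt0.
have xn : x <= n%:R.
  apply: ltW; apply: lt_le_trans (archi_boundP (ltW x0)) _.
  by rewrite ler_nat ltnW.
have n0 : 0 < n%:R :> R by exact: lt_le_trans xn.
have : e^-1 <= p * ln n%:R.
  have : ln x <= ln n%:R by rewrite ler_ln ?posrE.
  by rewrite expRK ler_pdivrMr // mulrC.
move=> h; rewrite rpwN -[e]invrK lef_pV2 ?posrE ?invr_gt0 ?rpw_gt0 //.
apply: le_trans h _; have := expR_ge1Dx (p * ln (n%:R : R)); rewrite /rpw; lra.
Qed.

Lemma ln1D_sub_le x : `|x| <= 2^-1 -> `|ln (1 + x) - x| <= 2 * x ^+ 2.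
Proof.
rewrite ler_norml => /andP[h1 h2].
have x1 : 0 < 1 + x by lra.
have h3 := @le_ln1Dx R x ltac:(lra).
have e1 : 1 + - (x / (1 + x)) = (1 + x)^-1 by field; rewrite gt_eqF.
have xx : x / (1 + x) < 1 by rewrite ltr_pdivrMr //; lra.
have := @le_ln1Dx R (- (x / (1 + x))) ltac:(by rewrite ltrN2); rewrite e1 lnV ?posrE // => h4.
have h5 : x - x / (1 + x) <= 2 * x ^+ 2.
  have -> : x - x / (1 + x) = x ^+ 2 / (1 + x) by field; rewrite gt_eqF.
  by rewrite ler_pdivrMr //; nra.
have x2 := sqr_ge0 x.
by rewrite ler_norml; clear -h3 h4 h5 x2; lra.
Qed.

Lemma pwr_sub1_le x w : `|x| <= 2^-1 -> 4 * (nc w * `|x|) <= 1 ->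
  nc (pwr (1 + x) w - 1 - w * x%:C) <= (24 * nc w ^+ 2 + 2 * nc w) * x ^+ 2.
Proof.
move=> hx hw; have hl := ln1D_sub_le hx; have w0 := nc_ge0 w.
have l2 : `|ln (1 + x)| <= 2 * `|x|.
  have := ler_normD (ln (1 + x) - x) x; rewrite subrK => h; apply: le_trans h _.
  have : 2 * x ^+ 2 <= `|x|.
    have a0 := normr_ge0 x; rewrite -real_normK ?num_real //; move: `|x| hx a0 => a hx a0; clear -hx a0.
    have : 0 <= a * (1 - 2 * a) by rewrite mulr_ge0 //; lra.
    by rewrite expr2; lra.
  lra.
have n1 : nc (w * (ln (1 + x))%:C) <= 2^-1.
  by rewrite ncM nc_real; have := ler_wpM2l w0 l2; clear -hw; lra.
have := cexp_sub1x_le n1.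
have -> : pwr (1 + x) w - 1 - w * x%:C = (cexp (w * (ln (1 + x))%:C) - 1 - w * (ln (1 + x))%:C)
   + w * (ln (1 + x) - x)%:C by rewrite /pwr raddfB; ring.
move=> h; apply: le_trans (ncD _ _) _; rewrite mulrDl; apply: lerD.
  apply: le_trans h _; rewrite ncM nc_real exprMn -mulrA.
  have -> : 24 * (nc w ^+ 2 * x ^+ 2) = 6 * (nc w ^+ 2 * (2 * `|x|) ^+ 2).
    by rewrite exprMn real_normK ?num_real //; ring.
  rewrite ler_pM2l // ler_wpM2l ?exprn_ge0 // lerXn2r ?nnegrE // mulr_ge0 //.
by rewrite ncM nc_real [2 * nc w]mulrC -mulrA ler_wpM2l.
Qed.

Lemma crder_pwr w x : 0 < x -> crder (fun t => pwr t w) (fun t => w * pwr t (w - 1)) x.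
Proof.
move=> x0 e e0.
pose K := (24 * nc w ^+ 2 + 2 * nc w) * nc (pwr x w) / x ^+ 2.
have K0 : 0 <= K by rewrite /K !mulr_ge0 ?invr_ge0 ?addr_ge0 ?mulr_ge0 ?exprn_ge0 ?nc_ge0 // ltW.
pose d := Num.min (x / 2) (Num.min (x / (4 * (nc w + 1))) (e / (K + 1))).
have w1 : 0 < nc w + 1 by rewrite ltr_wpDl ?nc_ge0.
have K1 : 0 < K + 1 by rewrite ltr_wpDl.
exists d; first by rewrite !lt_min !divr_gt0 ?mulr_gt0.
move=> t; rewrite !lt_min => /and3P[h1 h2 h3].
pose u := (t - x) / x.
have tE : t = x * (1 + u) by rewrite /u; field; rewrite gt_eqF.
have un : `|u| = `|t - x| / x by rewrite normrM normfV (gtr0_norm x0).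
have u1 : `|u| <= 2^-1 by rewrite un ler_pdivrMr // mulrC ltW.
have u2 : 4 * (nc w * `|u|) <= 1.
  rewrite un; apply: (@le_trans _ _ (4 * ((nc w + 1) * (`|t - x| / x)))).
    by rewrite ler_pM2l // ler_wpM2r ?lerDl // divr_ge0 // ltW.
  move: h2; rewrite ltr_pdivlMr ?mulr_gt0 // => h2.
  by rewrite mulrA mulrA ler_pdivrMr // mul1r mulrC ltW.
have u3 : 0 < 1 + u by move: u1; rewrite ler_norml; lra.
have -> : w * pwr x (w - 1) = pwr x w * (w * (x^-1)%:C).
  by rewrite pwrD pwrN pwr_one // fmorphV; ring.
rewrite {1}tE pwrM //.
have -> : pwr x w * pwr (1 + u) w - pwr x w - pwr x w * (w * (x^-1)%:C) * (t - x)%:C =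
   pwr x w * (pwr (1 + u) w - 1 - w * u%:C).
  by rewrite /u rmorphM; ring.
rewrite ncM; apply: le_trans (ler_wpM2l (nc_ge0 _) (pwr_sub1_le u1 u2)) _.
have -> : nc (pwr x w) * ((24 * nc w ^+ 2 + 2 * nc w) * u ^+ 2) = K * `|t - x| * `|t - x|.
  have -> : u ^+ 2 = (`|t - x| / x) ^+ 2 by rewrite -un real_normK ?num_real.
  by rewrite /K; field; rewrite gt_eqF.
rewrite ler_wpM2r //; apply: (@le_trans _ _ ((K + 1) * `|t - x|)).
  by rewrite ler_wpM2r // lerDl.
by move: h3; rewrite ltr_pdivlMr // mulrC => /ltW.
Qed.

End Powers.

(** * Continuation of the zeta function *)

Section Continuation.
Context {R : realType}.
Local Notation C := R[i].
Local Notation nc := (@Normc.normc R).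
Implicit Types (x y : R) (s w z : C).

(* The binomial coefficient [w (w - 1) ... (w - j + 1) / j!]. *)
Fixpoint bc w j : C := if j is j'.+1 then w / j'.+1%:R * bc (w - 1) j' else 1.

(** The modulus of [w (w - 1) ... (w - j + 1)], which dominates that of [bc w j]. *)
Fixpoint falling w j : R := if j is j'.+1 then nc w * falling (w - 1) j' else 1.

(* The Taylor remainder of [(1 + x) ^ w]. *)
Definition rho k w x : C := pwr (1 + x) w - \sum_(0 <= j < k) bc w j * x%:C ^+ j.

Lemma natC_neq0 n : (n.+1%:R : C) != 0.
Proof. by rewrite pnatr_eq0. Qed.

Lemma bcS w j : bc w j.+1 = bc w j * ((w - j%:R) / j.+1%:R).
Proof.
elim: j w => [|j IH] w; first by rewrite /= subr0; ring.
rewrite -[LHS]/(w / j.+2%:R * bc (w - 1) j.+1) IH -[bc w j.+1]/(w / j.+1%:R * bc (w - 1) j).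
have -> : w - 1 - j%:R = w - j.+1%:R :> C by rewrite -[j.+1%:R]natr1; ring.
ring.
Qed.

Lemma bc1 w : bc w 1 = w.
Proof. by rewrite /= divr1 mulr1. Qed.

Lemma falling_ge0 w j : 0 <= falling w j.
Proof. by elim: j w => [|j IH] w //=; rewrite mulr_ge0 // nc_ge0. Qed.

Lemma nc_subn w j : nc (w - j%:R) <= nc w + j%:R.
Proof.
apply: le_trans (ncB _ _) _; rewrite lerD2l -[j%:R in leLHS](rmorph_nat (@real_complex R)).
by rewrite nc_real ger0_norm.
Qed.

Lemma falling_le w j W : nc w + j%:R <= W -> falling w j <= W ^+ j.
Proof.
elim: j w => [|j IH] w; first by rewrite expr0.
rewrite -natr1 => h /=; have w0 := nc_ge0 w; have j0 : 0 <= j%:R :> R by [].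
rewrite exprS ler_pM ?nc_ge0 ?falling_ge0 //; first by clear -h w0 j0; lra.
by apply: IH; have := nc_subn w 1; clear -h; lra.
Qed.

Lemma nc_bc w j : nc (bc w j) <= falling w j.
Proof.
elim: j w => [|j IH] w; first by rewrite /= expr1n expr0n addr0 sqrtr1.
rewrite [bc _ _]/= [falling _ _]/=.
rewrite !ncM; apply: ler_pM; rewrite ?mulr_ge0 ?nc_ge0 ?IH //.
rewrite ler_piMr ?nc_ge0 // -(rmorph_nat (@real_complex R)) -fmorphV nc_real.
by rewrite ger0_norm ?invr_ge0 // invf_le1 // ler1n.
Qed.

Lemma is_derive_crder (h : R -> R) (x l : R) (c : C) : is_derive x 1 h l ->
  crder (fun t => c * (h t)%:C) (fun=> c * l%:C) x.
Proof.
move=> [/cvg_ex[/= l' hl] <-] e e0; have -> : 'D_1 h x = l' by exact: cvg_lim.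
have c1 : 0 < nc c + 1 by rewrite ltr_wpDl ?nc_ge0.
move/cvgrPdist_le: hl => /(_ (e / (nc c + 1))); rewrite divr_gt0 // => /(_ isT).
rewrite near_withinE => /nbhs_ballP [d /= d0 H].
exists d => // t td; have -> : c * (h t)%:C - c * (h x)%:C - c * l'%:C * (t - x)%:C =
   c * (h t - h x - l' * (t - x))%:C by rewrite !(rmorphB, rmorphM) /=; ring.
rewrite ncM nc_real.
have [->|tx] := eqVneq t x; first by rewrite !subrr mulr0 subr0 normr0 mulr0 mulr0.
have tx0 : t - x != 0 by rewrite subr_eq0.
have := H (t - x); rewrite /ball /= sub0r normrN => /(_ td tx0).
rewrite /shift /= -[(t - x) *: 1]/((t - x) * 1) mulr1 subrK -[_ *: _]/(_ * _).
have -> : l' - (t - x)^-1 * (h t - h x) = - ((h t - h x - l' * (t - x)) / (t - x)).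
  by rewrite [in RHS]mulrBl mulfK // opprB mulrC.
rewrite normrN normrM normfV ler_pdivrMr ?normr_gt0 // => k.
apply: (@le_trans _ _ ((nc c + 1) * (e / (nc c + 1) * `|t - x|))).
  by rewrite ler_pM ?nc_ge0 // lerDl.
by rewrite mulrA [_ * (e / _)]mulrC divfK // gt_eqF.
Qed.

Lemma crderD (F G f g : R -> C) x : crder F f x -> crder G g x ->
  crder (fun t => F t + G t) (fun t => f t + g t) x.
Proof.
move=> hF hG e e0; have e2 : 0 < e / 2 by rewrite divr_gt0.
have [d1 d10 H1] := hF _ e2; have [d2 d20 H2] := hG _ e2.
exists (Num.min d1 d2) => [|t]; first by rewrite lt_min d10.
rewrite lt_min => /andP[/H1 h1 /H2 h2].
have -> : F t + G t - (F x + G x) - (f x + g x) * (t - x)%:C =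
  (F t - F x - f x * (t - x)%:C) + (G t - G x - g x * (t - x)%:C) by ring.
by apply: le_trans (ncD _ _) _; rewrite [e]splitr mulrDl lerD.
Qed.

Lemma crder_sum n (F f : nat -> R -> C) x : (forall j, crder (F j) (f j) x) ->
  crder (fun t => \sum_(0 <= j < n) F j t) (fun t => \sum_(0 <= j < n) f j t) x.
Proof.
move=> H; elim: n => [|n IH].
  move=> e e0; exists 1 => // t _; rewrite !big_geq // subrr mul0r subrr nc0.
  by rewrite mulr_ge0 // ltW.
have := crderD IH (H n); congr crder; apply/funext => t; by rewrite big_nat_recr.
Qed.

(** Differentiation lowers order and exponent together, because
    [j.+1 * bc w j.+1 = w * bc (w - 1) j]. *)
Lemma crder_rho k w x : 0 <= x -> crder (rho k.+1 w) (fun t => w * rho k (w - 1) t) x.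
Proof.
move=> x0.
have D1 : crder (fun t => pwr (1 + t) w) (fun t => w * pwr (1 + t) (w - 1)) x.
  move=> e e0; have [|d d0 H] := @crder_pwr R w (1 + x) _ e e0; first by rewrite ltr_wpDr.
  exists d => // t h; have := H (1 + t).
  have -> : 1 + t - (1 + x) = t - x by ring.
  exact.
have D2 j : crder (fun t => - bc w j.+1 * t%:C ^+ j.+1) (fun t => - w * (bc (w - 1) j * t%:C ^+ j)) x.
  have -> : (fun t : R => - bc w j.+1 * t%:C ^+ j.+1) = (fun t : R => - bc w j.+1 * (t ^+ j.+1)%:C).
    by apply/funext => t; rewrite rmorphXn.
  have := @is_derive_crder (fun t => t ^+ j.+1) x (j.+1%:R * x ^+ j) (- bc w j.+1).
  move=> H e e0; have [|d d0 Hd] := H _ e e0.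
    have := @is_deriveX R R^o id j.+1 x 1 1 (is_derive_id x 1).
    by rewrite -[_%:A]/(_ * _) mulr1 exprfctE.
  exists d => // t /Hd; congr (nc (_ - _ * _) <= _).
  rewrite [bc _ _]/= rmorphM rmorph_nat rmorphXn; have := natC_neq0 j.
  move: (j.+1%:R : C) => q q0; field.
  exact: q0.
have D3 := crderD D1 (crder_sum k D2).
move=> e e0; have [d d0 Hd] := D3 e e0; exists d => // t /Hd; congr (nc (_ - _ * _) <= _).
  rewrite /rho !big_nat_recl //= !expr0.
  have E (y : R) : \sum_(0 <= i < k) - (w / i.+1%:R * bc (w - 1) i) * y%:C ^+ i.+1 =
    - \sum_(0 <= i < k) (w / i.+1%:R * bc (w - 1) i) * y%:C ^+ i.+1.
    by rewrite -sumrN; apply: eq_bigr => i _; rewrite mulNr.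
  rewrite !E; ring.
rewrite /rho mulrBr mulr_sumr -sumrN; congr (_ + _); apply: eq_bigr => i _; ring.
Qed.

Lemma crder_ccont (F f : R -> C) a b : (forall t, a <= t <= b -> crder F f t) -> ccont F a b.
Proof.
move=> H t tt e e0; have [d d0 Hd] := H t tt 1 ltr01.
have c1 : 0 < nc (f t) + 1 by rewrite ltr_wpDl ?nc_ge0.
exists (Num.min d (e / (nc (f t) + 1) / 2)) => [|t' _]; first by rewrite lt_min d0 !divr_gt0.
rewrite lt_min => /andP[/Hd h1]; rewrite ltr_pdivlMr // ltr_pdivlMr // => h2.
have -> : F t' - F t = (F t' - F t - f t * (t' - t)%:C) + f t * (t' - t)%:C by ring.
apply: le_lt_trans (ncD _ _) _; rewrite ncM nc_real.
have := normr_ge0 (t' - t); have := nc_ge0 (f t).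
move: h1 h2; set a1 := nc _; set a2 := nc _; set a3 := `|_|; clear; nra.
Qed.

(** Each order is the integral from 0 of the preceding one by [crder_rho], which yields one more
    factor [nc w] and one more [y]. At order 0 the bound is [expR B] since [ln (1 + x)] lies between
    0 and 1. *)
Lemma rho_le k w x y B : 0 <= x -> x <= y -> y <= 1 -> 0 <= B -> complex.Re w <= B ->
  nc (rho k w x) <= expR B * falling w k * y ^+ k.
Proof.
move=> x0 xy y1 B0; elim: k w x x0 xy => [|k IH] w x x0 xy wB.
  rewrite /rho big_geq // subr0 nc_pwr expr0 !mulr1 ler_expR.
  have l0 : 0 <= ln (1 + x) by rewrite ln_ge0 // lerDl.
  have l1 : ln (1 + x) <= 1.
    apply: le_trans (@le_ln1Dx R x _) _; first by rewrite (lt_le_trans _ x0) // ltrN10.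
    exact: le_trans y1.
  apply: (@le_trans _ _ (B * ln (1 + x))); first by rewrite ler_wpM2r.
  by rewrite ler_piMr.
have d t : 0 <= t <= x -> crder (rho k.+1 w) (fun t => w * rho k (w - 1) t) t.
  by move=> /andP[t0 _]; exact: crder_rho.
have cc : ccont (fun t => w * rho k (w - 1) t) 0 x.
  apply: ccontZ; case: k {IH d} => [|k].
    move=> t /andP[t0 tx] e e0; rewrite /rho.
    have c : ccont (fun t => pwr (1 + t) (w - 1)) 0 x.
      apply: (@crder_ccont _ (fun t => (w - 1) * pwr (1 + t) (w - 1 - 1))) => u /andP[u0 _] e' e'0.
      have [|d d0 H] := @crder_pwr R (w - 1) (1 + u) _ e' e'0; first by rewrite ltr_wpDr.
      exists d => // t' h; have := H (1 + t').
      have -> : 1 + t' - (1 + u) = t' - u by ring.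
      exact.
    have [|d d0 H] := c t _ e e0; first by rewrite t0.
    by exists d => // t' t'x h; rewrite !big_geq // !subr0; exact: H.
  by apply: crder_ccont => t /andP[t0 _]; exact: crder_rho.
have := cint_FTC x0 cc d.
have -> : rho k.+1 w 0 = 0.
  rewrite /rho addr0 pwr1s big_nat_recl //= expr0 mulr1 big1 ?addr0 ?subrr // => j _.
  by rewrite expr0n mulr0.
rewrite subr0 => <-.
have wB' : complex.Re (w - 1) <= B.
  by case: (w) wB => a b /= h; rewrite (le_trans _ h) // gerBl.
apply: le_trans (cint_le x0 cc (M := nc w * (expR B * falling (w - 1) k * y ^+ k)) _) _.
  move=> t /andP[t0 tx]; rewrite ncM ler_wpM2l ?nc_ge0 //; apply: IH => //.
  exact: le_trans xy.
rewrite subr0 /= exprSr.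
have -> : nc w * (expR B * falling (w - 1) k * y ^+ k) * x = (expR B * (nc w * falling (w - 1) k) * y ^+ k) * x by ring.
rewrite [leRHS]mulrA ler_wpM2l // !mulr_ge0 ?nc_ge0 ?falling_ge0 ?expR_ge0 ?exprn_ge0 //.
exact: le_trans xy.
Qed.

End Continuation.

(** * Zeta from a binomial recurrence *)

Section ZetaExistence.
Context {R : realType}.
Local Notation C := R[i].
Local Notation nc := (@Normc.normc R).
Implicit Types (x y : R) (s w z : C).

Lemma sumrS (V : zmodType) (f : nat -> V) n :
  \sum_(0 <= i < n.+1) f i = \sum_(0 <= i < n) f i + f n.
Proof. by rewrite big_nat_recr. Qed.

Definition csum (u : nat -> C) : C := xget 0 [set S | csums u S].

Lemma csumP u S : csums u S -> csums u (csum u).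
Proof. by move=> h; rewrite /csum; case: xgetP => [S' _ //|/(_ S)]; case. Qed.

Lemma csumE u S : csums u S -> csum u = S.
Proof. by move=> h; apply: csums_unique (csumP h) h. Qed.

(** [(n+2)^(1-s)] minus the first [k] terms of its binomial expansion at [n+1]. It has order
    [n^(1 - s - k)], so the sum over [n] converges for [Re s > 2 - k]. For [k = 1] the sum
    telescopes, and raising [k] by 1 subtracts a multiple of a shifted zeta series; the continuation
    rests on these two facts. *)
Definition hterm k s n : C := pwr n.+1%:R (1 - s) * rho k (1 - s) n.+1%:R^-1.

Lemma Re1B s : complex.Re (1 - s) = 1 - complex.Re s.
Proof. by case: s. Qed.

Lemma ReDn s k : complex.Re (s + k%:R) = complex.Re s + k%:R.
Proof. by rewrite raddfD /= -(rmorph_nat (@real_complex R)). Qed.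

Lemma ImDn s k : complex.Im (s + k%:R) = complex.Im s.
Proof. by rewrite raddfD /= -(rmorph_nat (@real_complex R)) /= addr0. Qed.

Lemma inv_succ_itv n : 0 <= (n.+1%:R^-1 : R) <= 1.
Proof. by rewrite invr_ge0 ler0n invf_le1 // ler1n. Qed.

Lemma hterm_falling_le k s n B : 0 <= B -> 1 - complex.Re s <= B ->
  nc (hterm k s n) <= expR B * falling (1 - s) k * rpw n.+1 (1 - complex.Re s - k%:R).
Proof.
move=> B0 sB; have /andP[i0 i1] := inv_succ_itv n.
rewrite ncM nc_pwr_nat Re1B.
apply: le_trans (ler_wpM2l (rpw_ge0 _ _) (@rho_le R k (1 - s) _ _ B i0 (lexx _) i1 B0 _)) _.
  by rewrite Re1B.
by rewrite [rpw n.+1 (_ - k%:R)]rpwD rpwN rpw_nat // exprVn; apply: le_of_eq; ring.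
Qed.

Lemma hterm_le k s n B W : 0 <= B -> 1 - complex.Re s <= B -> nc (1 - s) + k%:R <= W ->
  nc (hterm k s n) <= expR B * W ^+ k * rpw n.+1 (1 - complex.Re s - k%:R).
Proof.
move=> B0 sB sW; apply: le_trans (hterm_falling_le k n B0 sB) _.
by rewrite ler_wpM2r ?rpw_ge0 // ler_wpM2l ?expR_ge0 // falling_le.
Qed.

Definition hser k s : C := csum (hterm k s).

Lemma hserP k s : 2 < complex.Re s + k%:R -> csums (hterm k s) (hser k s).
Proof.
move=> h; pose p := complex.Re s + k%:R - 2; have p0 : 0 < p by rewrite subr_gt0.
pose B := `|1 - complex.Re s|; pose c := expR B * falling (1 - s) k.
have [S HS] : exists S, csums (hterm k s) S.
  apply: (@csums_abs _ _ (c * (1 + p^-1))) => n.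
  apply: (@le_trans _ _ (\sum_(0 <= i < n) c * rpw i.+1 (- 1 - p))).
    apply: ler_sum => i _.
    apply: le_trans (@hterm_falling_le k s i B (normr_ge0 _) (ler_norm _)) _.
    rewrite -/c; apply: le_of_eq; congr (_ * rpw _ _); rewrite /p; ring.
  rewrite -mulr_sumr ler_wpM2l ?rpw_sum // mulr_ge0 ?expR_ge0 // falling_ge0 //.
exact: csumP HS.
Qed.

Lemma cdiff_sum n (f : nat -> C -> C) z : (forall j, (j < n)%N -> cdiff (f j) z) ->
  cdiff (fun w => \sum_(0 <= j < n) f j w) z.
Proof.
elim: n => [|n IH] H.
  have -> : (fun w : C => \sum_(0 <= j < 0) f j w) = (fun=> 0) by apply/funext => w; rewrite big_geq.
  exact: cdiff_cst.
have -> : (fun w => \sum_(0 <= j < n.+1) f j w) = (fun w => \sum_(0 <= j < n) f j w + f n w).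
  by apply/funext => w; rewrite big_nat_recr.
by apply: cdiffD; [apply: IH => j jn; apply: H; exact: ltnW|exact: H].
Qed.

Lemma cdiff_subl (c z : C) : cdiff (fun w => c - w) z.
Proof. by apply: cdiffB; [exact: cdiff_cst|exact: cdiff_id]. Qed.

Lemma cdiff_addr (c z : C) : cdiff (fun w => w + c) z.
Proof. by apply: cdiffD; [exact: cdiff_id|exact: cdiff_cst]. Qed.

Lemma cdiff_subr (c z : C) : cdiff (fun w => w - c) z.
Proof. exact: cdiff_addr. Qed.

Lemma cdiff_bc j z : cdiff (fun w => bc w j) z.
Proof.
elim: j => [|j IH]; first exact: cdiff_cst.
have -> : (fun w : C => bc w j.+1) = (fun w => bc w j * ((w - j%:R) * j.+1%:R^-1)).
  by apply/funext => w; rewrite bcS.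
by apply: (cdiffM IH); apply: (cdiffM (@cdiff_subr _ _)); exact: cdiff_cst.
Qed.

Lemma cdiff_bc1B j z : cdiff (fun w => bc (1 - w) j) z.
Proof. apply: (@cdiff_comp R (bc^~ j) (fun w => 1 - w) z); first exact: cdiff_subl.
exact: cdiff_bc. Qed.

Lemma cdiff_hterm k n z : cdiff (fun s => hterm k s n) z.
Proof.
have d1 := @cdiff_subl 1 z.
apply: (@cdiffM R (fun s => pwr n.+1%:R (1 - s)) (fun s => rho k (1 - s) n.+1%:R^-1)).
  exact: (@cdiff_pwr R _ (fun s => 1 - s) z d1).
apply: (@cdiffB R (fun s => pwr (1 + n.+1%:R^-1) (1 - s))
  (fun s => \sum_(0 <= j < k) bc (1 - s) j * (n.+1%:R^-1)%:C ^+ j)); first exact: (@cdiff_pwr R _ (fun s => 1 - s) z d1).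
apply: (@cdiff_sum k (fun j w => bc (1 - w) j * (n.+1%:R^-1)%:C ^+ j)) => j _.
by apply: (cdiffM (@cdiff_bc1B j z)); exact: cdiff_cst.
Qed.

Lemma cdiff_hser k z : 2 < complex.Re z + k%:R -> cdiff (hser k) z.
Proof.
move=> h; pose q := complex.Re z + k%:R - 2; have q0 : 0 < q by rewrite subr_gt0.
pose r := Num.min 1 (q / 4); have r0 : 0 < r by rewrite lt_min ltr01 divr_gt0.
have r1 : r <= 1 by rewrite ge_min lexx.
have rq : r <= q / 4 by rewrite ge_min lexx orbT.
pose p := q / 2; have p0 : 0 < p by rewrite divr_gt0.
pose B := `|1 - complex.Re z| + 2; pose W := nc (1 - z) + 4 + k%:R.
have B0 : 0 <= B by rewrite addr_ge0.
have W0 : 0 <= W by rewrite !addr_ge0 ?nc_ge0.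
pose c := expR B * W ^+ k; have c0 : 0 <= c by rewrite mulr_ge0 ?expR_ge0 ?exprn_ge0.
apply: (@cdiff_csums R (fun n s => hterm k s n) (hser k) (fun n => c * rpw n.+1 (- 1 - p)) (c * (1 + p^-1)) z r r0).
- by move=> n; rewrite mulr_ge0 ?rpw_ge0.
- by move=> n; rewrite -mulr_sumr ler_wpM2l ?rpw_sum.
move=> w win.
have [w1 w2] : `|complex.Re (w - z)| <= 2 * r /\ `|complex.Im (w - z)| <= 2 * r.
  by move: win; rewrite /in_rect; case: (w) (z) => a b [a' b'] /=; rewrite !ler_norml; clear; lra.
have wz : nc (w - z) <= 4 by apply: le_trans (nc_leD _) _; clear -w1 w2 r1; lra.
have wr : complex.Re z - 2 * r <= complex.Re w.
  by move: w1; case: (w) (z) => a b [a' b'] /=; rewrite ler_norml; clear; lra.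
have kw : 2 < complex.Re w + k%:R by move: wr rq q0; rewrite /q; clear; lra.
split; first exact: hserP kw.
move=> n; split; first exact: cdiff_hterm.
apply: le_trans (@hterm_le k w n B W B0 _ _) _.
- by rewrite /B; have := ler_norm (1 - complex.Re z); clear -wr r1; lra.
- rewrite /W lerD2r; have -> : 1 - w = (1 - z) - (w - z) by ring.
  by apply: le_trans (ncB _ _) _; rewrite lerD2l.
rewrite -/c ler_wpM2l // rpw_le //; move: wr rq; rewrite /p /q; clear; lra.
Qed.

Definition dseries s : C := csum (fun n => pwr n.+1%:R (- s)).

Lemma dseriesP s : 1 < complex.Re s -> csums (fun n => pwr n.+1%:R (- s)) (dseries s).
Proof.
move=> h; pose p := complex.Re s - 1; have p0 : 0 < p by rewrite subr_gt0.
have [S HS] : exists S, csums (fun n => pwr n.+1%:R (- s)) S.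
  apply: (@csums_abs _ _ (1 + p^-1)) => n; apply: le_trans (rpw_sum n p0).
  apply: ler_sum => i _; rewrite nc_pwr_nat; apply: le_of_eq; congr rpw.
  by case: (s) @p {h p0} => a b /=; ring.
exact: csumP HS.
Qed.

Lemma pwr_nat_sub n w j : pwr n.+1%:R (w - j%:R) = pwr n.+1%:R w * ((n.+1%:R^-1)%:C : C) ^+ j.
Proof. by rewrite pwrD pwrN pwr_natexp ?ltr0n // fmorphV exprVn. Qed.

Lemma hterm_step k s n : hterm k s n - hterm k.+1 s n = bc (1 - s) k * pwr n.+1%:R (- (s + k%:R - 1)).
Proof.
rewrite /hterm -mulrBr /rho big_nat_recr //=.
have -> : - (s + k%:R - 1) = (1 - s) - k%:R by ring.
rewrite pwr_nat_sub; set S := \sum_(_ <= _ < _) _; set q := pwr (1 + _) _; ring.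
Qed.

Lemma hser_step k s : 2 < complex.Re s + k%:R ->
  hser k s - hser k.+1 s = bc (1 - s) k * dseries (s + k%:R - 1).
Proof.
move=> h; have h1 : 2 < complex.Re s + k.+1%:R by rewrite (lt_trans h) // ltrD2l ltr_nat.
have h2 : 1 < complex.Re (s + k%:R - 1).
  have -> : s + k%:R - 1 = s - 1 + k%:R by ring.
  by rewrite ReDn; move: h; case: (s) => a b /=; lra.
have := csumsB (hserP h) (hserP h1).
move=> /(eq_csums (hterm_step k s)) H.
exact: csums_unique H (csumsZ _ (dseriesP h2)).
Qed.

Lemma rho1E w x : rho 1 w x = pwr (1 + x) w - 1.
Proof. by rewrite /rho big_nat1 expr0 mulr1. Qed.

Lemma hterm1E s n : hterm 1 s n = pwr n.+2%:R (1 - s) - pwr n.+1%:R (1 - s).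
Proof.
rewrite /hterm rho1E mulrBr mulr1; congr (_ - _).
have n0 : 0 < n.+1%:R :> R by rewrite ltr0n.
rewrite -(pwrM _ n0); last by rewrite addr_gt0 ?invr_gt0.
by rewrite mulrDr mulr1 mulfV ?pnatr_eq0 // natr1.
Qed.

Lemma hser1 s : 1 < complex.Re s -> hser 1 s = - 1.
Proof.
move=> h; pose p := complex.Re s - 1; have p0 : 0 < p by rewrite subr_gt0.
have : csums (hterm 1 s) (- pwr 1 (1 - s)).
  apply: (@eq_csums _ (fun n => pwr n.+2%:R (1 - s) - pwr n.+1%:R (1 - s))).
    by move=> n; rewrite hterm1E.
  apply: (@csums_telescope R (fun n => pwr n.+1%:R (1 - s))) => e e0.
  have [N HN] := rpw_vanish p0 e0; exists N => n Nn.
  rewrite nc_pwr_nat Re1B; have -> : 1 - complex.Re s = - p by rewrite /p; ring.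
  by apply: HN; exact: leqW.
by rewrite pwr1s => /csumE.
Qed.

(* [xi d] is [(s - 1) zeta(s)] on the half plane [Re s > 1 - d]. *)
Fixpoint xi d s : C := if d is d'.+1 then
    1 - \sum_(0 <= j < d') bc (1 - s) j.+1 / j.+2%:R * xi d' (s + j.+1%:R) + hser d.+1 s
  else (s - 1) * dseries s.

Arguments xi : simpl never.

Lemma xiS d s : xi d.+1 s = 1 - \sum_(0 <= j < d) bc (1 - s) j.+1 / j.+2%:R * xi d (s + j.+1%:R) + hser d.+2 s.
Proof. by []. Qed.

(** The last factor of the binomial coefficient is [-(s + j)], which cancels the pole of zeta at
    [s + j.+1 = 1]. Therefore the recurrence is stated for [xi], which has no pole. *)
Lemma bc_factor s j z : bc (1 - s) j.+1 / j.+2%:R * ((s + j.+1%:R - 1) * z) = - bc (1 - s) j.+2 * z.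
Proof.
rewrite (bcS _ j.+1); have -> : 1 - s - j.+1%:R = - (s + j.+1%:R - 1) by ring.
ring.
Qed.

(** Start from the telescoping value [- 1] at order 1 and apply [hser_step]. The summand [j = 0]
    contains [(1 - s) * dseries s]; solving for it expresses [(s - 1) * zeta s] by the values of
    zeta at [s + 1, s + 2, ...] and a better convergent series, which is the recurrence defining
    [xi]. *)
Lemma hser_dseries d s : 1 < complex.Re s ->
  hser d.+1 s = - 1 - \sum_(0 <= j < d) bc (1 - s) j.+1 * dseries (s + j%:R).
Proof.
move=> s1; elim: d => [|d IH]; first by rewrite hser1 // big_geq // subr0.
rewrite sumrS.
rewrite opprD addrA -IH.
have := @hser_step d.+1 s; have -> : s + d.+1%:R - 1 = s + d%:R by rewrite -natr1; ring.
move=> <-; first by rewrite opprB addrC subrK.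
rewrite -natr1; have : 0 <= d%:R :> R by []. by move: s1; clear; lra.
Qed.

Lemma xi_dseries d s : 1 < complex.Re s -> xi d s = (s - 1) * dseries s.
Proof.
elim: d s => [//|d IH] s s1; rewrite xiS hser_dseries // big_nat_recl // bc1 addr0.
rewrite -[X in dseries X](addr0 s).
have -> : \sum_(0 <= j < d) bc (1 - s) j.+1 / j.+2%:R * xi d (s + j.+1%:R) =
  - \sum_(0 <= j < d) bc (1 - s) j.+2 * dseries (s + j.+1%:R).
  rewrite -sumrN; apply: eq_bigr => j _; rewrite IH ?bc_factor ?mulNr //.
  by rewrite ReDn (lt_le_trans s1) // lerDl.
set S := \sum_(_ <= _ < _) _; rewrite addr0; ring.
Qed.

(** Going one level deeper adds the term of [s + d.+1], whose real part exceeds 1, so that [xi]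
    there is the Dirichlet series; the change of order in [hser] cancels this term. The other terms
    agree by induction. *)
Lemma xi_step d s : 1 - d%:R < complex.Re s -> xi d.+1 s = xi d s.
Proof.
elim: d s => [|d IH] s; first by rewrite subr0 => s1; rewrite !xi_dseries.
rewrite -natr1 => sd.
have h2 : 2 < complex.Re s + d.+2%:R by rewrite -natr1 -natr1; move: sd; clear; lra.
have := hser_step h2; have -> : s + d.+2%:R - 1 = s + d.+1%:R by rewrite -[d.+2%:R]natr1; ring.
move=> hs; have hs' : hser d.+3 s = hser d.+2 s - bc (1 - s) d.+2 * dseries (s + d.+1%:R).
  by rewrite -hs opprB addrC subrK.
rewrite xiS hs' sumrS [RHS]xiS.
have h1 : 1 < complex.Re (s + d.+1%:R) by rewrite ReDn -natr1; move: sd; clear; lra.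
have -> : xi d.+1 (s + d.+1%:R) = (s + d.+1%:R - 1) * dseries (s + d.+1%:R) by exact: xi_dseries.
rewrite [_ + bc _ _ / _ * _]addrC bc_factor.
have -> : \sum_(0 <= i < d) bc (1 - s) i.+1 / i.+2%:R * xi d.+1 (s + i.+1%:R) =
   \sum_(0 <= i < d) bc (1 - s) i.+1 / i.+2%:R * xi d (s + i.+1%:R).
  apply: eq_bigr => j _; congr (_ * _); apply: IH; rewrite ReDn -natr1.
  have : 0 <= j%:R :> R by []. by move: sd; clear; lra.
set S := \sum_(_ <= _ < _) _; ring.
Qed.

Lemma xi_eq d d' s : 1 - d%:R < complex.Re s -> 1 - d'%:R < complex.Re s -> xi d s = xi d' s.
Proof.
wlog dd : d d' / (d <= d')%N.
  by move=> H h h'; case: (leqP d d') => [dd|/ltnW dd]; [exact: H|symmetry; exact: H].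
move=> h _; elim: d' dd => [|n IH]; first by rewrite leqn0 => /eqP ->.
rewrite leq_eqVlt => /predU1P[-> //|]; rewrite ltnS => dn; rewrite IH // xi_step //.
by apply: le_lt_trans h; rewrite lerD2l lerN2 ler_nat.
Qed.

Lemma cdiff_xi d s : - d%:R < complex.Re s -> cdiff (xi d.+1) s.
Proof.
elim: d s => [|d IH] s sd.
  have -> : xi 1 = (fun s => 1 + hser 2 s) by apply/funext => w; rewrite xiS big_geq // subr0.
  apply: cdiffD; first exact: cdiff_cst.
  by apply: cdiff_hser; move: sd; rewrite oppr0 => s0; rewrite -{1}[2]add0r ltrD2r.
have -> : xi d.+2 = (fun s => 1 - \sum_(0 <= j < d.+1) bc (1 - s) j.+1 / j.+2%:R * xi d.+1 (s + j.+1%:R) + hser d.+3 s) by [].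
apply: cdiffD; last first.
  by apply: cdiff_hser; rewrite -natr1 -natr1; move: sd; rewrite -natr1; clear; lra.
apply: cdiffB; first exact: cdiff_cst.
apply: (@cdiff_sum d.+1 (fun j s => bc (1 - s) j.+1 / j.+2%:R * xi d.+1 (s + j.+1%:R))) => j _.
apply: cdiffM.
  by apply: (cdiffM (@cdiff_bc1B j.+1 s)); exact: cdiff_cst.
apply: (@cdiff_comp R (xi d.+1) (fun w => w + j.+1%:R)); first exact: cdiff_addr.
apply: IH; rewrite ReDn -natr1; have : 0 <= j%:R :> R by [].
by move: sd; rewrite -natr1; clear; lra.
Qed.

Lemma cdiff_local (f g : C -> C) z r : 0 < r -> (forall w, nc (w - z) < r -> f w = g w) ->
  cdiff f z -> cdiff g z.
Proof.
move=> r0 fg /cdiffP[d Hd]; apply/cdiffP; exists d => e e0; have [dl dl0 H] := Hd e e0.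
exists (Num.min r dl) => [|w]; first by rewrite lt_min r0.
by rewrite lt_min => /andP[wr /H]; rewrite !fg // subrr nc0.
Qed.

(** The depth [D s] varies with [s], but by [xi_eq] any sufficient depth gives the same value. Near
    a given point [Z] therefore coincides with a quotient of fixed depth; the margin 3 in [D] covers
    a disc of radius 1. *)
Lemma is_zeta_exists : exists Z : C -> C, is_zeta Z.
Proof.
pose D s := Num.bound (`|complex.Re s| + 3).
pose Z s := xi (D s) s / (s - 1).
have DP s : `|complex.Re s| + 3 < (D s)%:R by apply: archi_boundP; rewrite addr_ge0.
exists Z; split.
  move=> s s1; have := DP s; set d := D s => hd; rewrite -/(cdiff Z s).
  have d0 : (0 < d)%N by rewrite -(@ltr0n R) (le_lt_trans _ hd) // addr_ge0.
  apply: (@cdiff_local (fun w => xi d w / (w - 1)) Z s 1) => // [w ws|].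
    congr (_ / _); apply: xi_eq.
      have := le_lt_trans (nc_Re _) ws; move: hd; case: (s) (w) => a b [a' b'] /=.
      have := ler_norm (- a); rewrite normrN => h1 h2 /ltr_normlP[]; clear -h1 h2; lra.
    have := DP w; have := ler_norm (- complex.Re w); rewrite normrN; clear; lra.
  apply: cdiffM; last by apply: cdiff_inv_sub.
  rewrite -(prednK d0); apply: cdiff_xi.
  have := ler_norm (- complex.Re s); rewrite normrN; move: hd; rewrite -(prednK d0) -natr1; clear; lra.
move=> s s1.
have -> : Z s = dseries s.
  rewrite /Z xi_dseries // mulrAC mulfV ?mul1r // subr_eq0.
  by apply: contraTneq s1 => ->; rewrite ltxx.
exact/csums_cvg/dseriesP.
Qed.

Lemma zetaP : is_zeta (zeta : C -> C).
Proof. by rewrite /zeta; case: xgetP => [Z _ //|H]; have [Z /H] := is_zeta_exists. Qed.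

Lemma cdiff_zeta s : s != 1 -> cdiff zeta s.
Proof. exact: zetaP.1. Qed.

Lemma zeta_dseries s : 1 < complex.Re s -> zeta s = dseries s.
Proof.
by move=> s1; apply: csums_unique (dseriesP s1); apply/cvg_csums/(zetaP.2 s s1).
Qed.

(** [is_zeta] fixes [zeta] only by holomorphy and the Dirichlet series, so the formula is carried to
    the left from [Re w >= 5/4] by [identity_right]. The rectangle has half height 2, and
    [|Im s| >= 3] keeps it at height at least 1, away from the pole. The condition on [Y] reads
    [5/4 + 25/16 <= 4] in the worst case. *)
Lemma zeta_hser2 s : 0 < complex.Re s -> 3 <= `|complex.Im s| -> (s - 1) * zeta s = 1 + hser 2 s.
Proof.
move=> s0 t3.
have big w : 1 < complex.Re w -> (w - 1) * zeta w = 1 + hser 2 w.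
  move=> w1; rewrite zeta_dseries // hser_dseries // big_nat1 bc1 addr0; ring.
have [s1|s1] := ltP 1 (complex.Re s); first exact: big.
apply/eqP; rewrite -subr_eq0; apply/eqP.
have := @identity_right R (fun w => (w - 1) * zeta w - (1 + hser 2 w)) (complex.Re s / 2) 2 (5 / 4)
  (complex.Re s) (complex.Im s) 2.
rewrite (_ : complex.Re s +i* complex.Im s = s); last by case: (s).
apply; try by move: s0 s1; clear; lra.
- have : 0 < 5 / 4 - complex.Re s / 2 <= 5 / 4 by move: s0 s1; clear; lra.
  by move: (5 / 4 - complex.Re s / 2) => u; clear; nra.
- move=> w win.
  have [wr wi] : 0 < complex.Re w /\ 1 <= `|complex.Im w|.
    move: win t3 s0; rewrite /in_rect; move: (complex.Im s) (complex.Re s) (complex.Re w) (complex.Im w) => t x a b.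
    rewrite !ler_normr; clear; case/and3P => /andP[h1 h2] h3 h4 /orP[] h5 h6; split; first lra.
    + by apply/orP; left; lra.
    + lra.
    + by apply/orP; right; lra.
  have w1 : w != 1 by apply: contraTneq wi => ->; rewrite normr0 -ltNge.
  apply: cdiffB; first by apply: cdiffM; [exact: cdiff_subr|exact: cdiff_zeta].
  apply: cdiffD; first exact: cdiff_cst.
  by apply: cdiff_hser; move: wr; clear; lra.
- by move=> w _ wp; rewrite big ?subrr // (lt_le_trans _ wp) //; lra.
Qed.

End ZetaExistence.

Ltac pos := first [ assumption | (apply: ltW; assumption) | exact: ler01 | exact: ler0n | exact: normr_ge0
  | exact: nc_ge0 | exact: rpw_ge0 | exact: expR_ge0 | exact: falling_ge0
  | (apply: exprn_ge0; pos) | (apply: mulr_ge0; pos) | (rewrite invr_ge0; pos) | (apply: addr_ge0; pos) ].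

(** * Tails of the zeta series to the left of the line of convergence *)

Section ZetaTail.
Context {R : realType}.
Local Notation C := R[i].
Local Notation nc := (@Normc.normc R).
Implicit Types (x y : R) (s w z : C).

Definition ztail N s : C := zeta s - \sum_(0 <= i < N) pwr i.+1%:R (- s).
Definition htail k N s : C := hser k s - \sum_(0 <= i < N) hterm k s i.

Lemma htail_le k N s : 0 <= complex.Re s -> 2 < complex.Re s + k%:R ->
  nc (htail k N s) <= expR 1 * falling (1 - s) k * (rpw N.+1 (2 - complex.Re s - k%:R) *
    (1 + (complex.Re s + k%:R - 2)^-1)).
Proof.
move=> s0 h; have S := csums_shift N (hserP h).
apply: csums_le_abs S _ => n.
pose p := complex.Re s + k%:R - 2; have p0 : 0 < p by rewrite subr_gt0.
have := @rpw_tail_sum R p N.+1 n p0 isT; have -> : - p = 2 - complex.Re s - k%:R by rewrite /p; ring.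
move=> H; have c0 : 0 <= expR 1 * falling (1 - s) k by rewrite mulr_ge0 ?expR_ge0 ?falling_ge0.
apply: le_trans (ler_wpM2l c0 H); rewrite mulr_sumr; apply: ler_sum => i _.
have -> : - 1 + (2 - complex.Re s - k%:R) = 1 - complex.Re s - k%:R by ring.
by apply: hterm_falling_le => //; rewrite gerBl.
Qed.

Lemma sumrT (V : zmodType) (f : nat -> V) n :
  \sum_(0 <= i < n) (f i.+1 - f i) = f n - f 0%N.
Proof. by rewrite telescope_sumr. Qed.

Lemma ztail_htail2 N s : 0 < complex.Re s -> 3 <= `|complex.Im s| ->
  (s - 1) * ztail N s = pwr N.+1%:R (1 - s) + htail 2 N s.
Proof.
move=> s0 t3; rewrite /ztail mulrBr zeta_hser2 // /htail.
have -> : \sum_(0 <= i < N) hterm 2 s i =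
   \sum_(0 <= i < N) (pwr i.+2%:R (1 - s) - pwr i.+1%:R (1 - s)) + (s - 1) * \sum_(0 <= i < N) pwr i.+1%:R (- s).
  rewrite mulr_sumr -big_split /=; apply: eq_bigr => i _.
  have := hterm_step 1 s i; rewrite hterm1E bc1 addrK => h.
  have -> : hterm 2 s i = pwr i.+2%:R (1 - s) - pwr i.+1%:R (1 - s) - (1 - s) * pwr i.+1%:R (- s).
    by rewrite -h opprB addrC subrK.
  ring.
rewrite (sumrT (fun i => pwr i.+1%:R (1 - s))) pwr1s; ring.
Qed.

Lemma htail_step k N s : 2 < complex.Re s + k%:R ->
  htail k N s - htail k.+1 N s = bc (1 - s) k * ztail N (s + k%:R - 1).
Proof.
move=> h; have z1 : 1 < complex.Re (s + k%:R - 1).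
  have -> : s + k%:R - 1 = s - 1 + k%:R by ring.
  by rewrite ReDn; move: h; case: (s) => a b /=; lra.
rewrite /htail /ztail zeta_dseries // mulrBr -hser_step //.
have -> : bc (1 - s) k * \sum_(0 <= i < N) pwr i.+1%:R (- (s + k%:R - 1)) =
  \sum_(0 <= i < N) hterm k s i - \sum_(0 <= i < N) hterm k.+1 s i.
  by rewrite mulr_sumr -sumrB; apply: eq_bigr => i _; rewrite hterm_step.
ring.
Qed.

(** An expansion in the manner of Euler and Maclaurin, in which tails of zeta at [s + 1, s + 2, ...]
    stand in place of derivatives; each new term is one application of [htail_step]. *)
Lemma ztail_expansion k N s : 0 < complex.Re s -> 3 <= `|complex.Im s| ->
  (s - 1) * ztail N s = pwr N.+1%:R (1 - s) +
    \sum_(0 <= j < k) bc (1 - s) j.+2 * ztail N (s + j.+1%:R) + htail k.+2 N s.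
Proof.
move=> s0 t3; elim: k => [|k IH]; first by rewrite ztail_htail2 // big_geq // addr0.
rewrite IH sumrS.
have h2 : 2 < complex.Re s + k.+2%:R.
  by rewrite -natr1 -natr1; have : 0 <= k%:R :> R by []; move: s0; clear; lra.
have := htail_step N h2; have -> : s + k.+2%:R - 1 = s + k.+1%:R by rewrite -[k.+2%:R]natr1; ring.
move=> <-; ring.
Qed.

Lemma ztail_le_aux (t M : R) j k : 0 < t -> t <= M -> (j < k)%N ->
  t ^+ j.+2 * M ^- j.+1 / t * (1 + t ^+ (k - j.+1).+2 / M ^+ (k - j.+1).+1) <= 1 + t ^+ k.+2 / M ^+ k.+1.
Proof.
move=> t0 tM jk; have M0 : 0 < M by exact: lt_le_trans tM.
have -> : k.+2 = (j.+1 + (k - j.+1).+2)%N by rewrite !addnS subnKC.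
have -> : k.+1 = (j.+1 + (k - j.+1).+1)%N by rewrite !addnS subnKC.
have e1 : t ^+ j.+2 * M ^- j.+1 / t = (t / M) ^+ j.+1.
  by rewrite exprS expr_div_n mulrC !mulrA mulVf ?gt_eqF // mul1r.
rewrite e1 mulrDr mulr1 [t ^+ (j.+1 + _)]exprD [M ^+ (j.+1 + _)]exprD invfM mulrACA -expr_div_n lerD2r.
by rewrite exprn_ile1 // ?divr_ge0 ?(ltW t0) ?(ltW M0) // ler_pdivrMr // mul1r.
Qed.

(** In the expansion the tail at [s + j.+1] is bounded with order [k - j.+1]: the power of [|Im s|]
    in its coefficient is compensated by the shift of the exponent of [N.+1]. The last factor is at
    most 2 once [|Im s| ^+ k.+2 <= N.+1 ^+ k.+1], so with [k] large a length [T ^ (1 + e)] is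
    enough. *)
Lemma ztail_le (d : R) k B : 0 < d -> exists2 K, 0 <= K & forall k' N s, (k' <= k)%N ->
  d <= complex.Re s <= B -> 3 <= `|complex.Im s| -> `|complex.Im s| <= N.+1%:R ->
  nc (ztail N s) <= K * (rpw N.+1 (1 - complex.Re s) / `|complex.Im s|) *
     (1 + `|complex.Im s| ^+ k'.+2 / N.+1%:R ^+ k'.+1).
Proof.
move=> d0; elim/ltn_ind: k B => k IHk B.
(* Two uses of the induction hypothesis: [K'] serves the shifted arguments, whose real parts reach
   [|B| + k], and [K1] the orders [k' < k]. *)
have [K' K'0 HK'] : exists2 K, 0 <= K & forall k' N s, (k' < k)%N ->
    d <= complex.Re s <= `|B| + k%:R -> 3 <= `|complex.Im s| -> `|complex.Im s| <= N.+1%:R ->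
    nc (ztail N s) <= K * (rpw N.+1 (1 - complex.Re s) / `|complex.Im s|) *
     (1 + `|complex.Im s| ^+ k'.+2 / N.+1%:R ^+ k'.+1).
  case: k IHk => [|k] IH; first by exists 0.
  by have [K K0 HK] := IH k (leqnn _) (`|B| + k.+1%:R); exists K.
have [K1 K10 HK1] : exists2 K, 0 <= K & forall k' N s, (k' < k)%N ->
    d <= complex.Re s <= B -> 3 <= `|complex.Im s| -> `|complex.Im s| <= N.+1%:R ->
    nc (ztail N s) <= K * (rpw N.+1 (1 - complex.Re s) / `|complex.Im s|) *
     (1 + `|complex.Im s| ^+ k'.+2 / N.+1%:R ^+ k'.+1).
  case: k IHk {HK'} => [|k] IH; first by exists 0.
  by have [K K0 HK] := IH k (leqnn _) B; exists K.
pose c := 3 + `|B| + k%:R; have c1 : 1 <= c.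
  by have := normr_ge0 B; have : 0 <= k%:R :> R by []; rewrite /c; clear; lra.
have c0 : 0 <= c by exact: le_trans c1.
pose K := 1 + c ^+ k.+2 * K' * k%:R + expR 1 * c ^+ k.+2 * (1 + d^-1).
have i0 : 0 <= d^-1 by rewrite invr_ge0 ltW.
have K0 : 0 <= K.
  have ck := exprn_ge0 k.+2 c0.
  apply: addr_ge0; last by apply: mulr_ge0; [exact: mulr_ge0 (expR_ge0 _) ck|exact: addr_ge0].
  by apply: addr_ge0 => //; apply: mulr_ge0 => //; exact: mulr_ge0.
exists (Num.max K K1) => [|k' N s]; first by rewrite le_max K0.
rewrite leq_eqVlt => /predU1P[->|k'k] sB t3 tN; last first.
  apply: le_trans (HK1 k' N s k'k sB t3 tN) _; do 2 (apply: ler_wpM2r; first by pos).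
  by rewrite le_max lexx orbT.
have [sd sB'] := andP sB.
have s0 : 0 < complex.Re s by exact: lt_le_trans sd.
set t := `|complex.Im s| in t3 tN *; set M := N.+1%:R in tN *.
have t0 : 0 < t by exact: lt_le_trans t3.
have M0 : 0 < M by exact: lt_le_trans tN.
set Q := 1 + _ / _; set L := rpw _ _.
have Q1 : 1 <= Q by rewrite /Q lerDl; pos.
have L0 : 0 <= L by exact: rpw_ge0.
have Q0 : 0 <= Q by exact: le_trans Q1.
have w_le : nc (1 - s) + k.+2%:R <= c * t.
  have -> : c * t = (3 + `|B|) * t + k%:R * t by rewrite /c; ring.
  have h1 : nc (1 - s) <= 1 + complex.Re s + t.
    apply: le_trans (ncB _ _) _; rewrite nc1 -addrA lerD2l.
    by apply: le_trans (nc_leD _) _; rewrite ger0_norm // ltW.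
  have h2 : k%:R <= k%:R * t by rewrite ler_peMr //; move: t3; clear; lra.
  have h3 := ler_norm B; have h4 := normr_ge0 B.
  have h5 : `|B| <= `|B| * t by rewrite ler_peMr //; move: t3; clear; lra.
  rewrite -natr1 -natr1; move: h1 h2 h3 h4 h5 sB' t3; set kt := k%:R * t; set bt := `|B| * t.
  rewrite mulrDl -/bt; clear; lra.
have fall j : (j <= k.+2)%N -> falling (1 - s) j <= (c * t) ^+ j.
  move=> jk; apply: falling_le; apply: le_trans w_le; by rewrite lerD2l ler_nat.
have main : t * nc (ztail N s) <= K * L * Q.
  apply: (@le_trans _ _ (nc ((s - 1) * ztail N s))).
    rewrite ncM ler_wpM2r ?nc_ge0 //; apply: le_trans (nc_Im (s - 1)).
    by case: (s) @t {t3 tN t0 w_le fall HK' HK1 Q Q1 Q0} => a b /=; rewrite subr0.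
  rewrite (ztail_expansion k) //.
  apply: le_trans (ncD _ _) _; rewrite /K 2!mulrDl 2!mulrDl; apply: lerD.
    apply: le_trans (ncD _ _) _; apply: lerD.
      rewrite nc_pwr_nat Re1B -/L mul1r ler_peMr //.
    apply: le_trans (nc_sum _ _ _) _.
    apply: (@le_trans _ _ (\sum_(0 <= j < k) c ^+ k.+2 * K' * L * Q)); last first.
      rewrite sumr_const_nat subn0 -[leLHS]mulr_natr; apply: le_of_eq; ring.
    rewrite big_nat_cond [leRHS]big_nat_cond; apply: ler_sum => j; rewrite andbT => /andP[_ jk].
    have sj : d <= complex.Re (s + j.+1%:R) <= `|B| + k%:R.
      by rewrite ReDn (le_trans sd) ?lerDl //= lerD // ?ler_nat // (le_trans sB') // ler_norm.
    have := HK' (k - j.+1)%N N (s + j.+1%:R) _ sj; rewrite ImDn -/t -/M => /(_ _ t3 tN).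
    have kj : (k - j.+1 < k)%N by rewrite ltn_subrL (leq_trans _ jk).
    move=> /(_ kj) H.
    rewrite ncM; apply: le_trans (ler_pM (nc_ge0 _) (nc_ge0 _) (le_trans (nc_bc _ _) (fall _ _)) H) _.
      by rewrite ltnS ltnW.
    rewrite ReDn opprD addrA rpwD -/L rpwN rpw_nat // -/M.
    have := ztail_le_aux t0 tN jk; rewrite -/Q; set G := _ * (1 + _) => hG.
    have -> : (c * t) ^+ j.+2 * (K' * (L * (M ^+ j.+1)^-1 / t) *
       (1 + t ^+ (k - j.+1).+2 / M ^+ (k - j.+1).+1)) = c ^+ j.+2 * (K' * L * G).
      by rewrite /G exprMn; ring.
    have -> : c ^+ k.+2 * K' * L * Q = c ^+ k.+2 * (K' * L * Q) by ring.
    apply: ler_pM; [by pos|by rewrite /G; pos|by rewrite ler_weXn2l // ltnS ltnW|].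
    by apply: ler_wpM2l => //; pos.
  have h2 : 2 < complex.Re s + k.+2%:R.
    by rewrite -natr1 -natr1; have : 0 <= k%:R :> R by []; move: s0; clear; lra.
  apply: le_trans (htail_le N (ltW s0) h2) _.
  have -> : 2 - complex.Re s - k.+2%:R = (1 - complex.Re s) - k.+1%:R by rewrite -[k.+2%:R]natr1; ring.
  rewrite rpwD -/L rpwN rpw_nat // -/M.
  have q1 : (complex.Re s + k.+2%:R - 2)^-1 <= d^-1.
    rewrite lef_pV2 ?posrE ?subr_gt0 //; apply: le_trans sd _.
    by rewrite -natr1 -natr1; have : 0 <= k%:R :> R by []; clear; lra.
  apply: (@le_trans _ _ (expR 1 * (c * t) ^+ k.+2 * (L / M ^+ k.+1 * (1 + d^-1)))).
    rewrite -[leLHS]mulrA -[leRHS]mulrA; apply: ler_wpM2l; first exact: expR_ge0.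
    apply: ler_pM; rewrite ?falling_ge0 ?fall //.
      rewrite !mulr_ge0 ?invr_ge0 ?exprn_ge0 ?addr_ge0 ?(ltW M0) // invr_ge0 ltW // subr_gt0 //.
    by apply: ler_wpM2l; [pos|rewrite lerD2l].
  have -> : expR 1 * (c * t) ^+ k.+2 * (L / M ^+ k.+1 * (1 + d^-1)) =
     expR 1 * c ^+ k.+2 * (1 + d^-1) * L * (t ^+ k.+2 / M ^+ k.+1) by rewrite exprMn; ring.
  have ck := exprn_ge0 k.+2 c0.
  apply: ler_wpM2l; last by rewrite /Q lerDr.
  by apply: mulr_ge0 L0; apply: mulr_ge0; [exact: mulr_ge0 (expR_ge0 _) ck|exact: addr_ge0].
have : nc (ztail N s) <= K * (L / t) * Q.
  have -> : K * (L / t) * Q = K * L * Q / t by ring.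
  by rewrite ler_pdivlMr // mulrC.
move=> h; apply: le_trans h _; do 2 (apply: ler_wpM2r; first by pos).
by rewrite le_max lexx.
Qed.

End ZetaTail.

(** * Growth of the zeta function *)

Section ExponentialSums.
Context {R : realType}.
Local Notation C := R[i].
Local Notation nc := (@Normc.normc R).
Implicit Types (x y t : R) (s w z : C).

Definition eix x : C := cexp (0 +i* x).

Lemma eixE x : eix x = cos x +i* sin x.
Proof. by rewrite /eix /cexp /= expR0 mul1r. Qed.

Lemma nc_eix x : nc (eix x) = 1.
Proof. by rewrite nc_cexp expR0. Qed.

Lemma eixD x y : eix (x + y) = eix x * eix y.
Proof. by rewrite /eix -cexpD; congr cexp; apply/eqP; rewrite eq_complex /= addr0 !eqxx. Qed.

Lemma sin_ge_half x : 0 <= x -> x <= 1 -> x / 2 <= sin x.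
Proof.
move=> x0 x1; have := sin_sub_le x; rewrite (ger0_norm x0) ler_norml => /andP[h _].
have : x * (x ^+ 2 / 2) <= x * (1 / 2) by rewrite ler_wpM2l // ler_wpM2r ?invr_ge0 // exprn_ile1.
lra.
Qed.

(** Half the cotangent of [x / 2]. *)
Definition cotau x : R := sin x / (2 * (1 - cos x)).

Lemma cos_lt1 x : 0 < x -> x <= 1 -> cos x < 1.
Proof.
move=> x0 x1; have s0 : 0 < sin x.
  by apply: lt_le_trans (sin_ge_half (ltW x0) x1); rewrite divr_gt0.
have := cos2Dsin2 x; have : 0 < sin x ^+ 2 by rewrite exprn_gt0.
by move: (sin x ^+ 2) => v; rewrite expr2; move: (cos x) => c; clear; nra.
Qed.

Lemma inv_one_sub_eix x : 0 < x -> x <= 1 -> (1 - eix x)^-1 = 2^-1 +i* cotau x.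
Proof.
move=> x0 x1; rewrite eixE /GRing.inv /= /cotau.
have c1 : 0 < 1 - cos x by rewrite subr_gt0 cos_lt1.
have -> : (1 - cos x) ^+ 2 + (0 - sin x) ^+ 2 = 2 * (1 - cos x).
  have := cos2Dsin2 x; rewrite sub0r sqrrN !expr2; move: (cos x) (sin x) => c v; clear; lra.
apply/eqP; rewrite eq_complex /=; apply/andP; split; apply/eqP.
  by rewrite invfM mulrCA mulfV ?mulr1 // gt_eqF.
by rewrite sub0r mulNr opprK.
Qed.

(** With denominators cleared the inequality is [sin y <= sin x + sin (y - x)]. *)
Lemma cotau_anti x y : 0 < x -> x <= y -> y <= 1 -> cotau y <= cotau x.
Proof.
move=> x0 xy y1; have y0 := lt_le_trans x0 xy; have x1 := le_trans xy y1.
have cx : 0 < 1 - cos x by rewrite subr_gt0 cos_lt1.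
have cy : 0 < 1 - cos y by rewrite subr_gt0 cos_lt1.
rewrite /cotau ler_pdivrMr ?mulr_gt0 // mulrAC ler_pdivlMr ?mulr_gt0 //.
pose d := y - x; have yE : y = x + d by rewrite /d addrC subrK.
have d0 : 0 <= d by rewrite subr_ge0.
have d1 : d <= 1 by rewrite /d; move: x0 y1; clear; lra.
have sx : 0 <= sin x by apply: le_trans (sin_ge_half (ltW x0) x1); rewrite divr_ge0 // ltW.
have sd : 0 <= sin d by apply: le_trans (sin_ge_half d0 d1); rewrite divr_ge0.
have h1 : sin y <= sin x + sin d.
  rewrite yE sinD lerD //; first by rewrite ler_piMr // cos_le1.
  by rewrite ler_piMl // cos_le1.
have h2 : sin d = sin y * cos x - cos y * sin x by rewrite /d sinB.
move: h1; rewrite h2; move: (sin x) (sin y) (cos x) (cos y) => a b c e; clear; lra.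
Qed.

Lemma cotau_ge0 x : 0 < x -> x <= 1 -> 0 <= cotau x.
Proof.
move=> x0 x1; have s0 : 0 <= sin x.
  by apply: le_trans (sin_ge_half (ltW x0) x1); rewrite divr_ge0 // ltW.
by rewrite /cotau divr_ge0 // mulr_ge0 // subr_ge0 cos_le1.
Qed.

Lemma nc_inv_one_sub_eix x : 0 < x -> x <= 1 -> nc (1 - eix x)^-1 <= 2 / x.
Proof.
move=> x0 x1; rewrite ncV -[2 / x]invf_div lef_pV2 ?posrE ?divr_gt0 //.
  apply: le_trans (sin_ge_half (ltW x0) x1) _; apply: le_trans (nc_Im _).
  by rewrite eixE /= sub0r normrN ler_norm.
rewrite nc_gt0 subr_eq0 eixE eq_complex /= negb_and eq_sym lt_eqF //; exact: cos_lt1.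
Qed.

(* With [c n = 1 / (1 - exp (i (f (n+1) - f n)))], the terms are [c n] times the differences
   of the exponentials, and the [c n] all have real part 1/2 and monotone imaginary part. *)
Lemma kusmin_landau (f : nat -> R) L (d : R) : 0 < d ->
  (forall n, (n < L)%N -> d <= f n.+1 - f n <= 1) ->
  (forall n, (n.+1 < L)%N -> f n.+2 - f n.+1 <= f n.+1 - f n) ->
  nc (\sum_(0 <= n < L) eix (f n)) <= 8 / d.
Proof.
move=> d0 H1 H2; case: L H1 H2 => [|L] H1 H2.
  by rewrite big_geq // nc0 divr_ge0 // ltW.
pose g n := f n.+1 - f n; pose c n := (1 - eix (g n))^-1.
have g0 n : (n <= L)%N -> 0 < g n by move=> nL; have /andP[h _] := H1 n nL; exact: lt_le_trans h.
have g1 n : (n <= L)%N -> g n <= 1 by move=> nL; have /andP[_ h] := H1 n nL.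
have cE n : (n <= L)%N -> c n = 2^-1 +i* cotau (g n) by move=> nL; rewrite /c inv_one_sub_eix ?g0 ?g1.
have cb n : (n <= L)%N -> nc (c n) <= 2 / d.
  move=> nL; apply: le_trans (nc_inv_one_sub_eix (g0 n nL) (g1 n nL)) _.
  by rewrite ler_pM2l // lef_pV2 ?posrE ?g0 //; have /andP[] := H1 n nL.
have aE n : (n <= L)%N -> eix (f n) = (eix (f n) - eix (f n.+1)) * c n.
  move=> nL; have -> : f n.+1 = f n + g n by rewrite /g addrC subrK.
  rewrite eixD -{2}[eix (f n)]mulr1 -mulrBr -mulrA mulfV ?mulr1 //.
  have := g0 n nL; have := g1 n nL => h1 h2.
  by rewrite subr_eq0 eixE eq_complex /= negb_and eq_sym lt_eqF // cos_lt1.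
have abel : forall K, (K <= L)%N -> \sum_(0 <= n < K.+1) eix (f n) =
   eix (f 0%N) * c 0%N - eix (f K.+1) * c K + \sum_(0 <= n < K) eix (f n.+1) * (c n.+1 - c n).
  elim=> [_|K IH KL]; first by rewrite big_nat1 big_geq // addr0 -mulrBl -aE.
  rewrite sumrS IH ?(ltnW KL) // sumrS [X in _ + X = _](aE K.+1 KL).
  set S := \sum_(_ <= _ < _) _; ring.
(* The increments of [f] decrease, so [cotau (g n)] increases and the total variation of [c]
   telescopes. *)
have csum K : (K <= L)%N -> nc (\sum_(0 <= n < K) eix (f n.+1) * (c n.+1 - c n)) <= cotau (g K) - cotau (g 0%N).
  elim: K => [_|K IH KL]; first by rewrite big_geq // nc0 subrr.
  rewrite sumrS; apply: le_trans (ncD _ _) _.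
  have -> : cotau (g K.+1) - cotau (g 0%N) = (cotau (g K) - cotau (g 0%N)) + (cotau (g K.+1) - cotau (g K)) by ring.
  apply: lerD; first by apply: IH; exact: ltnW.
  rewrite ncM nc_eix mul1r !cE ?(ltnW KL) //.
  have -> : (2^-1 +i* cotau (g K.+1)) - (2^-1 +i* cotau (g K)) = 0 +i* (cotau (g K.+1) - cotau (g K)).
    by apply/eqP; rewrite eq_complex /= subrr !eqxx.
  rewrite /= expr0n add0r sqrtr_sqr ger0_norm // subr_ge0.
  apply: cotau_anti; [exact: g0|exact: H2|apply: g1; exact: ltnW].
rewrite abel //; apply: le_trans (ncD _ _) _.
have t1 := cb 0%N isT; have t2 := cb L (leqnn L).
have t3 : cotau (g L) <= 2 / d.
  by apply: le_trans t2; apply: le_trans (nc_Im _); rewrite cE //= ler_norm.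
have t4 := cotau_ge0 (g0 0%N isT) (g1 0%N isT).
have t5 := csum L (leqnn L).
have t6 : nc (eix (f 0%N) * c 0%N - eix (f L.+1) * c L) <= 2 / d + 2 / d.
  by apply: le_trans (ncB _ _) _; rewrite (ncM (eix (f 0%N))) (ncM (eix (f L.+1))) !nc_eix !mul1r lerD.
have -> : 8 / d = 4 * (2 / d) by field; rewrite gt_eqF.
have d20 : 0 <= 2 / d by rewrite divr_ge0 // ltW.
move: t1 t2 t3 t4 t5 t6 d20; clear; lra.
Qed.

Lemma sqr_sum_le n (r : nat -> R) :
  (\sum_(0 <= i < n) r i) ^+ 2 <= n%:R * \sum_(0 <= i < n) r i ^+ 2.
Proof.
set S := \sum_(_ <= _ < _) _; set Q := \sum_(_ <= _ < _) _.
case: (posnP n) => [n0|n0]; first by rewrite /S /Q n0 !big_geq // expr0n mul0r.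
have n1 : 0 < n%:R :> R by rewrite ltr0n.
have : 0 <= \sum_(0 <= i < n) (n%:R * r i - S) ^+ 2 by apply: sumr_ge0 => i _; exact: sqr_ge0.
have -> : \sum_(0 <= i < n) (n%:R * r i - S) ^+ 2 = n%:R * (n%:R * Q - S ^+ 2).
  have -> : \sum_(0 <= i < n) (n%:R * r i - S) ^+ 2 =
      \sum_(0 <= i < n) (n%:R ^+ 2 * r i ^+ 2 - 2 * n%:R * S * r i + S ^+ 2).
    by apply: eq_bigr => i _; ring.
  rewrite big_split sumrB /= -!mulr_sumr -/S -/Q sumr_const_nat subn0 -mulr_natr; ring.
by rewrite pmulr_rge0 // subr_ge0.
Qed.

Lemma nc_conj z : nc (conjc z) = nc z.
Proof. by case: z => a b /=; rewrite sqrrN. Qed.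

Lemma sqr_nc z : nc z ^+ 2 = complex.Re (z * conjc z).
Proof.
by case: z => a b /=; rewrite sqr_sqrtr ?addr_ge0 ?sqr_ge0 // mulrN opprK !expr2.
Qed.

Lemma harmonic_le H : \sum_(0 <= d < H) (d.+1%:R^-1 : R) <= 1 + ln H%:R.
Proof.
case: H => [|H]; first by rewrite big_geq // addr_ge0 // ln_nat_ge0.
elim: H => [|H IH]; first by rewrite big_nat1 invr1 ln1 addr0.
rewrite sumrS; have := @ln_succ_ge R H.+1 isT; move: IH; set S := \sum_(_ <= _ < _) _.
set q := _^-1; clear; lra.
Qed.

Section WeylDifferencing.
Variables (a : nat -> C) (L H : nat) (B : R).
Hypothesis a1 : forall n, nc (a n) <= 1.
Hypothesis B0 : 0 <= B.
Hypothesis aB : forall d, (0 < d < H)%N ->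
  nc (\sum_(0 <= n < L - d) a (n + d)%N * conjc (a n)) <= B / d%:R.

(** The sequence delayed by [h] and padded with zeros, so that every delay [h < H] has the same sum
    over [m < L + H]. *)
Let A m h : C := if (h <= m < L + h)%N then a (m - h)%N else 0.

Lemma weyl_corr h h' : (h <= h')%N -> (h' < H)%N ->
  \sum_(0 <= m < L + H) A m h * conjc (A m h') =
  \sum_(0 <= n < L - (h' - h)) a (n + (h' - h))%N * conjc (a n).
Proof.
move=> hh h'H; have e1 : (L + H = h' + ((L - (h' - h)) + (L + H - h' - (L - (h' - h)))))%N by lia.
rewrite [in LHS]e1 2!sumr_shift.
rewrite [X in X + _]big_nat_cond [X in X + _]big1 ?add0r; last first.
  by move=> m; rewrite andbT => /andP[_ mh]; have -> : A m h' = 0 by [rewrite /A leqNgt mh]; rewrite conjc0 mulr0.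
rewrite [X in _ + X]big1 ?addr0; last first.
  move=> m _; rewrite {1}/A; case: ifP; last by rewrite mul0r.
  move=> c1; rewrite /A; case: ifP; last by rewrite conjc0 mulr0.
  by move=> c2; exfalso; move: c1 c2 hh; lia.
rewrite big_nat_cond [RHS]big_nat_cond; apply: eq_bigr => n; rewrite andbT => /andP[_ nL].
rewrite /A ifT; last by move: nL hh; lia.
rewrite ifT; last by move: nL hh; lia.
congr (a _ * conjc (a _)); by move: hh; lia.
Qed.

Lemma weyl_corr_le h : (h < H)%N ->
  \sum_(0 <= h' < H) nc (\sum_(0 <= m < L + H) A m h * conjc (A m h')) <=
  L%:R + 2 * B * \sum_(0 <= d < H) d.+1%:R^-1.
Proof.
move=> hH.
have diag : nc (\sum_(0 <= m < L + H) A m h * conjc (A m h)) <= L%:R.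
  rewrite weyl_corr // subnn subn0; apply: le_trans (nc_sum _ _ _) _.
  apply: (@le_trans _ _ (\sum_(0 <= i < L) 1)); last by rewrite sumr_const_nat subn0.
  by apply: ler_sum => i _; rewrite addn0 ncM nc_conj -[1]mulr1 ler_pM ?nc_ge0.
have right h' : (h < h')%N -> (h' < H)%N ->
    nc (\sum_(0 <= m < L + H) A m h * conjc (A m h')) <= B / (h' - h)%:R.
  by move=> hh h'H; rewrite weyl_corr ?(ltnW hh) //; apply: aB; move: hh h'H; lia.
have left h' : (h' < h)%N ->
    nc (\sum_(0 <= m < L + H) A m h * conjc (A m h')) <= B / (h - h')%:R.
  move=> hh; rewrite -nc_conj rmorph_sum /=.
  have -> : \sum_(0 <= m < L + H) conjc (A m h * conjc (A m h')) =
            \sum_(0 <= m < L + H) A m h' * conjc (A m h).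
    by apply: eq_bigr => m _; rewrite rmorphM /= conjcK mulrC.
  by rewrite weyl_corr ?(ltnW hh) //; apply: aB; move: hh hH; lia.
have e : H = (h + (1 + (H - h - 1)))%N by move: hH; lia.
rewrite [X in \sum_(0 <= _ < X) nc _]e 2!sumr_shift big_nat1.
have harm K : (K <= H)%N -> \sum_(0 <= d < K) (d.+1%:R^-1 : R) <= \sum_(0 <= d < H) d.+1%:R^-1.
  by move=> KH; rewrite -(subnKC KH) sumr_shift lerDl; apply: sumr_ge0 => i _; rewrite invr_ge0.
have t1 : \sum_(0 <= h' < h) nc (\sum_(0 <= m < L + H) A m h * conjc (A m h')) <=
    B * \sum_(0 <= d < H) d.+1%:R^-1.
  apply: le_trans (ler_wpM2l B0 (harm h (ltnW hH))); rewrite mulr_sumr [leRHS]big_nat_rev /=.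
  rewrite big_nat_cond [leRHS]big_nat_cond; apply: ler_sum => i; rewrite andbT => /andP[_ ih].
  by apply: le_trans (left i ih) _; have -> : (0 + h - i.+1).+1 = (h - i)%N by move: ih; lia.
have t2 : \sum_(0 <= i < H - h - 1) nc (\sum_(0 <= m < L + H) A m h * conjc (A m (h + (1 + i)))) <=
    B * \sum_(0 <= d < H) d.+1%:R^-1.
  have kH : (H - h - 1 <= H)%N by lia.
  apply: le_trans (ler_wpM2l B0 (harm _ kH)); rewrite mulr_sumr.
  rewrite big_nat_cond [leRHS]big_nat_cond; apply: ler_sum => i; rewrite andbT => /andP[_ ih].
  have ih' : (h + (1 + i) < H)%N by move: ih; lia.
  apply: le_trans (right _ _ ih') _; first by lia.
  by have -> : (h + (1 + i) - h)%N = i.+1 by lia.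
rewrite addn0; move: t1 t2 diag; clear.
set x1 := \sum_(_ <= _ < h) _; set x2 := \sum_(_ <= _ < H - h - 1) _; set x3 := nc _.
set x4 := \sum_(_ <= _ < _) _; lra.
Qed.

(** [H] times the sum is the double sum of the delayed copies; Cauchy's inequality over the [L + H]
    values of [m] leaves correlations, which depend on the difference of the delays only. Their
    bound [B / d] produces the harmonic sum. *)
Lemma weyl_differencing : (0 < H)%N ->
  H%:R * nc (\sum_(0 <= n < L) a n) ^+ 2 <=
  (L + H)%:R * (L%:R + 2 * B * \sum_(0 <= d < H) d.+1%:R^-1).
Proof.
move=> H0; set S := \sum_(0 <= n < L) a n.
have H1 : 0 < H%:R :> R by rewrite ltr0n.
have rowE h : (h < H)%N -> \sum_(0 <= m < L + H) A m h = S.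
  move=> hH; have e : (L + H = h + (L + (H - h)))%N by move: hH; lia.
  rewrite e 2!sumr_shift.
  rewrite [X in X + _]big_nat_cond [X in X + _]big1 ?add0r; last first.
    by move=> m; rewrite andbT => /andP[_ mh]; rewrite /A leqNgt mh.
  rewrite [X in _ + X]big1 ?addr0; last first.
    by move=> m _; rewrite /A ifF //; lia.
  rewrite /S big_nat_cond [RHS]big_nat_cond; apply: eq_bigr => n; rewrite andbT => /andP[_ nL].
  by rewrite /A ifT ?addKn //; move: nL; lia.
have HS : \sum_(0 <= m < L + H) \sum_(0 <= h < H) A m h = H%:R * S.
  rewrite exchange_big /=.
  have -> : \sum_(0 <= h < H) \sum_(0 <= m < L + H) A m h = \sum_(0 <= h < H) S.
    rewrite big_nat_cond [RHS]big_nat_cond; apply: eq_bigr => h; rewrite andbT => /andP[_ hH].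
    exact: rowE.
  by rewrite sumr_const_nat subn0 mulr_natl.
have key : (H%:R * nc S) ^+ 2 <= (L + H)%:R * (H%:R * (L%:R + 2 * B * \sum_(0 <= d < H) d.+1%:R^-1)).
  have -> : H%:R * nc S = nc (H%:R * S).
    by rewrite ncM -(rmorph_nat (@real_complex R)) nc_real ger0_norm.
  rewrite -HS.
  apply: (@le_trans _ _ ((\sum_(0 <= m < L + H) nc (\sum_(0 <= h < H) A m h)) ^+ 2)).
    by rewrite lerXn2r ?nnegrE ?nc_ge0 ?sumr_ge0 // => [i _|]; [exact: nc_ge0|exact: nc_sum].
  apply: le_trans (sqr_sum_le _ _) _; rewrite ler_wpM2l //.
  have -> : \sum_(0 <= m < L + H) nc (\sum_(0 <= h < H) A m h) ^+ 2 =
    complex.Re (\sum_(0 <= h < H) \sum_(0 <= h' < H) \sum_(0 <= m < L + H) A m h * conjc (A m h')).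
    have -> : \sum_(0 <= h < H) \sum_(0 <= h' < H) \sum_(0 <= m < L + H) A m h * conjc (A m h') =
       \sum_(0 <= m < L + H) (\sum_(0 <= h < H) A m h) * conjc (\sum_(0 <= h < H) A m h).
      under eq_bigr do rewrite exchange_big /=.
      rewrite exchange_big /=; apply: eq_bigr => m _; rewrite mulr_suml; apply: eq_bigr => h _.
      by rewrite rmorph_sum /= mulr_sumr.
    rewrite raddf_sum; apply: eq_bigr => m _; exact: sqr_nc.
  apply: le_trans (ler_norm _) _; apply: le_trans (nc_Re _) _.
  apply: le_trans (nc_sum _ _ _) _.
  apply: (@le_trans _ _ (\sum_(0 <= h < H) (L%:R + 2 * B * \sum_(0 <= d < H) d.+1%:R^-1))).
    rewrite big_nat_cond [leRHS]big_nat_cond; apply: ler_sum => h; rewrite andbT => /andP[_ hH].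
    by apply: le_trans (nc_sum _ _ _) _; exact: weyl_corr_le.
  by apply: le_of_eq; rewrite sumr_const_nat subn0 [RHS]mulr_natl.
move: key; rewrite exprMn [H%:R ^+ 2]expr2 -[_ * _ * nc S ^+ 2]mulrA [leRHS]mulrCA ler_pM2l //.
Qed.

End WeylDifferencing.

End ExponentialSums.

(** * Sums of [n ^ (i t)] and the convexity bound for zeta *)

Section PartialSums.
Context {R : realType}.
Local Notation C := R[i].
Local Notation nc := (@Normc.normc R).
Implicit Types (x y t k d : R) (s w z : C).

Arguments eix : simpl never.

Lemma ln_ratio_le x y : 0 < x -> x <= y -> ln y - ln x <= (y - x) / x.
Proof.
move=> x0 xy; have y0 := lt_le_trans x0 xy.
rewrite -lnV ?posrE // -lnM ?posrE ?invr_gt0 //.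
have -> : y * x^-1 = 1 + (y - x) / x by field; rewrite gt_eqF.
apply: le_ln1Dx; have : 0 <= (y - x) / x by rewrite divr_ge0 ?subr_ge0 // ltW.
lra.
Qed.

Lemma ln_ratio_ge x y : 0 < x -> x <= y -> (y - x) / y <= ln y - ln x.
Proof.
move=> x0 xy; have y0 := lt_le_trans x0 xy.
rewrite -[leRHS]opprB lerNr -lnV ?posrE // -lnM ?posrE ?invr_gt0 //.
have -> : x * y^-1 = 1 + - ((y - x) / y) by field; rewrite gt_eqF.
apply: le_ln1Dx; rewrite ltrN2 ltr_pdivrMr // mul1r; lra.
Qed.

Lemma block_large t M L : 0 < t -> t <= M%:R -> (L <= M)%N ->
  nc (\sum_(0 <= n < L) eix (t * ln (M + n)%:R)) <= 16 * M%:R / t.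
Proof.
move=> t0 tM LM; have M0 : 0 < M%:R :> R by exact: lt_le_trans tM.
have Mn n : 0 < (M + n)%:R :> R by rewrite ltr0n addn_gt0 -(ltr0n R) M0.
have h1 n : ((M + n.+1)%:R : R) = (M + n)%:R + 1 by rewrite addnS natr1.
have -> : 16 * M%:R / t = 8 / (t / (2 * M%:R)) by field; rewrite !gt_eqF.
apply: kusmin_landau => [|n nL|n nL]; first by rewrite divr_gt0 // mulr_gt0.
  rewrite -mulrBr h1; apply/andP; split.
    rewrite ler_pM2l //; apply: le_trans (ln_ratio_ge (Mn n) _); last by rewrite lerDl.
    rewrite addrC addKr div1r lef_pV2 ?posrE ?addr_gt0 ?mulr_gt0 //.
    rewrite -natrM natr1 ler_nat; lia.
  apply: (@le_trans _ _ (t * ((M + n)%:R)^-1)).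
    rewrite ler_pM2l //; apply: le_trans (ln_ratio_le (Mn n) _) _; first by rewrite lerDl.
    by rewrite addrC addKr div1r.
  by rewrite ler_pdivrMr // mul1r (le_trans tM) // ler_nat leq_addr.
rewrite -!mulrBr ler_pM2l // lerBlDr addrAC lerBrDr -!lnM ?posrE //.
by rewrite ler_ln ?posrE ?mulr_gt0 // -!natrM ler_nat; lia.
Qed.

Lemma ln_second_diff k d : 0 < k -> 0 <= d ->
  ln (k + d) - ln k - (ln (k + 1 + d) - ln (k + 1)) = ln (1 + d / (k * (k + d + 1))).
Proof.
move=> k0 d0; have k1 : 0 < k + 1 by rewrite addr_gt0.
have kd : 0 < k + d by rewrite ltr_wpDr.
have kd1 : 0 < k + 1 + d by rewrite ltr_wpDr.
have -> : 1 + d / (k * (k + d + 1)) = ((k + d) / k) * ((k + 1) / (k + 1 + d)).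
  by field; rewrite !gt_eqF // addrAC.
by rewrite !lnM ?posrE ?mulr_gt0 ?invr_gt0 // !lnV ?posrE //; ring.
Qed.

(** The phase differences [ln (M + n + e) - ln (M + n)] decrease in [n] and convexly so; after
    conjugation the increments are positive and decreasing, of size between [t * e / (4 * M ^ 2)]
    and 1, as [kusmin_landau] demands. *)
Lemma block_diff t M L e : 0 < t -> (0 < M)%N -> (0 < e)%N -> t * e%:R <= M%:R ^+ 2 -> (L + e <= M)%N ->
  nc (\sum_(0 <= n < L) eix (t * (ln (M + n + e)%:R - ln (M + n)%:R))) <= 32 * M%:R ^+ 2 / t / e%:R.
Proof.
move=> t0 M0 e0 teM LM; have M0' : 0 < M%:R :> R by rewrite ltr0n.
have e0' : 0 < e%:R :> R by rewrite ltr0n.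
have M2 : 0 < M%:R ^+ 2 :> R by rewrite exprn_gt0.
have conjE x : conjc (eix x) = eix (- x) :> C by rewrite !eixE cosN sinN.
have -> : \sum_(0 <= n < L) eix (t * (ln (M + n + e)%:R - ln (M + n)%:R)) =
    conjc (\sum_(0 <= n < L) eix (t * (ln (M + n)%:R - ln (M + n + e)%:R))).
  rewrite rmorph_sum; apply: eq_bigr => n _; apply: esym; apply: (etrans (conjE _)).
  by rewrite -mulrN opprB.
rewrite nc_conj.
have Mn n : 0 < (M + n)%:R :> R by rewrite ltr0n addn_gt0 M0.
pose q n : R := e%:R / ((M + n)%:R * ((M + n)%:R + e%:R + 1)).
have den n : 0 < (M + n)%:R * ((M + n)%:R + e%:R + 1) :> R by rewrite mulr_gt0 // !addr_gt0.
have q0 n : 0 < q n by rewrite divr_gt0.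
have gE n : t * (ln (M + n.+1)%:R - ln (M + n.+1 + e)%:R) - t * (ln (M + n)%:R - ln (M + n + e)%:R) = t * ln (1 + q n).
  rewrite -mulrBr /q -ln_second_diff ?(ltW e0') //; congr (t * _).
  have -> : (M + n + e)%:R = (M + n)%:R + e%:R :> R by rewrite natrD.
  have -> : (M + n.+1 + e)%:R = (M + n)%:R + 1 + e%:R :> R by rewrite natrD addnS natr1.
  have -> : (M + n.+1)%:R = (M + n)%:R + 1 :> R by rewrite addnS natr1.
  ring.
have -> : 32 * M%:R ^+ 2 / t / e%:R = 8 / (t * e%:R / (4 * M%:R ^+ 2)) by field; rewrite !gt_eqF.
apply: kusmin_landau => [|n nL|n nL]; first by rewrite !divr_gt0 ?mulr_gt0.
  rewrite gE; apply/andP; split.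
    rewrite -mulrA ler_pM2l //.
    have := @ln_ratio_ge 1 (1 + q n) ltr01; rewrite lerDl => /(_ (ltW (q0 n))).
    rewrite ln1 subr0 => h; apply: le_trans h.
    have -> : (1 + q n - 1) / (1 + q n) = e%:R / (((M + n)%:R + e%:R) * ((M + n)%:R + 1)).
      rewrite /q; move: (Mn n) e0'; move: ((M + n)%:R) (e%:R) => u v u0 v0; clear -u0 v0.
      by field; rewrite !gt_eqF //; nra.
    rewrite ler_pM2l // lef_pV2 ?posrE ?mulr_gt0 ?addr_gt0 //.
    rewrite natr1 -natrD expr2 -!natrM ler_nat; nia.
  apply: (@le_trans _ _ (t * q n)).
    rewrite ler_pM2l //; apply: le_ln1Dx; apply: lt_trans (q0 n); exact: ltrN10.
  rewrite /q mulrA ler_pdivrMr // mul1r (le_trans teM) // expr2 ler_pM ?(ltW M0') ?ler_nat ?leq_addr //.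
  by rewrite -natrD natr1 ler_nat -addnA -addnS leq_addr.
rewrite !gE ler_pM2l // ler_ln ?posrE ?addr_gt0 // lerD2l /q ler_pM2l // lef_pV2 ?posrE //.
have -> : (M + n.+1)%:R = (M + n)%:R + 1 :> R by rewrite addnS natr1.
by move: (Mn n) e0'; set m := (M + n)%:R; set v := e%:R; clear; nra.
Qed.

Lemma block_middle t M L : 1 <= t -> t <= M%:R ^+ 2 -> M%:R <= t -> (L <= M)%N -> (0 < M)%N ->
  nc (\sum_(0 <= n < L) eix (t * ln (M + n)%:R)) <= 17 * (Num.sqrt t * (1 + ln M%:R)).
Proof.
move=> t1 tM Mt LM M0; have t0 : 0 < t by exact: lt_le_trans t1.
have M0' : 0 < M%:R :> R by rewrite ltr0n.
have l0 := @ln_nat_ge0 R M.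
pose u := M%:R ^+ 2 / t; have u1 : 1 <= u by rewrite ler_pdivlMr // mul1r.
(* [M ^ 2 / t] bounds the shifts [e] for which [block_diff] has its hypothesis [t * e <= M ^ 2];
   with so many shifts the diagonal and the correlations balance up to a logarithm. *)
pose H := Num.truncn u.
have [H1 H2] : H%:R <= u /\ u < H.+1%:R by have /andP[] := truncn_itv (le_trans ler01 u1).
have H0 : (0 < H)%N by rewrite -(ltr_nat R); move: H2 u1; rewrite -natr1; lra.
have H0' : 1 <= H%:R :> R by rewrite ler1n.
have uM : u <= M%:R by rewrite ler_pdivrMr // expr2 ler_pM2l.
have HM : (H <= M)%N by rewrite -(ler_nat R) (le_trans H1).
have W := @weyl_differencing R (fun n => eix (t * ln (M + n)%:R)) L H (32 * M%:R ^+ 2 / t).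
have := W (fun n => le_of_eq (nc_eix _)) _ _ H0; set S := \sum_(_ <= _ < _) eix _ => {}W.
have {}W := W ltac:(by rewrite !mulr_ge0 ?invr_ge0 ?exprn_ge0 // ltW) _.
have {}W := W _.
have key : H%:R * nc S ^+ 2 <= (L + H)%:R * (L%:R + 2 * (32 * M%:R ^+ 2 / t) * \sum_(0 <= d < H) d.+1%:R^-1).
  apply: W => e /andP[e0 eH].
  have [eL|Le] := leqP e L; last first.
    have -> : (L - e = 0)%N by apply/eqP; rewrite subn_eq0 ltnW.
    by rewrite big_geq // nc0 !mulr_ge0 ?invr_ge0 ?exprn_ge0 // ltW.
  apply: le_trans (block_diff (L := L - e) t0 M0 e0 _ _); last 2 first.
  - apply: (@le_trans _ _ (t * u)); last by rewrite /u mulrC divfK // gt_eqF.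
    by rewrite ler_pM2l // (le_trans _ H1) // ler_nat ltnW.
  - by rewrite subnK.
  apply: le_of_eq; congr (nc _); apply: eq_bigr => n _.
  have conjE x : conjc (eix x) = eix (- x) :> C by rewrite !eixE cosN sinN.
  by rewrite conjE -eixD mulrBr addnA.
have harm := @harmonic_le R H.
have lH : ln H%:R <= ln M%:R :> R by rewrite ler_ln ?posrE ?ler_nat // (lt_le_trans ltr01).
have b1 : (L + H)%:R <= 2 * M%:R :> R by rewrite natrD mulr_natl mulr2n lerD ?ler_nat.
have b2 : L%:R + 2 * (32 * M%:R ^+ 2 / t) * \sum_(0 <= d < H) d.+1%:R^-1 <= M%:R + 64 * u * (1 + ln M%:R).
  apply: lerD; first by rewrite ler_nat.
  have -> : 2 * (32 * M%:R ^+ 2 / t) = 64 * u by rewrite /u; ring.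
  rewrite ler_pM2l; last by rewrite mulr_gt0 // (lt_le_trans ltr01).
  by apply: le_trans harm _; rewrite lerD2l.
have key2 : u / 2 * nc S ^+ 2 <= 2 * M%:R * (M%:R + 64 * u * (1 + ln M%:R)).
  apply: (@le_trans _ _ (H%:R * nc S ^+ 2)).
    rewrite ler_wpM2r ?exprn_ge0 ?nc_ge0 //; move: H2 H0'; rewrite -natr1; clear; lra.
  apply: le_trans key _; apply: ler_pM => //.
  apply: addr_ge0; first exact: ler0n.
  by rewrite !mulr_ge0 ?invr_ge0 ?exprn_ge0 ?(ltW t0) // sumr_ge0 // => i _; rewrite invr_ge0.
have key3 : nc S ^+ 2 <= 260 * (t * (1 + ln M%:R)).
  have e1 : u * t = M%:R ^+ 2 by rewrite /u divfK // gt_eqF.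
  have uM2 : u * t = M%:R * M%:R by rewrite e1 expr2.
  have : M%:R ^+ 2 * nc S ^+ 2 <= M%:R ^+ 2 * (4 * t + 256 * M%:R * (1 + ln M%:R)).
    have := ler_wpM2r (ltW t0) key2.
    have -> : u / 2 * nc S ^+ 2 * t = (u * t) * nc S ^+ 2 / 2 by ring.
    have -> : 2 * M%:R * (M%:R + 64 * u * (1 + ln M%:R)) * t =
      2 * (M%:R * M%:R) * t + 128 * M%:R * (u * t) * (1 + ln M%:R) by ring.
    by rewrite uM2 expr2; set w := nc S ^+ 2; set l := ln _; set m := M%:R; clear; lra.
  rewrite ler_pM2l ?exprn_gt0 // => h; apply: le_trans h _.
  move: Mt t0 l0; set l := ln _; set m := M%:R; clear => mt t0 l0.
  have : m * (1 + l) <= t * (1 + l) by rewrite ler_wpM2r // addr_ge0.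
  have : 0 <= t * l by rewrite mulr_ge0 // ltW.
  lra.
have S0 := nc_ge0 S; have r0 := sqrtr_ge0 t.
rewrite -(@ler_pXn2r _ 2) ?nnegrE ?mulr_ge0 ?addr_ge0 //.
apply: le_trans key3 _; rewrite !exprMn sqr_sqrtr ?(ltW t0) //; set l := ln _ in l0 *.
have -> : 260 * (t * (1 + l)) = t * (260 * (1 + l)) by ring.
have -> : 17 ^+ 2 * (t * (1 + l) ^+ 2) = t * (289 * (1 + l) ^+ 2) by ring.
by rewrite ler_pM2l //; clear -l0; rewrite !expr2; nra.
Qed.

(** Three ranges: for [M >= t] the phase itself has increments at most 1, for [M <= t <= M ^ 2] one
    differencing step is needed, and for [t > M ^ 2] the trivial bound [M] is below the square root
    of [t]. *)
Lemma block_le t M L : 1 <= t -> (0 < M)%N -> (L <= M)%N ->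
  nc (\sum_(0 <= n < L) eix (t * ln (M + n)%:R)) <= 17 * (Num.sqrt t * (1 + ln M%:R)) + 16 * M%:R / t.
Proof.
move=> t1 M0 LM; have t0 : 0 < t by exact: lt_le_trans t1.
have l0 := @ln_nat_ge0 R M; have r0 := sqrtr_ge0 t.
have p1 : 0 <= 17 * (Num.sqrt t * (1 + ln M%:R)) by rewrite !mulr_ge0 // addr_ge0.
have p2 : 0 <= 16 * M%:R / t by rewrite divr_ge0 ?mulr_ge0 // ltW.
have [tM|Mt] := leP t M%:R; first by apply: le_trans (block_large t0 tM LM) _; rewrite lerDr.
have [tM2|Mt2] := leP t (M%:R ^+ 2).
  by apply: le_trans (block_middle t1 tM2 (ltW Mt) LM M0) _; rewrite lerDl.
apply: (@le_trans _ _ (17 * (Num.sqrt t * (1 + ln M%:R)))); last by rewrite lerDl.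
apply: le_trans (nc_sum _ _ _) _; under eq_bigr do rewrite nc_eix.
rewrite sumr_const_nat subn0.
apply: (@le_trans _ _ (Num.sqrt t)); last first.
  by rewrite mulrCA ler_peMr //; move: l0; clear; lra.
apply: (@le_trans _ _ M%:R); first by rewrite ler_nat.
by rewrite -[leLHS]ger0_norm // -sqrtr_sqr ler_wsqrtr // ltW.
Qed.

(** Splitting off the upper half of the range costs one block, and halving [x] lowers [2 * ln x] by
    at least 1 because [ln 2 >= 1/2]. *)
Lemma partial_sum_le t (x X : nat) : 1 <= t -> (0 < x)%N -> (x <= X)%N ->
  nc (\sum_(0 <= n < x) eix (t * ln n.+1%:R)) <=
  (17 * (Num.sqrt t * (1 + ln X%:R)) + 16 * X%:R / t) * (1 + 2 * ln x%:R).
Proof.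
move=> t1; have t0 : 0 < t by exact: lt_le_trans t1.
set E := _ + _ => x0 xX; have X0 : (0 < X)%N by exact: leq_trans xX.
have lX := @ln_nat_ge0 R X; have r0 := sqrtr_ge0 t.
have E1 : 1 <= E.
  have r1 : 1 <= Num.sqrt t by rewrite -sqrtr1 ler_wsqrtr.
  have : 0 <= 16 * X%:R / t by rewrite divr_ge0 ?mulr_ge0 // ltW.
  rewrite /E; have : 1 * 1 <= Num.sqrt t * (1 + ln X%:R) by rewrite ler_pM // lerDl.
  lra.
elim/ltn_ind: x x0 xX => x IH x0 xX.
have [x1|x2] := leqP x 1.
  have -> : x = 1%N by move: x0 x1; clear; lia.
  by rewrite big_nat1 nc_eix ln1 mulr0 addr0 mulr1.
pose y := (x %/ 2)%N; have y0 : (0 < y)%N by rewrite /y divn_gt0.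
have yx : (y < x)%N by rewrite /y ltn_Pdiv.
have xy : (x - y <= y.+1)%N by rewrite /y; move: x2; clear; lia.
rewrite -(subnKC (ltnW yx)) sumr_shift subnKC ?(ltnW yx) //.
apply: le_trans (ncD _ _) _.
have h1 := IH y yx y0 (leq_trans (ltnW yx) xX).
have h2 := block_le t1 (ltn0Sn y) xy.
have -> : \sum_(0 <= n < x - y) eix (t * ln (y + n).+1%:R) = \sum_(0 <= n < x - y) eix (t * ln (y.+1 + n)%:R) by [].
have h3 : 17 * (Num.sqrt t * (1 + ln y.+1%:R)) + 16 * y.+1%:R / t <= E.
  have yX : y.+1%:R <= X%:R :> R by rewrite ler_nat (leq_trans yx).
  rewrite /E; apply: lerD; first by rewrite ler_pM2l // ler_wpM2l // lerD2l ler_ln ?posrE ?ltr0n.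
  by rewrite ler_wpM2r ?invr_ge0 ?(ltW t0) // ler_pM2l.
apply: le_trans (lerD h1 (le_trans h2 h3)) _.
rewrite -[X in _ + X]mulr1 -mulrDr ler_wpM2l // ?(le_trans ler01) //.
have : ln (2 * y)%:R <= ln x%:R :> R by rewrite ler_ln ?posrE ?ltr0n ?muln_gt0 // ler_nat /y; move: x2; clear; lia.
rewrite natrM lnM ?posrE ?ltr0n //.
have := @ln_succ_ge R 1 isT; rewrite ln1 subr0.
move: (ln 2) (ln y%:R) (ln x%:R) => a b c; lra.
Qed.

Lemma pwr_polar n s : pwr n%:R (- s) = (rpw n (- complex.Re s))%:C * eix (- complex.Im s * ln n%:R).
Proof.
rewrite /pwr /rpw eixE /cexp; case: s => a b /=.
by rewrite !mulr0 subr0 add0r.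
Qed.

Lemma rpw_diff_le n y : (0 < n)%N -> 0 <= y -> rpw n (- y) - rpw n.+1 (- y) <= y * rpw n (- 1 - y).
Proof.
move=> n0 y0; rewrite [- 1 - y]addrC rpwD [rpw _ (- 1)]rpwN rpw_one //.
have e : rpw n.+1 (- y) = rpw n (- y) * expR (- (y * (ln n.+1%:R - ln n%:R))).
  by rewrite /rpw -expRD; congr expR; ring.
have h := expR_ge1Dx (- (y * (ln n.+1%:R - ln (n%:R : R)))).
have l1 : ln n.+1%:R - ln n%:R <= n%:R^-1 :> R.
  have := @ln_ratio_le n%:R n.+1%:R; rewrite ltr0n ler_nat leqnSn => /(_ n0 isT).
  by have -> : n.+1%:R - n%:R = 1 :> R by [rewrite -natr1 addrC addKr]; rewrite div1r.
have h2 := ler_wpM2l y0 l1.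
rewrite e -[X in X - _]mulr1 -mulrBr mulrCA ler_wpM2l ?rpw_ge0 //.
move: h h2; set q := _^-1; set l := ln _ - ln _; clear; lra.
Qed.

(** The two bounds on the partial sums combine to [x ^ th * Y ^ (1 - th)] with [th] the smaller of 1
    and [y]. In the summation by parts [th <= y] cancels the powers of [n] down to [1 / n], hence
    only a logarithm is lost. *)
Lemma dirichlet_abel (a : nat -> C) (y Y : R) N : 0 <= y -> 1 <= Y ->
  (forall x : nat, (x <= N)%N -> nc (\sum_(0 <= n < x) a n) <= x%:R) ->
  (forall x : nat, (0 < x <= N)%N -> nc (\sum_(0 <= n < x) a n) <= Y) ->
  nc (\sum_(0 <= n < N) (rpw n.+1 (- y))%:C * a n) <=
  expR (Num.max 0 (1 - y) * ln Y) * (y * (1 + ln N%:R) + 1).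
Proof.
move=> y0 Y1 h1 h2; pose P (x : nat) := \sum_(0 <= n < x) a n.
pose th := 1 - Num.max 0 (1 - y).
have [th0 th1 thy] : [/\ 0 <= th, th <= 1 & th <= y].
  rewrite /th; have [h|h] := leP 0 (1 - y); first by split; move: h y0; clear; lra.
  by split; move: h; clear; lra.
have lY : 0 <= ln Y by rewrite ln_ge0.
have Pb (x : nat) : (0 < x <= N)%N -> nc (P x) <= rpw x th * expR (Num.max 0 (1 - y) * ln Y).
  move=> /andP[x0 xN].
  have b1 := h1 x xN; have b2 := h2 x ltac:(by rewrite x0).
  have -> : Num.max 0 (1 - y) = 1 - th by rewrite /th; ring.
  rewrite /rpw -expRD; have x0' : 0 < x%:R :> R by rewrite ltr0n.
  have lx : 0 <= ln x%:R :> R by exact: ln_nat_ge0.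
  have [xY|Yx] := leP x%:R Y.
    apply: le_trans b1 _; rewrite -{1}[x%:R]lnK ?posrE // ler_expR.
    have : ln x%:R <= ln Y by rewrite ler_ln ?posrE // (lt_le_trans ltr01).
    by move: th0 th1 lx lY; set u := ln _; set v := ln Y; clear; nra.
  have Y0 : 0 < Y by exact: lt_le_trans Y1.
  apply: le_trans b2 _; rewrite -{1}[Y]lnK ?posrE // ler_expR.
  have : ln Y <= ln x%:R by rewrite ler_ln ?posrE // ltW.
  by move: th0 th1 lx lY; set u := ln _; set v := ln _; clear; nra.
set G := expR _ in Pb *; have G0 : 0 <= G by exact: expR_ge0.
have abel (x : nat) : \sum_(0 <= n < x) (rpw n.+1 (- y))%:C * a n =
   \sum_(0 <= n < x) (rpw n.+1 (- y) - rpw n.+2 (- y))%:C * P n.+1 + (rpw x.+1 (- y))%:C * P x.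
  elim: x => [|x IH]; first by rewrite !big_geq // /P big_geq // mulr0 addr0.
  rewrite !sumrS IH; have -> : P x.+1 = P x + a x by rewrite /P sumrS.
  rewrite rmorphB; set S := \sum_(_ <= _ < _) _; rewrite /=; ring.
rewrite abel; apply: le_trans (ncD _ _) _; rewrite mulrDr mulr1; apply: lerD.
  apply: le_trans (nc_sum _ _ _) _.
  apply: (@le_trans _ _ (\sum_(0 <= n < N) (G * y) * n.+1%:R^-1)); last first.
    by rewrite -mulr_sumr [G * (y * _)]mulrA ler_wpM2l ?mulr_ge0 // harmonic_le.
  rewrite big_nat_cond [leRHS]big_nat_cond; apply: ler_sum => n; rewrite andbT => /andP[_ nN].
  rewrite ncM nc_real ger0_norm ?subr_ge0 ?rpw_anti ?oppr_le0 //.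
  apply: le_trans (ler_pM _ (nc_ge0 _) (rpw_diff_le (ltn0Sn n) y0) (Pb n.+1 _)) _ => //.
    by rewrite subr_ge0 rpw_anti // oppr_le0.
  have -> : y * rpw n.+1 (- 1 - y) * (rpw n.+1 th * G) = (G * y) * (rpw n.+1 (- 1) * rpw n.+1 (th - y)).
    have <- : rpw n.+1 (- 1 - y) * rpw n.+1 th = rpw n.+1 (- 1) * rpw n.+1 (th - y) :> R.
      by rewrite -!rpwD; congr rpw; ring.
    ring.
  rewrite ler_wpM2l ?mulr_ge0 // rpwN rpw_one // ler_piMr ?invr_ge0 // rpw_le1 // subr_le0 //.
rewrite ncM nc_real ger0_norm ?rpw_ge0 //.
case: N h1 h2 Pb abel => [|N] h1 h2 Pb abel; first by rewrite /P big_geq // nc0 mulr0.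
apply: le_trans (ler_wpM2l (rpw_ge0 _ _) (Pb N.+1 _)) _; first by rewrite leqnn.
rewrite mulrA ler_piMl //.
apply: (@le_trans _ _ (rpw N.+2 (- y) * rpw N.+2 th)); first by rewrite ler_wpM2l ?rpw_ge0 // rpw_homo.
by rewrite -rpwD rpw_le1 // addrC subr_le0.
Qed.

(** Zeta is cut at a length near [|t| ^ (1 + e)]: beyond it [ztail_le] gives a bounded tail, and
    below it [dirichlet_abel] is applied with exponential sums of size the square root of [|t|] up
    to logarithms. This yields the exponent [(1 - Re s) / 2] without the functional equation. *)
Lemma zeta_convexity (d B : R) : 0 < d -> 0 <= B -> exists2 K, 0 <= K & forall s,
  d <= complex.Re s <= B -> 3 <= `|complex.Im s| ->
  nc (zeta s) <= K * (1 + ln `|complex.Im s|) ^+ 3 *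
    expR (Num.max 0 ((1 - complex.Re s) / 2) * ln `|complex.Im s|).
Proof.
move=> d0 B0; pose e := Num.min (Num.min d 1) (2^-1).
have e0 : 0 < e by rewrite !lt_min d0 ltr01 invr_gt0 ltr0n.
have [ed e1 eh] : [/\ e <= d, e <= 1 & e <= 2^-1] by rewrite !ge_min !lexx !orbT.
clearbody e.
(* With [k.+1 >= 1 / e] the extra factor of [ztail_le] at length [t ^ (1 + e)] is bounded. *)
pose k := Num.truncn e^-1.
have ek : 1 <= e * k.+1%:R.
  have ie : 0 <= e^-1 by rewrite invr_ge0 ltW.
  have /andP[_ /ltW h] := truncn_itv ie; have := ler_wpM2l (ltW e0) h.
  by rewrite mulfV ?gt_eqF.
have [K1 K10 HK1] := ztail_le k B d0.
exists (4 * K1 + 264 * (3 * B + 1)) => [|s sB t3]; first by rewrite addr_ge0 ?mulr_ge0 ?addr_ge0 ?mulr_ge0.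
have [ds sB'] := andP sB; set sg := complex.Re s in ds sB' *; set t := `|complex.Im s| in t3 *.
have t0 : 0 < t by exact: lt_le_trans t3.
have t1 : 1 <= t by move: t3; clear; lra.
set l := ln t; have l0 : 0 <= l by rewrite ln_ge0.
have tE : t = expR l by rewrite /l lnK.
pose X := expR ((1 + e) * l).
have X0 : 0 < X by exact: expR_gt0.
pose N := Num.truncn X; have /andP[N1 N2] := truncn_itv (ltW X0); rewrite -/N in N1 N2.
have tX : t <= X by rewrite tE ler_expR ler_peMl // lerDl ltW.
have tN : t <= N.+1%:R by apply: le_trans tX (ltW N2).
have X1 : 1 <= X by exact: le_trans tX.
have NX : N.+1%:R <= 2 * X by rewrite -natr1; move: N1 X1; clear; lra.
have N0' : 0 < N.+1%:R :> R by [].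
have ln2 : ln 2 <= 1 :> R.
  by apply: le_trans (@le_ln1Dx R 1 _) _; [rewrite (lt_trans _ ltr01) // ltrN10|].
have lN : ln N.+1%:R <= ln 2 + (1 + e) * l.
  apply: (@le_trans _ _ (ln (2 * X))); first by rewrite ler_ln ?posrE ?mulr_gt0.
  by rewrite lnM ?posrE // /X expRK.
have lN' : ln N.+1%:R <= 1 + 2 * l.
  by move: lN ln2 (ler_wpM2r l0 e1); clear; lra.
have lN0 := @ln_nat_ge0 R N.+1.
have tail : nc (ztail N s) <= 4 * K1.
  apply: le_trans (HK1 k N s (leqnn k) sB t3 tN) _; rewrite -/sg -/t.
  have q1 : rpw N.+1 (1 - sg) <= 2 * t.
    rewrite /rpw; have -> : 2 * t = expR (ln 2 + l) by rewrite expRD -tE lnK // posrE.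
    rewrite ler_expR; have [h|h] := leP (1 - sg) 0.
      apply: (@le_trans _ _ 0); first exact: mulr_le0_ge0.
      by rewrite addr_ge0 // ln_ge0 // ler1n.
    have b1 : (1 - sg) * ln N.+1%:R <= (1 - sg) * (ln 2 + (1 + e) * l) by rewrite ler_pM2l.
    have l2 : 0 <= ln 2 :> R by rewrite ln_ge0 // ler1n.
    have b2 : (1 - sg) * (1 + e) <= 1.
      have : 0 <= 1 - sg by exact: ltW.
      move: e0 ed ds; clear; nra.
    have b3 : (1 - sg) * (1 + e) * l <= 1 * l by rewrite ler_wpM2r.
    have b4 : (1 - sg) * ln 2 <= 1 * ln 2 by rewrite ler_wpM2r // gerBl (le_trans (ltW d0)).
    by move: b1 b3 b4; clear; lra.
  have q2 : t ^+ k.+2 / N.+1%:R ^+ k.+1 <= 1.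
    rewrite ler_pdivrMr ?exprn_gt0 // mul1r.
    apply: (@le_trans _ _ (X ^+ k.+1)); last by rewrite lerXn2r ?nnegrE ?(ltW X0) // ltW.
    rewrite tE /X -!expRM_natl ler_expR mulrA ler_wpM2r // -natr1.
    by move: ek; clear; lra.
  have -> : 4 * K1 = K1 * 2 * 2 by ring.
  apply: ler_pM.
  - by rewrite mulr_ge0 // divr_ge0 ?rpw_ge0 // ltW.
  - by rewrite addr_ge0 // divr_ge0 ?exprn_ge0 // ltW.
  - by rewrite ler_wpM2l // ler_pdivrMr.
  - by move: q2; clear; lra.
have L1 : 1 <= 1 + l by rewrite lerDl.
have L3 : 1 <= (1 + l) ^+ 3 by rewrite exprn_ege1.
set G := expR (_ * l); have G1 : 1 <= G.
  by rewrite -expR0 ler_expR mulr_ge0 // le_max lexx.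
have r1 : 1 <= Num.sqrt t by rewrite -sqrtr1 ler_wsqrtr.
(* [264 = 66 * 4]: 66 comes from the two terms of [partial_sum_le], as 34 and 32, and 4 from its
   number of blocks. *)
pose Y := 264 * (Num.sqrt t * (1 + l) ^+ 2).
have L2 : 1 <= (1 + l) ^+ 2 by rewrite exprn_ege1.
have SL : 1 <= Num.sqrt t * (1 + l) ^+ 2 by exact: mulr_ege1.
have Y1 : 1 <= Y by rewrite /Y; move: SL; clear; lra.
have psum (x : nat) : (0 < x <= N.+1)%N -> nc (\sum_(0 <= n < x) eix (t * ln n.+1%:R)) <= Y.
  move=> /andP[x0 xN]; apply: le_trans (partial_sum_le t1 x0 xN) _.
  have a1 : 17 * (Num.sqrt t * (1 + ln N.+1%:R)) + 16 * N.+1%:R / t <= 66 * (Num.sqrt t * (1 + l)).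
    have h1 : 17 * (Num.sqrt t * (1 + ln N.+1%:R)) <= 34 * (Num.sqrt t * (1 + l)).
      have -> : 34 * (Num.sqrt t * (1 + l)) = 17 * (Num.sqrt t * (2 + 2 * l)) by ring.
      by rewrite ler_pM2l // ler_wpM2l ?sqrtr_ge0 //; move: lN'; clear; lra.
    have h2 : N.+1%:R / t <= 2 * Num.sqrt t.
      rewrite ler_pdivrMr // (le_trans NX) // -mulrA ler_pM2l //.
      have -> : Num.sqrt t = expR (l / 2).
        by rewrite -[expR _]ger0_norm ?expR_ge0 // -sqrtr_sqr -expRM_natl mulrC divfK // -tE.
      rewrite tE -expRD /X ler_expR; have := ler_wpM2r l0 eh; clear; lra.
    have h3 : Num.sqrt t <= Num.sqrt t * (1 + l) by rewrite ler_peMr // (le_trans ler01).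
    rewrite -mulrA; move: h1 h2 h3; clear; lra.
  have lx : ln x%:R <= ln N.+1%:R :> R by rewrite ler_ln ?posrE ?ltr0n // ler_nat.
  have lx0 := @ln_nat_ge0 R x.
  have a2 : 1 + 2 * ln x%:R <= 4 * (1 + l) by move: lx lN'; clear; lra.
  have -> : Y = 66 * (Num.sqrt t * (1 + l)) * (4 * (1 + l)) by rewrite /Y; ring.
  apply: ler_pM => //; last by rewrite addr_ge0 // mulr_ge0.
  apply: addr_ge0; first by rewrite !mulr_ge0 ?sqrtr_ge0 // addr_ge0.
  by rewrite !mulr_ge0 ?invr_ge0 // ltW.
have psum' (x : nat) : nc (\sum_(0 <= n < x) eix (- complex.Im s * ln n.+1%:R)) =
    nc (\sum_(0 <= n < x) eix (t * ln n.+1%:R)).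
  rewrite /t; case: (ger0P (complex.Im s)) => h //.
  rewrite -[LHS]nc_conj rmorph_sum; congr nc; apply: eq_bigr => n _.
  have conjE (u : R) : conjc (eix u) = eix (- u) :> C by rewrite !eixE cosN sinN.
  by apply: (etrans (conjE _)); rewrite mulNr opprK.
have D := @dirichlet_abel (fun n => eix (- complex.Im s * ln n.+1%:R)) sg Y N
   (le_trans (ltW d0) ds) Y1.
have {}D := D _ _.
have dir : nc (\sum_(0 <= i < N) pwr i.+1%:R (- s)) <= 264 * (3 * B + 1) * (1 + l) ^+ 3 * G.
  have -> : \sum_(0 <= i < N) pwr i.+1%:R (- s) =
     \sum_(0 <= n < N) (rpw n.+1 (- sg))%:C * eix (- complex.Im s * ln n.+1%:R).
    by apply: eq_bigr => i _; rewrite pwr_polar.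
  apply: le_trans (D _ _) _ => [x xN|x /andP[x0 xN]|].
  - apply: le_trans (nc_sum _ _ _) _; under eq_bigr do rewrite nc_eix.
    by rewrite sumr_const_nat subn0.
  - by rewrite psum' psum // x0 leqW.
  have -> : 264 * (3 * B + 1) * (1 + l) ^+ 3 * G = (264 * (1 + l) ^+ 2 * G) * ((3 * B + 1) * (1 + l)) by ring.
  have c0 : 0 <= 1 + l by exact: le_trans L1.
  apply: ler_pM; rewrite ?expR_ge0 //.
  - apply: addr_ge0 => //; apply: mulr_ge0; first exact: le_trans (ltW d0) ds.
    by apply: addr_ge0 => //; exact: ln_nat_ge0.
  - have YL : ln Y = ln (264 * (1 + l) ^+ 2) + l / 2.
      have -> : Y = (264 * (1 + l) ^+ 2) * Num.sqrt t by rewrite /Y; ring.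
      have c264 : 0 < 264 * (1 + l) ^+ 2 by move: L2; clear; lra.
      rewrite lnM ?posrE //; last exact: lt_le_trans r1.
      congr (_ + _).
      have -> : Num.sqrt t = expR (l / 2).
        by rewrite -[expR _]ger0_norm ?expR_ge0 // -sqrtr_sqr -expRM_natl mulrC divfK // -tE.
      by rewrite expRK.
    set m := Num.max 0 (1 - sg).
    have m0 : 0 <= m by rewrite le_max lexx.
    have m1 : m <= 1 by rewrite /m ge_max ler01 gerBl (le_trans (ltW d0)).
    have Gm : G = expR (m * (l / 2)).
      rewrite /G /m; congr expR; have [h|h] := leP 0 (1 - sg).
        have -> : Num.max 0 ((1 - sg) / 2) = (1 - sg) / 2 by apply/max_idPr; rewrite divr_ge0.
        ring.
      have -> : Num.max 0 ((1 - sg) / 2) = 0 by apply/max_idPl; rewrite pmulr_lle0 ?invr_gt0 // ltW.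
      by rewrite !mul0r.
    have c1 : 1 <= 264 * (1 + l) ^+ 2 by move: L2; clear; lra.
    rewrite YL mulrDr expRD Gm; apply: ler_wpM2r; first exact: expR_ge0.
    rewrite -[leRHS]lnK ?posrE ?(lt_le_trans ltr01) // ler_expR ler_piMl // ln_ge0 //.
  - apply: (@le_trans _ _ (B * (1 + (1 + 2 * l)) + 1)).
      rewrite lerD2r; apply: ler_pM => //; first exact: le_trans (ltW d0) ds.
        by apply: addr_ge0 => //; exact: ln_nat_ge0.
      rewrite lerD2l (le_trans _ lN') //; case: (N) => [|n]; first by rewrite ln0 // ln1.
      by rewrite ler_ln ?posrE ?ltr0n // ler_nat.
    have : 0 <= B * l by rewrite mulr_ge0.
    by move: B0 l0; clear; lra.
have -> : zeta s = \sum_(0 <= i < N) pwr i.+1%:R (- s) + ztail N s by rewrite /ztail addrC subrK.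
apply: le_trans (ncD _ _) _; rewrite addrC 2!mulrDl; apply: lerD => //.
apply: le_trans tail _; rewrite -[leLHS]mulr1 -[leRHS]mulrA; apply: ler_wpM2l; first by rewrite mulr_ge0.
exact: mulr_ege1.
Qed.

End PartialSums.

(** * Shift of the line of integration *)

Section ContourShift.
Context {R : realType}.
Local Notation C := R[i].
Local Notation nc := (@Normc.normc R).
Local Notation mu := (@lebesgue_measure R).
Implicit Types (x y t T : R) (s w z : C).

Lemma cint_le_prim (f : R -> C) (g G : R -> R) x y : x <= y -> ccont f x y ->
  ccont (fun t => (g t)%:C) x y ->
  (forall t, x <= t <= y -> nc (f t) <= g t) ->
  (forall t, x <= t <= y -> crder (fun t => (G t)%:C) (fun t => (g t)%:C) t) ->
  nc (cint x y f) <= G y - G x.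
Proof.
move=> xy cf cg fg dG.
have e : cint x y (fun t => (g t)%:C) = (G y - G x)%:C by rewrite (cint_FTC xy cg dG) rmorphB.
have [I0|I0] := eqVneq (cint x y f) 0.
  rewrite I0 nc0 -[leRHS]/(complex.Re (G y - G x)%:C) -e.
  have h := cint_Re_ge (m := 0) xy cg; rewrite mul0r in h; apply: h => t tt /=.
  exact: le_trans (nc_ge0 _) (fg t tt).
set I := cint x y f in I0 *.
pose u := (nc I)%:C / I.
have uI : u * I = (nc I)%:C by rewrite /u divfK.
have nu : nc u = 1.
  by rewrite /u ncM nc_real ncV ger0_norm ?nc_ge0 // mulfV // nc_eq0.
have : u * I = cint x y (fun t => u * f t) by rewrite cintZ.
rewrite uI => /(congr1 (@complex.Re R)).
rewrite -[X in X = _ -> _]/(nc I) => ->; rewrite -[leRHS]/(complex.Re (G y - G x)%:C) -e.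
apply: le_Rintegral => //.
- exact: rcont_integrable (ccont_Re (ccontZ u cf)).
- exact: rcont_integrable (ccont_Re cg).
- move=> t; rewrite /= in_itv /= => tab.
  apply: le_trans (ler_norm _) _; apply: le_trans (nc_Re _) _.
  by rewrite ncM nu mul1r fg.
Qed.

Lemma crder_ln t : 0 < t -> crder (fun t => (ln t)%:C) (fun t => (t^-1)%:C) t.
Proof.
move=> t0; have := @is_derive_crder R (@ln R) t t^-1 1 (is_derive1_ln t0).
move=> H e e0; have [d d0 Hd] := H e e0; exists d => // t' /Hd.
by rewrite !mul1r.
Qed.

Lemma ccont_inv x y : 0 < x -> ccont (fun t => (t^-1)%:C : C) x y.
Proof.
move=> x0 t /andP[xt _] e e0; have t0 : 0 < t by exact: lt_le_trans xt.
exists (Num.min (t / 2) (e * t ^+ 2 / 4)) => [|t' _].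
  by rewrite lt_min !divr_gt0 // mulr_gt0 // exprn_gt0.
rewrite lt_min => /andP[h1 h2]; rewrite -rmorphB nc_real.
have t'0 : t / 2 < t' by move: h1; rewrite ltr_norml; lra.
have t'1 : 0 < t' by apply: lt_trans t'0; rewrite divr_gt0.
have -> : t'^-1 - t^-1 = - ((t' - t) / (t' * t)) by field; rewrite !gt_eqF.
rewrite normrN normrM normfV [`|t' * t|]gtr0_norm ?mulr_gt0 // ltr_pdivrMr ?mulr_gt0 //.
apply: lt_le_trans h2 _; rewrite -mulrA ler_pM2l // expr2.
have : t / 2 * t <= t' * t by rewrite ler_wpM2r // ltW.
have : 0 <= t * t by rewrite mulr_ge0 // ltW.
lra.
Qed.

Lemma ccont_zeta_line (sg al x y : R) :
  (forall t, x <= t <= y -> sg +i* (al * t) != 1 :> C) ->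
  ccont (fun t => zeta (sg +i* (al * t))) x y.
Proof.
move=> H t tt e e0.
have [d d0 Hd] := cdiff_pcont (cdiff_zeta (H t tt)) e0.
have a1 : 0 < `|al| + 1 by rewrite ltr_wpDl.
exists (d / (`|al| + 1)) => [|t' _ td]; first by rewrite divr_gt0.
apply: Hd; rewrite nc_vdist -mulrBr normrM.
move: td; rewrite ltr_pdivlMr // => td; apply: le_lt_trans td.
by rewrite mulrC ler_wpM2l // lerDl.
Qed.

Lemma re_neq1 sg y : sg != 1 -> sg +i* y != 1 :> C.
Proof. by move=> y0; rewrite eq_complex /= (negbTE y0). Qed.

Section Params.
Variables (a b c s1 : R).
Hypotheses (a0 : 0 < a) (ac : a < c) (cb : c <= b).
Hypotheses (s10 : 0 < s1) (as1 : a * s1 < 2^-1) (cs1 : 2^-1 < c * s1).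

Let c0 : 0 < c := lt_trans a0 ac.
Let b0 : 0 < b := lt_le_trans c0 cb.

Definition zprod w : C :=
  zeta ((2^-1)%:C + a%:C * w) * zeta ((2^-1)%:C - b%:C * w) * zeta ((2^-1)%:C - c%:C * w).

Lemma zprodE x y : zprod (x +i* y) =
  zeta ((2^-1 + a * x) +i* (a * y)) * zeta ((2^-1 - b * x) +i* (- (b * y))) *
  zeta ((2^-1 - c * x) +i* (- (c * y))).
Proof.
rewrite /zprod; congr (zeta _ * zeta _ * zeta _); apply/eqP; rewrite eq_complex /=;
  apply/andP; split; apply/eqP; ring.
Qed.

Lemma zprod0 t : zprod (0 +i* t) = zeta_prod a b c t.
Proof. by rewrite zprodE !mulr0 addr0 subr0. Qed.

Lemma cdiff_zprod w : 0 < complex.Im w -> cdiff zprod w.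
Proof.
move=> w0.
have arg (k : R) : k != 0 -> (2^-1)%:C + k%:C * w != 1.
  move=> k0; apply: contraTneq w0 => /(congr1 (@complex.Im R)).
  case: (w) => x y /= => /eqP; rewrite add0r mul0r addr0 mulf_eq0 (negbTE k0) /= => /eqP ->.
  by rewrite ltxx.
have d (k : R) : k != 0 -> cdiff (fun w => zeta ((2^-1)%:C + k%:C * w)) w.
  move=> k0; apply: (@cdiff_comp R zeta (fun w => (2^-1)%:C + k%:C * w)); last exact/cdiff_zeta/arg.
  apply: cdiffD; first exact: cdiff_cst.
  by apply: cdiffM; [exact: cdiff_cst|exact: cdiff_id].
have N (k : R) : (fun w => zeta ((2^-1)%:C - k%:C * w)) = (fun w => zeta ((2^-1)%:C + (- k)%:C * w)).
  by apply/funext => v; rewrite rmorphN mulNr.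
have da := d a ltac:(by rewrite gt_eqF).
have db := d (- b) ltac:(by rewrite oppr_eq0 gt_eqF); rewrite -N in db.
have dc := d (- c) ltac:(by rewrite oppr_eq0 gt_eqF); rewrite -N in dc.
by rewrite /zprod; apply: (cdiffM _ dc); apply: (cdiffM da db).
Qed.

Lemma ccont_zeta_prod x y : ccont (zeta_prod a b c) x y.
Proof.
have h : 2^-1 != 1 :> R by rewrite lt_eqF // invf_lt1 ?ltr1n.
have -> : zeta_prod a b c = (fun t => zeta (2^-1 +i* (a * t)) * zeta (2^-1 +i* ((- b) * t)) *
   zeta (2^-1 +i* ((- c) * t))) by apply/funext => t; rewrite /zeta_prod !mulNr.
by do 2 (apply: ccontM; last by apply: ccont_zeta_line => t _; exact: re_neq1);
   apply: ccont_zeta_line => t _; exact: re_neq1.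
Qed.

Lemma zeta_momentE T : zeta_moment a b c T = cint 0 T (zeta_prod a b c).
Proof. by []. Qed.

(** The poles of the three factors have real [w]; starting at height [t0 > 0] keeps the rectangle
    clear of them. The horizontal sides are all that separates the two vertical integrals. *)
Lemma contour_shift t0 T M0 M1 : 0 < t0 -> t0 <= T ->
  (forall x, - s1 <= x <= 0 -> nc (zprod (x +i* t0)) <= M0) ->
  (forall x, - s1 <= x <= 0 -> nc (zprod (x +i* T)) <= M1) ->
  nc (cint t0 T (zeta_prod a b c) - cint t0 T (fun t => zprod ((- s1) +i* t))) <= (M0 + M1) * s1.
Proof.
move=> t00 tT H0 H1.
have s1' : - s1 <= 0 by rewrite oppr_le0 ltW.
have G := @goursat R zprod (- s1) 0 t0 T s1' tT.
have pc w : t0 <= complex.Im w -> pcont zprod w.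
  by move=> tw; apply/cdiff_pcont/cdiff_zprod; exact: lt_le_trans tw.
have {}G := G _; have {G} : rint zprod (- s1) 0 t0 T = 0.
  by apply: G => w /andP[_ /andP[tw _]]; apply: cdiff_zprod; exact: lt_le_trans tw.
rewrite /rint => E.
have e0 : vint zprod 0 t0 T = cint t0 T (zeta_prod a b c).
  by apply: eq_cint => t _; exact: zprod0.
rewrite -e0 -/(vint zprod (- s1) t0 T).
set D := vint _ _ _ _ - vint _ _ _ _ in E *.
have -> : nc D = nc (hint zprod T (- s1) 0 - hint zprod t0 (- s1) 0).
  have I1 : nc (0 +i* 1 : C) = 1 by rewrite /= expr0n expr1n add0r sqrtr1.
  rewrite -[LHS]mul1r -I1 -ncM; congr nc.
  by move/eqP: E; rewrite addrC addr_eq0 opprB => /eqP.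
have hb y M : t0 <= y -> (forall x, - s1 <= x <= 0 -> nc (zprod (x +i* y)) <= M) ->
    nc (hint zprod y (- s1) 0) <= M * s1.
  move=> ty H; have h := @cint_le R (- s1) 0 (fun x => zprod (x +i* y)) M s1'.
  rewrite sub0r opprK in h; apply: h => //; apply: ccont_hline => x _; exact: pc.
apply: le_trans (ncB _ _) _; rewrite mulrDl addrC.
by apply: lerD; apply: hb.
Qed.

(** The exponent of the first factor is [(1/2 - a x) / 2]. Those of the other two are at most
    [(1/2 + a x) / 2] because [b x] and [c x] do not exceed [a x] for [x <= 0]. Their sum is
    [3/4 + a x / 2], so the sides are smaller than [T] by a power. *)
Lemma zprod_horizontal : exists2 K, 0 <= K & forall T x, 3 / a <= T -> - s1 <= x <= 0 ->
  nc (zprod (x +i* T)) <= K * (1 + ln (b * T)) ^+ 9 * expR (3 / 4 * ln (b * T)).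
Proof.
pose d := 2^-1 - a * s1; have d0 : 0 < d by rewrite subr_gt0.
pose B := 2^-1 + b * s1; have B0 : 0 <= B by rewrite addr_ge0 ?invr_ge0 // mulr_ge0 // ltW.
have [K K0 HK] := zeta_convexity d0 B0.
exists (K ^+ 3) => [|T x aT /andP[x1 x0]]; first by rewrite exprn_ge0.
have aT3 : 3 <= a * T by move: aT; rewrite ler_pdivrMr // mulrC.
have T0 : 0 < T by apply: lt_le_trans aT; rewrite divr_gt0.
have acT : a * T <= c * T by rewrite ler_pM2r // ltW.
have cbT : c * T <= b * T by rewrite ler_pM2r.
have cT3 := le_trans aT3 acT; have bT3 := le_trans cT3 cbT.
set L := ln (b * T).
have pos3 y : 3 <= y -> 0 < y by apply: lt_le_trans.
have lL y : 3 <= y -> y <= b * T -> 0 <= ln y <= L.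
  move=> y3 yb; rewrite ln_ge0 ?(le_trans _ y3) ?ler1n //= ler_ln ?posrE ?pos3 //.
have L0 : 0 <= L by have /andP[] := lL (b * T) bT3 (lexx _).
have one k y sg : 3 <= y -> y <= b * T -> d <= sg <= B -> k = y \/ k = - y ->
   nc (zeta (sg +i* k)) <= K * (1 + L) ^+ 3 * expR (Num.max 0 ((1 - sg) / 2) * L).
  move=> y3 yb sgB ky.
  have ky' : `|k| = y by case: ky => ->; rewrite ?normrN gtr0_norm // pos3.
  apply: le_trans (HK (sg +i* k) sgB _) _; first by rewrite /= ky'.
  rewrite /= ky'; have /andP[l0 l1] := lL y y3 yb.
  apply: ler_pM; rewrite ?expR_ge0 //.
  - by rewrite mulr_ge0 // exprn_ge0 // addr_ge0.
  - by rewrite ler_wpM2l // lerXn2r ?nnegrE ?addr_ge0 // lerD2l.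
  - by rewrite ler_expR ler_wpM2l // le_max lexx.
have ax : a * x <= 0 by rewrite pmulr_rle0.
have bx : b * x <= 0 by rewrite pmulr_rle0.
have cx : c * x <= 0 by rewrite pmulr_rle0.
have ax1 : - (a * s1) <= a * x by rewrite -mulrN ler_pM2l.
have bx1 : - (b * s1) <= b * x by rewrite -mulrN ler_pM2l.
have cx1 : - (c * s1) <= c * x by rewrite -mulrN ler_pM2l.
have cbs : c * s1 <= b * s1 by rewrite ler_pM2r.
have as0 : 0 < a * s1 by rewrite mulr_gt0.
have cax : c * x <= a * x by rewrite ler_wnM2r // ltW.
have bax : b * x <= a * x by rewrite ler_wnM2r // (le_trans (ltW ac)).
have h12 : 0 < 2^-1 :> R by rewrite invr_gt0.
have n1 := one (a * T) (a * T) (2^-1 + a * x) aT3 (le_trans acT cbT) _ (or_introl erefl).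
have n2 := one (- (b * T)) (b * T) (2^-1 - b * x) bT3 (lexx _) _ (or_intror erefl).
have n3 := one (- (c * T)) (c * T) (2^-1 - c * x) cT3 cbT _ (or_intror erefl).
rewrite zprodE !ncM.
have {}n1 := n1 ltac:(rewrite /d /B; lra).
have {}n2 := n2 ltac:(rewrite /d /B; lra).
have {}n3 := n3 ltac:(rewrite /d /B; lra).
apply: le_trans (ler_pM _ (nc_ge0 _) (ler_pM (nc_ge0 _) (nc_ge0 _) n1 n2) n3) _.
  by rewrite mulr_ge0 ?nc_ge0.
set m1 := Num.max _ _; set m2 := Num.max _ _; set m3 := Num.max _ _.
have -> : K * (1 + L) ^+ 3 * expR (m1 * L) * (K * (1 + L) ^+ 3 * expR (m2 * L)) *
   (K * (1 + L) ^+ 3 * expR (m3 * L)) = K ^+ 3 * (1 + L) ^+ 9 * expR ((m1 + m2 + m3) * L).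
  rewrite 2!mulrDl !expRD; have -> : 9%N = (3 + 3 + 3)%N by []; rewrite !exprD; ring.
rewrite ler_wpM2l ?mulr_ge0 ?exprn_ge0 ?addr_ge0 // ler_expR ler_wpM2r //.
have e1 : m1 = (1 - (2^-1 + a * x)) / 2.
  by apply/max_idPr; rewrite divr_ge0 // subr_ge0; move: ax h12; lra.
have e2 : m2 <= (1 - (2^-1 - a * x)) / 2.
  rewrite ge_max; apply/andP; split; first by rewrite divr_ge0 // subr_ge0; move: ax1 as1; lra.
  by rewrite ler_wpM2r ?invr_ge0 //; move: bax; lra.
have e3 : m3 <= (1 - (2^-1 - a * x)) / 2.
  rewrite ge_max; apply/andP; split; first by rewrite divr_ge0 // subr_ge0; move: ax1 as1; lra.
  by rewrite ler_wpM2r ?invr_ge0 //; move: cax; lra.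
rewrite e1; move: e2 e3 ax; lra.
Qed.

End Params.

End ContourShift.

(** * The shifted line: oscillating integrals and Dirichlet polynomials *)

Section VerticalLine.
Context {R : realType}.
Local Notation C := R[i].
Local Notation nc := (@Normc.normc R).
Implicit Types (x y t T : R) (s z : C).

Lemma cint_le_inv (f : R -> C) x y k : 0 < x -> x <= y -> 0 <= k -> ccont f x y ->
  (forall t, x <= t <= y -> nc (f t) <= k / t) -> nc (cint x y f) <= k * (ln y - ln x).
Proof.
move=> x0 xy k0 cf H.
have [e|k1] := eqVneq k 0.
  have : nc (cint x y f) <= 0 * (y - x) by apply: cint_le => // t /H; rewrite e mul0r.
  by rewrite e !mul0r.
have {k0}k0 : 0 < k by rewrite lt_neqAle eq_sym k1.
have h : nc (cint x y (fun t => (k^-1)%:C * f t)) <= ln y - ln x.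
  apply: (@cint_le_prim R _ (fun t => t^-1)) => //.
  - exact: ccontZ.
  - exact: ccont_inv.
  - move=> t tt; rewrite ncM nc_real ger0_norm ?invr_ge0 ?(ltW k0) // ler_pdivrMl //.
    exact: H.
  - by move=> t /andP[xt _]; apply: crder_ln; exact: lt_le_trans xt.
move: h; rewrite cintZ // ncM nc_real ger0_norm ?invr_ge0 ?(ltW k0) // ler_pdivrMl //.
Qed.

Lemma crder_eix k x : crder (fun t => eix (k * t) : C) (fun t => (0 +i* k) * eix (k * t)) x.
Proof.
move=> e e0; have k1 : 0 < 1 + `|k| by rewrite ltr_wpDr.
pose K := 6 * k ^+ 2; have K0 : 0 <= K by rewrite mulr_ge0 // sqr_ge0.
have K1 : 0 < 1 + K by rewrite ltr_wpDr.
exists (Num.min ((1 + `|k|)^-1 / 2) (e / (1 + K))) => [|t]; first by rewrite lt_min !divr_gt0 ?invr_gt0.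
rewrite lt_min => /andP[]; rewrite ltr_pdivlMr // -[X in _ < X]div1r ltr_pdivlMr // => h1.
rewrite ltr_pdivlMr // => h2.
have -> : eix (k * t) = eix (k * x) * eix (k * (t - x)) by rewrite -eixD; congr eix; ring.
pose z : C := 0 +i* (k * (t - x)).
have -> : eix (k * x) * eix (k * (t - x)) - eix (k * x) - (0 +i* k) * eix (k * x) * (t - x)%:C =
   eix (k * x) * (cexp z - 1 - z).
  have -> : z = (0 +i* k) * (t - x)%:C by apply/eqP; rewrite eq_complex /=; apply/andP; split; apply/eqP; ring.
  have -> : eix (k * (t - x)) = cexp ((0 +i* k) * (t - x)%:C).
    by congr cexp; apply/eqP; rewrite eq_complex /=; apply/andP; split; apply/eqP; ring.
  ring.
have nz : nc z = `|k| * `|t - x| by rewrite /= expr0n add0r sqrtr_sqr normrM.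
have z2 : nc z <= 2^-1.
  rewrite nz -[leRHS]mul1r ler_pdivlMr //; move: h1; have := normr_ge0 (t - x); lra.
rewrite ncM nc_eix mul1r; apply: le_trans (cexp_sub1x_le z2) _.
have -> : 6 * nc z ^+ 2 = K * `|t - x| * `|t - x|.
  by rewrite nz exprMn real_normK ?num_real // /K; ring.
rewrite ler_wpM2r //; have := normr_ge0 (t - x); lra.
Qed.

Lemma ccont_eix k x y : ccont (fun t => eix (k * t) : C) x y.
Proof. by apply: crder_ccont => t _; exact: crder_eix. Qed.

Definition osc x y k : C := cint x y (fun t => eix (k * t)).

Lemma osc0 x y : x <= y -> osc x y 0 = (y - x)%:C.
Proof.
move=> xy; rewrite /osc -[RHS]mul1r -cint_itv //; apply: eq_cint => t _.
by rewrite mul0r eixE cos0 sin0.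
Qed.

Lemma osc_le x y k : x <= y -> nc (osc x y k) <= y - x.
Proof.
move=> xy; rewrite -[leRHS]mul1r; apply: cint_le => //; first exact: ccont_eix.
by move=> t _; rewrite nc_eix.
Qed.

Lemma osc_le_inv x y k : x <= y -> k != 0 -> nc (osc x y k) <= 2 / `|k|.
Proof.
move=> xy k0; have i0 : (0 +i* k : C) != 0 by rewrite eq_complex /= negb_and k0 orbT.
have e : (0 +i* k) * osc x y k = eix (k * y) - eix (k * x).
  rewrite /osc -cintZ; last exact: ccont_eix.
  apply: (@cint_FTC R (fun t => eix (k * t))) => //; first by apply: ccontZ; exact: ccont_eix.
  by move=> t _; exact: crder_eix.
have nk : nc (0 +i* k) = `|k| by rewrite /= expr0n add0r sqrtr_sqr.
rewrite ler_pdivlMr ?normr_gt0 // mulrC -nk -ncM e.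
by apply: le_trans (ncB _ _) _; rewrite !nc_eix.
Qed.

Definition dpoly N s : C := \sum_(0 <= i < N) pwr i.+1%:R (- s).

Lemma nc_dpoly_le N s : nc (dpoly N s) <= \sum_(0 <= i < N) rpw i.+1 (- complex.Re s).
Proof.
apply: le_trans (nc_sum _ _ _) _; apply: ler_sum => i _; rewrite nc_pwr_nat; apply: le_of_eq.
by case: s => x y.
Qed.

Lemma nc_dpoly_le1 N s : 0 <= complex.Re s -> nc (dpoly N s) <= N%:R.
Proof.
move=> s0; apply: le_trans (nc_dpoly_le _ _) _.
apply: (@le_trans _ _ (\sum_(0 <= i < N) 1)); last by rewrite sumr_const_nat subn0.
by apply: ler_sum => i _; rewrite rpw_le1 // oppr_le0.
Qed.

Lemma nc_dpoly_le2 N s : 1 < complex.Re s -> nc (dpoly N s) <= 1 + (complex.Re s - 1)^-1.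
Proof.
move=> s1; apply: le_trans (nc_dpoly_le _ _) _.
have p0 : 0 < complex.Re s - 1 by rewrite subr_gt0.
have := rpw_sum N p0; have -> : - 1 - (complex.Re s - 1) = - complex.Re s by ring.
by [].
Qed.

Lemma nc_zeta_le s : 1 < complex.Re s -> nc (zeta s) <= 1 + (complex.Re s - 1)^-1.
Proof.
move=> s1; rewrite zeta_dseries //; apply: csums_le (dseriesP s1) _ => n.
exact: nc_dpoly_le2.
Qed.

Lemma zeta_dpoly_le N s : 1 < complex.Re s ->
  nc (zeta s - dpoly N s) <= rpw N.+1 (- (complex.Re s - 1)) * (1 + (complex.Re s - 1)^-1).
Proof.
move=> s1; rewrite zeta_dseries //.
have p0 : 0 < complex.Re s - 1 by rewrite subr_gt0.
apply: csums_le_abs (csums_shift N (dseriesP s1)) _ => n.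
have := @rpw_tail_sum R (complex.Re s - 1) N.+1 n p0 isT.
have -> : - 1 - (complex.Re s - 1) = - complex.Re s by ring.
move=> h; apply: le_trans h; apply: ler_sum => i _; rewrite nc_pwr_nat; apply: le_of_eq.
by case: (s).
Qed.

Section Line.
Variables (a b c u v w : R).
Hypotheses (a0 : 0 < a) (u0 : 0 < u) (v1 : 1 < v) (w1 : 1 < w).

Definition lform (n m k : nat) : R := a * ln n%:R - b * ln m%:R - c * ln k%:R.
Definition weight (n m k : nat) : R := rpw n (- u) * rpw m (- v) * rpw k (- w).

Definition line_poly N M t : C :=
  dpoly N (u +i* (a * t)) * dpoly M (v +i* (- (b * t))) * dpoly M (w +i* (- (c * t))).

Lemma line_polyE N M t : line_poly N M t =
  \sum_(0 <= n < N) \sum_(0 <= m < M) \sum_(0 <= k < M)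
    (weight n.+1 m.+1 k.+1)%:C * eix (- lform n.+1 m.+1 k.+1 * t).
Proof.
rewrite /line_poly /dpoly mulr_suml mulr_suml; apply: eq_bigr => n _.
rewrite [X in X * _]mulr_sumr mulr_suml; apply: eq_bigr => m _.
rewrite mulr_sumr; apply: eq_bigr => k _; rewrite !pwr_polar.
rewrite [complex.Re _]/= [complex.Im _]/=  [complex.Re _]/= [complex.Im _]/= [complex.Re _]/= [complex.Im _]/=.
have -> : eix (- lform n.+1 m.+1 k.+1 * t) = eix (- (a * t) * ln n.+1%:R) *
   eix (- - (b * t) * ln m.+1%:R) * eix (- - (c * t) * ln k.+1%:R).
  by rewrite -!eixD; congr eix; rewrite /lform; ring.
rewrite /weight !rmorphM /=; ring.
Qed.

Lemma cint_line_poly N M x y : cint x y (line_poly N M) =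
  \sum_(0 <= n < N) \sum_(0 <= m < M) \sum_(0 <= k < M)
    (weight n.+1 m.+1 k.+1)%:C * osc x y (- lform n.+1 m.+1 k.+1).
Proof.
have -> : line_poly N M = fun t => \sum_(0 <= n < N) \sum_(0 <= m < M) \sum_(0 <= k < M)
    (weight n.+1 m.+1 k.+1)%:C * eix (- lform n.+1 m.+1 k.+1 * t).
  by apply/funext => t; exact: line_polyE.
have cs K (F : nat -> R -> C) : (forall i, ccont (F i) x y) -> ccont (fun t => \sum_(0 <= i < K) F i t) x y.
  move=> H; elim: K => [|K IH].
    by move=> t tt e e0; exists 1 => // t' _ _; rewrite !big_geq // subrr nc0.
  have -> : (fun t => \sum_(0 <= i < K.+1) F i t) = (fun t => \sum_(0 <= i < K) F i t + F K t).
    by apply/funext => t; rewrite sumrS.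
  exact: ccontD.
have c1 n m k : ccont (fun t => (weight n.+1 m.+1 k.+1)%:C * eix (- lform n.+1 m.+1 k.+1 * t)) x y.
  by apply: ccontZ; exact: ccont_eix.
have c2 n m : ccont (fun t => \sum_(0 <= k < M) (weight n.+1 m.+1 k.+1)%:C * eix (- lform n.+1 m.+1 k.+1 * t)) x y.
  exact: (cs M (fun k t => (weight n.+1 m.+1 k.+1)%:C * eix (- lform n.+1 m.+1 k.+1 * t))).
have c3 n : ccont (fun t => \sum_(0 <= m < M) \sum_(0 <= k < M) (weight n.+1 m.+1 k.+1)%:C * eix (- lform n.+1 m.+1 k.+1 * t)) x y.
  exact: (cs M (fun m t => \sum_(0 <= k < M) (weight n.+1 m.+1 k.+1)%:C * eix (- lform n.+1 m.+1 k.+1 * t))).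
rewrite (cint_sum _ _ c3); apply: eq_bigr => n _.
rewrite (cint_sum _ _ (c2 n)); apply: eq_bigr => m _.
rewrite (cint_sum _ _ (c1 n m)); apply: eq_bigr => k _.
by rewrite cintZ //; exact: ccont_eix.
Qed.

Definition line_zeta t : C :=
  zeta (u +i* (a * t)) * zeta (v +i* (- (b * t))) * zeta (w +i* (- (c * t))).

Lemma ccont_dpoly N (sg al x y : R) : ccont (fun t => dpoly N (sg +i* (al * t))) x y.
Proof.
have -> : (fun t => dpoly N (sg +i* (al * t))) =
   (fun t => \sum_(0 <= i < N) (rpw i.+1 (- sg))%:C * eix ((- al * ln i.+1%:R) * t)).
  apply/funext => t; apply: eq_bigr => i _; rewrite pwr_polar; congr (_ * eix _).
  by rewrite [complex.Im _]/=; ring.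
elim: N => [|K IH].
  by move=> t tt e e0; exists 1 => // t' _ _; rewrite !big_geq // subrr nc0.
have -> : (fun t => \sum_(0 <= i < K.+1) (rpw i.+1 (- sg))%:C * eix ((- al * ln i.+1%:R) * t)) =
   (fun t => \sum_(0 <= i < K) (rpw i.+1 (- sg))%:C * eix ((- al * ln i.+1%:R) * t) +
     (rpw K.+1 (- sg))%:C * eix ((- al * ln K.+1%:R) * t) : C).
  by apply/funext => t; rewrite sumrS.
by apply: ccontD => //; apply: ccontZ; exact: ccont_eix.
Qed.

(** The first factor is cut at a fixed [N]; its tail carries [1 / t] and integrates to a logarithm.
    In the other two, absolutely convergent factors, [M] may be taken as large as desired after [N]
    and [T]: [eta] is chosen so that this second truncation costs at most 1 in all. *)
Lemma line_truncation (k : nat) : u < 1 -> exists2 K, 0 <= K & forall N T, 3 / a <= T -> a * T <= N.+1%:R ->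
  (a * T) ^+ k.+2 <= N.+1%:R ^+ k.+1 -> exists M0, forall M, (M0 <= M)%N ->
  nc (cint (3 / a) T line_zeta - cint (3 / a) T (line_poly N M)) <=
    K * rpw N.+1 (1 - u) * (ln T - ln (3 / a)) + 1.
Proof.
move=> u1; have [K1 K10 HK] := ztail_le k 1 u0.
pose Zv := 1 + (v - 1)^-1; pose Zw := 1 + (w - 1)^-1.
have Zv1 : 1 <= Zv by rewrite lerDl invr_ge0 subr_ge0 ltW.
have Zw1 : 1 <= Zw by rewrite lerDl invr_ge0 subr_ge0 ltW.
have Zv0 : 0 <= Zv by exact: le_trans Zv1.
have Zw0 : 0 <= Zw by exact: le_trans Zw1.
exists (2 * K1 / a * Zv * Zw) => [|N T aT aN aTk]; first by rewrite !mulr_ge0 // invr_ge0 ltW.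
set t0 := 3 / a in aT *; have t00 : 0 < t0 by rewrite divr_gt0.
have T0 : 0 < T by exact: lt_le_trans aT.
pose eta := (2 * N.+1%:R * Zv * Zw * T)^-1.
have den : 0 < 2 * N.+1%:R * Zv * Zw * T.
  by rewrite !mulr_gt0 // (lt_le_trans ltr01).
have eta0 : 0 < eta by rewrite invr_gt0.
have [Mv HMv] := rpw_vanish (p := v - 1) ltac:(by rewrite subr_gt0) eta0.
have [Mw HMw] := rpw_vanish (p := w - 1) ltac:(by rewrite subr_gt0) eta0.
exists (maxn Mv Mw) => M; rewrite geq_max => /andP[Mv' Mw'].
have mulN (al t : R) : - (al * t) = (- al) * t by rewrite mulNr.
have ca : ccont (fun t => zeta (u +i* (a * t))) t0 T.
  by apply: ccont_zeta_line => t _; apply: re_neq1; rewrite lt_eqF.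
have cb : ccont (fun t => zeta (v +i* (- (b * t)))) t0 T.
  have -> : (fun t => zeta (v +i* (- (b * t)))) = (fun t => zeta (v +i* ((- b) * t))) by apply/funext => t; rewrite mulN.
  by apply: ccont_zeta_line => t _; apply: re_neq1; rewrite gt_eqF.
have cc : ccont (fun t => zeta (w +i* (- (c * t)))) t0 T.
  have -> : (fun t => zeta (w +i* (- (c * t)))) = (fun t => zeta (w +i* ((- c) * t))) by apply/funext => t; rewrite mulN.
  by apply: ccont_zeta_line => t _; apply: re_neq1; rewrite gt_eqF.
have pa : ccont (fun t => dpoly N (u +i* (a * t))) t0 T by exact: ccont_dpoly.
have pb : ccont (fun t => dpoly M (v +i* (- (b * t)))) t0 T.
  have -> : (fun t => dpoly M (v +i* (- (b * t)))) = (fun t => dpoly M (v +i* ((- b) * t))) by apply/funext => t; rewrite mulN.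
  exact: ccont_dpoly.
have pc : ccont (fun t => dpoly M (w +i* (- (c * t)))) t0 T.
  have -> : (fun t => dpoly M (w +i* (- (c * t)))) = (fun t => dpoly M (w +i* ((- c) * t))) by apply/funext => t; rewrite mulN.
  exact: ccont_dpoly.
have cz : ccont line_zeta t0 T by exact: ccontM (ccontM ca cb) cc.
have cp : ccont (line_poly N M) t0 T by exact: ccontM (ccontM pa pb) pc.
rewrite -cintB //.
pose D1 t := (zeta (u +i* (a * t)) - dpoly N (u +i* (a * t))) * zeta (v +i* (- (b * t))) * zeta (w +i* (- (c * t))).
pose D2 t := dpoly N (u +i* (a * t)) * ((zeta (v +i* (- (b * t))) - dpoly M (v +i* (- (b * t)))) * zeta (w +i* (- (c * t))) +
   dpoly M (v +i* (- (b * t))) * (zeta (w +i* (- (c * t))) - dpoly M (w +i* (- (c * t))))).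
have c1 : ccont D1 t0 T by exact: ccontM (ccontM (ccontB ca pa) cb) cc.
have c2 : ccont D2 t0 T by exact: ccontM pa (ccontD (ccontM (ccontB cb pb) cc) (ccontM pb (ccontB cc pc))).
have -> : cint t0 T (fun t => line_zeta t - line_poly N M t) = cint t0 T (fun t => D1 t + D2 t).
  by apply: eq_cint => t _; rewrite /line_zeta /line_poly /D1 /D2; ring.
rewrite cintD //; apply: le_trans (ncD _ _) _; apply: lerD.
  apply: cint_le_inv => //.
    by rewrite !mulr_ge0 ?rpw_ge0 // invr_ge0 ltW.
  move=> t /andP[t0t tT]; have tp : 0 < t by exact: lt_le_trans t0t.
  have at3 : 3 <= a * t by move: t0t; rewrite /t0 ler_pdivrMr // mulrC.
  have at0 : 0 < a * t by rewrite mulr_gt0.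
  have atT : a * t <= a * T by rewrite ler_pM2l.
  have B1 : nc (zeta (u +i* (a * t)) - dpoly N (u +i* (a * t))) <= K1 * (rpw N.+1 (1 - u) / (a * t)) * 2.
    have := HK k N (u +i* (a * t)) (leqnn k); rewrite /= gtr0_norm // lexx (ltW u1) => /(_ isT at3 (le_trans atT aN)).
    rewrite -[zeta _ - _]/(ztail N (u +i* (a * t))) => h; apply: le_trans h _.
    apply: ler_wpM2l; first by rewrite mulr_ge0 // divr_ge0 ?rpw_ge0 // ltW.
    have : (a * t) ^+ k.+2 / N.+1%:R ^+ k.+1 <= 1; last by lra.
    rewrite ler_pdivrMr ?exprn_gt0 // mul1r (le_trans _ aTk) //.
    by rewrite lerXn2r ?nnegrE ?(ltW at0) // (le_trans (ltW at0)).
  have B2 : nc (zeta (v +i* (- (b * t)))) <= Zv by exact: nc_zeta_le.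
  have B3 : nc (zeta (w +i* (- (c * t)))) <= Zw by exact: nc_zeta_le.
  rewrite /D1 ncM ncM; apply: le_trans (ler_pM (mulr_ge0 (nc_ge0 _) (nc_ge0 _)) (nc_ge0 _) (ler_pM (nc_ge0 _) (nc_ge0 _) B1 B2) B3) _.
  by apply: le_of_eq; field; rewrite !gt_eqF.
have tT' : T - t0 <= T by rewrite gerBl ltW.
apply: (@le_trans _ _ (T^-1 * (T - t0))); last by rewrite mulrC ler_pdivrMr // mul1r.
apply: cint_le => // t _.
have B1 : nc (dpoly N (u +i* (a * t))) <= N.+1%:R.
  by apply: le_trans (nc_dpoly_le1 _ _) _; rewrite ?(ltW u0) // ler_nat.
have B2 : nc (zeta (v +i* (- (b * t))) - dpoly M (v +i* (- (b * t)))) <= eta * Zv.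
  apply: le_trans (zeta_dpoly_le _ _) _ => //=; rewrite ler_wpM2r // HMv //; exact: leqW.
have B3 : nc (zeta (w +i* (- (c * t))) - dpoly M (w +i* (- (c * t)))) <= eta * Zw.
  apply: le_trans (zeta_dpoly_le _ _) _ => //=; rewrite ler_wpM2r // HMw //; exact: leqW.
have B4 : nc (zeta (w +i* (- (c * t)))) <= Zw by exact: nc_zeta_le.
have B5 : nc (dpoly M (v +i* (- (b * t)))) <= Zv by exact: nc_dpoly_le2.
have B6 : nc ((zeta (v +i* (- (b * t))) - dpoly M (v +i* (- (b * t)))) * zeta (w +i* (- (c * t))) +
   dpoly M (v +i* (- (b * t))) * (zeta (w +i* (- (c * t))) - dpoly M (w +i* (- (c * t))))) <= eta * Zv * Zw + Zv * (eta * Zw).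
  apply: le_trans (ncD _ _) _; rewrite !ncM; apply: lerD; apply: ler_pM; rewrite ?nc_ge0 //.
rewrite /D2 ncM; apply: le_trans (ler_pM (nc_ge0 _) (nc_ge0 _) B1 B6) _.
apply: le_of_eq; have Zv' : Zv != 0 by rewrite gt_eqF // (lt_le_trans ltr01).
have Zw' : Zw != 0 by rewrite gt_eqF // (lt_le_trans ltr01).
have N' : N.+1%:R != 0 :> R by rewrite pnatr_eq0.
have T' : T != 0 by rewrite gt_eqF.
rewrite /eta; move: (N.+1%:R : R) N' => NN N'.
by field; rewrite T' Zw' Zv' N'.
Qed.

End Line.

End VerticalLine.

(** * Off-diagonal terms *)

Section OffDiagonal.
Context {R : realType}.
Local Notation C := R[i].
Local Notation nc := (@Normc.normc R).
Implicit Types (x y t T X : R) (n m k N M : nat).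

Lemma inv_ln_ratio_le x X : 0 < x -> 0 < X -> x != X -> `|ln x - ln X|^-1 <= 1 + x / `|x - X|.
Proof.
move=> x0 X0; rewrite neq_lt => /orP[xX|Xx].
  have h := ln_ratio_ge x0 (ltW xX); have p : 0 < X - x by rewrite subr_gt0.
  have q : 0 < (X - x) / X by rewrite divr_gt0.
  rewrite distrC ger0_norm; last by exact: le_trans (ltW q) h.
  rewrite distrC gtr0_norm //.
  have -> : 1 + x / (X - x) = ((X - x) / X)^-1 by field; rewrite !gt_eqF.
  by rewrite lef_pV2 ?posrE // (lt_le_trans q).
have h := ln_ratio_ge X0 (ltW Xx); have p : 0 < x - X by rewrite subr_gt0.
have q : 0 < (x - X) / x by rewrite divr_gt0.
rewrite ger0_norm; last by exact: le_trans (ltW q) h.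
rewrite gtr0_norm //; apply: (@le_trans _ _ (x / (x - X))); last by rewrite lerDr.
rewrite -[leRHS]invrK invf_div lef_pV2 ?posrE // (lt_le_trans q) //.
Qed.

Definition near X n := `|n%:R - X| < 2^-1.

Lemma sum_near_le X N : \sum_(0 <= n < N) (if near X n.+1 then 1 else 0) <= (1 : R).
Proof.
elim: N => [|N IH]; first by rewrite big_geq.
rewrite sumrS; case: ifP => h; last by rewrite addr0.
rewrite big_nat_cond big1 ?add0r // => n; rewrite andbT => /andP[_ nN].
rewrite ifF //; apply/negP => h'.
have : n.+1%:R <= N%:R :> R by rewrite ler_nat.
move: h h'; rewrite /near !ltr_norml -[N.+1%:R]natr1 => /andP[h1 h2] /andP[h3 h4] h5; lra.
Qed.

Lemma sum_far_le X N : 1 <= X ->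
  \sum_(0 <= n < N) (if near X n.+1 then 0 else `|n.+1%:R - X|^-1) <= 4 * (1 + ln N%:R).
Proof.
move=> X1; pose p := Num.truncn X.
have /andP[p1 p2] := truncn_itv (le_trans ler01 X1); rewrite -/p in p1 p2.
(* Twice the inverse distance to the integer part [p] of [X], counted from 1 on either side; the
   factor 2 absorbs both the fractional part of [X] and the excluded radius 1/2. *)
pose d n : R := if (n < p)%N then 2 * ((p - n)%:R)^-1 else 2 * (n.+1 - p)%:R^-1.
have step n : (if near X n.+1 then 0 else `|n.+1%:R - X|^-1) <= d n.
  case: ifP => [_|/negbT]; first by rewrite /d; case: ifP => _; rewrite mulr_ge0 ?invr_ge0.
  rewrite /near -leNgt /d => h; case: ltnP => np.
    have q : 0 < (p - n)%:R :> R by rewrite ltr0n subn_gt0.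
    have e : (p - n)%:R = p%:R - n%:R :> R by rewrite natrB // ltnW.
    have np' : n.+1%:R <= p%:R :> R by rewrite ler_nat.
    have h2 : (p - n)%:R / 2 <= `|n.+1%:R - X|.
      have [pn|pn] := leqP (p - n) 1.
        apply: le_trans h; rewrite ler_pdivrMr // mulVf // -[1]/(1%:R) ler_nat //.
      have : 2 <= (p - n)%:R :> R by rewrite ler_nat.
      rewrite distrC; have := ler_norm (X - n.+1%:R); rewrite e -natr1; lra.
    rewrite -[leRHS]invrK invfM invrK [2^-1 * _]mulrC lef_pV2 ?posrE ?divr_gt0 //.
    by apply: lt_le_trans h2; rewrite divr_gt0.
  have q : 0 < (n.+1 - p)%:R :> R by rewrite ltr0n subn_gt0.
  have e : (n.+1 - p)%:R = n.+1%:R - p%:R :> R by rewrite natrB // leqW.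
  have h2 : (n.+1 - p)%:R / 2 <= `|n.+1%:R - X|.
    have [pn|pn] := leqP (n.+1 - p) 1.
      apply: le_trans h; rewrite ler_pdivrMr // mulVf // -[1]/(1%:R) ler_nat //.
    have : 2 <= (n.+1 - p)%:R :> R by rewrite ler_nat.
    have := ler_norm (n.+1%:R - X); rewrite e; move: p2; rewrite -natr1; lra.
  rewrite -[leRHS]invrK invfM invrK [2^-1 * _]mulrC lef_pV2 ?posrE ?divr_gt0 //.
  by apply: lt_le_trans h2; rewrite divr_gt0.
apply: (@le_trans _ _ (\sum_(0 <= n < N) d n)); first by apply: ler_sum => n _; exact: step.
have H0 K : 0 <= \sum_(0 <= j < K) (j.+1%:R^-1 : R) by apply: sumr_ge0 => i _; rewrite invr_ge0.
have Hmono K : (K <= N)%N -> \sum_(0 <= j < K) (j.+1%:R^-1 : R) <= \sum_(0 <= j < N) j.+1%:R^-1.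
  by move=> KN; rewrite -(subnKC KN) sumr_shift lerDl; apply: sumr_ge0 => i _; rewrite invr_ge0.
have low K : (K <= N)%N -> (K <= p)%N -> \sum_(0 <= n < K) d n <= 2 * \sum_(0 <= j < N) j.+1%:R^-1.
  move=> KN Kp; apply: le_trans (ler_wpM2l _ (Hmono K KN)) => //.
  rewrite mulr_sumr [leRHS]big_nat_rev /= big_nat_cond [leRHS]big_nat_cond.
  apply: ler_sum => n; rewrite andbT => /andP[_ nK]; rewrite /d (leq_trans nK Kp) ler_pM2l //.
  rewrite lef_pV2 ?posrE ?ltr0n ?subn_gt0 ?(leq_trans nK) // ler_nat; lia.
have -> : 4 * (1 + ln N%:R) = 2 * (1 + ln N%:R) + 2 * (1 + ln N%:R) :> R by ring.
have har := harmonic_le N (R := R).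
have har2 := ler_wpM2l (ler0n R 2) har.
case: (leqP N p) => [Np|pN].
  apply: le_trans (low N (leqnn _) Np) _; apply: le_trans har2 _.
  by rewrite lerDl mulr_ge0 // (le_trans (H0 N)).
rewrite -(subnKC (ltnW pN)) sumr_shift subnKC ?(ltnW pN) //; apply: lerD.
  by apply: le_trans (low p (ltnW pN) (leqnn _)) _.
apply: le_trans har2; apply: le_trans (ler_wpM2l _ (Hmono (N - p)%N (leq_subr _ _))) => //.
rewrite mulr_sumr; apply: ler_sum => n _; rewrite /d ltnNge leq_addr /=.
by have -> : ((p + n).+1 - p)%N = n.+1 by lia.
Qed.

(** Away from [X] the inverse of [ln n - ln X] is at most [1 + n / |n - X|]; the weight turns this
    into [n ^ (1 - u)] times two harmonic sums, with constants [2 + 8 = 10]. At most one [n] is near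
    [X], and it contributes at most [g]. *)
Lemma sum_nearest (a u X : R) (tau : nat -> R) (g : R) N : 0 < a -> 0 < u -> u < 1 -> 1 <= X -> 0 <= g ->
  (forall n, (0 < n)%N -> ~~ near X n -> tau n <= 2 / (a * `|ln n%:R - ln X|)) ->
  (forall n, (0 < n)%N -> near X n -> tau n <= g) ->
  \sum_(0 <= n < N) rpw n.+1 (- u) * tau n.+1 <= 10 / a * (rpw N (1 - u) * (1 + ln N%:R)) + g.
Proof.
move=> a0 u0 u1 X1 g0 H1 H2.
have X0 : 0 < X by exact: lt_le_trans X1.
pose far n : R := if near X n.+1 then 0 else `|n.+1%:R - X|^-1.
pose ind n : R := if near X n.+1 then 1 else 0.
have step n : (n < N)%N -> rpw n.+1 (- u) * tau n.+1 <=
   2 / a * rpw N (1 - u) * n.+1%:R^-1 + 2 / a * rpw N (1 - u) * far n + g * ind n.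
  move=> nN; have rN : rpw n.+1 (1 - u) <= rpw N (1 - u) :> R by rewrite rpw_homo // subr_ge0 ltW.
  have c0 : 0 <= 2 / a by rewrite divr_ge0 // ltW.
  rewrite /far /ind; case: ifP => [nr|/negbT nr].
    rewrite mulr0 addr0 mulr1; apply: (@le_trans _ _ g); last first.
      by rewrite lerDr !mulr_ge0 ?rpw_ge0 ?invr_ge0 // ltW.
    have h := H2 n.+1 isT nr; apply: (@le_trans _ _ (rpw n.+1 (- u) * g)).
      by rewrite ler_wpM2l ?rpw_ge0.
    by rewrite ler_piMl // rpw_le1 // oppr_le0 ltW.
  rewrite mulr0 addr0; have h := H1 n.+1 isT nr.
  have nX : n.+1%:R != X.
    by apply: contraNneq nr => e; rewrite /near e subrr normr0 invr_gt0.
  have n0 : 0 < n.+1%:R :> R by [].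
  have h2 := inv_ln_ratio_le n0 X0 nX.
  apply: (@le_trans _ _ (rpw n.+1 (- u) * (2 / a * (1 + n.+1%:R / `|n.+1%:R - X|)))).
    rewrite ler_wpM2l ?rpw_ge0 // (le_trans h) // invfM mulrA ler_wpM2l //.
  have e : rpw n.+1 (- u) = rpw n.+1 (1 - u) / n.+1%:R :> R.
    by rewrite -rpw_one // -rpwN -rpwD; congr rpw; ring.
  rewrite e; set q := `|_|.
  have q0 : 0 < q by rewrite normr_gt0 subr_eq0.
  have -> : rpw n.+1 (1 - u) / n.+1%:R * (2 / a * (1 + n.+1%:R / q)) =
     2 / a * rpw n.+1 (1 - u) * n.+1%:R^-1 + 2 / a * rpw n.+1 (1 - u) * q^-1.
    by field; rewrite !gt_eqF.
  by apply: lerD; rewrite ler_wpM2r ?invr_ge0 ?(ltW q0) // ler_wpM2l.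
apply: (@le_trans _ _ (\sum_(0 <= n < N) (2 / a * rpw N (1 - u) * n.+1%:R^-1 + 2 / a * rpw N (1 - u) * far n + g * ind n))).
  rewrite big_nat_cond [leRHS]big_nat_cond; apply: ler_sum => n; rewrite andbT => /andP[_ nN].
  exact: step.
rewrite 2!big_split /= -!mulr_sumr; apply: lerD; last first.
  by rewrite -[leRHS]mulr1; apply: ler_wpM2l => //; exact: sum_near_le.
have c0 : 0 <= 2 / a * rpw N (1 - u) by rewrite mulr_ge0 ?rpw_ge0 // divr_ge0 // ltW.
have b1 := ler_wpM2l c0 (harmonic_le N (R := R)).
have b2 := ler_wpM2l c0 (sum_far_le N X1).
apply: le_trans (lerD b1 b2) _; apply: le_of_eq; ring.
Qed.

Lemma sum_tail_le (v : R) M1 M : 1 < v ->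
  \sum_(0 <= m < M) rpw m.+1 (- v) * (if (m.+1 <= M1)%N then 0 else 1) <=
  rpw M1.+1 (- (v - 1)) * (1 + (v - 1)^-1).
Proof.
move=> v1; have p0 : 0 < v - 1 by rewrite subr_gt0.
have e (i : nat) : rpw i (- v) = rpw i (- 1 - (v - 1)) :> R by congr rpw; ring.
case: (leqP M M1) => [MM|MM].
  rewrite big_nat_cond big1 => [|m]; last first.
    by rewrite andbT => /andP[_ mM]; rewrite (leq_trans mM MM) mulr0.
  by rewrite mulr_ge0 ?rpw_ge0 // addr_ge0 // invr_ge0 ltW.
rewrite -(subnKC (ltnW MM)) sumr_shift.
rewrite [X in X + _]big_nat_cond [X in X + _]big1 ?add0r => [|m]; last first.
  by rewrite andbT => /andP[_ mM]; rewrite mM mulr0.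
apply: le_trans (rpw_tail_sum (M - M1) p0 (ltn0Sn M1)).
by apply: ler_sum => i _; rewrite ltnNge leq_addr /= mulr1 e addSn.
Qed.

Variables (a b c u v w : R).
Hypotheses (a0 : 0 < a) (b0 : 0 <= b) (c0 : 0 <= c) (u0 : 0 < u) (u1 : u < 1) (v1 : 1 < v) (w1 : 1 < w).

Definition nearX m k : R := expR ((b * ln m%:R + c * ln k%:R) / a).

Lemma lformE n m k : lform a b c n m k = a * (ln n%:R - ln (nearX m k)).
Proof. by rewrite /lform /nearX expRK; field; rewrite gt_eqF. Qed.

Lemma nearX_ge1 m k : 1 <= nearX m k.
Proof.
by rewrite -expR0 ler_expR divr_ge0 ?(ltW a0) // addr_ge0 // mulr_ge0 // ln_nat_ge0.
Qed.

Definition diag_sum N M : R := \sum_(0 <= n < N) \sum_(0 <= m < M) \sum_(0 <= k < M)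
  (if lform a b c n.+1 m.+1 k.+1 == 0 then weight u v w n.+1 m.+1 k.+1 else 0).

(** For fixed [m, k] only the [n] nearest to [nearX m k] is dangerous. It is charged [be] when
    [m, k <= M1], where linear forms are bounded below, and the full length [T] otherwise, which the
    tails of the convergent sums over [m] and [k] make small. *)
Lemma off_diagonal : exists2 K, 0 <= K & forall N M M1 (t0 T be : R), 0 < t0 -> t0 <= T -> 0 <= be ->
  (forall n m k, (0 < n)%N -> (0 < m <= M1)%N -> (0 < k <= M1)%N -> near (nearX m k) n ->
     lform a b c n m k != 0 -> 2 / `|lform a b c n m k| <= be) ->
  nc (cint t0 T (line_poly a b c u v w N M) - ((T - t0) * diag_sum N M)%:C) <=
  K * (rpw N (1 - u) * (1 + ln N%:R) + be +
       T * (rpw M1.+1 (- (v - 1)) + rpw M1.+1 (- (w - 1)))).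
Proof.
pose Zv := 1 + (v - 1)^-1; pose Zw := 1 + (w - 1)^-1.
have Zv1 : 1 <= Zv by rewrite lerDl invr_ge0 subr_ge0 ltW.
have Zw1 : 1 <= Zw by rewrite lerDl invr_ge0 subr_ge0 ltW.
have Zv0 : 0 <= Zv by exact: le_trans Zv1.
have Zw0 : 0 <= Zw by exact: le_trans Zw1.
pose K := (10 / a + 1) * (Zv * Zw).
have aV : 0 <= 10 / a by rewrite divr_ge0 // ltW.
have K0 : 0 <= K by rewrite !mulr_ge0 // addr_ge0.
exists K => // N M M1 t0 T be t00 tT be0 H.
have T0 : 0 <= T by rewrite (le_trans _ tT) // ltW.
have Tt0 : 0 <= T - t0 by rewrite subr_ge0.
(* An oscillating integral is bounded both by the length of the segment and by [2 / |lform|]; the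
   value 0 on the diagonal reflects that these terms are subtracted exactly. *)
pose tau n m k : R := if lform a b c n m k == 0 then 0 else Num.min T (2 / `|lform a b c n m k|).
have tau0 n m k : 0 <= tau n m k.
  by rewrite /tau; case: ifP => // _; rewrite le_min T0 divr_ge0.
rewrite cint_line_poly.
have -> : ((T - t0) * diag_sum N M)%:C = \sum_(0 <= n < N) \sum_(0 <= m < M) \sum_(0 <= k < M)
   ((T - t0) * (if lform a b c n.+1 m.+1 k.+1 == 0 then weight u v w n.+1 m.+1 k.+1 else 0))%:C.
  rewrite /diag_sum mulr_sumr rmorph_sum; apply: eq_bigr => n _.
  rewrite mulr_sumr rmorph_sum; apply: eq_bigr => m _.
  by rewrite mulr_sumr rmorph_sum.
rewrite -sumrB; apply: le_trans (nc_sum _ _ _) _.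
apply: (@le_trans _ _ (\sum_(0 <= n < N) \sum_(0 <= m < M) \sum_(0 <= k < M)
   weight u v w n.+1 m.+1 k.+1 * tau n.+1 m.+1 k.+1)).
  apply: ler_sum => n _; rewrite -sumrB; apply: le_trans (nc_sum _ _ _) _.
  apply: ler_sum => m _; rewrite -sumrB; apply: le_trans (nc_sum _ _ _) _.
  apply: ler_sum => k _; set W := weight _ _ _ _ _ _; set L := lform _ _ _ _ _ _.
  have W0 : 0 <= W by rewrite !mulr_ge0 ?rpw_ge0.
  rewrite /tau -/L; case: eqVneq => [->|L0].
    rewrite oppr0 (osc0 tT); have -> : W%:C * (T - t0)%:C = ((T - t0) * W)%:C by rewrite [RHS]rmorphM mulrC.
    by rewrite subrr nc0 mulr0.
  rewrite mulr0 subr0 ncM nc_real ger0_norm // ler_wpM2l // le_min.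
  rewrite -normrN osc_le_inv ?oppr_eq0 // andbT; apply: le_trans (osc_le _ tT) _.
  by rewrite gerBl ltW.
have -> : \sum_(0 <= n < N) \sum_(0 <= m < M) \sum_(0 <= k < M) weight u v w n.+1 m.+1 k.+1 * tau n.+1 m.+1 k.+1 =
  \sum_(0 <= m < M) \sum_(0 <= k < M) rpw m.+1 (- v) * rpw k.+1 (- w) *
     \sum_(0 <= n < N) rpw n.+1 (- u) * tau n.+1 m.+1 k.+1.
  rewrite exchange_big /=; apply: eq_bigr => m _; rewrite exchange_big /=; apply: eq_bigr => k _.
  by rewrite mulr_sumr; apply: eq_bigr => n _; rewrite /weight; ring.
pose A := 10 / a * (rpw N (1 - u) * (1 + ln N%:R)) + be.
have X0 : 0 <= rpw N (1 - u) * (1 + ln N%:R) by rewrite mulr_ge0 ?rpw_ge0 // addr_ge0 // ln_nat_ge0.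
have A0 : 0 <= A by exact: addr_ge0 (mulr_ge0 aV X0) be0.
(* Indicator of [m.+1 > M1]. *)
pose im m : R := if (m.+1 <= M1)%N then 0 else 1.
have im0 m : 0 <= im m by rewrite /im; case: ifP.
have inner m k : \sum_(0 <= n < N) rpw n.+1 (- u) * tau n.+1 m.+1 k.+1 <= A + T * im m + T * im k.
  have g0 : 0 <= be + T * im m + T * im k by rewrite !addr_ge0 // mulr_ge0.
  have S := @sum_nearest a u (nearX m.+1 k.+1) (fun n => tau n m.+1 k.+1) (be + T * im m + T * im k) N
    a0 u0 u1 (nearX_ge1 _ _) g0.
  have -> : A + T * im m + T * im k =
    10 / a * (rpw N (1 - u) * (1 + ln N%:R)) + (be + T * im m + T * im k) by rewrite /A; ring.
  apply: S => n n0 nr.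
    rewrite /tau; case: ifP => [_|_].
      by rewrite divr_ge0 // mulr_ge0 // ltW.
    by rewrite ge_min lformE normrM gtr0_norm // lexx orbT.
  rewrite /tau; case: ifP => [_ //|/negbT L0].
  rewrite ge_min; apply/orP; rewrite /im; case: ifP => [mM|_]; last first.
    left; rewrite mulr1; have : 0 <= T * (if (k.+1 <= M1)%N then 0 else 1) by rewrite mulr_ge0 //; case: ifP.
    by move: be0; set q := T * _; lra.
  case: ifP => [kM|_].
    by right; rewrite !mulr0 !addr0; exact: H.
  by left; rewrite mulr0 mulr1 addr0 lerDr.
apply: (@le_trans _ _ (\sum_(0 <= m < M) \sum_(0 <= k < M) rpw m.+1 (- v) * rpw k.+1 (- w) * (A + T * im m + T * im k))).
  apply: ler_sum => m _; apply: ler_sum => k _; rewrite ler_wpM2l // mulr_ge0 ?rpw_ge0 //.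
have Sv : \sum_(0 <= m < M) rpw m.+1 (- v) <= Zv.
  have p0 : 0 < v - 1 by rewrite subr_gt0.
  by have := rpw_sum M p0; have -> : - 1 - (v - 1) = - v by ring.
have Sw : \sum_(0 <= m < M) rpw m.+1 (- w) <= Zw.
  have p0 : 0 < w - 1 by rewrite subr_gt0.
  by have := rpw_sum M p0; have -> : - 1 - (w - 1) = - w by ring.
have Sv' := sum_tail_le M1 M v1; have Sw' := sum_tail_le M1 M w1.
rewrite -/Zv in Sv'; rewrite -/Zw in Sw'.
set rv := rpw M1.+1 (- (v - 1)) in Sv' *; set rw := rpw M1.+1 (- (w - 1)) in Sw' *.
have rv0 : 0 <= rv by exact: rpw_ge0.
have rw0 : 0 <= rw by exact: rpw_ge0.
set sv := \sum_(0 <= m < M) rpw m.+1 (- v) in Sv; set sw := \sum_(0 <= m < M) rpw m.+1 (- w) in Sw.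
set tv := \sum_(0 <= m < M) _ in Sv'; set tw := \sum_(0 <= m < M) _ in Sw'.
have sv0 : 0 <= sv by apply: sumr_ge0 => i _; exact: rpw_ge0.
have sw0 : 0 <= sw by apply: sumr_ge0 => i _; exact: rpw_ge0.
have tv0 : 0 <= tv by apply: sumr_ge0 => i _; rewrite mulr_ge0 ?rpw_ge0 //; exact: im0.
have tw0 : 0 <= tw by apply: sumr_ge0 => i _; rewrite mulr_ge0 ?rpw_ge0 //; exact: im0.
have -> : \sum_(0 <= m < M) \sum_(0 <= k < M) rpw m.+1 (- v) * rpw k.+1 (- w) * (A + T * im m + T * im k) =
   sv * sw * A + T * (tv * sw + sv * tw).
  have e m : \sum_(0 <= k < M) rpw m.+1 (- v) * rpw k.+1 (- w) * (A + T * im m + T * im k) =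
     rpw m.+1 (- v) * (sw * A + T * tw) + (rpw m.+1 (- v) * im m) * (T * sw).
    rewrite /sw /tw !mulr_suml !mulr_sumr -!big_split /= !mulr_sumr -big_split /=; apply: eq_bigr => k _; rewrite -/(im k); ring.
  under eq_bigr do rewrite e.
  rewrite big_split /= -!mulr_suml -/sv -/tv; ring.
have B1 : sv * sw * A <= Zv * Zw * A by rewrite ler_wpM2r // ler_pM.
have B2 : tv * sw <= rv * Zv * Zw by rewrite ler_pM.
have B3 : sv * tw <= Zv * (rw * Zw) by rewrite ler_pM.
have B4 : T * (tv * sw + sv * tw) <= T * (rv * Zv * Zw + Zv * (rw * Zw)) by rewrite ler_wpM2l // lerD.
apply: le_trans (lerD B1 B4) _.
have P0 : 0 <= Zv * Zw by exact: mulr_ge0.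
have -> : Zv * Zw * A + T * (rv * Zv * Zw + Zv * (rw * Zw)) = Zv * Zw * (A + T * (rv + rw)) by ring.
rewrite /K [_ * (Zv * Zw)]mulrC -[leRHS]mulrA ler_wpM2l // /A.
have T1 : 0 <= T * (rv + rw) by rewrite mulr_ge0 // addr_ge0.
move: X0 T1 be0 aV; set X := rpw N _ * _; set Y := T * _; set q := 10 / a => X0 T1 be0 aV.
have : 0 <= q * be by exact: mulr_ge0. have : 0 <= q * Y by exact: mulr_ge0.
lra.
Qed.

End OffDiagonal.

(** * Diagonal terms *)

Lemma nat_root l n : (0 < n)%N -> (0 < l)%N -> (forall p, prime p -> l %| logn p n)%N ->
  exists r, (0 < r)%N /\ n = (r ^ l)%N.
Proof.
move=> n0 l0 H; exists (\prod_(p <- primes n) p ^ (logn p n %/ l))%N; split.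
  rewrite big_seq_cond prodn_cond_gt0 // => p; rewrite andbT mem_primes => /andP[/prime_gt0 p0 _].
  by rewrite expn_gt0 p0.
rewrite {1}(prod_prime_decomp n0) prime_decompE big_map /=.
have E : forall s : seq nat, ((\prod_(p <- s) p ^ (logn p n %/ l)) ^ l = \prod_(p <- s) (p ^ (logn p n %/ l)) ^ l)%N.
  elim=> [|p s IH]; first by rewrite !big_nil exp1n.
  by rewrite !big_cons expnMn IH.
rewrite E big_seq_cond [RHS]big_seq_cond; apply: eq_bigr => p; rewrite andbT mem_primes => /andP[pp _].
by rewrite -expnM divnK // H.
Qed.

(** * Vanishing and lower bounds of the forms [a ln n - b ln m - c ln k] *)

Section LinearForms.
Context {R : realType}.
Implicit Types (beta : R) (x y n m k p : nat) (e f l : int).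

Lemma ln_natX x p : (0 < x)%N -> ln ((x ^ p)%N%:R : R) = p%:R * ln x%:R.
Proof. by move=> x0; rewrite natrX lnXn ?ltr0n // mulr_natl. Qed.

(** The coefficients may have either sign: their positive parts go to the numerator [u] or the
    denominator [v], and the negative parts to the other one. *)
Lemma int_log_form e f x y : (0 < x)%N -> (0 < y)%N -> exists u v : nat,
  [/\ (0 < u)%N, (0 < v)%N,
      ln (u%:R : R) - ln v%:R = e%:~R * ln x%:R - f%:~R * ln y%:R,
      ln (u%:R : R) <= `|e|%:R * ln x%:R + `|f|%:R * ln y%:R &
      ln (v%:R : R) <= `|e|%:R * ln x%:R + `|f|%:R * ln y%:R].
Proof.
move=> x0 y0.
have lx := @ln_nat_ge0 R x; have ly := @ln_nat_ge0 R y.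
pose P (g : int) := if (0 <= g)%R then `|g|%N else 0%N.
pose Q (g : int) := if (0 <= g)%R then 0%N else `|g|%N.
have PQ (g : int) : (P g)%:R - (Q g)%:R = g%:~R :> R.
  rewrite /P /Q; case: ifP => g0; first by rewrite subr0 -[g in RHS]gez0_abs.
  by rewrite sub0r -[g in RHS]opprK -[- g in RHS]gtz0_abs ?abszN ?mulrNz // oppr_gt0 ltNge g0.
have Pl (g : int) : (P g)%:R <= `|g|%:R :> R by rewrite ler_nat /P; case: ifP.
have Ql (g : int) : (Q g)%:R <= `|g|%:R :> R by rewrite ler_nat /Q; case: ifP.
exists (x ^ P e * y ^ Q f)%N, (x ^ Q e * y ^ P f)%N.
have lnE i j : ln ((x ^ i * y ^ j)%N%:R : R) = i%:R * ln x%:R + j%:R * ln y%:R.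
  by rewrite natrM lnM ?posrE ?ltr0n ?expn_gt0 ?x0 ?y0 // !ln_natX.
split; rewrite ?muln_gt0 ?expn_gt0 ?x0 ?y0 // !lnE.
- rewrite -!PQ; ring.
- by rewrite lerD // ler_wpM2r.
- by rewrite lerD // ler_wpM2r.
Qed.

Lemma int_form_bound beta : algebraicOver ratr beta -> ~ rational_real beta ->
  exists D T0 : nat, forall p (e1 f1 e2 f2 : int) x1 y1 x2 y2, (T0 <= p)%N ->
    (0 < x1)%N -> (0 < y1)%N -> (0 < x2)%N -> (0 < y2)%N ->
    `|e1|%:R * ln (x1%:R : R) + `|f1|%:R * ln y1%:R <= p%:R ^+ 3 ->
    `|e2|%:R * ln (x2%:R : R) + `|f2|%:R * ln y2%:R <= p%:R ^+ 3 ->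
    let P := e1%:~R * ln (x1%:R : R) - f1%:~R * ln y1%:R in
    let Q := e2%:~R * ln (x2%:R : R) - f2%:~R * ln y2%:R in
    P <> 0 \/ Q <> 0 -> (p%:R ^- (D * p ^ 8) : R) <= `|beta * P - Q|.
Proof.
move=> alg irr; have [D [T0 H]] := log_form_bound alg irr.
exists D, T0 => p e1 f1 e2 f2 x1 y1 x2 y2 pT x10 y10 x20 y20 h1 h2 P Q PQ.
have [u1 [v1 [u10 v10 E1 lu1 lv1]]] := int_log_form e1 f1 x10 y10.
have [u2 [v2 [u20 v20 E2 lu2 lv2]]] := int_log_form e2 f2 x20 y20.
rewrite /P /Q -E1 -E2; apply: H => //; try exact: le_trans h1; try exact: le_trans h2.
case: PQ => N; [left|right] => uv; apply: N; first by rewrite /P -E1 uv subrr.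
by rewrite /Q -E2 uv subrr.
Qed.

Lemma rational_realM (x y : R) : rational_real x -> rational_real y -> rational_real (x * y).
Proof. by move=> [q ->] [r ->]; exists (q * r); rewrite rmorphM. Qed.
Lemma rational_realD (x y : R) : rational_real x -> rational_real y -> rational_real (x + y).
Proof. by move=> [q ->] [r ->]; exists (q + r); rewrite rmorphD. Qed.
Lemma rational_realV (x : R) : rational_real x -> rational_real x^-1.
Proof. by move=> [q ->]; exists q^-1; rewrite fmorphV. Qed.
Lemma rational_real_int l : rational_real (l%:~R : R).
Proof. by exists l%:~R; rewrite ratr_int. Qed.

Lemma algebraic_ratio (x y : R) : algebraicOver ratr x -> algebraicOver ratr y -> algebraicOver ratr (x / y).
Proof. exact: algebraic_div. Qed.

Section Relation.
Variables (a b c : R) (l1 l2 l3 : int).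
Hypotheses (a0 : 0 < a) (b0 : 0 < b) (c0 : 0 < c).
Hypotheses (alga : algebraicOver ratr a) (algb : algebraicOver ratr b) (algc : algebraicOver ratr c).
Hypotheses (nrat : ~ rational_ratio a b c) (nz : (l1, l2, l3) <> (0, 0, 0)).
Hypothesis rel : a * l1%:~R = b * l2%:~R + c * l3%:~R.

Let L : nat := (`|l1| + `|l2| + `|l3|)%N.

(** If [l1] is nonzero, [l1] times the form is [c * (b / c * P - Q)] with [P = l2 ln n - l1 ln m]
    and [Q = l1 ln k - l3 ln n]. If [l1 = 0], [l2] times it is [c * (a / c * P - Q)] with
    [P = l2 ln n] and [Q = l2 ln k - l3 ln m]. Were [b / c], respectively [a / c], rational, the
    relation would make both [b / a] and [c / a] rational. The second alternative is [P = Q = 0].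
    The halves in the hypotheses leave room for the two logarithms in each of [P], [Q]. *)
Lemma lform_relations : exists (D T0 : nat) (kap : R), 0 < kap /\ forall p n m k, (T0 <= p)%N ->
  (0 < n)%N -> (0 < m)%N -> (0 < k)%N ->
  L%:R * ln (n%:R : R) <= p%:R ^+ 3 / 2 -> L%:R * ln (m%:R : R) <= p%:R ^+ 3 / 2 ->
  L%:R * ln (k%:R : R) <= p%:R ^+ 3 / 2 ->
  kap * p%:R ^- (D * p ^ 8) <= `|lform a b c n m k| \/
  [/\ lform a b c n m k = 0,
      l2%:~R * ln n%:R = l1%:~R * ln (m%:R : R),
      l3%:~R * ln n%:R = l1%:~R * ln (k%:R : R) &
      l3%:~R * ln m%:R = l2%:~R * ln (k%:R : R)].
Proof.
have cn : c != 0 by rewrite gt_eqF.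
have half (e f : int) x y (z : R) : (`|e| <= L)%N -> (`|f| <= L)%N -> L%:R * ln (x%:R : R) <= z / 2 ->
    L%:R * ln (y%:R : R) <= z / 2 -> `|e|%:R * ln (x%:R : R) + `|f|%:R * ln y%:R <= z.
  move=> eL fL h1 h2; rewrite [z]splitr; apply: lerD.
    by apply: le_trans h1; rewrite ler_wpM2r ?ln_nat_ge0 // ler_nat.
  by apply: le_trans h2; rewrite ler_wpM2r ?ln_nat_ge0 // ler_nat.
have L0 : (`|0%R : int| <= L)%N by [].
have L1 : (`|l1| <= L)%N by rewrite /L -addnA leq_addr.
have L2 : (`|l2| <= L)%N by rewrite /L addnAC leq_addl.
have L3 : (`|l3| <= L)%N by rewrite /L leq_addl.
have [l10|l10] := eqVneq l1 0.
  have rel0 : b * l2%:~R = - (c * l3%:~R).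
    by move: rel; rewrite l10 mulr0 => /esym/eqP; rewrite addr_eq0 => /eqP.
  have l2n : l2 != 0.
    apply/negP => /eqP l20; move: rel0; rewrite l20 mulr0 => /esym/eqP.
    rewrite oppr_eq0 mulf_eq0 (negbTE cn) /= intr_eq0 => /eqP l30; apply: nz.
    by rewrite l10 l20 l30.
  have l2r : l2%:~R != 0 :> R by rewrite intr_eq0.
  have irr : ~ rational_real (a / c).
    move=> r; apply: nrat; have rca : rational_real (c / a).
      by rewrite -[c / a]invrK invf_div; exact: rational_realV.
    split => //; have -> : b / a = (- l3)%:~R / l2%:~R * (c / a).
      have -> : b = (- l3)%:~R / l2%:~R * c.
        by apply: (mulIf l2r); rewrite rel0 mulrNz; field.
      by rewrite mulrA.
    by apply: rational_realM => //; apply: rational_realM; [|apply: rational_realV]; exact: rational_real_int.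
  have [D [T0 H]] := int_form_bound (algebraic_ratio alga algc) irr.
  exists D, T0, (c / `|l2%:~R|); split; first by rewrite divr_gt0 // normr_gt0.
  move=> p n m k pT n0 m0 k0 hn hm hk.
  have := H p l2 0 l2 l3 n n k m pT n0 n0 k0 m0 (half _ _ _ _ _ L2 L0 hn hn) (half _ _ _ _ _ L2 L3 hk hm).
  rewrite /=; set P := _ - _; set Q := _ - _ => B.
  have E : lform a b c n m k = c / l2%:~R * (a / c * P - Q).
    rewrite /lform /P /Q mul0r subr0; apply: (mulIf l2r).
    have -> : (a * ln n%:R - b * ln m%:R - c * ln k%:R) * l2%:~R =
      a * ln n%:R * l2%:~R - (b * l2%:~R) * ln m%:R - c * ln k%:R * l2%:~R by ring.
    by rewrite rel0; field; rewrite cn l2r.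
  have [/eqP P0|/eqP P0] := boolP (P == 0); last first.
    left; rewrite E normrM normrM normfV (gtr0_norm c0) ler_pM2l ?divr_gt0 ?normr_gt0 //.
    by apply: B; left.
  have [/eqP Q0|/eqP Q0] := boolP (Q == 0); last first.
    left; rewrite E normrM normrM normfV (gtr0_norm c0) ler_pM2l ?divr_gt0 ?normr_gt0 //.
    by apply: B; right.
  right; move: (P0); rewrite {1}/P mul0r subr0 => /eqP; rewrite mulf_eq0 (negbTE l2r) /= => /eqP lnn.
  split; first by rewrite E P0 Q0 mulr0 subrr mulr0.
  - by rewrite lnn l10 mulr0 mul0r.
  - by rewrite lnn l10 mulr0 mul0r.
  - by move/eqP: Q0; rewrite /Q subr_eq0 => /eqP.
have l1r : l1%:~R != 0 :> R by rewrite intr_eq0.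
have irr : ~ rational_real (b / c).
  move=> r; apply: nrat.
  have rac : rational_real (a / c).
    have -> : a / c = (b / c * l2%:~R + l3%:~R) / l1%:~R.
      by apply: (mulIf l1r); rewrite divfK // mulrAC rel; field.
    apply: rational_realM; last by apply: rational_realV; exact: rational_real_int.
    apply: rational_realD; last exact: rational_real_int.
    by apply: rational_realM => //; exact: rational_real_int.
  have rca : rational_real (c / a) by rewrite -[c / a]invrK invf_div; exact: rational_realV.
  split => //; have -> : b / a = b / c * (c / a) by rewrite mulrA divfK.
  exact: rational_realM.
have [D [T0 H]] := int_form_bound (algebraic_ratio algb algc) irr.
exists D, T0, (c / `|l1%:~R|); split; first by rewrite divr_gt0 // normr_gt0.
move=> p n m k pT n0 m0 k0 hn hm hk.
have := H p l2 l1 l1 l3 n m k n pT n0 m0 k0 n0 (half _ _ _ _ _ L2 L1 hn hm) (half _ _ _ _ _ L1 L3 hk hn).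
rewrite /=; set P := _ - _; set Q := _ - _ => B.
have E : lform a b c n m k = c / l1%:~R * (b / c * P - Q).
  rewrite /lform /P /Q; apply: (mulIf l1r).
  have -> : (a * ln n%:R - b * ln m%:R - c * ln k%:R) * l1%:~R =
    (a * l1%:~R) * ln n%:R - b * ln m%:R * l1%:~R - c * ln k%:R * l1%:~R by ring.
  by rewrite rel; field; rewrite cn l1r.
have [/eqP P0|/eqP P0] := boolP (P == 0); last first.
  left; rewrite E normrM normrM normfV (gtr0_norm c0) ler_pM2l ?divr_gt0 ?normr_gt0 //.
  by apply: B; left.
have [/eqP Q0|/eqP Q0] := boolP (Q == 0); last first.
  left; rewrite E normrM normrM normfV (gtr0_norm c0) ler_pM2l ?divr_gt0 ?normr_gt0 //.
  by apply: B; right.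
right; have e1 : l2%:~R * ln n%:R = l1%:~R * ln (m%:R : R) by move/eqP: P0; rewrite /P subr_eq0 => /eqP.
have e2 : l3%:~R * ln n%:R = l1%:~R * ln (k%:R : R) by move/eqP: Q0; rewrite /Q subr_eq0 eq_sym => /eqP.
split=> //; first by rewrite E P0 Q0 mulr0 subrr mulr0.
apply: (mulfI l1r); rewrite mulrCA -e1 [RHS]mulrCA -e2; ring.
Qed.

(** The qualitative Gelfond-Schneider statement follows from the quantitative one: some [p] is large
    enough for the given triple, and then the lower bound of [lform_relations] is positive. *)
Lemma lform_eq0 n m k : (0 < n)%N -> (0 < m)%N -> (0 < k)%N -> lform a b c n m k = 0 ->
  [/\ l2%:~R * ln n%:R = l1%:~R * ln (m%:R : R),
      l3%:~R * ln n%:R = l1%:~R * ln (k%:R : R) &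
      l3%:~R * ln m%:R = l2%:~R * ln (k%:R : R)].
Proof.
move=> n0 m0 k0 F0; have [D [T0 [kap [kap0 H]]]] := lform_relations.
pose p := (T0 + (Num.truncn (2 * L%:R * (ln (n%:R : R) + ln (m%:R : R) + ln (k%:R : R)))).+1)%N.
have ln0 := @ln_nat_ge0 R n; have lm0 := @ln_nat_ge0 R m; have lk0 := @ln_nat_ge0 R k.
have S0 : 0 <= 2 * L%:R * (ln (n%:R : R) + ln (m%:R : R) + ln (k%:R : R)).
  by rewrite !mulr_ge0 ?addr_ge0.
have p1 : 1 <= p%:R :> R by rewrite ler1n /p addnS.
have pS : 2 * L%:R * (ln (n%:R : R) + ln (m%:R : R) + ln (k%:R : R)) <= p%:R ^+ 3.
  apply: (@le_trans _ _ p%:R); last by rewrite exprS ler_peMr ?(le_trans ler01) // exprn_ege1.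
  have /andP[_ /ltW h] := truncn_itv S0; apply: le_trans h _.
  by rewrite ler_nat /p leq_addl.
have bd (x y z : R) : 0 <= x -> 0 <= y -> 0 <= z -> 2 * L%:R * (x + y + z) <= p%:R ^+ 3 -> L%:R * x <= p%:R ^+ 3 / 2.
  move=> x0 y0 z0 h; rewrite ler_pdivlMr //.
  have : 0 <= L%:R * y by rewrite mulr_ge0. have : 0 <= L%:R * z by rewrite mulr_ge0.
  by move: h; lra.
have bn := bd _ _ _ ln0 lm0 lk0 pS.
have pS2 : 2 * L%:R * (ln (m%:R : R) + ln n%:R + ln k%:R) <= p%:R ^+ 3 by rewrite [ln m%:R + _]addrC.
have pS3 : 2 * L%:R * (ln (k%:R : R) + ln n%:R + ln m%:R) <= p%:R ^+ 3 by rewrite -addrA [ln k%:R + _]addrC.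
have bm := bd _ _ _ lm0 ln0 lk0 pS2; have bk := bd _ _ _ lk0 ln0 lm0 pS3.
have {}H := H p n m k (leq_addr _ _) n0 m0 k0 bn bm bk; case: H => [|[//]].
rewrite F0 normr0 => h; suff : 0 < kap * p%:R ^- (D * p ^ 8) by move=> h2; have := le_lt_trans h h2; rewrite ltxx.
by rewrite mulr_gt0 // invr_gt0 exprn_gt0 // (lt_le_trans ltr01).
Qed.

Lemma ln_nat_eq0 n : (0 < n)%N -> ln (n%:R : R) = 0 -> n = 1%N.
Proof.
move=> n0 h; apply/eqP; rewrite -(@eqr_nat R) -[n%:R]lnK ?posrE ?ltr0n // h expR0 //.
Qed.

Lemma opposite_signs (e f : int) (x y : R) : e * f < 0 -> 0 <= x -> 0 <= y ->
  e%:~R * x = f%:~R * y -> x = 0 /\ y = 0.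
Proof.
move=> ef x0 y0 h.
have H : (e%:~R * f%:~R : R) < 0 by rewrite -intrM ltrz0.
have e0 : e%:~R != 0 :> R by apply: contraTneq H => ->; rewrite mul0r ltxx.
have f0 : f%:~R != 0 :> R by apply: contraTneq H => ->; rewrite mulr0 ltxx.
have k : (e%:~R * f%:~R) * x = f%:~R ^+ 2 * y by rewrite mulrAC h expr2; ring.
have k1 : (e%:~R * f%:~R) * x <= 0 by rewrite mulr_le0_ge0 // ltW.
have k2 : 0 <= f%:~R ^+ 2 * y by rewrite mulr_ge0 // sqr_ge0.
have x00 : x = 0.
  have : (e%:~R * f%:~R) * x == 0 by rewrite eq_le k1 k.
  by rewrite mulf_eq0 (lt_eqF H) /= => /eqP.
split => //; move/eqP: h; rewrite x00 mulr0 eq_sym mulf_eq0 (negbTE f0) /= => /eqP //.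
Qed.

(** Proportional nonnegative logarithms with coefficients of opposite signs vanish. If [l1 = 0], the
    relation forces [l2] and [l3] to have opposite signs. If [l1] is nonzero and neither [l2] nor
    [l3] has the sign opposite to it, all nonzero entries agree in sign, and by normalization they
    are positive, contrary to the negative entry. *)
Lemma diag_trivial n m k : sign_normalized l1 l2 l3 -> l1 < 0 \/ l2 < 0 \/ l3 < 0 ->
  (0 < n)%N -> (0 < m)%N -> (0 < k)%N -> lform a b c n m k = 0 -> [/\ n = 1, m = 1 & k = 1]%N.
Proof.
move=> sgn neg n0 m0 k0 /(lform_eq0 n0 m0 k0)[E1 E2 E3].
have ln0 := @ln_nat_ge0 R n; have lm0 := @ln_nat_ge0 R m; have lk0 := @ln_nat_ge0 R k.
have fin : ln (n%:R : R) = 0 -> ln (m%:R : R) = 0 -> ln (k%:R : R) = 0 -> [/\ n = 1, m = 1 & k = 1]%N.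
  by move=> h1 h2 h3; split; exact: ln_nat_eq0.
have [l10|l10] := eqVneq l1 0.
  have rel0 : b * l2%:~R + c * l3%:~R = 0 by rewrite -rel l10 mulr0.
  have l23 : l2 * l3 < 0.
    have h23 : l2 < 0 -> 0 < l3.
      move=> h; rewrite -(ltr0z R) -(pmulr_rgt0 _ c0).
      have : b * l2%:~R < 0 by rewrite pmulr_rlt0 // ltrz0.
      by move: rel0; lra.
    have h32 : l3 < 0 -> 0 < l2.
      move=> h; rewrite -(ltr0z R) -(pmulr_rgt0 _ b0).
      have : c * l3%:~R < 0 by rewrite pmulr_rlt0 // ltrz0.
      by move: rel0; lra.
    case: neg => [|[h|h]]; first by rewrite l10 ltxx.
      by rewrite nmulr_rlt0 // h23.
    by rewrite pmulr_rlt0 // h32.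
  have l2n : l2 != 0 by apply: contraTneq l23 => ->; rewrite mul0r ltxx.
  have nn : ln (n%:R : R) = 0.
    by move/eqP: E1; rewrite l10 mul0r mulf_eq0 intr_eq0 (negbTE l2n) /= => /eqP.
  rewrite mulrC in l23; have [h1 h2] := opposite_signs l23 lm0 lk0 E3.
  exact: fin.
have l1r : l1%:~R != 0 :> R by rewrite intr_eq0.
case: (ltP (l2 * l1) 0) => h12.
  have [h1 h2] := opposite_signs h12 ln0 lm0 E1; apply: fin => //.
  by move/eqP: E2; rewrite h1 mulr0 eq_sym mulf_eq0 (negbTE l1r) /= => /eqP.
case: (ltP (l3 * l1) 0) => h13.
  have [h1 h2] := opposite_signs h13 ln0 lk0 E2; apply: fin => //.
  by move/eqP: E1; rewrite h1 mulr0 eq_sym mulf_eq0 (negbTE l1r) /= => /eqP.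
exfalso; case: (ltgtP l1 0) => [h|h|h]; last by rewrite h eqxx in l10.
- rewrite nmulr_lge0 // in h12; rewrite nmulr_lge0 // in h13.
  have S : 0 < l1.
    apply: sgn; rewrite ?inE ?eqxx // => x y.
    have ng z : z \in [:: l1; l2; l3] -> z != 0 -> sgz z = -1.
      rewrite !inE => /or3P[] /eqP -> z0; apply: ltr0_sgz => //; rewrite lt_neqAle z0 //.
    by move=> xin yin x0 y0; rewrite !ng.
  by rewrite ltNge (ltW h) in S.
- rewrite pmulr_lge0 // in h12; rewrite pmulr_lge0 // in h13.
  by case: neg => [|[]]; rewrite ltNge ?(ltW h) ?h12 ?h13.
Qed.

(** The relations say [n ^ l2 = m ^ l1] and [n ^ l3 = k ^ l1], so [l1] divides [l2] and [l3] times
    every prime valuation of [n]. As [l1] is coprime to the gcd of [l2] and [l3], it divides the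
    valuations, and [n] is an exact power. Positivity of [l1] comes from [b, c > 0]. *)
Lemma diag_powers n m k : gcdz (gcdz l1 l2) l3 = 1 -> 0 <= l1 -> 0 <= l2 -> 0 <= l3 ->
  (0 < n)%N -> (0 < m)%N -> (0 < k)%N -> lform a b c n m k = 0 ->
  exists r, [/\ (0 < r)%N, n = (r ^ `|l1|)%N, m = (r ^ `|l2|)%N & k = (r ^ `|l3|)%N].
Proof.
move=> g1 l1p l2p l3p n0 m0 k0 F0; have [E1 E2 E3] := lform_eq0 n0 m0 k0 F0.
have l10 : (0 < `|l1|)%N.
  rewrite absz_gt0; apply/negP => /eqP l10.
  have rel0 : b * l2%:~R + c * l3%:~R = 0 by rewrite -rel l10 mulr0.
  have p2 : 0 <= b * l2%:~R by rewrite mulr_ge0 ?ler0z // ltW.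
  have p3 : 0 <= c * l3%:~R by rewrite mulr_ge0 ?ler0z // ltW.
  move/eqP: rel0; rewrite paddr_eq0 // !mulf_eq0 (gt_eqF b0) (gt_eqF c0) /= !intr_eq0 => /andP[/eqP h2 /eqP h3].
  by apply: nz; rewrite l10 h2 h3.
have absE (l : int) : 0 <= l -> l%:~R = `|l|%:R :> R by move=> h; rewrite -{1}(gez0_abs h).
rewrite !absE // in E1 E2 E3.
have G (i j x y : nat) : (0 < x)%N -> (0 < y)%N -> i%:R * ln (x%:R : R) = j%:R * ln y%:R -> (x ^ i = y ^ j)%N.
  move=> x0 y0; rewrite -!ln_natX // => /ln_inj; rewrite !posrE !ltr0n !expn_gt0 x0 y0 => /(_ isT isT) /eqP.
  by rewrite eqr_nat => /eqP.
have e1 := G _ _ _ _ n0 m0 E1; have e2 := G _ _ _ _ n0 k0 E2.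
have gc : gcdn (gcdn `|l1| `|l2|) `|l3| = 1%N by move: g1; rewrite /gcdz => -[].
have [r [r0 nr]] : exists r, (0 < r)%N /\ n = (r ^ `|l1|)%N.
  apply: nat_root => // p pp.
  have d1 : (`|l1| %| `|l2| * logn p n)%N by rewrite -lognX e1 lognX dvdn_mulr.
  have d2 : (`|l1| %| `|l3| * logn p n)%N by rewrite -lognX e2 lognX dvdn_mulr.
  have : (`|l1| %| gcdn `|l2| `|l3| * logn p n)%N by rewrite muln_gcdl dvdn_gcd d1.
  by rewrite Gauss_dvdr // /coprime gcdnA gc.
exists r; split => //.
  have : (m ^ `|l1| = (r ^ `|l2|) ^ `|l1|)%N by rewrite -e1 nr -!expnM mulnC.
  by move/eqP; rewrite eqn_exp2r // => /eqP.
have : (k ^ `|l1| = (r ^ `|l3|) ^ `|l1|)%N by rewrite -e2 nr -!expnM mulnC.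
by move/eqP; rewrite eqn_exp2r // => /eqP.
Qed.

Lemma lform_powers r : 0 <= l1 -> 0 <= l2 -> 0 <= l3 -> (0 < r)%N ->
  lform a b c (r ^ `|l1|) (r ^ `|l2|) (r ^ `|l3|) = 0.
Proof.
move=> l1p l2p l3p r0; rewrite /lform !ln_natX //.
have absE (l : int) : 0 <= l -> `|l|%:R = l%:~R :> R by move=> h; rewrite -{2}(gez0_abs h).
rewrite !absE //; have -> : a * (l1%:~R * ln r%:R) = (a * l1%:~R) * ln r%:R by rewrite mulrA.
rewrite rel; ring.
Qed.

(** From [a < c <= b] one gets [l1 > l2 + l3 > 0]. Hence the argument of zeta in case (ii) is at
    least 3/2, inside the half plane of convergence. *)
Lemma exponents_ge3 : 0 <= l1 -> 0 <= l2 -> 0 <= l3 -> a < c -> c <= b ->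
  (0 < `|l1|)%N /\ (3 <= `|l1| + `|l2| + `|l3|)%N.
Proof.
move=> l1p l2p l3p ac cb.
have absE (l : int) : 0 <= l -> l%:~R = `|l|%:R :> R by move=> h; rewrite -{1}(gez0_abs h).
have := rel; rewrite !absE //.
have nz' : (`|l1| + `|l2| + `|l3|)%N <> 0%N.
  move=> /eqP; rewrite !addn_eq0 !absz_eq0 => /andP[/andP[/eqP h1 /eqP h2] /eqP h3].
  by apply: nz; rewrite h1 h2 h3.
move: nz'; move: (`|l1|)%N (`|l2|)%N (`|l3|)%N => x y z xyz e.
have bz : b * y%:R >= a * y%:R by rewrite ler_wpM2r // (le_trans (ltW ac)).
have cz : c * z%:R >= a * z%:R by rewrite ler_wpM2r // ltW.
have x0 : (0 < x)%N.
  rewrite lt0n; apply/negP => /eqP x0; move: e; rewrite x0 mulr0 => /esym/eqP.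
  rewrite paddr_eq0 ?mulr_ge0 ?(ltW b0) ?(ltW c0) // !mulf_eq0 (gt_eqF b0) (gt_eqF c0) /= !pnatr_eq0.
  by move=> /andP[/eqP y0 /eqP z0]; apply: xyz; rewrite x0 y0 z0.
have yz : (0 < y + z)%N.
  rewrite lt0n addn_eq0; apply/negP => /andP[/eqP y0 /eqP z0].
  move: e; rewrite y0 z0 !mulr0 addr0 => /eqP; rewrite mulf_eq0 (gt_eqF a0) /= pnatr_eq0 => /eqP x00.
  by rewrite x00 in x0.
split => //; have yzx : (y + z < x)%N.
  rewrite -(ltr_nat R) -(ltr_pM2l a0) e natrD mulrDr.
  case: (posnP z) => z0; last first.
    by apply: ler_ltD => //; rewrite ltr_pM2r ?ltr0n.
  by rewrite z0 !mulr0 !addr0 ltr_pM2r ?(lt_le_trans ac) // ltr0n; move: yz; rewrite z0 addn0.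
by move: x0 yz yzx; lia.
Qed.

End Relation.

End LinearForms.

(** * The moment *)

Section MomentApproximation.
Context {R : realType}.
Local Notation C := R[i].
Local Notation nc := (@Normc.normc R).
Implicit Types (x y t T X : R) (n m k p N M : nat).

(** On the scale [T = expR (x ^ 9)]: a saving of a power of [T] pays for any power of the logarithm
    and for [expR (- x ^ 3)] besides. *)
Lemma absorb (d : R) k : 0 < d -> exists x0 : R, forall x, x0 <= x ->
  (1 + x ^+ 9) ^+ k * expR ((1 - d) * x ^+ 9) <= expR (x ^+ 9) * expR (- x ^+ 3).
Proof.
move=> d0; exists (Num.max 1 ((9 * k%:R + 1) / d)) => x; rewrite ge_max => /andP[x1 xd].
have x0 : 0 <= x by exact: le_trans x1.
have dx : 9 * k%:R + 1 <= d * x by rewrite [d * x]mulrC -ler_pdivrMr.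
have x9 : 1 + x ^+ 9 <= expR (9 * x).
  apply: (@le_trans _ _ ((1 + x) ^+ 9)).
    have x3 : 1 + x ^+ 3 <= (1 + x) ^+ 3.
      have -> : (1 + x) ^+ 3 = 1 + x ^+ 3 + 3 * x + 3 * x ^+ 2 by ring.
      by rewrite -addrA lerDl addr_ge0 // mulr_ge0 // exprn_ge0.
    have y3 : 1 + (x ^+ 3) ^+ 3 <= (1 + x ^+ 3) ^+ 3.
      have : 0 <= x ^+ 3 by rewrite exprn_ge0.
      move: (x ^+ 3) => y y0.
      have -> : (1 + y) ^+ 3 = 1 + y ^+ 3 + 3 * y + 3 * y ^+ 2 by ring.
      by rewrite -addrA lerDl addr_ge0 // mulr_ge0 // exprn_ge0.
    rewrite (exprM x 3 3) (exprM (1 + x) 3 3); apply: le_trans y3 _.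
    by rewrite lerXn2r ?nnegrE ?addr_ge0 ?exprn_ge0 // addr_ge0.
  by rewrite expRM_natl lerXn2r ?nnegrE ?addr_ge0 ?expR_ge0 // expR_ge1Dx.
apply: (@le_trans _ _ (expR (9 * x) ^+ k * expR ((1 - d) * x ^+ 9))).
  by rewrite ler_wpM2r ?expR_ge0 // lerXn2r ?nnegrE ?expR_ge0 ?addr_ge0 ?exprn_ge0.
rewrite -expRM_natl -!expRD ler_expR.
have x3 : x <= x ^+ 3 by rewrite exprS ler_peMr // exprn_ege1.
have e : x ^+ 9 = x ^+ 6 * x ^+ 3 by rewrite -exprD.
have x6 : x <= x ^+ 6 by rewrite exprS ler_peMr // exprn_ege1.
have p3 : 0 <= x ^+ 3 by rewrite exprn_ge0.
have h1 : k%:R * (9 * x) <= 9 * k%:R * x ^+ 3.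
  by rewrite mulrA [k%:R * 9]mulrC ler_wpM2l // mulr_ge0.
have h2 : (9 * k%:R + 1) * x ^+ 3 <= d * x ^+ 9.
  rewrite e mulrA ler_wpM2r // (le_trans dx) // ler_wpM2l // ltW //.
have -> : (1 - d) * x ^+ 9 = x ^+ 9 - d * x ^+ 9 by ring.
move: h1 h2; rewrite mulrDl mul1r; clear; lra.
Qed.

(* The loss in the lower bound for linear forms in logarithms of numbers up to
   [expR (x ^ 3)], where [p] has order [x], is at most the square root of [T = expR (x ^ 9)]. *)
Lemma gelfond_loss (D : nat) (q : R) : 1 <= q -> exists x0 : R, forall x, x0 <= x ->
  forall p, (0 < p)%N -> p%:R <= 2 * q * x -> p%:R ^+ (D * p ^ 8) <= expR (x ^+ 9 / 2) :> R.
Proof.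
move=> q1; have q0 : 0 <= q by exact: le_trans q1.
(* [ln p] is estimated by twice the square root of [z]; [B] gathers the constants so that
   [B <= Num.sqrt z] is what has to hold. *)
pose B : R := 8 * q * D%:R * (2 * q) ^+ 8.
have B0 : 0 <= B by rewrite !mulr_ge0 ?exprn_ge0 ?mulr_ge0.
exists (1 + B ^+ 2) => x Bx p p0 px.
have x1 : 1 <= x by apply: le_trans Bx; rewrite lerDl sqr_ge0.
have x0 : 0 <= x by exact: le_trans x1.
set z := 2 * q * x in px.
have zx : x <= z by rewrite /z -mulrA; have : 1 * x <= q * x by [rewrite ler_wpM2r]; move: x0; lra.
have z1 : 1 <= z by exact: le_trans zx.
have sB : B <= Num.sqrt z.
  rewrite -[B]ger0_norm // -sqrtr_sqr ler_wsqrtr // (le_trans _ zx) // (le_trans _ Bx) //.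
  by rewrite lerDr.
have s0 := sqrtr_ge0 z.
have zs : Num.sqrt z * Num.sqrt z = z by rewrite -expr2 sqr_sqrtr // (le_trans ler01).
have lz : ln z <= 2 * Num.sqrt z.
  have sp : 0 < Num.sqrt z by rewrite sqrtr_gt0 (lt_le_trans ltr01).
  have -> : ln z = 2 * ln (Num.sqrt z) by rewrite -{1}zs lnM ?posrE // mulr_natl mulr2n.
  rewrite ler_pM2l //.
  have := @le_ln1Dx R (Num.sqrt z - 1); have -> : 1 + (Num.sqrt z - 1) = Num.sqrt z by [ring]; move=> h.
  apply: le_trans (h _) _; last by rewrite gerBl.
  by rewrite ltrBrDr addrC subrr.
have p0' : 0 < p%:R :> R by rewrite ltr0n.
have lp : ln p%:R <= ln z by rewrite ler_ln ?posrE // (lt_le_trans ltr01).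
rewrite -[p%:R]lnK ?posrE // -expRM_natl ler_expR.
have lp0 := @ln_nat_ge0 R p.
have e1 : (D * p ^ 8)%:R <= D%:R * (z ^+ 8) :> R.
  by rewrite natrM natrX ler_wpM2l // lerXn2r ?nnegrE // (le_trans _ z1).
apply: (@le_trans _ _ (D%:R * z ^+ 8 * (2 * Num.sqrt z))).
  apply: ler_pM => //; exact: le_trans lz.
have -> : D%:R * z ^+ 8 * (2 * Num.sqrt z) = (D%:R * (2 * q) ^+ 8 * 2 * Num.sqrt z) * x ^+ 8.
  by rewrite /z [(2 * q * x) ^+ 8]exprMn; ring.
have -> : x ^+ 9 / 2 = (x / 2) * x ^+ 8 by rewrite exprS; ring.
rewrite ler_wpM2r ?exprn_ge0 // ler_pdivlMr //.
have q0' : 0 < q by exact: lt_le_trans q1.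
rewrite -(ler_pM2l (x := 2 * q)) ?mulr_gt0 // -/z.
have -> : 2 * q * (D%:R * (2 * q) ^+ 8 * 2 * Num.sqrt z * 2) = B * Num.sqrt z by rewrite /B; ring.
by rewrite -{2}zs ler_wpM2r.
Qed.

(** The length is [T ^ (1 + u / 2)]. It exceeds [T] by a power, so that some [k] satisfies the
    condition of [line_truncation], and still [(1 + u / 2) * (1 - u) <= 1 - u / 2], so that
    [N ^ (1 - u)] saves a power of [T]. *)
Lemma cutoff_length (a u : R) : 0 < a -> 0 < u -> u < 1 -> exists k x0, forall x, x0 <= x ->
  exists N, [/\ expR (x ^+ 9) <= N.+1%:R, a * expR (x ^+ 9) <= N.+2%:R,
    (a * expR (x ^+ 9)) ^+ k.+2 <= N.+2%:R ^+ k.+1,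
    rpw N.+2 (1 - u) <= expR 2 * expR ((1 - u / 2) * x ^+ 9) & ln (N.+2%:R : R) <= 2 + 2 * x ^+ 9].
Proof.
move=> a0 u0 u1; pose e := u / 2; have e0 : 0 < e by rewrite divr_gt0.
pose k := Num.truncn (2 / e).
have ek : 2 <= e * k.+1%:R.
  have ie : 0 <= 2 / e by rewrite divr_ge0 // ltW.
  have /andP[_ /ltW h] := truncn_itv ie; have := ler_wpM2l (ltW e0) h.
  by rewrite mulrC divfK ?gt_eqF.
pose la := `|ln a|.
exists k, (Num.max 1 (Num.max (la / e + 1) (la * k.+2%:R + 1))) => x.
rewrite !ge_max => /and3P[x1 xla xlk].
have x0 : 0 <= x by exact: le_trans x1.
have x9x : x <= x ^+ 9 by rewrite exprS ler_peMr // exprn_ege1.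
move: (x ^+ 9) x9x => y xy; have y0 : 0 <= y by exact: le_trans xy.
pose g := expR ((1 + e) * y); have g0 : 0 <= g by exact: expR_ge0.
pose N := Num.truncn g; have /andP[] := truncn_itv g0; rewrite -/N => N1 N2.
have N3 : N.+1%:R <= N.+2%:R :> R by rewrite ler_nat.
have gN : g <= N.+2%:R by rewrite (le_trans _ N3) // ltW.
have e1 : e <= 1 by rewrite ler_pdivrMr // mul1r (le_trans (ltW u1)) // ler1n.
have lnN : ln (N.+2%:R : R) <= 2 + (1 + e) * y.
  have h : N.+2%:R <= expR (2 + (1 + e) * y).
    rewrite expRD -/g; have e2 : 1 + 2 <= expR 2 :> R by exact: expR_ge1Dx.
    have g1 : 1 <= g by rewrite (le_trans _ (expR_ge1Dx _)) // lerDl mulr_ge0 // addr_ge0 // ltW.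
    have h2 : (1 + 2) * g <= expR 2 * g by rewrite ler_wpM2r.
    apply: le_trans h2; have -> : N.+2%:R = N%:R + 2 :> R by rewrite -addn2 natrD.
    by move: N1 g1; clear; lra.
  by rewrite -[leRHS]expRK ler_ln ?posrE ?expR_gt0 ?ltr0n.
have laa : ln a <= la by exact: ler_norm.
have aT : a * expR y = expR (ln a + y) by rewrite expRD lnK.
exists N; split.
- by rewrite (le_trans _ (ltW N2)) // ler_expR ler_peMl // lerDl ltW.
- rewrite aT (le_trans _ gN) // ler_expR mulrDl mul1r addrC lerD2l.
  apply: le_trans laa _; rewrite mulrC -ler_pdivrMr //; move: xla xy; clear; lra.
- apply: (@le_trans _ _ (g ^+ k.+1)); last by rewrite lerXn2r ?nnegrE.
  rewrite aT -!expRM_natl ler_expR.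
  have h1 : k.+2%:R * ln a <= y.
    have : k.+2%:R * ln a <= k.+2%:R * la by rewrite ler_wpM2l.
    by move: xlk xy; rewrite [la * _]mulrC; clear; lra.
  have h2 : 2 * y <= (e * k.+1%:R) * y by rewrite ler_wpM2r.
  rewrite mulrDr; have -> : k.+2%:R * y = k.+1%:R * y + y by rewrite -[k.+2%:R]natr1 mulrDl mul1r.
  have -> : k.+1%:R * ((1 + e) * y) = k.+1%:R * y + e * k.+1%:R * y by ring.
  by move: h1 h2; set r := k.+1%:R * y; clear; lra.
- rewrite -expRD /rpw ler_expR.
  have q1 : (1 - u) * ln N.+2%:R <= (1 - u) * (2 + (1 + e) * y) by rewrite ler_pM2l // subr_gt0.
  have q2 : (1 + e) * (1 - u) * y <= (1 - u / 2) * y.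
    rewrite ler_wpM2r //; have : 0 <= u * u by rewrite mulr_ge0 // ltW.
    by rewrite /e; clear; lra.
  by apply: le_trans q1 _; move: q2 u0; clear; lra.
- apply: (le_trans lnN); rewrite lerD2l ler_wpM2r //; move: e1; clear; lra.
Qed.

Section Params.
Variables (a b c : R).
Hypotheses (a0 : 0 < a) (ac : a < c) (cb : c <= b).
Variables (L : nat).
Hypothesis gelfond : exists (D T0 : nat) (kap : R), 0 < kap /\ forall p n m k, (T0 <= p)%N ->
  (0 < n)%N -> (0 < m)%N -> (0 < k)%N ->
  L%:R * ln (n%:R : R) <= p%:R ^+ 3 / 2 -> L%:R * ln (m%:R : R) <= p%:R ^+ 3 / 2 ->
  L%:R * ln (k%:R : R) <= p%:R ^+ 3 / 2 ->
  lform a b c n m k != 0 -> kap * p%:R ^- (D * p ^ 8) <= `|lform a b c n m k|.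

Let c0 : 0 < c := lt_trans a0 ac.
Let b0 : 0 < b := lt_le_trans c0 cb.

(** For [m, k] up to [expR (x ^ 3)] an integer near [nearX m k] has logarithm [O(x ^ 3)] too. The
    bound for linear forms applies with [p] of order [x], and by [gelfond_loss] it costs at most the
    square root of [T]. *)
Lemma near_bound : exists (C1 x0 : R), 0 <= C1 /\ forall x, x0 <= x ->
  forall n m k M1, M1%:R <= expR (x ^+ 3) -> (0 < n)%N -> (0 < m <= M1)%N -> (0 < k <= M1)%N ->
  near (nearX a b c m k) n -> lform a b c n m k != 0 ->
  2 / `|lform a b c n m k| <= C1 * expR (x ^+ 9 / 2).
Proof.
have [D [T0 [kap [kap0 H]]]] := gelfond.
pose q0 := 1 + (b + c) / a.
have bca : 0 <= (b + c) / a by rewrite divr_ge0 ?addr_ge0 // ltW.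
have q01 : 1 <= q0 by rewrite /q0 lerDl.
(* [q0 * x ^ 3] bounds all three logarithms, and [p >= q * x] gives
   [p ^ 3 >= 2 * L * q0 * x ^ 3]. *)
pose q := 1 + 2 * L%:R * q0.
have q1 : 1 <= q by rewrite lerDl !mulr_ge0 // (le_trans ler01).
have [x0 Hx0] := gelfond_loss D q1.
exists (2 / kap), (Num.max x0 (Num.max 1 T0%:R)); split; first by rewrite divr_ge0 // ltW.
move=> x; rewrite !ge_max => /and3P[xx0 x1 xT] n m k M1 M1x n0 /andP[m0 mM] /andP[k0 kM] nr L0.
have xp : 0 <= x by exact: le_trans x1.
have x3 : 1 <= x ^+ 3 by rewrite exprn_ege1.
have lnb (y : nat) : (0 < y)%N -> (y <= M1)%N -> ln (y%:R : R) <= x ^+ 3.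
  move=> y0 yM; rewrite -[leRHS]expRK ler_ln ?posrE ?ltr0n ?expR_gt0 //.
  by rewrite (le_trans _ M1x) // ler_nat.
have lm := lnb m m0 mM; have lk := lnb k k0 kM.
have lX : ln (nearX a b c m k) <= (b + c) / a * x ^+ 3.
  rewrite /nearX expRK mulrAC ler_wpM2r ?invr_ge0 ?(ltW a0) // mulrDl.
  by apply: lerD; rewrite ler_pM2l.
have X1 := nearX_ge1 a0 (ltW b0) (ltW c0) m k.
have lnn : ln (n%:R : R) <= q0 * x ^+ 3.
  have nX : n%:R <= 2 * nearX a b c m k :> R.
    by move: nr X1; rewrite /near ltr_norml => /andP[_]; lra.
  apply: (@le_trans _ _ (ln (2 * nearX a b c m k))).
    by rewrite ler_ln ?posrE ?ltr0n // mulr_gt0 // (lt_le_trans ltr01).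
  have X0 : 0 < nearX a b c m k by exact: lt_le_trans X1.
  rewrite lnM ?posrE // /q0 mulrDl mul1r; apply: lerD => //.
  by apply: le_trans x3; apply: le_trans (@le_ln1Dx R 1 _) _.
pose p := (Num.truncn (q * x)).+1.
have qx0 : 0 <= q * x by rewrite mulr_ge0 // (le_trans ler01).
have /andP[p1 p2] := truncn_itv qx0.
have pq : q * x <= p%:R by exact: ltW.
have pq2 : p%:R <= 2 * q * x.
  have -> : p%:R = (Num.truncn (q * x))%:R + 1 :> R by rewrite natr1.
  rewrite -mulrA; have : 1 <= q * x by exact: mulr_ege1.
  by move: p1; lra.
have p3 : 2 * L%:R * q0 * x ^+ 3 <= p%:R ^+ 3.
  apply: (@le_trans _ _ ((q * x) ^+ 3)); last by rewrite lerXn2r ?nnegrE.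
  rewrite exprMn ler_wpM2r ?exprn_ge0 // (@le_trans _ _ q) //; first by rewrite /q lerDr.
  by rewrite exprS ler_peMr ?exprn_ege1 // (le_trans ler01).
have lq (y : nat) : ln (y%:R : R) <= q0 * x ^+ 3 -> L%:R * ln (y%:R : R) <= p%:R ^+ 3 / 2.
  move=> h; rewrite ler_pdivlMr //; apply: le_trans p3.
  have : L%:R * ln (y%:R : R) <= L%:R * (q0 * x ^+ 3) by rewrite ler_wpM2l.
  by lra.
have q0x : x ^+ 3 <= q0 * x ^+ 3 by rewrite ler_peMl // exprn_ge0.
have Tp : (T0 <= p)%N.
  rewrite -(ler_nat R) (le_trans xT) // (le_trans _ pq) // ler_peMl //.
have B := H p n m k Tp n0 m0 k0 (lq n lnn) (lq m (le_trans lm q0x)) (lq k (le_trans lk q0x)) L0.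
have E := Hx0 x xx0 p isT pq2.
have pp : 0 < p%:R ^+ (D * p ^ 8) :> R by rewrite exprn_gt0 // ltr0n.
rewrite ler_pdivrMr ?normr_gt0 //.
apply: (@le_trans _ _ (2 / kap * expR (x ^+ 9 / 2) * (kap * p%:R ^- (D * p ^ 8)))); last first.
  by rewrite ler_wpM2l // mulr_ge0 ?expR_ge0 // divr_ge0 // ltW.
have -> : 2 / kap * expR (x ^+ 9 / 2) * (kap * p%:R ^- (D * p ^ 8)) = 2 * (expR (x ^+ 9 / 2) / p%:R ^+ (D * p ^ 8)).
  by field; rewrite !gt_eqF.
by rewrite ler_peMr // ler_pdivlMr // mul1r.
Qed.

(* [T = expR (x ^ 9)], so that [x ^ 3] is [(ln T) ^ (1 / 3)]. *)
Lemma moment_approx : exists C1 eta x0 t0 : R, [/\ 0 <= C1, 0 < eta, eta <= 1, 0 < t0 &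
  exists u v w : R, [/\ 0 < u, 1 < v & 1 < w] /\
  (forall n m k, lform a b c n m k = 0 -> weight u v w n m k = rpw n (- 2^-1) * rpw m (- 2^-1) * rpw k (- 2^-1)) /\
  forall x, x0 <= x -> exists N M0, [/\ expR (x ^+ 9) <= N%:R & forall M, (M0 <= M)%N ->
    nc (zeta_moment a b c (expR (x ^+ 9)) - ((expR (x ^+ 9) - t0) * diag_sum a b c u v w N M)%:C) <=
    C1 * (expR (x ^+ 9) * expR (- (eta * x ^+ 3)))]].
Proof.
have arith1 (y : R) : 0 <= y -> 2 + 2 * y <= 4 * (1 + y) - 1 by lra.
have arith2 (B y l : R) : 0 <= B -> 0 <= y -> - l <= B -> y - l <= (1 + B) * (1 + y).
  by move=> B0 y0; have : 0 <= B * y by [rewrite mulr_ge0]; lra.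
have arith3 (B y l : R) : 0 <= B -> 0 <= y -> l <= B -> 1 + l + y <= (1 + B) * (1 + y).
  by move=> B0 y0; have : 0 <= B * y by [rewrite mulr_ge0]; lra.
have arith4 (B y l : R) : 0 <= B -> l <= B -> 3 / 4 * (l + y) <= B + (1 - 1 / 4) * y by lra.
(* The midpoint of the admissible interval from [1 / (2 c)] to [1 / (2 a)]. *)
pose s1 := (a^-1 + c^-1) / 4.
have s10 : 0 < s1 by rewrite divr_gt0 // addr_gt0 ?invr_gt0.
have ac1 : a / c < 1 by rewrite ltr_pdivrMr // mul1r.
have ca1 : 1 < c / a by rewrite ltr_pdivlMr // mul1r.
have as1 : a * s1 < 2^-1.
  have -> : a * s1 = (1 + a / c) / 4 by rewrite /s1; field; rewrite !gt_eqF.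
  by move: ac1; lra.
have cs1 : 2^-1 < c * s1.
  have -> : c * s1 = (1 + c / a) / 4 by rewrite /s1; field; rewrite !gt_eqF.
  by move: ca1; lra.
have bs1 : c * s1 <= b * s1 by rewrite ler_pM2r.
have as0 : 0 < a * s1 by rewrite mulr_gt0.
pose u := 2^-1 + a * - s1; pose v := 2^-1 - b * - s1; pose w := 2^-1 - c * - s1.
have u0 : 0 < u by rewrite /u mulrN subr_gt0.
have u1 : u < 1 by rewrite /u mulrN; move: as0; lra.
have w1 : 1 < w by rewrite /w mulrN opprK; move: cs1; lra.
have v1 : 1 < v by rewrite /v mulrN opprK; move: cs1 bs1; lra.
(* From here on [a * t >= 3], the height from which the estimates for zeta hold; the initial segment
   contributes the constant [I0]. *)
pose t0 := 3 / a; have t00 : 0 < t0 by rewrite divr_gt0.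
have [kk [xd Hd]] := cutoff_length a0 u0 u1.
have [Kt Kt0 HKt] := line_truncation b c a0 u0 v1 w1 kk u1.
have [Ko Ko0 HKo] := off_diagonal a0 (ltW b0) (ltW c0) u0 u1 v1 w1.
have [Kh Kh0 HKh] := zprod_horizontal a0 ac cb s10 as1.
have [Cn [xn [Cn0 Hn]]] := near_bound.
pose I0 := nc (cint 0 t0 (zeta_prod a b c)).
pose M00 := Kh * (1 + ln (b * t0)) ^+ 9 * expR (3 / 4 * ln (b * t0)).
pose B0 := `|ln b|; pose B1 := `|ln t0|.
(* The sums over [m] and [k] beyond [expR (x ^ 3)] save [expR (- (v - 1) * x ^ 3)] and
   [expR (- (w - 1) * x ^ 3)]; [eta <= 1] makes the error at least 1, so that it absorbs
   constants. *)
pose eta := Num.min 1 (Num.min (v - 1) (w - 1)).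
have eta0 : 0 < eta by rewrite !lt_min ltr01 !subr_gt0 v1.
have [eta1 etav etaw] : [/\ eta <= 1, eta <= v - 1 & eta <= w - 1].
  by rewrite !ge_min !lexx !orbT.
have [xa Hxa] := @absorb (1 / 4) 9 ltac:(lra).
have [xb Hxb] := @absorb (u / 2) 1 ltac:(rewrite divr_gt0 //).
have [xc Hxc] := @absorb (2^-1) 0 ltac:(rewrite invr_gt0 //).
pose x1 := Num.max 1 (Num.max xn (Num.max xa (Num.max xb (Num.max xc (Num.max (B1 + 1) xd))))).
pose C1 := I0 + (M00 + Kh * (1 + B0) ^+ 9 * expR B0) * s1 + (Kt * expR 2 * (1 + B1) + 1) + Ko * (4 * expR 2 + Cn + 2).
have B00 : 0 <= B0 by exact: normr_ge0.
have B10 : 0 <= B1 by exact: normr_ge0.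
have I00 : 0 <= I0 by exact: nc_ge0.
have M000 : 0 <= M00.
  apply: le_trans (nc_ge0 (zprod a b c (0 +i* t0))) (HKh t0 0 (lexx _) _).
  by rewrite lexx oppr_le0 ltW.
have E1 : 0 <= expR 2 :> R by exact: expR_ge0.
have Q1 : 0 <= (M00 + Kh * (1 + B0) ^+ 9 * expR B0) * s1.
  by rewrite mulr_ge0 ?(ltW s10) // addr_ge0 // mulr_ge0 ?expR_ge0 // mulr_ge0 // exprn_ge0 // addr_ge0.
have Q2 : 0 <= Kt * expR 2 * (1 + B1) + 1 by rewrite addr_ge0 // !mulr_ge0 // addr_ge0.
have Q3 : 0 <= Ko * (4 * expR 2 + Cn + 2) by rewrite mulr_ge0 // !addr_ge0 // mulr_ge0.
exists C1, eta, x1, t0; split => //.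
  by rewrite /C1; apply: addr_ge0 Q3; apply: addr_ge0 Q2; apply: addr_ge0.
exists u, v, w; split=> //; split.
  (* Moving the line multiplies the weight by [expR (s1 * lform)], which is 1 on the diagonal; so
     the main term keeps the exponents 1/2 although the line has moved. *)
  move=> n m k L0; rewrite /weight /rpw -!expRD; congr expR.
  have -> : - u * ln n%:R + - v * ln m%:R + - w * ln k%:R =
    - 2^-1 * ln n%:R + - 2^-1 * ln m%:R + - 2^-1 * ln k%:R + s1 * lform a b c n m k.
    by rewrite /u /v /w /lform; ring.
  by rewrite L0 mulr0 addr0.
move=> x; rewrite !ge_max => /andP[xx1 /and4P[xxn xxa xxb /and3P[xxc xB1 xxd]]].
have x0 : 0 <= x by exact: le_trans xx1.
have x9x : x <= x ^+ 9 by rewrite exprS ler_peMr // exprn_ege1.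
have x39 : x ^+ 3 <= x ^+ 9 by rewrite (exprD x 3 6) ler_peMr ?exprn_ge0 // exprn_ege1.
have x90 : 0 <= x ^+ 9 by rewrite exprn_ge0.
have x30 : 0 <= x ^+ 3 by rewrite exprn_ge0.
set y := x ^+ 9 in x9x x39 x90 *; pose T := expR y; rewrite -/T.
have T0 : 0 < T by exact: expR_gt0.
pose Er := T * expR (- (eta * x ^+ 3)).
have Er0 : 0 <= Er by rewrite mulr_ge0 ?expR_ge0.
have Er1 : 1 <= Er.
  rewrite /Er /T -expRD -expR0 ler_expR subr_ge0 (le_trans _ x39) //.
  by rewrite ler_piMl.
have ErE : T * expR (- x ^+ 3) <= Er.
  by rewrite /Er ler_pM2l // ler_expR lerN2 ler_piMl.
have t0T : t0 <= T.
  rewrite -[t0]lnK ?posrE // ler_expR (le_trans (ler_norm _)) // -/B1; move: xB1 x9x; lra.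
have [N [TN aTN aTk rN lnN]] := Hd x xxd.
rewrite -/y -/T in TN aTN aTk rN lnN.
have [Mt HMt] := HKt N.+1 T t0T aTN aTk.
exists N.+1, Mt; split=> // M MM.
have lT : ln T = y by rewrite /T expRK.
have Xb : (1 + y) * expR ((1 - u / 2) * y) <= Er.
  by apply: le_trans ErE; have := Hxb x xxb; rewrite expr1.
have P1 : nc (cint t0 T (line_zeta a b c u v w) - cint t0 T (line_poly a b c u v w N.+1 M)) <=
    (Kt * expR 2 * (1 + B1) + 1) * Er.
  apply: le_trans (HMt M MM) _; rewrite [leRHS]mulrDl mul1r; apply: lerD => //.
  apply: (@le_trans _ _ (Kt * (expR 2 * expR ((1 - u / 2) * y)) * ((1 + B1) * (1 + y)))).
    apply: ler_pM; rewrite ?mulr_ge0 ?rpw_ge0 //.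
    - by rewrite subr_ge0 ler_ln ?posrE.
    - by rewrite ler_wpM2l.
    - by rewrite lT; apply: arith2 => //; rewrite /B1 -normrN ler_norm.
  have -> : Kt * (expR 2 * expR ((1 - u / 2) * y)) * ((1 + B1) * (1 + y)) =
     Kt * expR 2 * (1 + B1) * ((1 + y) * expR ((1 - u / 2) * y)) by ring.
  by rewrite ler_wpM2l // !mulr_ge0 // addr_ge0.
(* The largest range in which the lower bound for linear forms loses less than a power of [T]. *)
pose M1 := Num.truncn (expR (x ^+ 3)).
have /andP[M11 M12] := truncn_itv (expR_ge0 (x ^+ 3)).
have be0 : 0 <= Cn * expR (y / 2) by rewrite mulr_ge0 ?expR_ge0.
have P2 : nc (cint t0 T (line_poly a b c u v w N.+1 M) - ((T - t0) * diag_sum a b c u v w N.+1 M)%:C) <=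
    Ko * (4 * expR 2 + Cn + 2) * Er.
  apply: le_trans (HKo N.+1 M M1 t0 T _ t00 t0T be0 _) _.
    by move=> n m k n0 mM kM nr L0; exact: (Hn x xxn n m k M1).
  rewrite -mulrA ler_wpM2l // 2!mulrDl; apply: lerD; first apply: lerD.
  - apply: (@le_trans _ _ (expR 2 * expR ((1 - u / 2) * y) * (4 * (1 + y)))).
      have N12 : rpw N.+1 (1 - u) <= rpw N.+2 (1 - u) by rewrite rpw_homo // subr_ge0 ltW.
      have l12 : ln (N.+1%:R : R) <= ln N.+2%:R by rewrite ler_ln ?posrE ?ltr0n ?ler_nat.
      apply: ler_pM; rewrite ?rpw_ge0 ?addr_ge0 ?ln_nat_ge0 //; first exact: le_trans rN.
      by rewrite -lerBrDl (le_trans l12) // (le_trans lnN) //; exact: arith1.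
    have -> : expR 2 * expR ((1 - u / 2) * y) * (4 * (1 + y)) =
       4 * expR 2 * ((1 + y) * expR ((1 - u / 2) * y)) by ring.
    by rewrite ler_wpM2l // mulr_ge0.
  - rewrite ler_wpM2l //; apply: le_trans ErE; have := Hxc x xxc; rewrite expr0 mul1r.
    by have -> : (1 - 2^-1) * x ^+ 9 = y / 2 by rewrite -/y; field.
  - have tl z : eta <= z -> rpw M1.+1 (- z) <= expR (- (eta * x ^+ 3)).
      move=> ez; rewrite /rpw mulNr ler_expR lerN2; apply: ler_pM => //; first exact: ltW.
      rewrite -[leLHS]expRK ler_ln ?posrE ?expR_gt0 ?ltr0n //; exact: ltW.
    have -> : 2 * Er = T * (expR (- (eta * x ^+ 3)) + expR (- (eta * x ^+ 3))) by rewrite /Er; ring.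
    by rewrite ler_pM2l // lerD // tl.
have lz t : zprod a b c (- s1 +i* t) = line_zeta a b c u v w t by rewrite zprodE.
have P3 : nc (cint t0 T (zeta_prod a b c) - cint t0 T (line_zeta a b c u v w)) <=
    ((M00 + Kh * (1 + B0) ^+ 9 * expR B0) * s1) * Er.
  have -> : cint t0 T (line_zeta a b c u v w) = cint t0 T (fun t => zprod a b c (- s1 +i* t)).
    by apply: eq_cint => t _; rewrite lz.
  have H0 z : - s1 <= z <= 0 -> nc (zprod a b c (z +i* t0)) <= M00 by exact: HKh.
  have H1 z : - s1 <= z <= 0 -> nc (zprod a b c (z +i* T)) <= Kh * (1 + B0) ^+ 9 * expR B0 * Er.
    move=> zs; apply: le_trans (HKh T z t0T zs) _.
    have bT : ln (b * T) = ln b + y by rewrite lnM ?posrE // lT.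
    have lb : ln b <= B0 by exact: ler_norm.
    have bT0 : 0 <= ln (b * T).
      rewrite ln_ge0 //; apply: (@le_trans _ _ (a * t0)).
        by rewrite /t0 mulrCA divff ?gt_eqF // mulr1 ler1n.
      by apply: ler_pM => //; apply: ltW => //; exact: lt_le_trans ac cb.
    apply: (@le_trans _ _ (Kh * ((1 + B0) * (1 + y)) ^+ 9 * (expR B0 * expR ((1 - 1 / 4) * y)))).
      apply: ler_pM; rewrite ?mulr_ge0 ?exprn_ge0 ?expR_ge0 ?addr_ge0 //.
        rewrite ler_wpM2l // lerXn2r ?nnegrE ?mulr_ge0 ?addr_ge0 //.
        by rewrite bT addrA arith3.
      by rewrite -expRD ler_expR bT arith4.
    have -> : Kh * ((1 + B0) * (1 + y)) ^+ 9 * (expR B0 * expR ((1 - 1 / 4) * y)) =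
      Kh * (1 + B0) ^+ 9 * expR B0 * ((1 + y) ^+ 9 * expR ((1 - 1 / 4) * y)) by rewrite exprMn; ring.
    rewrite ler_wpM2l ?mulr_ge0 ?exprn_ge0 ?expR_ge0 ?addr_ge0 //.
    exact: le_trans (Hxa x xxa) ErE.
  apply: le_trans (contour_shift a0 ac cb s10 t00 t0T H0 H1) _.
  by rewrite [leRHS]mulrAC ler_pM2r // [leRHS]mulrDl lerD2r ler_peMr.
rewrite zeta_momentE (@cint_split R 0 T t0) ?(ltW t00) //; last exact: ccont_zeta_prod.
(* Initial segment, shift of the line, truncation, off-diagonal terms: the four summands of [C1]. *)
have -> : cint 0 t0 (zeta_prod a b c) + cint t0 T (zeta_prod a b c) - ((T - t0) * diag_sum a b c u v w N.+1 M)%:C =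
  cint 0 t0 (zeta_prod a b c) + (cint t0 T (zeta_prod a b c) - cint t0 T (line_zeta a b c u v w)) +
  (cint t0 T (line_zeta a b c u v w) - cint t0 T (line_poly a b c u v w N.+1 M)) +
  (cint t0 T (line_poly a b c u v w N.+1 M) - ((T - t0) * diag_sum a b c u v w N.+1 M)%:C) by ring.
rewrite -/Er /C1 (mulrDl _ _ Er) (mulrDl (_ + _) _ Er) (mulrDl I0 _ Er).
do 3 (apply: le_trans (ncD _ _) _; apply: lerD => //).
by rewrite -/I0 ler_peMr.
Qed.

End Params.

End MomentApproximation.

(** * The diagonal sum and the final asymptotics *)

Section Assembly.
Context {R : realType}.
Local Notation C := R[i].
Local Notation nc := (@Normc.normc R).
Implicit Types (x y t T X : R) (n m k p N M : nat).

Lemma sum_single N i (F : nat -> R) : (i < N)%N -> (forall j, j != i -> F j = 0) ->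
  \sum_(0 <= j < N) F j = F i.
Proof.
move=> iN F0; rewrite (bigD1_seq i) ?iota_uniq ?mem_index_iota //= big1 ?addr0 //.
Qed.

Lemma sum_indicator N q y :
  \sum_(0 <= n < N) (n.+1 == q)%:R * y = (0 < q <= N)%N%:R * y.
Proof.
case: (boolP (0 < q <= N)%N) => [/andP[q0 qN]|qN].
  rewrite (@sum_single N q.-1) ?prednK // ?eqxx // => j /negbTE jq.
  by rewrite -{1}(prednK q0) eqSS jq mul0r.
rewrite mul0r big1_seq // => n /andP[_]; rewrite mem_index_iota /= => nN.
by case: eqP => [nq|_]; [move: qN; rewrite -nq nN|rewrite mul0r].
Qed.

Section Relation.
Variables (a b c : R) (l1 l2 l3 : int).
Hypotheses (a0 : 0 < a) (b0 : 0 < b) (c0 : 0 < c).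
Hypotheses (alga : algebraicOver ratr a) (algb : algebraicOver ratr b) (algc : algebraicOver ratr c).
Hypotheses (nrat : ~ rational_ratio a b c) (nz : (l1, l2, l3) <> (0, 0, 0)).
Hypothesis rel : a * l1%:~R = b * l2%:~R + c * l3%:~R.
Hypotheses (ac : a < c) (cb : c <= b).
Variables (u v w : R).
Hypothesis halves : forall n m k, lform a b c n m k = 0 ->
  weight u v w n m k = rpw n (- 2^-1) * rpw m (- 2^-1) * rpw k (- 2^-1).

Lemma diag_sum_trivial N M : sign_normalized l1 l2 l3 -> l1 < 0 \/ l2 < 0 \/ l3 < 0 ->
  (0 < N)%N -> (0 < M)%N -> diag_sum a b c u v w N M = 1.
Proof.
move=> sgn neg N0 M0.
have only n m k : lform a b c n.+1 m.+1 k.+1 = 0 -> [/\ n = 0, m = 0 & k = 0]%N.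
  by move/(diag_trivial b0 c0 alga algb algc nrat nz rel sgn neg (ltn0Sn n) (ltn0Sn m) (ltn0Sn k)) => [[->] [->] [->]].
have off n m k : (n != 0) || (m != 0) || (k != 0)%N ->
   (if lform a b c n.+1 m.+1 k.+1 == 0 then weight u v w n.+1 m.+1 k.+1 else 0) = 0.
  by case: (eqVneq (lform a b c n.+1 m.+1 k.+1) 0) => // /only[-> -> ->].
rewrite /diag_sum (@sum_single N 0%N) // => [|n n0]; last first.
  by rewrite big1 // => m _; rewrite big1 // => k _; rewrite off // n0.
rewrite (@sum_single M 0%N) // => [|m m0]; last first.
  by rewrite big1 // => k _; rewrite off // m0 orbT.
rewrite (@sum_single M 0%N) // => [|k k0]; last by rewrite off // k0 orbT.
have -> : lform a b c 1 1 1 = 0 by rewrite /lform ln1 !mulr0 !subr0.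
by rewrite eqxx /weight !rpw1n !mulr1.
Qed.

Section Nonneg.
Hypothesis g1 : gcdz (gcdz l1 l2) l3 = 1.
Hypotheses (l1p : 0 <= l1) (l2p : 0 <= l2) (l3p : 0 <= l3).

Let s : R := (`|l1| + `|l2| + `|l3|)%N%:R / 2.

Lemma rpwX r e y : (0 < r)%N -> rpw (r ^ e)%N y = rpw r (e%:R * y).
Proof. by move=> r0; rewrite /rpw ln_natX // mulrCA mulrA. Qed.

(** [M] is so large that [r ^ l2] and [r ^ l3] fall in range for every [r <= N]; only the cutoff
    [r ^ l1 <= N] survives. The exponents 1/2 of the three weights add up to [s]. *)
Lemma diag_sum_powers N M : (N ^ (`|l2| + `|l3|).+1 <= M)%N ->
  diag_sum a b c u v w N M =
  \sum_(0 <= r < N) (r.+1 ^ `|l1| <= N)%N%:R * rpw r.+1 (- s).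
Proof.
move=> NM; have [e1 _] := exponents_ge3 a0 b0 c0 nz rel l1p l2p l3p ac cb.
rewrite /diag_sum.
(* A vanishing triple comes from exactly one [r], since [l1 > 0]; inserting the sum over [r] allows
   the sums over [n], [m] and [k] to be carried out first. *)
transitivity (\sum_(0 <= n < N) \sum_(0 <= m < M) \sum_(0 <= k < M) \sum_(0 <= r < N)
   (n.+1 == r.+1 ^ `|l1|)%N%:R * ((m.+1 == r.+1 ^ `|l2|)%N%:R * ((k.+1 == r.+1 ^ `|l3|)%N%:R * rpw r.+1 (- s)))).
  rewrite !big_nat; apply: eq_bigr => n /andP[_ nN]; apply: eq_bigr => m _; apply: eq_bigr => k _.
  case: eqP => [L0|L0].
    have [r [r0 En Em Ek]] := diag_powers b0 c0 alga algb algc nrat nz rel g1 l1p l2p l3p (ltn0Sn n) (ltn0Sn m) (ltn0Sn k) L0.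
    have rN : (r.-1 < N)%N.
      rewrite prednK //; apply: leq_trans nN; rewrite En; case: (`|l1|%N) e1 => // e _.
      by rewrite expnS leq_pmulr // expn_gt0 r0.
    rewrite (@sum_single N r.-1) // ?prednK // => [|j jr]; last first.
      rewrite En eqn_exp2r // -(prednK r0) eqSS eq_sym (negbTE jr) mul0r //.
    rewrite halves // En Em Ek !eqxx !mul1r !rpwX // -!rpwD; congr rpw.
    by rewrite /s !natrD; field.
  rewrite big1 // => r _; case: eqP => [En|]; last by rewrite mul0r.
  case: eqP => [Em|]; last by rewrite mul0r mulr0.
  case: eqP => [Ek|]; last by rewrite mul0r !mulr0.
  by case: L0; rewrite En Em Ek (lform_powers rel).
under eq_bigr do under eq_bigr do rewrite exchange_big /=.
under eq_bigr do rewrite exchange_big /=.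
rewrite exchange_big /=; rewrite !big_nat; apply: eq_bigr => r /andP[_ rN].
have pM e : (e <= `|l2| + `|l3|)%N -> (0 < r.+1 ^ e <= M)%N.
  move=> ee; rewrite expn_gt0 /=; apply: leq_trans NM.
  apply: (@leq_trans (N ^ e)); first by case: e ee => // e _; rewrite leq_exp2r.
  by rewrite leq_pexp2l //; [exact: leq_ltn_trans rN|exact: leqW].
rewrite -[RHS]/((r.+1 ^ `|l1| <= N)%N%:R * _).
transitivity (\sum_(0 <= n < N) (n.+1 == r.+1 ^ `|l1|)%N%:R * rpw r.+1 (- s)).
  apply: eq_bigr => n _.
  transitivity (\sum_(0 <= m < M) (m.+1 == r.+1 ^ `|l2|)%N%:R * ((n.+1 == r.+1 ^ `|l1|)%N%:R * rpw r.+1 (- s))).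
    apply: eq_bigr => m _.
    transitivity (\sum_(0 <= k < M) (k.+1 == r.+1 ^ `|l3|)%N%:R * ((m.+1 == r.+1 ^ `|l2|)%N%:R * ((n.+1 == r.+1 ^ `|l1|)%N%:R * rpw r.+1 (- s)))).
      by apply: eq_bigr => k _; ring.
    by rewrite sum_indicator pM ?leq_addl // mul1r.
  by rewrite sum_indicator pM ?leq_addr // mul1r.
by rewrite sum_indicator expn_gt0.
Qed.

(** The series is cut near [N ^ (1 / l1)], a power of [T], and it converges absolutely; the loss is
    a power of [T] and so certainly below [expR (- d * x ^ 3)]. *)
Lemma diag_sum_zeta : exists D d : R, [/\ 0 <= D, 0 < d & forall x N M, 1 <= x ->
  expR (x ^+ 9) <= N%:R -> (N ^ (`|l2| + `|l3|).+1 <= M)%N ->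
  nc ((diag_sum a b c u v w N M)%:C - zeta (((l1 + l2 + l3)%:~R / 2)%:C)) <= D * expR (- (d * x ^+ 3))].
Proof.
have [e1 e3] := exponents_ge3 a0 b0 c0 nz rel l1p l2p l3p ac cb.
(* As [s >= 3/2 = 1 + 1/4 + 1/4], one quarter is spent on convergence and the other on the saving;
   [r ^ l1 > N] turns [r ^ (- 1/4)] into [N ^ (- d)]. *)
pose d : R := (4 * `|l1|%:R)^-1.
have e10 : 0 < `|l1|%:R :> R by rewrite ltr0n.
have d0 : 0 < d by rewrite invr_gt0 mulr_gt0.
have d4 : d <= 4^-1 by rewrite lef_pV2 ?posrE ?mulr_gt0 // ler_peMr // ler1n.
have absE (l : int) : 0 <= l -> l%:~R = `|l|%:R :> R by move=> h; rewrite -{1}(gez0_abs h).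
have sE : (l1 + l2 + l3)%:~R / 2 = s by rewrite /s !intrD !absE // !natrD.
have s32 : 3 / 2 <= s by rewrite /s ler_pM2r ?invr_gt0 // (ler_nat R 3).
exists 8, d; split=> // x N M x1 xN NM.
rewrite sE diag_sum_powers //.
have x0 : 0 <= x by exact: le_trans x1.
have x39 : x ^+ 3 <= x ^+ 9 by rewrite (exprD x 3 6) ler_peMr ?exprn_ge0 // exprn_ege1.
have x30 : 0 <= x ^+ 3 by rewrite exprn_ge0.
have N0 : (0 < N)%N by rewrite -(ltr0n R) (lt_le_trans _ xN) ?expR_gt0.
have lN : x ^+ 3 <= ln (N%:R : R).
  by rewrite (le_trans x39) // -[leLHS]expRK ler_ln ?posrE ?expR_gt0 ?ltr0n.
have s1 : 1 < complex.Re (s%:C : C) by rewrite /=; move: s32; lra.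
set A : R := \sum_(0 <= r < N) _.
have dE : dpoly N s%:C = (\sum_(0 <= r < N) rpw r.+1 (- s))%:C.
  rewrite /dpoly rmorph_sum; apply: eq_bigr => r _; rewrite pwr_polar /= oppr0 mul0r.
  by rewrite eixE cos0 sin0 mulr1.
have -> : A%:C - zeta s%:C = (A%:C - dpoly N s%:C) - (zeta s%:C - dpoly N s%:C) by ring.
apply: le_trans (ncB _ _) _.
(* 5 is the bound [1 + 4] for the sum with exponent [- 1 - 1/4]; 3 bounds [1 + (s - 1)^-1] in the
   tail of zeta. *)
have -> : (8 : R) = 5 + 3 by ring.
rewrite mulrDl; apply: lerD; last first.
  apply: le_trans (zeta_dpoly_le N s1) _; rewrite mulrC; apply: ler_pM.
  - by rewrite addr_ge0 // invr_ge0 subr_ge0 ltW.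
  - exact: rpw_ge0.
  - have : (complex.Re (s%:C : C) - 1)^-1 <= 2.
      by rewrite -[leRHS]invrK lef_pV2 ?posrE ?subr_gt0 ?invr_gt0 //=; move: s32; lra.
    by lra.
  - rewrite /rpw mulNr ler_expR lerN2 /=; apply: ler_pM => //; first exact: ltW.
      by move: d4 s32; lra.
    by apply: le_trans lN _; rewrite ler_ln ?posrE ?ltr0n ?ler_nat.
rewrite dE -rmorphB nc_real /A -sumrB.
apply: le_trans (ler_norm_sum _ _ _) _.
apply: (@le_trans _ _ (\sum_(0 <= r < N) rpw r.+1 (- 1 - 4^-1) * expR (- (d * x ^+ 3)))); last first.
  rewrite -mulr_suml ler_wpM2r ?expR_ge0 //.
  have := @rpw_sum R 4^-1 N ltac:(by rewrite invr_gt0); rewrite invrK.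
  have -> : 1 + 4 = 5 :> R by ring.
  by [].
apply: ler_sum => r _.
case: (boolP (r.+1 ^ `|l1| <= N)%N) => [_|]; first by rewrite /= mul1r subrr normr0; apply: mulr_ge0; [exact: rpw_ge0|exact: expR_ge0].
rewrite -ltnNge /= mul0r sub0r normrN ger0_norm ?rpw_ge0 // => rN.
have ls : ln (N%:R : R) <= `|l1|%:R * ln r.+1%:R.
  by rewrite -ln_natX // ler_ln ?posrE ?ltr0n ?expn_gt0 // ler_nat ltnW.
apply: (@le_trans _ _ (rpw r.+1 (- 1 - 4^-1) * rpw r.+1 (- 4^-1))).
  by rewrite -rpwD rpw_le //; move: s32; lra.
rewrite ler_wpM2l ?rpw_ge0 // /rpw mulNr ler_expR lerN2.
have -> : 4^-1 * ln r.+1%:R = d * (`|l1|%:R * ln r.+1%:R).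
  by rewrite /d; field; rewrite gt_eqF.
by rewrite ler_pM2l // (le_trans lN).
Qed.
End Nonneg.

Lemma lform_lower_bound : exists (D T0 : nat) (kap : R), 0 < kap /\ forall p n m k, (T0 <= p)%N ->
  (0 < n)%N -> (0 < m)%N -> (0 < k)%N ->
  (`|l1| + `|l2| + `|l3|)%N%:R * ln (n%:R : R) <= p%:R ^+ 3 / 2 ->
  (`|l1| + `|l2| + `|l3|)%N%:R * ln (m%:R : R) <= p%:R ^+ 3 / 2 ->
  (`|l1| + `|l2| + `|l3|)%N%:R * ln (k%:R : R) <= p%:R ^+ 3 / 2 ->
  lform a b c n m k != 0 -> kap * p%:R ^- (D * p ^ 8) <= `|lform a b c n m k|.
Proof.
have [D [T0 [kap [kap0 H]]]] := lform_relations c0 alga algb algc nrat nz rel.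
exists D, T0, kap; split=> // p n m k Tp n0 m0 k0 hn hm hk /eqP L0.
by case: (H p n m k Tp n0 m0 k0 hn hm hk) => // -[].
Qed.
End Relation.

(** The abscissas [u], [v], [w] come out of [moment_approx] as unknowns, so the evaluation of the
    diagonal sum is assumed for all weights with the right values on the diagonal. The term with
    [t0] in the constant pays for replacing [T - t0] by [T]. *)
Lemma zeta_moment_asymp (a b c : R) (l1 l2 l3 : int) (Mn : C) : 0 < a -> 0 < b -> 0 < c ->
  algebraicOver ratr a -> algebraicOver ratr b -> algebraicOver ratr c ->
  ~ rational_ratio a b c -> (l1, l2, l3) <> (0, 0, 0) ->
  a * l1%:~R = b * l2%:~R + c * l3%:~R -> a < c -> c <= b ->
  (forall u v w : R, (forall n m k, lform a b c n m k = 0 ->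
     weight u v w n m k = rpw n (- 2^-1) * rpw m (- 2^-1) * rpw k (- 2^-1)) ->
   exists D d : R, [/\ 0 <= D, 0 < d & forall x N, 1 <= x -> expR (x ^+ 9) <= N%:R ->
     exists M0, forall M, (M0 <= M)%N ->
     nc ((diag_sum a b c u v w N M)%:C - Mn) <= D * expR (- (d * x ^+ 3))]) ->
  exists C1 eta x0 : R, [/\ 0 <= C1, 0 < eta & forall x, x0 <= x ->
    nc (zeta_moment a b c (expR (x ^+ 9)) - Mn * (expR (x ^+ 9))%:C) <=
    C1 * (expR (x ^+ 9) * expR (- (eta * x ^+ 3)))].
Proof.
move=> a0 b0 c0 alga algb algc nrat nz rel ac cb diag.
have [C1 [eta [x0 [t0 [C10 eta0 eta1 t00]]]]] :=
  moment_approx a0 ac cb (lform_lower_bound c0 alga algb algc nrat nz rel).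
move=> [u [v [w [_ [halves H]]]]].
have [D [d [D0 d0 HD]]] := diag u v w halves.
pose e := Num.min eta d; have e0 : 0 < e by rewrite lt_min eta0.
exists (C1 + D + t0 * (nc Mn + D)), e, (Num.max 1 x0); split=> //.
  by rewrite !addr_ge0 // mulr_ge0 ?(ltW t00) // addr_ge0 // nc_ge0.
move=> x; rewrite ge_max => /andP[x1 xx0].
have xp : 0 <= x by exact: le_trans x1.
have x30 : 0 <= x ^+ 3 by rewrite exprn_ge0.
have x39 : x ^+ 3 <= x ^+ 9 by rewrite (exprD x 3 6) ler_peMr ?exprn_ge0 // exprn_ege1.
have [N [M0 [xN HM]]] := H x xx0; have [M1 HM1] := HD x N x1 xN.
have {}HM := HM (maxn M0 M1) (leq_maxl _ _); have {}HM1 := HM1 (maxn M0 M1) (leq_maxr _ _).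
set T := expR (x ^+ 9) in HM *; have T0 : 0 <= T by exact: expR_ge0.
set Dg := diag_sum _ _ _ _ _ _ _ _ in HM HM1.
pose E := expR (- (e * x ^+ 3)); rewrite -/E; have E0 : 0 <= E by exact: expR_ge0.
have TE : 1 <= T * E.
  rewrite -expRD -expR0 ler_expR subr_ge0 (le_trans _ x39) // ler_piMl //.
  by rewrite ge_min eta1.
have eE : expR (- (eta * x ^+ 3)) <= E.
  by rewrite ler_expR lerN2 ler_wpM2r // ge_min lexx.
have dE : expR (- (d * x ^+ 3)) <= E.
  by rewrite ler_expR lerN2 ler_wpM2r // ge_min lexx orbT.
have DgM : nc Dg%:C <= nc Mn + D.
  have -> : Dg%:C = Mn + (Dg%:C - Mn) by ring.
  apply: le_trans (ncD _ _) _; rewrite lerD2l (le_trans HM1) // ler_piMr //.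
  by rewrite -expR0 ler_expR oppr_le0 mulr_ge0 // ltW.
have -> : zeta_moment a b c T - Mn * T%:C =
  (zeta_moment a b c T - ((T - t0) * Dg)%:C) + T%:C * (Dg%:C - Mn) - t0%:C * Dg%:C.
  by rewrite rmorphM rmorphB /=; ring.
apply: le_trans (ncB _ _) _; rewrite (mulrDl (C1 + D)); apply: lerD.
  rewrite [leRHS]mulrDl; apply: le_trans (ncD _ _) _; apply: lerD.
    by apply: le_trans HM _; rewrite ler_wpM2l // ler_wpM2l.
  rewrite ncM nc_real ger0_norm // [leRHS]mulrCA ler_wpM2l //.
  by apply: le_trans HM1 _; rewrite ler_wpM2l.
rewrite ncM nc_real ger0_norm ?(ltW t00) // -mulrA ler_wpM2l ?(ltW t00) //.
by apply: le_trans DgM _; rewrite ler_peMr // addr_ge0 ?nc_ge0.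
Qed.

(** With [x = (ln T) ^ (1/9)] the comparison is [eta >= (ln ln T) ^ (- 1/3)], true as soon as
    [ln ln T >= eta ^ - 3]. The summand [9 * B] in the threshold ensures [x >= x0]. *)
Lemma error_term_ge (eta x0 : R) : 0 < eta -> exists T0, forall T, T0 < T ->
  exists x, [/\ x0 <= x, T = expR (x ^+ 9) & T * expR (- (eta * x ^+ 3)) <= error_term 1 T].
Proof.
move=> eta0; pose B := Num.max 1 x0; pose P := eta^-1.
have P0 : 0 < P by rewrite invr_gt0.
have B1 : 1 <= B by rewrite le_max lexx.
exists (expR (expR (9 * B + P ^+ 3))) => T hT.
have T0 : 0 < T by apply: lt_trans hT; exact: expR_gt0.
have l1 : expR (9 * B + P ^+ 3) < ln T by rewrite -[ltLHS]expRK ltr_ln ?posrE ?expR_gt0.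
have l0 : 0 < ln T by apply: lt_trans l1; exact: expR_gt0.
pose l := ln (ln T).
have ll : 9 * B + P ^+ 3 < l by rewrite -[ltLHS]expRK ltr_ln ?posrE ?expR_gt0.
have P30 : 0 <= P ^+ 3 by rewrite exprn_ge0 // ltW.
have lP : P ^+ 3 <= l by move: ll B1; clear; lra.
have lB : 9 * B <= l by move: ll P30; clear; lra.
have lp : 0 < l by move: lB B1; clear; lra.
pose x := expR (l / 9).
have x9 : x ^+ 9 = ln T by rewrite /x -expRM_natl mulrC divfK // lnK.
have x3 : x ^+ 3 = ln T `^ (1 / 3).
  by rewrite /powR gt_eqF // /x -expRM_natl; congr expR; rewrite -/l; field.
have Pl : P <= l `^ (1 / 3).
  rewrite /powR gt_eqF // -[P]lnK ?posrE // ler_expR.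
  have -> : ln P = 1 / 3 * ln (P ^+ 3) by rewrite lnXn // -[_ *+ 3]mulr_natl; field.
  by rewrite ler_wpM2l // ler_ln ?posrE // exprn_gt0.
exists x; split.
- rewrite (@le_trans _ _ B) //; first by rewrite le_max lexx orbT.
  rewrite (le_trans _ (expR_ge1Dx _)) //; move: lB; clear; lra.
- by rewrite x9 lnK.
rewrite /error_term ler_wpM2l ?(ltW T0) // ler_expR lerN2 mul1r -/l -x3 mulrC.
rewrite ler_wpM2r ?exprn_ge0 ?expR_ge0 // -[leRHS]invrK lef_pV2 ?posrE ?invr_gt0 //.
exact: lt_le_trans Pl.
Qed.

(** Since [K = 1] serves for all inputs, the program required by [computed_by] is one that ignores
    its arguments. *)
Lemma constant_recfun n : exists F : recfun, forall s, rec_eval F s n.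
Proof.
elim: n => [|n [F HF]]; first by exists RZero => s; exact: EZero.
exists (RComp RSucc [:: F]) => s; apply: (@EComp _ _ _ [:: n]).
  by apply: ECons; [exact: HF|exact: ENil].
exact: ESucc.
Qed.

End Assembly.

(* F is the algorithm witnessing that K is effective: it does not depend on
   a, b, c, and computes K from them. *)
Theorem theorem1p6 (R : realType) :
  exists F : recfun,
  forall (a b c : R) (l1 l2 l3 : int),
    0 < a -> 0 < b -> 0 < c ->
    algebraicOver ratr a -> algebraicOver ratr b -> algebraicOver ratr c ->
    ~ rational_ratio a b c ->
    a < c -> c <= b ->
    (l1, l2, l3) <> (0, 0, 0) ->
    gcdz (gcdz l1 l2) l3 = 1 ->
    a * l1%:~R = b * l2%:~R + c * l3%:~R ->
    sign_normalized l1 l2 l3 ->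
    exists K : rat,
      [/\ 0 < K,
          computed_by F a b c K,
          l1 < 0 \/ l2 < 0 \/ l3 < 0 ->
            asymp_with_error (zeta_moment a b c) 1 (ratr K)
        & 0 <= l1 /\ 0 <= l2 /\ 0 <= l3 ->
            asymp_with_error (zeta_moment a b c)
              (zeta (((l1 + l2 + l3)%:~R / 2)%:C)) (ratr K)].
Proof.
have [F HF] := constant_recfun (pickle (1 : rat)).
exists F => a b c l1 l2 l3 a0 b0 c0 alga algb algc nrat ac cb nz g1 rel sgn.
have concl (Mn : R[i]) : (exists C1 eta x0 : R, [/\ 0 <= C1, 0 < eta & forall x, x0 <= x ->
    Normc.normc (zeta_moment a b c (expR (x ^+ 9)) - Mn * (expR (x ^+ 9))%:C) <=
    C1 * (expR (x ^+ 9) * expR (- (eta * x ^+ 3)))]) ->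
    asymp_with_error (zeta_moment a b c) Mn (ratr 1).
  move=> [C1 [eta [x0 [C10 eta0 H]]]]; exists C1.
  have [T0 HT] := error_term_ge x0 eta0.
  exists T0; split; first exact: num_real.
  move=> T /HT[x [xx0 TE]]; rewrite rmorph1 TE => err; apply: le_trans (H x xx0) _.
  exact: ler_wpM2l C10 _ _ err.
exists 1; split=> //.
- move=> neg; apply: concl.
  apply: (zeta_moment_asymp a0 b0 c0 alga algb algc nrat nz rel ac cb) => u v w _.
  (* In case (i) the diagonal sum is exactly 1 once [N] and [M] are positive, hence the error
     constant 0. *)
  exists 0, 1; split=> // x N _ xN; exists 1%N => M M1.
  have N0 : (0 < N)%N by rewrite -(ltr0n R) (lt_le_trans _ xN) ?expR_gt0.
  rewrite (diag_sum_trivial b0 c0 alga algb algc nrat nz rel) //.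
  by rewrite subrr nc0 mul0r.
- move=> [l1p [l2p l3p]]; apply: concl.
  apply: (zeta_moment_asymp a0 b0 c0 alga algb algc nrat nz rel ac cb) => u v w halves.
  have [D [d [D0 d0 HD]]] := diag_sum_zeta a0 b0 c0 alga algb algc nrat nz rel ac cb halves g1 l1p l2p l3p.
  exists D, d; split=> // x N x1 xN; exists (N ^ (`|l2| + `|l3|).+1)%N => M NM.
  exact: HD.
Qed.
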